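(* Assume that $E[|G^i|^2]<\infty$, that $G^i$ is Lipschitz continuous (with constant $L_G$) with respect to the uniform norm on $\Omega$, and that the functions $F$ and $f$ satisfy condition (Lip) (defined in the context). Let $(Y^{i,n},Z^{i,j,n})$ and $(Y^i,Z^i)$ be the respective solutions of $$Y^{i,n}_t=G^i+\int_t^TF_u\Big(Y^{i,n}_u,Z^{i,n}_u,\frac1n\sum_{j=1}^nf_u(Y^{i,n}_u,Y^{j,n}_u,Z^{i,n}_u)\Big)\,du-\sum_{j=1}^n\int_t^TZ^{i,j,n}_u\,dW^j_u,\quad i=1,\dots,n,$$ where $Z^{i,n}:=Z^{i,i,n}$, and $$Y^i_t=G^i+\int_t^TF_u\Big(Y^i_u,Z^i_u,\int_{\mathbb R^m}f_u(Y^i_u,y,Z^i_u)\,d\mathcal L(Y^i_u)(y)\Big)\,du-\int_t^TZ^i_u\,dW^i_u.$$ Then there is a constant $C$ depending only on $T,L_F,L_f$ and $L_G$ such that $$E\big[|Y^{1,n}_t-Y^1_t|^2\big]+E\Big[\int_0^T|Z^{1,n}_s-Z^1_s|^2\,ds\Big]\le C\,n^{-1}\qquad\text{for all }(t,n)\in[0,T]\times\mathbb N.$$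
   Context: Fix $d,m\in\mathbb N$ and $T>0$; $|\cdot|$ denotes Euclidean norms. $\Omega:=C([0,T],\mathbb R^d)$ carries the Wiener measure and the supremum norm $\|\cdot\|_\infty$. $W^1,W^2,\dots$ are independent $d$-dimensional Brownian motions (canonical processes on copies of $\Omega$), $P$ is the underlying probability, $E$ its expectation; the system of $n$ equations is considered in the completed filtration generated by $W^1,\dots,W^n$. $\mathcal L(X)$ is the law of $X$ under $P$. The $G^i$ are i.i.d. $\mathbb R^m$-valued random variables of the form $G^i=G(W^i)$, $G$ a functional on $\Omega$; Lipschitz continuity of $G^i$ means $|G(\omega)-G(\omega')|\le L_G\|\omega-\omega'\|_\infty$. In the equations with index $i$, $F_u(\cdot)$ is evaluated at the path $W^i$; $(t,\omega)\mapsto F_t(\omega,y,z,a)$ is progressively measurable for all $(y,z,a)$. Condition (Lip): $F:[0,T]\times\Omega\times\mathbb R^m\times\mathbb R^{m\times d}\times\mathbb R^m\to\mathbb R^m$ and $f:[0,T]\times\mathbb R^m\times\mathbb R^m\times\mathbb R^{m\times d}\to\mathbb R^m$ satisfy, for some constants $L_F,L_f\ge0$ and all values of the arguments, $$|F_t(\omega,y,z,a)-F_t(\omega',y',z',a')|\le L_F\big(\|\omega-\omega'\|_\infty+|y-y'|+|z-z'|+|a-a'|\big),\quad |F_t(y,z,a)|\le L_F(1+|y|+|z|+|a|),$$ $$|f_t(y_1,y_2,z)-f_t(y_1',y_2',z')|\le L_f\big(|y_1-y_1'|+|y_2-y_2'|+|z-z'|\big),\quad |f_t(y,y_1,z)|\le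 L_f(1+|y|+|y_1|+|z|).$$ Under (Lip) and $E[|G^i|^2]<\infty$ both equations admit unique square integrable solutions (i.e. $E\sup_t|Y_t|^2<\infty$, $E\int_0^T|Z_t|^2dt<\infty$); these are the solutions meant. *)

(* Defs.v *)
From HB Require Import structures.
From mathcomp Require Import all_boot all_order all_algebra.
From mathcomp Require Import all_classical all_reals all_analysis.

Set Implicit Arguments.
Unset Strict Implicit.
Unset Printing Implicit Defensive.

Import Order.TTheory GRing.Theory Num.Theory.
Import numFieldNormedType.Exports.

Local Open Scope classical_set_scope.
Local Open Scope ring_scope.

(* The Borel sigma-algebra on matrices (the library norm on matrices is the
   max norm, which induces the same topology as the Euclidean norm). *)
Section borel_matrix.
Context (R : realType) (p q : nat).

HB.instance Definition _ :=
  @isMeasurable.Build (sigma_display (@open 'M[R]_(p, q))) 'M[R]_(p, q)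
    <<s @open 'M[R]_(p, q) >> (@sigma_algebra0 _ setT _)
    (@sigma_algebraC _ _) (@sigma_algebra_bigcup _ setT _).

End borel_matrix.

(* Euclidean norm on column vectors, Frobenius norm on matrices. *)
Definition euclid (R : realType) (p q : nat) (A : 'M[R]_(p, q)) : R :=
  Num.sqrt (\sum_(i < p) \sum_(j < q) A i j ^+ 2).

(* C([0,T], R^d), represented by functions on R that are continuous on [0,T].
   The values outside [0,T] are irrelevant: every notion below only looks at the
   restriction to [0,T], and a functional that is Lipschitz for [cpath_dist]
   factors through that restriction. *)
Record cpath (R : realType) (d : nat) (T : R) := CPath {
  cpath_fun :> R -> 'cV[R]_d ;
  cpath_continuous : {within `[0, T], continuous cpath_fun} }.

Section cpath_pointed.
Context (R : realType) (d : nat) (T : R).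

Lemma cst_cpath_continuous :
  {within `[0, T], continuous (fun _ : R => 0 : 'cV[R]_d)}.
Proof. by apply: continuous_subspaceT => x; exact: cst_continuous. Qed.

HB.instance Definition _ := gen_eqMixin (cpath d T).
HB.instance Definition _ := gen_choiceMixin (cpath d T).
HB.instance Definition _ := isPointed.Build (cpath d T) (CPath cst_cpath_continuous).

End cpath_pointed.

Definition cpath_dist (R : realType) (d : nat) (T : R) (w w' : cpath d T) : R :=
  sup [set euclid (w s - w' s) | s in `[0, T]].

(* Systems of generators: [history X t] generates sigma(X_s : 0 <= s <= t). The
   generated sigma-algebra is taken by [<<s _ >>] or [g_sigma_algebraType]. *)
Definition history (R : realType) (Om : Type) (dV : measure_display)
    (V : measurableType dV) (X : R -> Om -> V) (t : R) : set_system Om :=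
  \bigcup_(s in `[0, t]) preimage_set_system setT (X s) measurable.

Definition canonical_history (R : realType) (d : nat) (T : R) :
    R -> set_system (cpath d T) :=
  history (fun s (w : cpath d T) => w s).

Section processes.
Context (R : realType) (Om : pointedType) (dV : measure_display)
  (V : measurableType dV).

Definition adapted (FF : R -> set_system Om) (T : R) (X : R -> Om -> V) :=
  forall t : R, 0 <= t <= T ->
    measurable_fun setT (X t : g_sigma_algebraType (FF t) -> V).

Definition progressive (FF : R -> set_system Om) (T : R) (X : R -> Om -> V) :=
  forall t : R, 0 <= t <= T ->
    measurable_fun (`[0, t] `*` setT)
      (fun p : R * g_sigma_algebraType (FF t) => X p.1 p.2).

End processes.

Section probability.
Context (R : realType) (dO : measure_display) (Om : measurableType dO)
  (P : probability Om R).

Definition mutually_independent (I : eqType) (G : I -> set_system Om) :=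
  forall J : seq I, uniq J -> forall A : I -> set Om,
    (forall i, i \in J -> <<s G i >> (A i)) ->
    P (\big[setI/setT]_(i <- J) A i) = \big[mule/1%E]_(i <- J) P (A i).

Definition independent (G1 G2 : set_system Om) :=
  forall A1 A2, <<s G1 >> A1 -> <<s G2 >> A2 ->
    P (A1 `&` A2) = (P A1 * P A2)%E.

(* Path continuity is not repeated here: it is part of the type [cpath]. *)
Definition brownian_coordinate (T : R) (B : R -> Om -> R) :=
  [/\ forall t : R, 0 <= t <= T -> measurable_fun setT (B t),
      {ae P, forall x, B 0 x = 0},
      forall s t : R, 0 <= s -> s < t -> t <= T -> forall A, measurable A ->
        pushforward P (B t \- B s : Om -> R) A = normal_prob 0 (Num.sqrt (t - s)) A
    & forall s t : R, 0 <= s -> s < t -> t <= T ->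
        independent (history B s)
          (preimage_set_system setT (B t \- B s : Om -> R) measurable)].

Definition brownian_motion (d : nat) (T : R) (W : Om -> cpath d T) :=
  (forall k : 'I_d, brownian_coordinate T (fun t x => W x t k ord0)) /\
  mutually_independent
    (fun k : 'I_d => history (fun t x => W x t k ord0) T).

Definition independent_brownian_motions (d : nat) (T : R)
    (W : nat -> Om -> cpath d T) :=
  (forall i, brownian_motion (W i)) /\
  mutually_independent (fun i : nat => history (fun t x => W i x t) T).

(* Generators of the filtration of (W^j)_{j in J}, completed by the P-null sets
   of the ambient sigma-algebra. When the latter is P-complete, these are all
   P-negligible sets. *)
Definition completed_filtration (d : nat) (T : R) (W : nat -> Om -> cpath d T)
    (J : set nat) (t : R) : set_system Om :=
  (\bigcup_(j in J) history (fun s x => W j x s) t) `|`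
  [set A | measurable A /\ P A = 0%E].

Definition E2 (p q : nat) (X : Om -> 'M[R]_(p, q)) : \bar R :=
  (\int[P]_x ((euclid (X x)) ^+ 2)%:E)%E.

Definition E2int (p q : nat) (T : R) (Z : R -> Om -> 'M[R]_(p, q)) : \bar R :=
  (\int[P]_x \int[lebesgue_measure]_(s in `[0%R, T])
     ((euclid (Z s x)) ^+ 2)%:E)%E.

Definition E2sup (p q : nat) (T : R) (Y : R -> Om -> 'M[R]_(p, q)) : \bar R :=
  (\int[P]_x ereal_sup [set ((euclid (Y t x)) ^+ 2)%:E | t in `[0%R, T]])%E.

End probability.

Section ito.
Context (R : realType) (dO : measure_display) (Om : measurableType dO)
  (P : probability Om R) (m d : nat).

(* The elementary process  sum_k xi_k 1_(t_k, t_(k+1)],  k < N. *)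
Record elementary := Elementary {
  el_size : nat ;
  el_time : nat -> R ;
  el_coef : nat -> Om -> 'M[R]_(m, d) }.

Definition elementary_spec (FF : R -> set_system Om) (T : R) (H : elementary) :=
  (forall k, (k < el_size H)%N ->
    [/\ 0 <= el_time H k, el_time H k <= el_time H k.+1, el_time H k.+1 <= T
      & measurable_fun setT
          (el_coef H k : g_sigma_algebraType (FF (el_time H k)) -> 'M[R]_(m, d))])
  /\ exists c : R, forall k x, (k < el_size H)%N -> euclid (el_coef H k x) <= c.

Definition elementary_val (H : elementary) (t : R) (x : Om) : 'M[R]_(m, d) :=
  \sum_(k < el_size H)
    (if (el_time H k < t) && (t <= el_time H k.+1) then el_coef H k x else 0).

Definition elementary_int (H : elementary) (B : R -> Om -> 'cV[R]_d)
    (t : R) (x : Om) : 'cV[R]_m :=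
  \sum_(k < el_size H)
    el_coef H k x *m
      (B (Num.min (el_time H k.+1) t) x - B (Num.min (el_time H k) t) x).

(* M_t = int_0^t Z_u dB_u for progressive Z with E int_0^T |Z|^2 < oo: the
   continuous adapted process obtained as L^2-limit of elementary integrals. *)
Definition is_ito_integral (FF : R -> set_system Om) (T : R)
    (Z : R -> Om -> 'M[R]_(m, d)) (B : R -> Om -> 'cV[R]_d)
    (M : R -> Om -> 'cV[R]_m) :=
  [/\ adapted FF T M,
      {ae P, forall x, {within `[0, T], continuous (fun t => M t x)}}
    & exists H : nat -> elementary,
        [/\ forall k, elementary_spec FF T (H k),
            (fun k => E2int P T (fun s x => elementary_val (H k) s x - Z s x))
              @ \oo --> 0%E
          & forall t : R, 0 <= t <= T ->
            (fun k => E2 P (fun x => elementary_int (H k) B t x - M t x))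
              @ \oo --> 0%E]].

End ito.

Definition vint (R : realType) (m : nat) (D : set R) (g : R -> 'cV[R]_m) :
    'cV[R]_m :=
  \col_(k < m) \int[lebesgue_measure]_(u in D) (g u k ord0).

(* int g(y) d(law of X)(y) in R^m. *)
Definition law_int (R : realType) (dO : measure_display)
    (Om : measurableType dO) (P : probability Om R) (m p : nat)
    (X : Om -> 'cV[R]_p) (g : 'cV[R]_p -> 'cV[R]_m) : 'cV[R]_m :=
  \col_(k < m) fine (\int[pushforward P X]_y (g y k ord0)%:E)%E.

Section lip.
Context (R : realType) (d m : nat) (T LF Lf : R).

Definition Lip (F : R -> cpath d T -> 'cV[R]_m -> 'M[R]_(m, d) -> 'cV[R]_m ->
                    'cV[R]_m)
    (f : R -> 'cV[R]_m -> 'cV[R]_m -> 'M[R]_(m, d) -> 'cV[R]_m) :=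
  forall t : R, 0 <= t <= T ->
  [/\ forall w w' y y' z z' a a',
        euclid (F t w y z a - F t w' y' z' a') <=
        LF * (cpath_dist w w' + euclid (y - y') + euclid (z - z')
              + euclid (a - a')),
      forall w y z a,
        euclid (F t w y z a) <= LF * (1 + euclid y + euclid z + euclid a),
      forall y1 y1' y2 y2' z z',
        euclid (f t y1 y2 z - f t y1' y2' z') <=
        Lf * (euclid (y1 - y1') + euclid (y2 - y2') + euclid (z - z'))
    & forall y y1 z,
        euclid (f t y y1 z) <= Lf * (1 + euclid y + euclid y1 + euclid z)].

End lip.

Section bsde.
Context (R : realType) (dO : measure_display) (Om : measurableType dO)
  (P : probability Om R) (d m : nat) (T : R) (W : nat -> Om -> cpath d T)
  (G : cpath d T -> 'cV[R]_m)
  (F : R -> cpath d T -> 'cV[R]_m -> 'M[R]_(m, d) -> 'cV[R]_m -> 'cV[R]_m)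
  (f : R -> 'cV[R]_m -> 'cV[R]_m -> 'M[R]_(m, d) -> 'cV[R]_m).

Let Wproc (j : nat) (t : R) (x : Om) : 'cV[R]_d := W j x t.

(* Indices i, j range over 0, .., n - 1 instead of 1, .., n; values of Y and Z at
   other indices are irrelevant. *)
Definition solves_system (n : nat) (Y : nat -> R -> Om -> 'cV[R]_m)
    (Z : nat -> nat -> R -> Om -> 'M[R]_(m, d)) :=
  let FF := completed_filtration P W `I_n in
  forall i, (i < n)%N ->
  [/\ progressive FF T (Y i), (E2sup P T (Y i) < +oo)%E,
      forall j, (j < n)%N ->
        progressive FF T (Z i j) /\ (E2int P T (Z i j) < +oo)%E
    & exists M : nat -> R -> Om -> 'cV[R]_m,
        (forall j, (j < n)%N ->
          is_ito_integral P FF T (Z i j) (Wproc j) (M j)) /\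
        {ae P, forall x, forall t : R, 0 <= t <= T ->
          Y i t x =
            G (W i x)
            + vint `[t, T] (fun u =>
                F u (W i x) (Y i u x) (Z i i u x)
                  (n%:R^-1 *: \sum_(j < n) f u (Y i u x) (Y j u x) (Z i i u x)))
            - \sum_(j < n) (M j T x - M j t x)}].

(* The McKean-Vlasov equation driven by W^i, in the completed filtration of W^i. *)
Definition solves_mckean_vlasov (i : nat) (Y : R -> Om -> 'cV[R]_m)
    (Z : R -> Om -> 'M[R]_(m, d)) :=
  let FF := completed_filtration P W [set i] in
  [/\ progressive FF T Y, (E2sup P T Y < +oo)%E,
      progressive FF T Z, (E2int P T Z < +oo)%E
    & exists M : R -> Om -> 'cV[R]_m,
        is_ito_integral P FF T Z (Wproc i) M /\
        {ae P, forall x, forall t : R, 0 <= t <= T ->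
          Y t x =
            G (W i x)
            + vint `[t, T] (fun u =>
                F u (W i x) (Y u x) (Z u x)
                  (law_int P (Y u) (fun y => f u (Y u x) y (Z u x))))
            - (M T x - M t x)}].

End bsde.

(* Main.v *)
Require Import Defs.
From HB Require Import structures.
From mathcomp Require Import all_boot all_order all_algebra.
From mathcomp Require Import all_classical all_reals all_analysis.
From mathcomp Require Import measurable_realfun ring lra.
Set Implicit Arguments.
Unset Strict Implicit.
Unset Printing Implicit Defensive.
Import Order.TTheory GRing.Theory Num.Theory.
Import numFieldNormedType.Exports.
Local Open Scope classical_set_scope.
Local Open Scope ring_scope.

(* Every component of a solution satisfies a scalar equation Y_s + V = Y_t + int_s^t Phi
   in which V is a stochastic integral over (s, t], hence orthogonal to Y_s.  Taking second
   moments gives an energy inequality without Ito's formula, and a backward Gronwall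
   argument turns it into a stability estimate.  Applied to Y^{i,n} - Y^i, first summed
   over i and then for a single i, it reduces the claim to an O(1/n) bound on the second
   moment of the error made when the mean of f(Y^i, Y^j, Z^i) over j replaces the integral
   against the law of Y^i.

   The summands of this error are orthogonal because the Y^j are independent with a common
   law: Y^i is a functional of W^i up to a null set, the same functional of W^j solves the
   equation driven by W^j, and solutions are unique.  Their second moments are controlled
   by E|Y^j - Y^k|^2, which the stability estimate bounds by the second moment of
   sup|W^j - W^k|, finite by Doob's inequality.  No moment of G enters the constant. *)

(** The average of [f] couples the error of one particle to the errors of all the others. Summing
    over the particles closes the estimate without any exchangeability of the system: the total
    error stays bounded in n, so its mean over the particles is of order 1/n.

    The energy inequality carries a factor t - s in front of the squared driver, which comes from
    Cauchy-Schwarz in time. That factor absorbs the Z-terms only on short intervals, so the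
    constants grow geometrically with the number of such intervals.

    Conditional expectation is replaced by Fubini: quantities depending on independent blocks of the
    noise are integrated one after the other. This gives the Ito isometry, the Markov property and
    the orthogonality in the law of large numbers.

    A stochastic integral is not an explicit functional of the path, so a solution is moved to
    another Brownian motion through the elementary approximations of its integral. *)

Lemma sqrD_le2 (R : realFieldType) (a b : R) : (a + b) ^+ 2 <= 2 * a ^+ 2 + 2 * b ^+ 2.
Proof. by have := sqr_ge0 (a - b); rewrite sqrrB sqrrD; lra. Qed.

Lemma normM_le_sqr (R : realFieldType) (a b : R) : 2 * `|a * b| <= a ^+ 2 + b ^+ 2.
Proof.
rewrite normrM -[a ^+ 2]real_normK ?num_real// -[b ^+ 2]real_normK ?num_real//.
by have := sqr_ge0 (`|a| - `|b|); rewrite sqrrB; lra.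
Qed.

(** * Square-integrable functions *)

Section L2kit.
Context d (T : measurableType d) (R : realType) (mu : {measure set T -> \bar R}).
Implicit Types X Y : T -> R.

Definition L2 X := measurable_fun setT X /\ (\int[mu]_x ((X x) ^+ 2)%:E < +oo)%E.

(** Real-valued, so that estimates can be closed by [ring] and [lra]. A divergent integral takes a
    default value, hence the [L2] hypotheses of the algebraic rules. *)
Definition ip X Y : R := \int[mu]_x (X x * Y x).

Definition nrm2 X : R := ip X X.

Lemma integrable_bound X Y : measurable_fun setT X -> mu.-integrable setT (EFin \o Y) ->
  (forall x, `|X x| <= Y x) -> mu.-integrable setT (EFin \o X).
Proof.
move=> mX iY XY; apply: le_integrable iY => //; first exact/measurable_EFinP.
by move=> x _ /=; rewrite lee_fin (le_trans (XY x))// ler_norm.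
Qed.

Lemma integrable_addR X Y : mu.-integrable setT (EFin \o X) -> mu.-integrable setT (EFin \o Y) ->
  mu.-integrable setT (EFin \o (fun x => X x + Y x)).
Proof. by move=> iX iY; exact: (@integrableD _ _ _ _ _ _ _ _ iX iY). Qed.

Lemma integrable_scaleR (a : R) X : mu.-integrable setT (EFin \o X) ->
  mu.-integrable setT (EFin \o (fun x => a * X x)).
Proof. by move=> iX; exact: (@integrableZl _ _ _ _ _ _ a _ iX). Qed.

Lemma L2_sqr X : L2 X -> mu.-integrable setT (EFin \o (fun x => X x ^+ 2)).
Proof.
move=> [mX fX]; apply/integrableP; split; first exact/measurable_EFinP/measurable_funX.
by under eq_integral do rewrite /= ger0_norm ?sqr_ge0//.
Qed.

Lemma L2P X : measurable_fun setT X -> mu.-integrable setT (EFin \o (fun x => X x ^+ 2)) -> L2 X.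
Proof.
move=> mX /integrableP[_ h]; split => //; apply: le_lt_trans h.
by under [leRHS]eq_integral do rewrite /= ger0_norm ?sqr_ge0//.
Qed.

Lemma L2_bound X Y : measurable_fun setT X -> mu.-integrable setT (EFin \o Y) ->
  (forall x, X x ^+ 2 <= Y x) -> L2 X.
Proof.
move=> mX iY XY; apply: L2P => //; apply: integrable_bound iY _ => //.
  exact: measurable_funX.
by move=> x; rewrite ger0_norm// sqr_ge0.
Qed.

Lemma L2D X Y : L2 X -> L2 Y -> L2 (fun x => X x + Y x).
Proof.
move=> lX lY; apply: (@L2_bound _ (fun x => 2 * (X x ^+ 2) + 2 * (Y x ^+ 2))).
- by apply: measurable_funD; [case: lX|case: lY].
- by apply: integrable_addR; apply: integrable_scaleR; exact: L2_sqr.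
- by move=> x; exact: sqrD_le2.
Qed.

Lemma L2Z (a : R) X : L2 X -> L2 (fun x => a * X x).
Proof.
move=> lX; apply: (@L2_bound _ (fun x => a ^+ 2 * (X x ^+ 2))).
- by apply: measurable_funM => //; case: lX.
- by apply: integrable_scaleR; exact: L2_sqr.
- by move=> x; rewrite exprMn.
Qed.

Lemma L2N X : L2 X -> L2 (fun x => - X x).
Proof.
by move=> /(L2Z (-1)); under eq_fun do rewrite mulN1r.
Qed.

Lemma L2B X Y : L2 X -> L2 Y -> L2 (fun x => X x - Y x).
Proof. by move=> lX lY; apply: L2D => //; exact: L2N. Qed.

Lemma L2_0 : L2 (fun=> 0).
Proof.
split; first exact: measurable_cst.
by under eq_integral do rewrite expr0n /=; rewrite integral0 ltry.
Qed.

Lemma L2_sum (I : Type) (s : seq I) (X : I -> T -> R) :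
  (forall i, L2 (X i)) -> L2 (fun x => \sum_(i <- s) X i x).
Proof.
move=> lX; elim: s => [|i s ih].
  by under eq_fun do rewrite big_nil; exact: L2_0.
by under eq_fun do rewrite big_cons; exact: L2D.
Qed.

Lemma L2_mulb X Y (c : R) : measurable_fun setT X -> (forall x, `|X x| <= c) -> L2 Y ->
  L2 (fun x => X x * Y x).
Proof.
move=> mX Xc lY; apply: (@L2_bound _ (fun x => c ^+ 2 * (Y x ^+ 2))).
- by apply: measurable_funM => //; case: lY.
- by apply: integrable_scaleR; exact: L2_sqr.
- move=> x; rewrite exprMn ler_wpM2r ?sqr_ge0//.
  by rewrite -[X x ^+ 2]real_normK ?num_real// lerXn2r ?nnegrE// (le_trans _ (Xc x)).
Qed.

Lemma L2_dom X Y : measurable_fun setT X -> L2 Y -> (forall x, `|X x| <= `|Y x|) -> L2 X.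
Proof.
move=> mX lY XY; apply: (@L2_bound _ (fun x => Y x ^+ 2)) => //; first exact: L2_sqr.
move=> x; rewrite -[X x ^+ 2]real_normK ?num_real// -[Y x ^+ 2]real_normK ?num_real//.
by rewrite lerXn2r ?nnegrE.
Qed.

Lemma L2_measurable X : L2 X -> measurable_fun setT X.
Proof. by case. Qed.

Lemma L2_mul_integrable X Y : L2 X -> L2 Y -> mu.-integrable setT (EFin \o (fun x => X x * Y x)).
Proof.
move=> lX lY; apply: (@integrable_bound _ (fun x => (X x ^+ 2) + (Y x ^+ 2))).
- by apply: measurable_funM; [case: lX|case: lY].
- by apply: integrable_addR; exact: L2_sqr.
- by move=> x; have := normM_le_sqr (X x) (Y x); have := normr_ge0 (X x * Y x); lra.
Qed.

Lemma ipC X Y : ip X Y = ip Y X.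
Proof. by rewrite /ip; congr fine; apply: eq_integral => x _; rewrite mulrC. Qed.

Lemma ipDr X Y Z : L2 X -> L2 Y -> L2 Z -> ip X (fun x => Y x + Z x) = ip X Y + ip X Z.
Proof.
move=> lX lY lZ; rewrite /ip -RintegralD//; last 2 first.
  exact: L2_mul_integrable.
  exact: L2_mul_integrable.
by congr fine; apply: eq_integral => x _; rewrite mulrDr.
Qed.

Lemma ipDl X Y Z : L2 X -> L2 Y -> L2 Z -> ip (fun x => X x + Y x) Z = ip X Z + ip Y Z.
Proof. by move=> *; rewrite ipC ipDr// ![ip Z _]ipC. Qed.

Lemma ipZr a X Y : L2 X -> L2 Y -> ip X (fun x => a * Y x) = a * ip X Y.
Proof.
move=> lX lY; rewrite /ip -RintegralZl//; last exact: L2_mul_integrable.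
by congr fine; apply: eq_integral => x _; rewrite mulrCA.
Qed.

Lemma ipZl a X Y : L2 X -> L2 Y -> ip (fun x => a * X x) Y = a * ip X Y.
Proof. by move=> *; rewrite ipC ipZr// ipC. Qed.

Lemma ip0r X : ip X (fun=> 0) = 0.
Proof. by rewrite /ip /Rintegral; under eq_integral do rewrite mulr0; rewrite integral0. Qed.

Lemma ip_sumr X (I : Type) (s : seq I) (Y : I -> T -> R) : L2 X -> (forall i, L2 (Y i)) ->
  ip X (fun x => \sum_(i <- s) Y i x) = \sum_(i <- s) ip X (Y i).
Proof.
move=> lX lY; elim: s => [|i s ih].
  by rewrite big_nil -[RHS](ip0r X); congr ip; apply/funext => x; rewrite big_nil.
rewrite big_cons -ih -ipDr//; last exact: L2_sum.
by congr ip; apply/funext => x; rewrite big_cons.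
Qed.

Lemma nrm2_sum (I : Type) (s : seq I) (Y : I -> T -> R) : (forall i, L2 (Y i)) ->
  nrm2 (fun x => \sum_(i <- s) Y i x) = \sum_(i <- s) \sum_(j <- s) ip (Y i) (Y j).
Proof.
move=> lY; rewrite /nrm2 ip_sumr//; last exact: L2_sum.
by apply: eq_bigr => i _; rewrite ipC ip_sumr.
Qed.

Lemma nrm2E X : nrm2 X = \int[mu]_x (X x ^+ 2).
Proof. by rewrite /nrm2 /ip; congr fine; apply: eq_integral => x _; rewrite expr2. Qed.

Lemma nrm2_EFin X : L2 X -> (nrm2 X)%:E = (\int[mu]_x (X x ^+ 2)%:E)%E.
Proof.
move=> lX; rewrite nrm2E /Rintegral fineK//.
have := lX.2 => /=; rewrite ge0_fin_numE//.
by apply: integral_ge0 => x _; rewrite lee_fin sqr_ge0.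
Qed.

Lemma nrm2_ge0 X : 0 <= nrm2 X.
Proof. by rewrite nrm2E; apply: Rintegral_ge0 => x _; rewrite sqr_ge0. Qed.

Lemma nrm2D X Y : L2 X -> L2 Y -> nrm2 (fun x => X x + Y x) = nrm2 X + 2 * ip X Y + nrm2 Y.
Proof.
move=> lX lY; rewrite /nrm2 ipDl//; last exact: L2D.
by rewrite !ipDr// (ipC Y X); ring.
Qed.

Lemma nrm2Z a X : L2 X -> nrm2 (fun x => a * X x) = a ^+ 2 * nrm2 X.
Proof.
move=> lX; rewrite /nrm2 ipZr//; last exact: L2Z.
by rewrite ipC ipZr// mulrA.
Qed.

Lemma nrm2N X : L2 X -> nrm2 (fun x => - X x) = nrm2 X.
Proof.
move=> lX; have := nrm2Z (-1) lX; rewrite sqrrN expr1n mul1r => <-.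
by congr nrm2; apply/funext => x; rewrite mulN1r.
Qed.

(** Young's inequality: expand the nonnegative squared norms of [r X + Y / r] and [r X - Y / r] with
    [r] the square root of [e]. The sign is the [s] of the proof. *)
Lemma ip_le X Y (e : R) : 0 < e -> L2 X -> L2 Y -> 2 * `|ip X Y| <= e * nrm2 X + e^-1 * nrm2 Y.
Proof.
move=> e0 lX lY.
have h (s : R) : s ^+ 2 = 1 -> 0 <= e * nrm2 X + 2 * (s * ip X Y) + e^-1 * nrm2 Y.
  move=> s1; pose r := Num.sqrt e.
  have r0 : r != 0 by rewrite lt0r_neq0// sqrtr_gt0.
  have re : e = r ^+ 2 by rewrite sqr_sqrtr// ltW.
  have := nrm2_ge0 (fun x => r * X x + (s / r) * Y x).
  rewrite nrm2D; [|exact: L2Z..].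
  rewrite ipZl//; last exact: L2Z.
  rewrite ipZr// !nrm2Z// re exprMn s1 mul1r exprVn.
  by rewrite (_ : r * (s / r * _) = s * ip X Y)// mulrA mulrCA divff// mulr1.
have := h 1 (expr1n _ _); have := h (-1); rewrite sqrrN expr1n => /(_ erefl).
by case: (ger0P (ip X Y)) => _ *; lra.
Qed.

Lemma nrm2_cvg X (V : nat -> T -> R) : L2 X -> (forall n, L2 (V n)) ->
  (fun n => nrm2 (fun x => V n x - X x)) @ \oo --> (0 : R) ->
  (fun n => nrm2 (V n)) @ \oo --> nrm2 X.
Proof.
move=> lX lV V0; apply/cvgrPdist_le => e e0.
have q0 : 0 < nrm2 X + 1 by rewrite ltr_wpDl// nrm2_ge0.
(* The parameter in Young's inequality: [k * nrm2 X] stays below [e / 2], and the rest is a multiple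
   of the error norm. The [+ 1] covers [nrm2 X = 0]. *)
pose k := e / 2 / (nrm2 X + 1).
have k0 : 0 < k by rewrite !divr_gt0.
have k1 : 0 < k^-1 + 1 by rewrite ltr_wpDl// invr_ge0 ltW.
have e' : 0 < e / 2 / (k^-1 + 1) by rewrite !divr_gt0.
have := V0 => /cvgrPdist_le /(_ _ e').
apply: filterS => n; rewrite sub0r normrN ger0_norm ?nrm2_ge0// ler_pdivlMr// => h.
have lD : L2 (fun x => V n x - X x) by exact: L2B.
have -> : V n = (fun x => X x + (V n x - X x)) by apply/funext => x; rewrite addrC subrK.
rewrite nrm2D//; set D := fun x => _ in h *.
have h1 := ip_le k0 lX lD.
have h2 : k * nrm2 X <= e / 2.
  by rewrite /k mulrAC -mulrA ler_piMr// ?divr_ge0 ?ltW// ltr_pdivrMr// mul1r ltrDl.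
have h3 := nrm2_ge0 D.
have -> : nrm2 X - (nrm2 X + 2 * ip X D + nrm2 D) = - (2 * ip X D + nrm2 D) by ring.
rewrite normrN (le_trans (ler_normD _ _))// (ger0_norm h3) normrM ger0_norm//.
by rewrite (le_trans (lerD h1 (lexx _)))//; lra.
Qed.

Lemma L2_ae X Y : measurable_fun setT X -> L2 Y -> {ae mu, forall x, X x = Y x} -> L2 X.
Proof.
move=> mX lY XY; split => //; apply: le_lt_trans lY.2.
rewrite le_eqVlt; apply/orP; left; apply/eqP; apply: ge0_ae_eq_integral => //.
- exact/measurable_EFinP/measurable_funX.
- by apply/measurable_EFinP/measurable_funX; case: lY.
- by move=> x _; rewrite lee_fin sqr_ge0.
- by move=> x _; rewrite lee_fin sqr_ge0.
- by apply: filterS XY => x -> _.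
Qed.

Lemma nrm2_ae X Y : measurable_fun setT X -> measurable_fun setT Y ->
  {ae mu, forall x, X x = Y x} -> nrm2 X = nrm2 Y.
Proof.
move=> mX mY XY; rewrite !nrm2E; congr fine; apply: ge0_ae_eq_integral => //.
- exact/measurable_EFinP/measurable_funX.
- exact/measurable_EFinP/measurable_funX.
- by move=> x _; rewrite lee_fin sqr_ge0.
- by move=> x _; rewrite lee_fin sqr_ge0.
- by apply: filterS XY => x -> _.
Qed.

Lemma ip_ae X X' Y : measurable_fun setT X -> measurable_fun setT X' -> measurable_fun setT Y ->
  {ae mu, forall x, X x = X' x} -> ip X Y = ip X' Y.
Proof.
move=> mX mX' mY XX'; congr fine; apply: ae_eq_integral => //.
- exact/measurable_EFinP/measurable_funM.
- exact/measurable_EFinP/measurable_funM.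
- by apply: filterS XX' => x -> _.
Qed.

Lemma nrm2_eq0_ae X : L2 X -> nrm2 X = 0 -> {ae mu, forall x, X x = 0}.
Proof.
move=> lX X0; have [/measurable_int mX _] := conj (L2_sqr lX) I.
have h : (\int[mu]_x `|(X x ^+ 2)%:E| = 0)%E.
  under eq_integral do rewrite /= ger0_norm ?sqr_ge0//.
  by rewrite -nrm2_EFin// X0.
have /(ae_eq_integral_abs mu measurableT mX) := h.
by apply: filterS => x /= /(_ I) [] /eqP; rewrite sqrf_eq0 => /eqP.
Qed.

End L2kit.

Section L2_finite.
Context d (T : measurableType d) (R : realType) (P : probability T R).
Implicit Types X Y : T -> R.

Lemma L2_cst (c : R) : L2 P (fun=> c).
Proof.
split; first exact: measurable_cst.
by rewrite integral_cst//= probability_setT mule1 ltry.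
Qed.

Lemma L2_integrable X : L2 P X -> P.-integrable setT (EFin \o X).
Proof.
move=> lX; have := L2_mul_integrable (L2_cst 1) lX.
by under eq_fun do rewrite mul1r.
Qed.

(** The variance of [X] is nonnegative. *)
Lemma Rintegral_sqr_le X : L2 P X -> (\int[P]_x X x) ^+ 2 <= nrm2 P X.
Proof.
move=> lX; set c := \int[P]_x X x.
have := nrm2_ge0 P (fun x => X x + (- c)).
have nc : nrm2 P (fun=> - c) = c ^+ 2.
  by rewrite nrm2E /Rintegral integral_cst//= probability_setT mule1 /= sqrrN.
have ic : ip P X (fun=> - c) = - c ^+ 2.
  rewrite /ip RintegralZr//; last exact: L2_integrable.
  by rewrite -/c mulrN expr2.
rewrite (nrm2D lX (L2_cst (- c))) nc ic; lra.
Qed.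

End L2_finite.

(** * Measurability of matrix-valued functions *)

Section matrix_measurability.
Context (R : realType) (p q : nat).

Lemma measurable_coord (D : set 'M[R]_(p, q)) i j : measurable_fun D (fun A : 'M[R]_(p, q) => A i j).
Proof.
suff h : measurable_fun setT (fun A : 'M[R]_(p, q) => A i j) by exact: measurable_funTS.
apply: (measurability _ (@RGenOInfty.measurableE R)) => _ [_ [a ->]] <-.
rewrite setTI; apply: sub_sigma_algebra => /=.
rewrite set_itvE; apply: (open_comp (f := fun A : 'M[R]_(p, q) => A i j)); last exact: open_gt.
by move=> A _; exact: coord_continuous.
Qed.

Context d (T : measurableType d) (D : set T).

(** An open set of matrices is a countable union of boxes with rational centre and radius, and the
    preimage of a box is a finite intersection of coordinate conditions. *)
Lemma measurable_fun_mxP (f : T -> 'M[R]_(p, q)) :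
  measurable_fun D f <-> forall i j, measurable_fun D (fun x => f x i j).
Proof.
split=> [mf i j|mf].
  exact: (measurableT_comp (@measurable_coord setT i j)).
have [mD|nD] := pselect (measurable D); last by move=> /nD.
have box (v : 'M[rat]_(p, q)) (r : rat) :
    measurable (D `&` [set x | forall i j, `|f x i j - ratr (v i j)| < ratr r]).
  have -> : D `&` [set x | forall i j, `|f x i j - ratr (v i j)| < ratr r] =
     D `&` \bigcap_i \bigcap_j (D `&` (fun x => f x i j) @^-1` `](ratr (v i j) - ratr r), (ratr (v i j) + ratr r)[).
    apply/seteqP; split => x [Dx /= h]; split => //.
      move=> i _ j _; split => //=; rewrite in_itv /=; have := h i j.
      by rewrite ltr_distl.
    by move=> i j; have [_ /=] := h i I j I; rewrite in_itv /= ltr_distl.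
  apply: measurableI => //; apply: fin_bigcap_measurable => // i _.
  by apply: fin_bigcap_measurable => // j _; apply: mf.
apply: (measurability _ (erefl : @measurable _ 'M[R]_(p, q) = <<s @open 'M[R]_(p, q) >>)) => _ [U oU <-].
have -> : D `&` f @^-1` U = \bigcup_(vr in [set vr : 'M[rat]_(p, q) * rat |
    [set A : 'M[R]_(p, q) | forall i j, `|A i j - ratr (vr.1 i j)| < ratr vr.2] `<=` (U : set 'M[R]_(p, q))])
    (D `&` [set x | forall i j, `|f x i j - ratr (vr.1 i j)| < ratr vr.2]).
  apply/seteqP; split=> [x [Dx /= fU]|x [vr /= vrU [Dx /= h]]]; last first.
    by split => //; exact: vrU.
  have : nbhs (f x) U by apply: open_nbhs_nbhs.
  move=> /nbhs_ballP [e /= e0 eU].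
  (* A rational centre within [r] of [f x] and a box of radius [r] around it stay within [2 r < e]
     of [f x]. *)
  have /rat_in_itvoo [r /itvP rP] : 0 < e / 2 by rewrite divr_gt0.
  have rp : 0 < ratr r :> R by rewrite rP.
  have /choice [v hv] : forall ij : 'I_p * 'I_q, exists w : rat, `|f x ij.1 ij.2 - ratr w| < ratr r.
    move=> ij; have /rat_in_itvoo [w /itvP wP] : f x ij.1 ij.2 - ratr r < f x ij.1 ij.2 + ratr r.
      by move: rp; lra.
    by exists w; rewrite distrC ltr_distl !wP.
  exists (\matrix_(i, j) v (i, j), r) => /=; last first.
    by split => //= i j; rewrite mxE; exact: (hv (i, j)).
  move=> A /= hA; apply: eU; split => // i j; rewrite /ball /=.
  have := hA i j; rewrite mxE => h1; have := hv (i, j) => /= h2.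
  have : ratr r < e / 2 by rewrite rP.
  by move: h1 h2; rewrite !ltr_distl => /andP[? ?] /andP[? ?] ?; apply/andP; split; lra.
rewrite bigcup_mkcond.
apply: countable_bigcupT_measurable => // vr.
by case: ifPn => _; [exact: box|exact: measurable0].
Qed.

End matrix_measurability.

Section euclid_lemmas.
Context (R : realType) (p q : nat).
Implicit Types A B : 'M[R]_(p, q).

Lemma euclid_sqr A : euclid A ^+ 2 = \sum_(i < p) \sum_(j < q) A i j ^+ 2.
Proof. by rewrite sqr_sqrtr// sumr_ge0// => i _; rewrite sumr_ge0// => j _; rewrite sqr_ge0. Qed.

Lemma euclid_ge0 A : 0 <= euclid A. Proof. exact: sqrtr_ge0. Qed.

Lemma coord_le_euclid A i j : `|A i j| <= euclid A.
Proof.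
rewrite -[leLHS]sqrtr_sqr ler_wsqrtr// (bigD1 i)//= (bigD1 j)//= -addrA lerDl.
by rewrite addr_ge0// sumr_ge0// => k _; rewrite ?sqr_ge0// sumr_ge0// => l _; rewrite sqr_ge0.
Qed.

Lemma euclid_le_sum A : euclid A <= \sum_(i < p) \sum_(j < q) `|A i j|.
Proof.
have s0 : 0 <= \sum_(i < p) \sum_(j < q) `|A i j| by do 2 (apply: sumr_ge0 => ? _).
have le1 (I : finType) (a : I -> R) : (forall i, 0 <= a i) -> \sum_i a i ^+ 2 <= (\sum_i a i) ^+ 2.
  move=> a0; rewrite [leRHS]expr2 big_distrl /=; apply: ler_sum => i _.
  by rewrite expr2 ler_wpM2l// (bigD1 i)//= lerDl sumr_ge0.
rewrite -(ler_pXn2r (n := 2))// ?nnegrE ?euclid_ge0// euclid_sqr.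
apply: le_trans (le1 _ _ _); last by move=> i; rewrite sumr_ge0.
apply: ler_sum => i _; apply: le_trans (le1 _ _ _) => //.
by apply: ler_sum => j _; rewrite real_normK// num_real.
Qed.

Lemma euclidN A : euclid (- A) = euclid A.
Proof. by congr Num.sqrt; apply: eq_bigr => i _; apply: eq_bigr => j _; rewrite mxE sqrrN. Qed.

Lemma euclid_distC A B : euclid (A - B) = euclid (B - A).
Proof. by rewrite -euclidN opprB. Qed.

Lemma euclid0 : euclid (0 : 'M[R]_(p, q)) = 0.
Proof.
rewrite /euclid big1 ?sqrtr0// => i _; rewrite big1// => j _.
by rewrite mxE expr0n.
Qed.

Lemma measurable_euclid_sqr d (T : measurableType d) (D : set T) (X : T -> 'M[R]_(p, q)) :
  measurable_fun D X -> measurable_fun D (fun x => euclid (X x) ^+ 2).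
Proof.
move=> /measurable_fun_mxP mX; under eq_fun do rewrite euclid_sqr.
apply: measurable_sum => i; apply: measurable_sum => j.
exact: measurable_funX.
Qed.

End euclid_lemmas.

(** Rounding [y] down to the grid of mesh [1 / n.+1] leaves countably many values. On each level set
    [g] is evaluated at a fixed matrix, and the Lipschitz bound gives pointwise convergence as the
    mesh shrinks. *)
Lemma measurable_caratheodory (R : realType) (p q : nat) d (T : measurableType d) (D : set T)
    (g : T -> 'M[R]_(p, q) -> R) (y : T -> 'M[R]_(p, q)) (K : R) :
  (forall v, measurable_fun D (g ^~ v)) ->
  (forall x v v', D x -> `|g x v - g x v'| <= K * euclid (v - v')) ->
  measurable_fun D y -> measurable_fun D (fun x => g x (y x)).
Proof.
move=> mg gK my.
have [mD|nD] := pselect (measurable D); last by move=> /nD.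
pose w n (v : 'M[R]_(p, q)) : 'M[int]_(p, q) := \matrix_(i, j) Num.floor (n.+1%:R * v i j).
pose u n (z : 'M[int]_(p, q)) : 'M[R]_(p, q) := \matrix_(i, j) ((z i j)%:~R / n.+1%:R).
have dist n v : euclid (u n (w n v) - v) <= (p * q)%:R / n.+1%:R.
  apply: le_trans (euclid_le_sum _) _.
  apply: (@le_trans _ _ (\sum_(i < p) \sum_(j < q) n.+1%:R^-1)); last first.
    by rewrite !sumr_const !card_ord -!mulrnA mulr_natl mulnC.
  apply: ler_sum => i _; apply: ler_sum => j _; rewrite !mxE.
  have n0 : 0 < n.+1%:R :> R by [].
  set t := n.+1%:R * v i j; have -> : v i j = t / n.+1%:R by rewrite mulrC mulKf// lt0r_neq0.
  rewrite -mulrBl normrM [X in _ * X]ger0_norm ?invr_ge0//.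
  rewrite ler_piMl ?invr_ge0// distrC ger0_norm ?subr_ge0 ?floor_le//.
  by rewrite lerBlDr addrC -intrD1 ltW// floorD1_gt.
apply: (@measurable_fun_cvg _ _ _ D (fun n x => g x (u n (w n (y x))))).
  move=> n _ B mB.
  have -> : D `&` (fun x => g x (u n (w n (y x)))) @^-1` B =
     \bigcup_(z : 'M[int]_(p, q)) ((D `&` [set x | w n (y x) = z]) `&` (D `&` (fun x => g x (u n z)) @^-1` B)).
    apply/seteqP; split=> [x [Dx /= h]|x [z _ [[Dx /= <-] [_ h]]]//].
    by exists (w n (y x)).
  apply: countable_bigcupT_measurable => // z.
  apply: measurableI; last exact: mg.
  have -> : D `&` [set x | w n (y x) = z] =
     D `&` \bigcap_i \bigcap_j (D `&` (fun x => n.+1%:R * y x i j) @^-1` `[(z i j)%:~R, (z i j + 1)%:~R[).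
    apply/seteqP; split => x [Dx /= h]; split => //.
      move=> i _ j _; split => //=; rewrite in_itv /= -h mxE floor_le/=.
      exact: floorD1_gt.
    apply/matrixP => i j; rewrite mxE; have [_ /=] := h i I j I; rewrite in_itv /=.
    by move=> zz; apply/floor_def.
  apply: measurableI => //; apply: fin_bigcap_measurable => // i _.
  apply: fin_bigcap_measurable => // j _; apply: measurable_funM => //.
  by have /measurable_fun_mxP := my.
move=> x Dx; apply/cvgrPdist_le => e e0.
have pq0 : 0 < `|K| * (p * q)%:R + 1 by rewrite ltr_wpDl// mulr_ge0.
near=> n.
rewrite (le_trans (gK _ _ _ Dx))// euclid_distC (le_trans (ler_wpM2r (euclid_ge0 _) (ler_norm _)))//.
rewrite (le_trans (ler_wpM2l (normr_ge0 _) (dist _ _)))// mulrA ler_pdivrMr// .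
apply: (@le_trans _ _ (`|K| * (p * q)%:R + 1)); first by rewrite lerDl.
rewrite -ler_pdivrMl// mulrC.
apply: (@le_trans _ _ n%:R); last by rewrite ler_nat.
near: n; exact: nbhs_infty_ger.
Unshelve. all: by end_near. Qed.

(** * Image measures, generated sigma-algebras and independence *)

Section mk_mfun.
Context d1 d2 (T1 : measurableType d1) (T2 : measurableType d2) (f : T1 -> T2)
  (mf : measurable_fun setT f).

Let mf_mixin := isMeasurableFun.Build _ _ _ _ _ mf.

Definition mk_mfun : {mfun T1 >-> T2} := HB.pack f mf_mixin.

End mk_mfun.

Section law_transfer.
Context d1 d2 (T1 : measurableType d1) (T2 : measurableType d2) (R : realType)
  (P : probability T1 R) (f : T1 -> T2) (mf : measurable_fun setT f).

Definition law_of : probability T2 R := distribution P (mk_mfun mf).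

Lemma ge0_integral_law (g : T2 -> \bar R) : measurable_fun setT g -> (forall y, 0 <= g y)%E ->
  (\int[law_of]_y g y = \int[P]_x g (f x))%E.
Proof. by move=> mg g0; rewrite /law_of /distribution ge0_integral_pushforward. Qed.

Lemma integral_law (g : T2 -> R) : measurable_fun setT g ->
  \int[law_of]_y g y = \int[P]_x g (f x).
Proof.
move=> mg; rewrite /Rintegral integralE [in RHS]integralE; congr (fine (_ - _)%E).
  rewrite ge0_integral_law//; last exact/measurable_funepos/measurable_EFinP.
  by under [RHS]eq_integral do rewrite (funepos_comp (EFin \o g) f).
rewrite ge0_integral_law//; last exact/measurable_funeneg/measurable_EFinP.
by under [RHS]eq_integral do rewrite (funeneg_comp (EFin \o g) f).
Qed.

End law_transfer.

Section sub_sigma.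
Context d (Om : measurableType d).

Lemma g_sigma_sub (S : set_system Om) : S `<=` measurable -> <<s S >> `<=` measurable.
Proof. by move=> h; apply: smallest_sub => //; exact: sigma_algebra_measurable. Qed.

Lemma measurable_fun_g_sigma d' (V : measurableType d') (S : set_system Om) (f : Om -> V) :
  S `<=` measurable -> measurable_fun setT (f : g_sigma_algebraType S -> V) -> measurable_fun setT f.
Proof.
move=> h mf _ A mA; apply: g_sigma_sub h _ _.
exact: (mf measurableT A mA).
Qed.

Lemma measurable_fun_g_sigmaS d' (V : measurableType d') (S S' : set_system Om) (f : Om -> V) :
  S `<=` <<s S' >> -> measurable_fun setT (f : g_sigma_algebraType S -> V) ->
  measurable_fun setT (f : g_sigma_algebraType S' -> V).
Proof.
move=> h mf _ A mA; apply: (smallest_sub _ h); last exact: (mf measurableT A mA).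
exact: smallest_sigma_algebra.
Qed.

Lemma measurable_id_g_sigma (S : set_system Om) : S `<=` measurable ->
  measurable_fun setT (fun x : Om => x : g_sigma_algebraType S).
Proof. by move=> h _ A mA; rewrite setTI; exact: g_sigma_sub h _ mA. Qed.

End sub_sigma.

Section independence.
Context (R : realType) d (Om : measurableType d) (P : probability Om R).

(** Independence says that the diagonal map sends [P] to the product of its restrictions to the two
    generated sigma-algebras; Fubini then separates the two arguments. This takes the place of
    conditional expectation throughout. *)
Lemma indep_integral (S1 S2 : set_system Om) : S1 `<=` measurable -> S2 `<=` measurable ->
  independent P S1 S2 ->
  forall k : g_sigma_algebraType S1 * g_sigma_algebraType S2 -> R,
  measurable_fun setT k -> P.-integrable setT (fun x => (k (x, x))%:E) ->
  \int[P]_x k (x, x) = \int[P]_x (\int[P]_y k (x, y)).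
Proof.
move=> m1 m2 ind k mk ik.
have i1 := measurable_id_g_sigma m1; have i2 := measurable_id_g_sigma m2.
have id := measurable_fun_pair i1 i2.
pose Q := (law_of P i1 \x law_of P i2)%E.
have eQ A : measurable A -> law_of P id A = Q A.
  move=> mA; apply/esym/(@product_measure_unique _ _ _ _ _ (law_of P i1) (law_of P i2) (law_of P id)) => // A1 A2 mA1 mA2; exact: ind.
have iQ : Q.-integrable setT (EFin \o k).
  apply/integrableP; split; first exact/measurable_EFinP.
  rewrite (eq_measure_integral (law_of P id)); last by move=> A mA _; exact: (esym (eQ A mA)).
  rewrite ge0_integral_law//; last by apply: measurableT_comp => //; exact/measurable_EFinP.
  by case/integrableP : ik.
rewrite -(@integral_law _ _ _ _ _ P _ id)// {1}/Rintegral.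
rewrite (eq_measure_integral Q); last by move=> A mA _; exact: eQ.
rewrite -(integral12_prod_meas1 iQ).
have mF := measurable_fubini_F iQ; have iF := integrable_fubini_F iQ.
have FE x : fine (fubini_F (law_of P i2) (EFin \o k) x) = \int[P]_y k (x, y).
  exact: (@integral_law _ _ _ _ _ P _ i2 (fun y => k (x, y)) (measurableT_comp mk (pair1_measurable x))).
have mfF : measurable_fun setT (fun x => fine (fubini_F (law_of P i2) (EFin \o k) x)).
  rewrite (_ : (fun x => _) = fine \o (fubini_F (law_of P i2) (EFin \o k)))//; exact: measurableT_comp.
transitivity (\int[law_of P i1]_x fine (fubini_F (law_of P i2) (EFin \o k) x)).
  congr fine; apply: ae_eq_integral => //.
    exact/measurable_EFinP.
  have := integrable_ae measurableT iF.
  by apply: filterS => x /= h _; rewrite fineK// h.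
rewrite (integral_law _ _ mfF); by congr fine; apply: eq_integral => x _; rewrite FE.
Qed.

End independence.

Section independence_pi.
Context (R : realType) d (Om : measurableType d) (P : probability Om R).

Definition null_sets : set_system Om := [set A | measurable A /\ P A = 0%E].

Lemma independentC (S1 S2 : set_system Om) : independent P S1 S2 -> independent P S2 S1.
Proof. by move=> h A1 A2 h1 h2; rewrite setIC h// muleC. Qed.

Lemma independentS (S1 S2 S1' S2' : set_system Om) : S1' `<=` <<s S1 >> -> S2' `<=` <<s S2 >> ->
  independent P S1 S2 -> independent P S1' S2'.
Proof.
move=> s1 s2 h A1 A2 h1 h2; apply: h.
  by apply: smallest_sub s1 _ h1; exact: smallest_sigma_algebra.
by apply: smallest_sub s2 _ h2; exact: smallest_sigma_algebra.
Qed.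

(** For fixed [B], the sets [A] that satisfy the product formula form a Dynkin system. Adjoining the
    null sets to [C] preserves stability under intersection, because a null set intersected with a
    measurable set is again null. *)
Lemma independent_pi (C S2 : set_system Om) : setI_closed C -> C `<=` measurable -> S2 `<=` measurable ->
  (forall A B, C A -> <<s S2 >> B -> P (A `&` B) = (P A * P B)%E) ->
  independent P (C `|` null_sets) S2.
Proof.
move=> CI mC mS2 h A B hA hB.
have mB : measurable B by exact: g_sigma_sub mS2 _ hB.
have CNI : setI_closed (C `|` null_sets).
  move=> X Y [CX|[mX X0]] [CY|[mY Y0]].
  - by left; exact: CI.
  - right; split; first by apply: measurableI => //; exact: mC.
    by apply: (subset_measure0 (B := Y)) => //; apply: measurableI => //; exact: mC.
  - right; split; first by apply: measurableI => //; exact: mC.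
    by apply: (subset_measure0 (B := X)) => //; apply: measurableI => //; exact: mC.
  - right; split; first by apply: measurableI.
    by apply: (subset_measure0 (B := X)) => //; apply: measurableI.
have CNm : C `|` null_sets `<=` measurable by move=> X [/mC|[]].
suff : <<s C `|` null_sets >> `<=` [set X | measurable X /\ P (X `&` B) = (P X * P B)%E].
  by move=> /(_ A hA) [].
rewrite -setI_closed_g_dynkin_g_sigma_algebra//; apply: smallest_sub.
  split.
  - by rewrite /=; split => //; rewrite setTI probability_setT mul1e.
  - move=> X [mX hX]; split; first exact: measurableC.
    have -> : ~` X `&` B = B `\` (X `&` B).
      by rewrite setDE setCI setIUr setICr setU0 setIC.
    rewrite measureD//; last 2 first.
      exact: measurableI.
      by rewrite -ge0_fin_numE// fin_num_measure.
    rewrite (_ : B `&` (X `&` B) = X `&` B) ?hX; last by rewrite setICA setIid.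
    rewrite probability_setC// muleBl ?fin_num_adde_defr ?fin_num_measure//.
    by rewrite mul1e; congr (_ - _)%E; exact: hX.
  - move=> F tF hF; split; first by apply: bigcupT_measurable => k; have [] := hF k.
    rewrite setI_bigcupl !measure_bigcup//; last 3 first.
      by move=> k _; have [] := hF k.
      by move=> k _; apply: measurableI => //; have [] := hF k.
      exact: trivIset_setIr.
    rewrite -(fineK (fin_num_measure P B mB)) muleC -nneseriesZl//.
    by apply: eq_eseriesr => k _; rewrite fineK ?fin_num_measure// [RHS]muleC; have [_ e] := hF k; exact: e.
move=> X [CX|[mX X0]]; split => //=; first exact: mC.
- by apply: h.
- by rewrite X0 mul0e; apply: (subset_measure0 (B := X)) => //; apply: measurableI.
Qed.

End independence_pi.

Section block_independence.
Context (R : realType) d (Om : measurableType d) (P : probability Om R).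
Context (I : finType) (G : I -> set_system Om) (S2 : set_system Om).
Hypothesis mG : forall i, G i `<=` measurable.
Hypothesis mS2 : S2 `<=` measurable.
Hypothesis GS2 : forall (A : I -> set Om) B, (forall i, <<s G i >> (A i)) -> <<s S2 >> B ->
  P ((\bigcap_i A i) `&` B) = (P (\bigcap_i A i) * P B)%E.

(** The intersections of one event from each [G i] form a pi-system that generates the join of the
    [G i]. The pi-system argument runs once for each side, so that null sets can be adjoined to
    both. *)
Lemma independent_block :
  independent P (\bigcup_i G i `|` null_sets P) (S2 `|` null_sets P).
Proof.
pose C := [set X | exists2 A : I -> set Om, (forall i, <<s G i >> (A i)) & X = \bigcap_i A i].
have mC : C `<=` measurable.
  move=> _ [A hA ->]; apply: fin_bigcap_measurable => // i _.
  exact: g_sigma_sub (@mG i) _ (hA i).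
have CI : setI_closed C.
  move=> _ _ [A hA ->] [B hB ->]; exists (fun i => A i `&` B i); last first.
    by rewrite -bigcapI.
  move=> i; have := @measurableI _ (g_sigma_algebraType (G i)) (A i) (B i).
  by apply; [exact: hA|exact: hB].
have i1 : independent P (C `|` null_sets P) S2.
  by apply: independent_pi => // _ B [A hA ->] hB; exact: GS2.
(* Second run with the roles exchanged: the sigma-algebra generated by [S2] is itself a
   pi-system. *)
have i2 : independent P (S2 `|` null_sets P) (C `|` null_sets P).
  pose C2 := [set X | <<s S2 >> X].
  have C2I : setI_closed C2 by move=> A B; exact: (@measurableI _ (g_sigma_algebraType S2)).
  have mC2 : C2 `<=` measurable by exact: g_sigma_sub.
  have mCN : C `|` null_sets P `<=` measurable by move=> X [/mC|[]].
  apply: (independentS _ _ (independent_pi (P := P) C2I mC2 mCN _)); last first.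
  - by move=> A B hA hB; rewrite setIC muleC; exact: i1.
  - exact: sub_sigma_algebra.
  - move=> A [hA|hA]; apply: sub_sigma_algebra; [left|by right].
    exact: sub_sigma_algebra.
apply: independentS (independentC i2); last exact: sub_sigma_algebra.
move=> A [[i _ hA]|hA]; apply: sub_sigma_algebra; [left|by right].
exists (fun j => if j == i then A else setT).
  move=> j; case: eqP => [->|_]; first exact: sub_sigma_algebra.
  exact: (@measurableT _ (g_sigma_algebraType (G j))).
apply/seteqP; split=> [x Ax j _|x /(_ i Logic.I)]; last by rewrite eqxx.
by case: eqP.
Qed.

End block_independence.

(** * Brownian increments *)

Section density.
Local Open Scope ereal_scope.
Context (R : realType).
Local Notation mu := (@lebesgue_measure R).
Import HBNNSimple.

(** Both sides agree on indicators by the definition of the Gaussian measure through its density;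
    simple functions and monotone convergence do the rest. *)
Lemma ge0_integral_normal_prob (s : R) (f : R -> \bar R) : measurable_fun setT f -> (forall x, 0 <= f x) ->
  \int[normal_prob 0 s]_x f x = \int[mu]_x (f x * (normal_pdf 0 s x)%:E).
Proof.
move=> mf f0; set g := fun x => (normal_pdf 0 s x)%:E.
have g0 x : 0 <= g x by rewrite lee_fin normal_pdf_ge0.
have mg : measurable_fun setT g by apply/measurable_EFinP; exact: measurable_normal_pdf.
pose h := nnsfun_approx measurableT mf.
have hm n : measurable_fun setT (EFin \o h n) by apply/measurable_EFinP.
have hge n x : 0 <= (EFin \o h n) x by rewrite lee_fin.
have hf x : (EFin \o h n) x @[n --> \oo] --> f x by exact: cvg_nnsfun_approx.
have hnd x : {homo (fun n => (EFin \o h n) x) : a b / (a <= b)%N >-> a <= b}.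
  by move=> a b ab; rewrite lee_fin; exact/lefP/nd_nnsfun_approx.
have -> : \int[normal_prob 0 s]_x f x = limn (fun n => \int[normal_prob 0 s]_x (EFin \o h n) x).
  rewrite -monotone_convergence//.
  - by apply: eq_integral => x _; apply/esym/cvg_lim => //.
have -> : \int[mu]_x (f x * g x) = limn (fun n => \int[mu]_x ((EFin \o h n) x * g x)).
  rewrite -monotone_convergence//.
  - by apply: eq_integral => x _; apply/esym/cvg_lim => //; exact: cvgeZr.
  - by move=> n; apply: emeasurable_funM => //; exact: hm.
  - by move=> n x _; apply: mule_ge0; [exact: hge|exact: g0].
  - by move=> x _ a b ab; apply: lee_wpmul2r; [exact: g0|exact: hnd].
apply/congr_lim/funext => n /=.
transitivity (\int[normal_prob 0 s]_x (\sum_(y \in range (h n)) (y * \1_(h n @^-1` [set y]) x)%:E)).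
  by apply: eq_integral => t _; rewrite /= fimfunE -fsumEFin.
have indich m r : measurable_fun setT (fun x => (r * \1_(h m @^-1` [set r]) x)%:E).
  by apply/measurable_EFinP; exact: measurable_funM.
rewrite ge0_integral_fsum//; last 2 first.
- by move=> r; exact: indich.
- by move=> m y _; exact: nnfun_muleindic_ge0.
transitivity (\int[mu]_x (\sum_(y \in range (h n)) (y * \1_(h n @^-1` [set y]) x)%:E * g x)); last first.
  apply: eq_integral => x _.
  rewrite -ge0_mule_fsuml => [|y]; last exact: nnfun_muleindic_ge0.
  by congr (_ * _); rewrite [in RHS]fimfunE -fsumEFin.
rewrite ge0_integral_fsum//; last 2 first.
- by move=> y; apply: emeasurable_funM; [exact: indich|exact: mg].
- by move=> m y _; rewrite mule_ge0// nnfun_muleindic_ge0.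
apply: eq_fsbigr => r rhn.
have [r0|r0] := leP 0%R r; last first.
  have e : h n @^-1` [set r] = set0 by apply: preimage_nnfun0.
  rewrite integral0_eq ?[RHS]integral0_eq// => x _.
    by rewrite e indic0 mulr0 mul0e.
  by rewrite e indic0 mulr0.
have mA : measurable (h n @^-1` [set r]) by apply: measurable_funPTI.
have mind : measurable_fun setT (fun x => (\1_(h n @^-1` [set r]) x : R)%:E).
  by apply/measurable_EFinP/measurable_indic; exact: measurable_funPTI.
under eq_integral do rewrite EFinM.
rewrite ge0_integralZl//.
under [RHS]eq_integral do rewrite EFinM -muleA.
rewrite ge0_integralZl; [|by []|exact: emeasurable_funM|by move=> x _; rewrite mule_ge0// lee_fin|by rewrite ?lee_fin].
congr (_ * _); rewrite integral_indic// setIT /normal_prob [LHS]integral_mkcond; apply: eq_integral => x _.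
by rewrite epatch_indic /= muleC.
Qed.

End density.

Section normal_moments.
Context (R : realType) (s : R).
Hypothesis s0 : 0 < s.
Local Notation mu := (@lebesgue_measure R).

Lemma normal_probN (A : set R) : measurable A ->
  normal_prob 0 s ((-%R : R -> R) @^-1` A) = normal_prob 0 s A.
Proof.
move=> mA; rewrite /normal_prob.
have pN x : normal_pdf 0 s (- x) = normal_pdf 0 s x.
  by rewrite !normal_pdfE ?gt_eqF// /normal_fun !subr0 sqrrN.
transitivity (\int[pushforward mu (-%R : _ -> measurableTypeR R)]_(x in A) (normal_pdf 0 s x)%:E)%E.
  rewrite ge0_integral_pushforward//.
  - by apply: eq_integral => x _ /=; rewrite pN.
  - by apply/measurable_EFinP/measurable_funTS; exact: measurable_normal_pdf.
  - by move=> x _; rewrite lee_fin normal_pdf_ge0.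
by apply: eq_measure_integral => B mB _; exact: lebesgue_measureN.
Qed.

Let w (x : R) := normal_pdf 0 s x.

Let wE x : w x = normal_peak s * expR (- x ^+ 2 / (s ^+ 2 *+ 2)).
Proof. by rewrite /w normal_pdfE ?gt_eqF// /normal_fun subr0. Qed.

(** Since [w' = - x w / s^2], this is an antiderivative of [(x^2 - s^2) w]. On a bounded interval
    the second moment thus equals [s^2] times the mass, up to a boundary term. *)
Let dw (x : R) : is_derive x 1 (fun y => - s ^+ 2 * (y * w y)) ((x ^+ 2 - s ^+ 2) * w x).
Proof.
have -> : (fun y => - s ^+ 2 * (y * w y)) =
  (fun y => - s ^+ 2 * (y * (normal_peak s * expR (- y ^+ 2 / (s ^+ 2 *+ 2))))).
  by apply/funext => y; rewrite wE.
apply: is_derive_eq; rewrite wE /GRing.scale /=.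
set e := expR _; field; exact: lt0r_neq0.
Qed.

Let wN x : w (- x) = w x.
Proof. by rewrite !wE sqrrN. Qed.

Let mw : measurable_fun setT w.
Proof. exact: measurable_normal_pdf. Qed.

Let I (n : nat) := `[- n.+1%:R, n.+1%:R]%classic : set R.

Let integral_I (n : nat) :
  (\int[mu]_(x in I n) (x ^+ 2 * w x)%:E = (s ^+ 2)%:E * \int[mu]_(x in I n) (w x)%:E
    - (2 * s ^+ 2 * (n.+1%:R * w n.+1%:R))%:E)%E.
Proof.
have n0 : 0 < n.+1%:R :> R by [].
have cw x : {for x, continuous w} by apply: continuous_normal_pdf; rewrite gt_eqF.
have cf : continuous (fun x : R => (x ^+ 2 - s ^+ 2) * w x).
  move=> x; apply: cvgM; last exact: cw.
  by apply: (@cvgB _ R^o); [exact: exprn_continuous|exact: cvg_cst].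
have cF : continuous (fun y : R => - s ^+ 2 * (y * w y)).
  move=> x; have [+ _] := dw x; move=> /derivable1_diffP /differentiable_continuous.
  by [].
have cxw : continuous (fun x : R => x ^+ 2 * w x).
  by move=> x; apply: cvgM; [exact: exprn_continuous|exact: cw].
have FTC : (\int[mu]_(x in I n) ((x ^+ 2 - s ^+ 2) * w x)%:E =
   (- s ^+ 2 * (n.+1%:R * w n.+1%:R))%:E - (- s ^+ 2 * (- n.+1%:R * w (- n.+1%:R)))%:E)%E.
  apply: (@continuous_FTC2 _ _ (fun y => - s ^+ 2 * (y * w y))).
  - lra.
  - exact: continuous_subspaceT.
  - split.
    + by move=> x _; have [] := dw x.
    + exact: cvg_at_right_filter (cF _).
    + exact: cvg_at_left_filter (cF _).
  - by move=> x _; rewrite derive1E; have [_] := dw x.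
have icont (g : R -> R) : continuous g -> mu.-integrable (I n) (EFin \o g).
  by move=> cg; apply: continuous_compact_integrable; [exact: segment_compact|exact: continuous_subspaceT].
have ixw := icont _ cxw; have iw := icont _ (fun x => cw x).
have mI : measurable (I n) by exact: measurable_itv.
have mint : mu.-integrable (I n) (EFin \o (fun x => (x ^+ 2 - s ^+ 2) * w x)) by exact: icont.
have siw : mu.-integrable (I n) (EFin \o (fun x => s ^+ 2 * w x)).
  by apply: icont => x; apply: cvgM; [exact: cvg_cst|exact: cw].
have e1 : (\int[mu]_(x in I n) (s ^+ 2 * w x)%:E = (s ^+ 2)%:E * \int[mu]_(x in I n) (w x)%:E)%E.
  under eq_integral do rewrite EFinM.
  rewrite integralZl//.
rewrite -e1.
have <- : (\int[mu]_(x in I n) ((x ^+ 2 - s ^+ 2) * w x)%:E = - (2 * s ^+ 2 * (n.+1%:R * w n.+1%:R))%:E)%E.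
  by rewrite FTC wN -EFinB -EFinN; congr EFin; ring.
rewrite -integralD//.
by apply: eq_integral => x _; rewrite /= -EFinD; congr EFin; ring.
Qed.

Let UI : \bigcup_n I n = setT.
Proof.
apply/seteqP; split=> // x _; exists (Num.trunc `|x|) => //; rewrite /I /= in_itv /= -ler_norml.
exact/ltW/truncnS_gt.
Qed.

(** The boundary term of the integration by parts is [O(1/n)]: the exponential of [q] is at least
    [q], so the one of [-q] is at most [1 / q]. *)
Let bnd (n : nat) : n.+1%:R * w n.+1%:R <= 2 * s ^+ 2 * normal_peak s / n.+1%:R.
Proof.
have n0 : 0 < n.+1%:R :> R by [].
set a := n.+1%:R in n0 *.
have q0 : 0 < a ^+ 2 / (s ^+ 2 *+ 2) by rewrite divr_gt0// ?exprn_gt0// pmulrn_lgt0// exprn_gt0.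
have h : expR (- a ^+ 2 / (s ^+ 2 *+ 2)) <= (a ^+ 2 / (s ^+ 2 *+ 2))^-1.
  rewrite mulNr expRN lef_pV2 ?posrE ?expR_gt0//.
  by apply: le_trans (expR_ge1Dx _); rewrite lerDr.
rewrite wE mulrCA (le_trans (ler_wpM2l (normal_peak_ge0 _) (ler_wpM2l (ltW n0) h)))//.
rewrite le_eqVlt; apply/orP; left; apply/eqP.
by field; rewrite !lt0r_neq0.
Qed.

Let lim0 : (fun n => (2 * s ^+ 2 * (n.+1%:R * w n.+1%:R))%:E) @ \oo --> (0%:E : \bar R).
Proof.
apply: cvg_EFin; first by apply: nearW.
rewrite -(mulr0 (2 * s ^+ 2)); apply: cvgMr.
apply: (@squeeze_cvgr _ _ _ _ (fun=> 0) (fun n => 2 * s ^+ 2 * normal_peak s / n.+1%:R)).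
- apply: nearW => n; rewrite bnd andbT mulr_ge0//.
  exact: normal_pdf_ge0.
- exact: cvg_cst.
- rewrite -(mulr0 (2 * s ^+ 2 * normal_peak s)); apply: cvgMr.
  exact: cvg_harmonic.
Qed.

Lemma normal_second_moment : (\int[normal_prob 0 s]_x (x ^+ 2)%:E = (s ^+ 2)%:E)%E.
Proof.
rewrite ge0_integral_normal_prob//; last 2 first.
- by apply/measurable_EFinP/measurable_funX.
- by move=> x; rewrite lee_fin sqr_ge0.
have ndI : nondecreasing_seq I.
  apply/nondecreasing_seqP => n; rewrite subsetEset => x; rewrite /I /= !in_itv /=.
  move=> /andP[a b]; apply/andP; split.
    by apply: le_trans a; rewrite lerN2 ler_nat.
  by apply: le_trans b _; rewrite ler_nat.
have h1 : (fun n => \int[mu]_(x in I n) (w x)%:E)%E @ \oo --> (1 : \bar R)%E.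
  rewrite -(integral_normal_pdf 0 s) -UI; apply: ge0_nondecreasing_set_cvg_integral => //.
  - by move=> n; exact: measurable_itv.
  - by move=> n; apply/measurable_EFinP/measurable_funTS.
  - by move=> n x _; rewrite lee_fin normal_pdf_ge0.
have h2 : (fun n => \int[mu]_(x in I n) (x ^+ 2 * w x)%:E)%E @ \oo --> (\int[mu]_x (x ^+ 2 * w x)%:E)%E.
  rewrite -UI; apply: ge0_nondecreasing_set_cvg_integral => //.
  - by move=> n; exact: measurable_itv.
  - by move=> n; apply/measurable_EFinP/measurable_funTS/measurable_funM => //; exact: measurable_funX.
  - by move=> n x _; rewrite lee_fin mulr_ge0// ?sqr_ge0// normal_pdf_ge0.
have -> : (\int[mu]_x ((x ^+ 2)%:E * (normal_pdf 0 s x)%:E) = \int[mu]_x (x ^+ 2 * w x)%:E)%E.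
  by apply: eq_integral => x _; rewrite EFinM.
have h3 : (fun n => ((s ^+ 2)%:E * \int[mu]_(x in I n) (w x)%:E -
    (2 * s ^+ 2 * (n.+1%:R * w n.+1%:R))%:E)%E) @ \oo --> ((s ^+ 2)%:E * 1 - 0 : \bar R)%E.
  by apply: cvgeB => //; exact: cvgeZl.
have e : (fun n => \int[mu]_(x in I n) (x ^+ 2 * w x)%:E)%E =
    (fun n => ((s ^+ 2)%:E * \int[mu]_(x in I n) (w x)%:E -
    (2 * s ^+ 2 * (n.+1%:R * w n.+1%:R))%:E)%E) by apply/funext => n; exact: integral_I.
by rewrite e in h2; rewrite mule1 sube0 in h3; exact: (cvg_unique _ h2 h3).
Qed.

Context d (Om : measurableType d) (P : probability Om R) (X : Om -> R).
Hypothesis mX : measurable_fun setT X.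
Hypothesis lawX : forall A, measurable A -> pushforward P X A = normal_prob 0 s A.

Lemma normal_rv_second_moment : (\int[P]_x (X x ^+ 2)%:E = (s ^+ 2)%:E)%E.
Proof.
rewrite -normal_second_moment.
rewrite -(@ge0_integral_law _ _ _ (measurableTypeR R) _ P X mX (fun y => (y ^+ 2)%:E)).
- by apply: eq_measure_integral => A mA _; exact: lawX.
- by apply/measurable_EFinP/measurable_funX.
- by move=> x; rewrite lee_fin sqr_ge0.
Qed.

Lemma normal_rv_L2 : L2 P X.
Proof. by split => //; rewrite normal_rv_second_moment ltry. Qed.

Lemma normal_rv_nrm2 : nrm2 P X = s ^+ 2.
Proof. by apply: EFin_inj; rewrite nrm2_EFin ?normal_rv_second_moment//; exact: normal_rv_L2. Qed.

(** The density is even, so [X] and [- X] have the same law and the mean equals its opposite. *)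
Lemma normal_rv_mean : \int[P]_x X x = 0.
Proof.
have mNX : measurable_fun setT (fun x => - X x) by exact: measurable_funN.
have iX : P.-integrable setT (EFin \o X).
  exact: L2_integrable normal_rv_L2.
have e : \int[P]_x X x = \int[P]_x (- X x).
  rewrite -(@integral_law _ _ _ (measurableTypeR R) _ P X mX id)// -(@integral_law _ _ _ (measurableTypeR R) _ P _ mNX id)//.
  congr fine; apply: eq_measure_integral => A mA _.
  transitivity (normal_prob 0 s A); first exact: lawX.
  rewrite -normal_probN// -lawX//.
  by rewrite -[X in measurable X]setTI; exact: (@oppr_measurable R setT).
have : \int[P]_x X x = - \int[P]_x X x.
  rewrite {1}e -mulN1r -RintegralZl//; congr fine; apply: eq_integral => x _.
  by rewrite mulN1r.
by move=> h; lra.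
Qed.

End normal_moments.

Section brownian_family.
Context (R : realType) dO (Om : measurableType dO) (P : probability Om R) (d : nat) (T : R)
  (W : nat -> Om -> cpath d T).
Hypothesis hW : independent_brownian_motions P W.

(** The first [N] motions are treated as one family of scalar Brownian motions, indexed by pairs
    (particle, coordinate). All stochastic integrals below are scalar and run along such pairs. *)
Definition bm_coord (N : nat) (c : 'I_N * 'I_d) (t : R) (x : Om) : R := W c.1 x t c.2 ord0.

Lemma bm_brownian (N : nat) (c : 'I_N * 'I_d) : brownian_coordinate P T (bm_coord c).
Proof. by have [/(_ c.1) [/(_ c.2)]] := hW. Qed.

Lemma measurable_bm_coord (N : nat) (c : 'I_N * 'I_d) t : 0 <= t <= T -> measurable_fun setT (bm_coord c t).
Proof. by move=> tT; have [h _ _ _] := bm_brownian c; exact: h. Qed.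

Lemma measurable_bm (j : nat) t : 0 <= t <= T -> measurable_fun setT (fun x => W j x t : 'cV[R]_d).
Proof.
move=> tT; apply/measurable_fun_mxP => k l; rewrite (ord1 l).
exact: (@measurable_bm_coord j.+1 (ord_max, k)).
Qed.

Lemma history_measurable dV (V : measurableType dV) (X : R -> Om -> V) t :
  (forall s, 0 <= s <= t -> measurable_fun setT (X s)) -> history X t `<=` measurable.
Proof.
move=> mX A [s /= st [B mB <-]]; rewrite in_itv /= in st.
by apply: mX.
Qed.

Lemma completed_filtration_measurable J t : t <= T ->
  completed_filtration P W J t `<=` measurable.
Proof.
move=> tT A [[j _ hA]|[]//]; apply: history_measurable hA => s /andP[s0 st].
by apply: measurable_bm; rewrite s0 (le_trans st).
Qed.

Lemma historyS Om' dV (V : measurableType dV) (X : R -> Om' -> V) s t : s <= t ->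
  history X s `<=` history X t.
Proof.
move=> st A [u /= us hA]; exists u => //=; move: us; rewrite !in_itv /=.
by case/andP => -> /le_trans ->.
Qed.

Lemma completed_filtrationS (J J' : set nat) s t : J `<=` J' -> s <= t ->
  completed_filtration P W J s `<=` completed_filtration P W J' t.
Proof.
move=> JJ st A [[j Jj hA]|hA]; [left|by right].
by exists j; [exact: JJ|exact: historyS st _ hA].
Qed.

Lemma measurable_bm_filtration (J : set nat) j s t : J j -> 0 <= s <= t ->
  measurable_fun setT ((fun x => W j x s : 'cV[R]_d) : g_sigma_algebraType (completed_filtration P W J t) -> _).
Proof.
move=> Jj st _ A mA; apply: sub_sigma_algebra; left; exists j => //.
by exists s; [rewrite /= in_itv|exists A].
Qed.

Variable N : nat.
Local Notation C := ('I_N * 'I_d)%type.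
Implicit Types c : C.

Definition FN t := completed_filtration P W `I_N t.

Lemma bm_coord_history c t : history (bm_coord c) t `<=` <<s history (fun s x => W c.1 x s : 'cV[R]_d) t >>.
Proof.
move=> A [s st [B mB <-]]; apply: sub_sigma_algebra; exists s => //.
exists ((fun v : 'cV[R]_d => v c.2 ord0) @^-1` B).
  rewrite -[X in measurable X]setTI; exact: (@measurable_coord R d 1 setT c.2 ord0).
by [].
Qed.

(** Independence is given on two levels, between the coordinates of one motion and between the
    motions. Intersecting over the coordinates of each motion yields events to which the second
    level applies. *)
Lemma bm_coord_product (A : C -> set Om) : (forall c, <<s history (bm_coord c) T >> (A c)) ->
  P (\bigcap_c A c) = \big[mule/1%E]_c P (A c).
Proof.
move=> hA.
pose E (j : 'I_N) := \bigcap_k A (j, k).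
have hE (j : 'I_N) : <<s history (fun s x => W j x s : 'cV[R]_d) T >> (E j).
  apply: (@fin_bigcap_measurable _ (g_sigma_algebraType (history (fun s x => W j x s : 'cV[R]_d) T))) => // k _.
  apply: smallest_sub (hA (j, k)); first exact: smallest_sigma_algebra.
  exact: (@bm_coord_history (j, k)).
have PE j : P (E j) = \big[mule/1%E]_k P (A (j, k)).
  have [_ ind] := hW.1 j.
  have := ind (enum 'I_d) (enum_uniq _) (fun k => A (j, k)) (fun k _ => hA (j, k)).
  rewrite [X in _ = X -> _]big_enum /= => <-; congr (P _).
  rewrite -bigcap_seq; apply/seteqP; split=> [x h k _|x h k _]; first exact: h.
  by apply: h => /=; rewrite mem_enum.
have -> : (\prod_c P (A c))%E = (\prod_j P (E j))%E.
  under [RHS]eq_bigr do rewrite PE.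
  by rewrite pair_bigA; apply: eq_bigr => -[].
(* The motions are indexed by all natural numbers; indices beyond [N] receive the sure event. *)
pose E' (j : nat) := if insub j is Some i then E i else setT.
have EE (j : 'I_N) : E' (val j) = E j by rewrite /E' valK.
have ul : uniq [seq val i | i <- enum 'I_N] by rewrite map_inj_uniq ?enum_uniq//; exact: val_inj.
have hE' j : j \in [seq val i | i <- enum 'I_N] ->
    <<s history (fun s x => W j x s : 'cV[R]_d) T >> (E' j).
  by move=> /mapP[i _ ->]; rewrite EE; exact: hE.
have -> : (\prod_j P (E j))%E = (\prod_(j <- [seq val i | i <- enum 'I_N]) P (E' j))%E.
  by rewrite big_map big_enum /=; apply: eq_bigr => j _; rewrite EE.
rewrite -(hW.2 _ ul E' hE') big_map -bigcap_seq; congr (P _).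
under [RHS]eq_bigcapr do rewrite EE.
apply/seteqP; split=> [x h j _ k _|x h [j k] _]; first exact: h.
by apply: (h j _ k) => //=; rewrite mem_enum.
Qed.

(** Only the coordinate [c] is stopped at [s]; every other coordinate is known up to [T]. Together
    with the null sets this contains the filtration at [s], and it makes simultaneous increments of
    two different coordinates orthogonal. *)
Definition bm_past c s : C -> set_system Om :=
  fun c' => if c' == c then history (bm_coord c) s else history (bm_coord c') T.

Definition bm_context c s : set_system Om := \bigcup_c' bm_past c s c' `|` null_sets P.

Definition bm_incr c s t x := bm_coord c t x - bm_coord c s x.

Lemma measurable_bm_incr c s t : 0 <= s <= T -> 0 <= t <= T -> measurable_fun setT (bm_incr c s t).
Proof. by move=> sT tT; apply: measurable_funB; exact: measurable_bm_coord. Qed.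

Lemma measurable_bm_coord_history c s t : 0 <= s <= t ->
  measurable_fun setT (bm_coord c s : g_sigma_algebraType (history (bm_coord c) t) -> R).
Proof.
by move=> st _ A mA; apply: sub_sigma_algebra; exists s; [rewrite /= in_itv|exists A].
Qed.

Lemma bm_past_measurable c s c' : 0 <= s <= T -> bm_past c s c' `<=` measurable.
Proof.
move=> /andP[s0 sT]; rewrite /bm_past; case: eqP => _; apply: history_measurable => u /andP[u0 us].
  by apply: measurable_bm_coord; rewrite u0 (le_trans us).
by apply: measurable_bm_coord; rewrite u0.
Qed.

Lemma bm_context_measurable c s : 0 <= s <= T -> bm_context c s `<=` measurable.
Proof. by move=> sT A [[c' _ /(bm_past_measurable sT)]|[]]. Qed.

(** An event of the increment belongs to the history of [c], so it is merged with the event of [c]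
    before the product formula is used. The factor of [c] then splits because a Brownian increment
    is independent of its own past. *)
Lemma bm_incr_independent c s t : 0 <= s -> s < t -> t <= T ->
  independent P (bm_context c s) (preimage_set_system setT (bm_incr c s t) measurable).
Proof.
move=> s0 st tT.
have sT : 0 <= s <= T by rewrite s0 (le_trans (ltW st)).
have tT' : 0 <= t <= T by rewrite tT andbT (le_trans s0)// ltW.
have mI : preimage_set_system setT (bm_incr c s t) measurable `<=` measurable.
  by move=> _ [B mB <-]; apply: (measurable_bm_incr c sT tT').
have [_ _ _ /(_ s t s0 st tT) ind] := bm_brownian c.
have sub c' : <<s bm_past c s c' >> `<=` <<s history (bm_coord c') T >>.
  apply: sub_sigma_algebra2; rewrite /bm_past; case: eqP => [->|_ //].
  by apply: historyS; case/andP: sT.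
suff GS2 : forall (A : C -> set Om) B, (forall c', <<s bm_past c s c' >> (A c')) ->
    <<s preimage_set_system setT (bm_incr c s t) measurable >> B ->
    P ((\bigcap_c' A c') `&` B) = (P (\bigcap_c' A c') * P B)%E.
  apply: (independentS _ _ (independent_block (fun c' => @bm_past_measurable c s c' sT) mI GS2)).
    exact: sub_sigma_algebra.
  by move=> A hA; apply: sub_sigma_algebra; left.
move=> A B hA hB.
have hB' : <<s history (bm_coord c) T >> B.
  apply: smallest_sub hB; first exact: smallest_sigma_algebra.
  move=> _ [D mD <-].
  have m1 := @measurable_bm_coord_history c s T sT; have m2 := @measurable_bm_coord_history c t T tT'.
  exact: (measurable_funB m2 m1).
have mA c' : measurable (A c') by apply: g_sigma_sub (hA c'); exact: bm_past_measurable.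
have mB : measurable B by exact: g_sigma_sub hB.
rewrite (bm_coord_product (fun c' => sub _ _ (hA c'))).
transitivity (P (\bigcap_c' (if c' == c then A c' `&` B else A c'))).
  congr (P _); apply/seteqP; split=> [x [h Bx] c' _|x h].
    by case: eqP => [->|_]; [split; [exact: h|]|exact: h].
  split; last by have := h c Logic.I; rewrite eqxx => -[].
  by move=> c' _; have := h c' Logic.I; case: eqP => [_ []|].
rewrite bm_coord_product; last first.
  move=> c'; case: eqP => [->|_]; last exact: sub (hA c').
  apply: (@measurableI _ (g_sigma_algebraType (history (bm_coord c) T))) => //.
  exact: sub (hA c).
rewrite (bigD1 c)//= eqxx (bigD1 c (F := fun c' => P (A c')))//=.
rewrite (eq_bigr (fun c' => P (A c'))); last by move=> c' /negbTE ->.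
rewrite ind//; last by have := hA c; rewrite /bm_past eqxx.
by rewrite -!muleA; congr (_ * _)%E; rewrite muleC.
Qed.

Lemma FN_bm_context c s : 0 <= s <= T -> FN s `<=` <<s bm_context c s >>.
Proof.
move=> /andP[s0 sT] A [[j /= jN [u /= us [B mB <-]]]|hA]; last by apply: sub_sigma_algebra; right.
rewrite in_itv /= in us.
suff : measurable_fun setT ((fun x => W j x u : 'cV[R]_d) : g_sigma_algebraType (bm_context c s) -> _).
  by move=> /(_ measurableT B mB).
apply/measurable_fun_mxP => k l; rewrite (ord1 l).
pose c' : C := (Ordinal jN, k).
apply: (measurable_fun_g_sigmaS (S := history (bm_coord c') (if c' == c then s else T))).
  move=> D hD; apply: sub_sigma_algebra; left; exists c' => //.
  by rewrite /bm_past; move: hD; case: eqP => [->|].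
apply: measurable_bm_coord_history; case: ifP => // _.
by case/andP: us => -> /le_trans ->.
Qed.

Lemma bm_incr_L2 c s t : 0 <= s -> s <= t -> t <= T -> L2 P (bm_incr c s t).
Proof.
move=> s0; rewrite le_eqVlt => /predU1P[->|st] tT.
  by rewrite /bm_incr; under eq_fun do rewrite subrr; exact: L2_0.
have [_ _ /(_ s t s0 st tT) law _] := bm_brownian c.
apply: (normal_rv_L2 _ _ law); first by rewrite sqrtr_gt0 subr_gt0.
by apply: measurable_bm_incr; rewrite ?s0 ?tT ?(le_trans s0 (ltW st)) ?(le_trans (ltW st) tT).
Qed.

Lemma bm_incr_mean c s t : 0 <= s -> s < t -> t <= T -> \int[P]_x bm_incr c s t x = 0.
Proof.
move=> s0 st tT; have [_ _ /(_ s t s0 st tT) law _] := bm_brownian c.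
apply: (normal_rv_mean _ _ law); first by rewrite sqrtr_gt0 subr_gt0.
by apply: measurable_bm_incr; rewrite ?s0 ?tT ?(le_trans s0 (ltW st)) ?(le_trans (ltW st) tT).
Qed.

Lemma bm_incr_nrm2 c s t : 0 <= s -> s < t -> t <= T -> nrm2 P (bm_incr c s t) = t - s.
Proof.
move=> s0 st tT; have [_ _ /(_ s t s0 st tT) law _] := bm_brownian c.
rewrite (normal_rv_nrm2 _ _ law); first by rewrite sqr_sqrtr// subr_ge0 ltW.
  by rewrite sqrtr_gt0 subr_gt0.
by apply: measurable_bm_incr; rewrite ?s0 ?tT ?(le_trans s0 (ltW st)) ?(le_trans (ltW st) tT).
Qed.

End brownian_family.

Section orthogonality.
Context (R : realType) dO (Om : measurableType dO) (P : probability Om R) (d : nat) (T : R)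
  (W : nat -> Om -> cpath d T).
Hypothesis hW : independent_brownian_motions P W.
Variable N : nat.
Local Notation C := ('I_N * 'I_d)%type.
Implicit Types c : C.
Local Notation B := (@bm_coord R dO Om d T W N).
Local Notation dB := (@bm_incr R dO Om d T W N).
Local Notation FF := (FN P W N).

Lemma bm_incr_orth c (s t : R) (X : Om -> R) : 0 <= s -> s <= t -> t <= T ->
  measurable_fun setT (X : g_sigma_algebraType (bm_context P W c s) -> R) -> L2 P X ->
  ip P X (dB c s t) = 0.
Proof.
move=> s0; rewrite le_eqVlt => /predU1P[->|st] tT mX lX.
  rewrite (_ : dB c t t = fun=> 0) ?ip0r//.
  by apply/funext => x; rewrite /bm_incr subrr.
have sT : 0 <= s <= T by rewrite s0 (le_trans (ltW st)).
have tT' : 0 <= t <= T by rewrite tT andbT (le_trans s0)// ltW.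
have mI : preimage_set_system setT (dB c s t) measurable `<=` measurable.
  by move=> _ [D mD <-]; apply: (measurable_bm_incr hW c sT tT').
have lI := bm_incr_L2 hW c s0 (ltW st) tT.
have ind := bm_incr_independent (c := c) hW s0 st tT.
rewrite /ip (@indep_integral _ _ _ P _ _ (bm_context_measurable (c := c) hW sT) mI ind (fun z => X z.1 * dB c s t z.2)) /=.
- rewrite -[RHS](ip0r P X); congr fine; apply: eq_integral => x _; congr EFin.
  rewrite RintegralZl//; last exact: L2_integrable.
  by rewrite (bm_incr_mean hW)// mulr0.
- apply: measurable_funM; first exact: measurableT_comp mX measurable_fst.
  apply: (measurableT_comp _ measurable_snd).
  exact: preimage_set_system_measurable_fun.
- exact: L2_mul_integrable.
Qed.

Lemma measurable_FN_context c s d' (V : measurableType d') (X : Om -> V) : 0 <= s <= T ->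
  measurable_fun setT (X : g_sigma_algebraType (FF s) -> V) ->
  measurable_fun setT (X : g_sigma_algebraType (bm_context P W c s) -> V).
Proof. by move=> sT; apply: measurable_fun_g_sigmaS; exact: FN_bm_context. Qed.

Lemma measurable_FN s t d' (V : measurableType d') (X : Om -> V) : s <= t ->
  measurable_fun setT (X : g_sigma_algebraType (FF s) -> V) ->
  measurable_fun setT (X : g_sigma_algebraType (FF t) -> V).
Proof.
move=> st; apply: measurable_fun_g_sigmaS => A hA; apply: sub_sigma_algebra.
exact: completed_filtrationS hA.
Qed.

Lemma measurable_FN_dO s d' (V : measurableType d') (X : Om -> V) : s <= T ->
  measurable_fun setT (X : g_sigma_algebraType (FF s) -> V) -> measurable_fun setT X.
Proof. by move=> sT; apply: measurable_fun_g_sigma; exact: completed_filtration_measurable. Qed.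

Lemma measurable_bm_coord_FN c s t : 0 <= s <= t ->
  measurable_fun setT (B c s : g_sigma_algebraType (FF t) -> R).
Proof.
move=> st; have := @measurable_bm_filtration _ _ _ P _ _ W `I_N c.1 s t (ltn_ord c.1) st.
by move=> /measurable_fun_mxP; apply.
Qed.

Lemma measurable_bm_incr_FN c r s t : 0 <= r <= t -> 0 <= s <= t ->
  measurable_fun setT (dB c r s : g_sigma_algebraType (FF t) -> R).
Proof. by move=> rt st; apply: measurable_funB; exact: measurable_bm_coord_FN. Qed.

Lemma bm_incr_orth_FN c (s t : R) (X : Om -> R) : 0 <= s -> s <= t -> t <= T ->
  measurable_fun setT (X : g_sigma_algebraType (FF s) -> R) -> L2 P X -> ip P X (dB c s t) = 0.
Proof.
move=> s0 st tT mX; apply: bm_incr_orth => //; apply: measurable_FN_context => //.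
by rewrite s0 (le_trans st).
Qed.

(** For distinct coordinates, [eta] times the increment of [c] is known in the context of [c'],
    where the increment of [c'] is centred. For equal ones, the squared increment has mean [t - s]
    and is independent of [eta]. *)
Lemma bm_incr_isometry c c' (s t : R) (eta : Om -> R) (K : R) : 0 <= s -> s <= t -> t <= T ->
  measurable_fun setT (eta : g_sigma_algebraType (FF s) -> R) -> (forall x, `|eta x| <= K) ->
  ip P (fun x => eta x * dB c s t x) (dB c' s t) = (c == c')%:R * (t - s) * \int[P]_x eta x.
Proof.
move=> s0; rewrite le_eqVlt => /predU1P[->|st] tT mX etaK.
  rewrite (_ : dB c' t t = fun=> 0) ?ip0r ?subrr ?mulr0 ?mul0r//.
  by apply/funext => x; rewrite /bm_incr subrr.
have sT : 0 <= s <= T by rewrite s0 (le_trans (ltW st)).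
have tT' : 0 <= t <= T by rewrite tT andbT (le_trans s0)// ltW.
have mI c0 : preimage_set_system setT (dB c0 s t) measurable `<=` measurable.
  by move=> _ [D mD <-]; apply: (measurable_bm_incr hW c0 sT tT').
have lI c0 := bm_incr_L2 hW c0 s0 (ltW st) tT.
have meta : measurable_fun setT eta by apply: (measurable_FN_dO _ mX); case/andP: sT.
have leta : L2 P (fun x => eta x * dB c s t x) by exact: (L2_mulb meta etaK).
have [->|cc] := eqVneq c c'; last first.
  rewrite !mul0r; apply: bm_incr_orth => //; first exact: ltW.
  apply: measurable_funM; first exact: measurable_FN_context.
  apply: (measurable_fun_g_sigmaS (S := history (B c) T)).
    move=> A hA; apply: sub_sigma_algebra; left; exists c => //.
    by rewrite /bm_past (negbTE cc).
  by apply: measurable_funB; exact: measurable_bm_coord_history.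
rewrite mul1r /ip.
have ind := bm_incr_independent (c := c') hW s0 st tT.
rewrite (_ : (fun x => _) = fun x => eta x * (dB c' s t x) ^+ 2); last first.
  by apply/funext => x; rewrite expr2 mulrA.
rewrite (@indep_integral _ _ _ P _ _ (bm_context_measurable (c := c') hW sT) (mI c') ind (fun z => eta z.1 * (dB c' s t z.2) ^+ 2)) /=.
- rewrite mulrC -RintegralZr//; last first.
    by apply: L2_integrable; apply: (L2_bound (Y := fun=> K ^+ 2)) => //;
      [exact: (L2_integrable (L2_cst _ _))|move=> x; rewrite -real_normK ?num_real// lerXn2r ?nnegrE// (le_trans _ (etaK x))].
  congr fine; apply: eq_integral => x _; congr EFin.
  rewrite RintegralZl//; last exact: L2_sqr.
  by rewrite -nrm2E (bm_incr_nrm2 hW).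
- apply: measurable_funM; first by apply: measurableT_comp measurable_fst; exact: measurable_FN_context.
  apply: measurable_funX; apply: (measurableT_comp _ measurable_snd).
  exact: preimage_set_system_measurable_fun.
- have := L2_mul_integrable (L2_mulb meta etaK (lI c')) (lI c').
  by under eq_fun do rewrite -mulrA -expr2.
Qed.

End orthogonality.

(** * Stochastic integrals of elementary processes *)

Section time_product.
Context (R : realType) dO (Om : measurableType dO) (P : probability Om R).
Local Notation leb := (@lebesgue_measure R).

Definition leb_prod : {measure set (measurableTypeR R * Om) -> \bar R} := (leb \x P)%E.

(** The time window sits in the integrand, so that all windows share the single measure [leb_prod].
    It is half-open like the elementary processes, and adjacent windows are disjoint. *)
Definition cut (s t : R) (A : R -> Om -> R) (p : R * Om) : R :=
  if (s < p.1) && (p.1 <= t) then A p.1 p.2 else 0.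

Lemma prod_integrable (u : R -> R) (g : Om -> R) :
  leb.-integrable setT (EFin \o u) -> P.-integrable setT (EFin \o g) ->
  leb_prod.-integrable setT (EFin \o (fun p => u p.1 * g p.2)).
Proof.
move=> iu ig.
have mu' : measurable_fun setT u by apply/measurable_EFinP; exact: (measurable_int leb).
have mg : measurable_fun setT g by apply/measurable_EFinP; exact: (measurable_int P).
have mk : measurable_fun setT (fun p : measurableTypeR R * Om => u p.1 * g p.2).
  apply: measurable_funM; first exact: measurableT_comp mu' measurable_fst.
  exact: measurableT_comp mg measurable_snd.
apply/integrable12ltyP; first exact/measurable_EFinP.
under eq_integral => x _.
  under eq_integral do rewrite /= normrM EFinM.
  rewrite ge0_integralZl//; last by apply/measurable_EFinP/measurableT_comp.
  over.
have /integrableP[_ gl] := ig; have /integrableP[_ ul] := iu.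
have gf : (\int[P]_x (`|g x|)%:E)%E \is a fin_num by rewrite ge0_fin_numE// integral_ge0.
rewrite -(fineK gf) ge0_integralZr//.
- by rewrite muleC lte_mul_pinfty// lee_fin fine_ge0// integral_ge0.
- by apply/measurable_EFinP/measurableT_comp.
- by rewrite lee_fin fine_ge0// integral_ge0.
Qed.

Lemma prod_Rintegral (u : R -> R) (g : Om -> R) :
  leb.-integrable setT (EFin \o u) -> P.-integrable setT (EFin \o g) ->
  \int[leb_prod]_p (u p.1 * g p.2) = \int[leb]_x u x * \int[P]_x g x.
Proof.
move=> iu ig; have := prod_integrable iu ig => ik.
rewrite /Rintegral -(integral12_prod_meas1 ik) /fubini_F /=.
under eq_integral => x _.
  under eq_integral do rewrite /= EFinM.
  rewrite integralZl//.
  over.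
have gf := integrable_fin_num measurableT ig.
rewrite -(fineK gf) integralZr//.
by rewrite fineM// (integrable_fin_num measurableT iu).
Qed.

End time_product.

(* The elementary integrand [tm_xi 1_(tm_a, tm_b]] along the Brownian coordinate [tm_c]. *)
Record term (I Om R : Type) := Term {
  tm_c : I ; tm_a : R ; tm_b : R ; tm_xi : Om -> R }.

Section elementary_isometry.
Context (R : realType) dO (Om : measurableType dO) (P : probability Om R) (d : nat) (T : R)
  (W : nat -> Om -> cpath d T).
Hypothesis hW : independent_brownian_motions P W.
Variable N : nat.
Local Notation C := ('I_N * 'I_d)%type.
Implicit Types c : C.
Local Notation B := (@bm_coord R dO Om d T W N).
Local Notation dB := (@bm_incr R dO Om d T W N).
Local Notation FF := (FN P W N).
Local Notation leb := (@lebesgue_measure R).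

Definition ok_term (tau : term C Om R) :=
  [/\ 0 <= tm_a tau, tm_a tau <= tm_b tau, tm_b tau <= T,
      measurable_fun setT (tm_xi tau : g_sigma_algebraType (FF (tm_a tau)) -> R)
    & exists K : R, forall x, `|tm_xi tau x| <= K].

Definition tm_val (tau : term C Om R) c (u : R) (x : Om) : R :=
  if (c == tm_c tau) && ((tm_a tau < u) && (u <= tm_b tau)) then tm_xi tau x else 0.

(** For [s <= t] this is the projection on [[s, t]]. Integrating an elementary term over the window
    amounts to clipping its endpoints, and a term outside the window collapses to a zero
    increment. *)
Definition clip (s t u : R) := Num.max s (Num.min u t).

Definition tm_int (s t : R) (tau : term C Om R) (x : Om) : R :=
  tm_xi tau x * dB (tm_c tau) (clip s t (tm_a tau)) (clip s t (tm_b tau)) x.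

Lemma ip_assoc (X Y Z : Om -> R) : ip P X (fun x => Y x * Z x) = ip P (fun x => X x * Y x) Z.
Proof. by congr fine; apply: eq_integral => x _; rewrite mulrA. Qed.

Lemma bm_incr_split c r s t x : dB c r t x = dB c r s x + dB c s t x.
Proof. by rewrite /bm_incr; ring. Qed.

Lemma bm_incr_isometry_le c c' (s e e' : R) (eta : Om -> R) (K : R) :
  0 <= s -> s <= e -> e <= e' -> e' <= T ->
  measurable_fun setT (eta : g_sigma_algebraType (FF s) -> R) -> (forall x, `|eta x| <= K) ->
  ip P (fun x => eta x * dB c s e x) (dB c' s e') = (c == c')%:R * (e - s) * \int[P]_x eta x.
Proof.
move=> s0 se ee' e'T me eK.
have e0 : 0 <= e by exact: le_trans se.
have eT : e <= T by exact: le_trans e'T.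
have meta : measurable_fun setT eta by apply: (measurable_FN_dO hW _ me); exact: le_trans eT.
have lX : L2 P (fun x => eta x * dB c s e x) by apply: (L2_mulb meta eK); exact: bm_incr_L2.
rewrite (_ : dB c' s e' = fun x => dB c' s e x + dB c' e e' x); last first.
  by apply/funext => x; exact: bm_incr_split.
rewrite ipDr//; [|exact: bm_incr_L2..].
rewrite (bm_incr_isometry hW _ _ s0 se eT me eK) (bm_incr_orth_FN hW c' e0)// ?addr0//.
apply: measurable_funM; first exact: measurable_FN me.
by apply: measurable_bm_incr_FN; rewrite ?s0 ?e0 ?lexx.
Qed.

(** The part of the first increment before [a'] is known at [a'], hence orthogonal to the second
    increment. Only the overlap of the two intervals contributes, through its length. *)
Lemma bm_bilinear_le c c' (a b a' b' : R) (xi xi' : Om -> R) (K K' : R) :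
  0 <= a -> a <= a' -> a <= b -> a' <= b' -> b <= T -> b' <= T ->
  measurable_fun setT (xi : g_sigma_algebraType (FF a) -> R) ->
  measurable_fun setT (xi' : g_sigma_algebraType (FF a') -> R) ->
  (forall x, `|xi x| <= K) -> (forall x, `|xi' x| <= K') ->
  ip P (fun x => xi x * dB c a b x) (fun x => xi' x * dB c' a' b' x) =
  (c == c')%:R * Num.max 0 (Num.min b b' - Num.max a a') * \int[P]_x (xi x * xi' x).
Proof.
move=> a0 aa' ab a'b' bT b'T mxi mxi' xiK xiK'.
have a'0 : 0 <= a' by exact: le_trans aa'.
have a'T : a' <= T by exact: le_trans b'T.
have b0 : 0 <= b by exact: le_trans ab.
have b'0 : 0 <= b' by exact: le_trans a'b'.
have aT : a <= T by exact: le_trans bT.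
have mxi0 : measurable_fun setT xi by exact: (measurable_FN_dO hW aT mxi).
have mxi'0 : measurable_fun setT xi' by exact: (measurable_FN_dO hW a'T mxi').
have mxia' := measurable_FN aa' mxi.
have ldB c0 u v : 0 <= u -> u <= v -> v <= T -> L2 P (dB c0 u v) by exact: bm_incr_L2.
have lX u v : 0 <= u -> u <= v -> v <= T -> L2 P (fun x => xi x * dB c u v x * xi' x).
  move=> u0 uv vT; under eq_fun do rewrite mulrC.
  by apply: (L2_mulb mxi'0 xiK'); apply: (L2_mulb mxi0 xiK); exact: ldB.
have orth u v : 0 <= u -> u <= v -> v <= a' -> ip P (fun x => xi x * dB c u v x * xi' x) (dB c' a' b') = 0.
  move=> u0 uv va'; apply: (bm_incr_orth_FN hW) => //.
    apply: measurable_funM => //; apply: measurable_funM => //.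
    by apply: measurable_bm_incr_FN; rewrite ?u0 ?(le_trans u0 uv) ?(le_trans uv va').
  by apply: lX => //; exact: le_trans a'T.
rewrite ip_assoc (max_idPr aa').
have [ba'|a'b] := leP b a'.
  rewrite orth// (max_idPl _) ?mulr0 ?mul0r// subr_le0.
  by rewrite ge_min ba'.
rewrite (_ : (fun x => _) = fun x => xi x * dB c a a' x * xi' x + xi x * dB c a' b x * xi' x); last first.
  by apply/funext => x; rewrite (bm_incr_split c a a' b) mulrDr mulrDl.
rewrite ipDl; [|exact: lX|by apply: lX => //; exact: ltW|exact: ldB].
rewrite orth// add0r.
rewrite (_ : (fun x => _) = fun x => (xi x * xi' x) * dB c a' b x); last first.
  by apply/funext => x; rewrite mulrAC.
have meta : measurable_fun setT ((fun x => xi x * xi' x) : g_sigma_algebraType (FF a') -> R).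
  exact: measurable_funM.
have etaK x : `|xi x * xi' x| <= K * K' by rewrite normrM ler_pM.
have [bb'|b'b] := leP b b'.
  by rewrite (bm_incr_isometry_le _ _ a'0 (ltW a'b) bb' b'T meta etaK) (max_idPr _)// subr_ge0 ltW.
rewrite (max_idPr _) ?subr_ge0//.
rewrite (_ : ip _ _ _ = ip P (fun x => xi x * xi' x * dB c' a' b' x) (dB c a' b)); last first.
  by congr fine; apply: eq_integral => x _; rewrite mulrAC.
by rewrite (bm_incr_isometry_le _ _ a'0 a'b' (ltW b'b) bT meta etaK) eq_sym.
Qed.

Lemma bm_incr0 c s : dB c s s = fun=> 0.
Proof. by apply/funext => x; rewrite /bm_incr subrr. Qed.

(** Measurability is required on nonempty intervals only: clipping sends a term that starts after
    [t] to an empty interval at [t], a time at which its coefficient need not be known. *)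
Lemma bm_bilinear c c' (a b a' b' : R) (xi xi' : Om -> R) (K K' : R) :
  0 <= a -> 0 <= a' -> a <= b -> a' <= b' -> b <= T -> b' <= T ->
  (a < b -> measurable_fun setT (xi : g_sigma_algebraType (FF a) -> R)) ->
  (a' < b' -> measurable_fun setT (xi' : g_sigma_algebraType (FF a') -> R)) ->
  (forall x, `|xi x| <= K) -> (forall x, `|xi' x| <= K') ->
  ip P (fun x => xi x * dB c a b x) (fun x => xi' x * dB c' a' b' x) =
  (c == c')%:R * Num.max 0 (Num.min b b' - Num.max a a') * \int[P]_x (xi x * xi' x).
Proof.
move=> a0 a'0; rewrite le_eqVlt => /predU1P[<-{b}|ab].
  move=> a'b' aT b'T _ _ _ _; rewrite bm_incr0 ipC (_ : (fun x => xi x * 0) = fun=> 0) ?ip0r; last first.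
    by apply/funext => x; rewrite mulr0.
  by rewrite (max_idPl _) ?mulr0 ?mul0r// subr_le0 (@le_trans _ _ a)// ?ge_min ?lexx// le_max lexx.
rewrite le_eqVlt => /predU1P[<-{b'}|a'b'].
  move=> bT a'T _ _ _ _; rewrite bm_incr0 (_ : (fun x => xi' x * 0) = fun=> 0) ?ip0r; last first.
    by apply/funext => x; rewrite mulr0.
  by rewrite (max_idPl _) ?mulr0 ?mul0r// subr_le0 (@le_trans _ _ a')// ?ge_min ?lexx ?orbT// le_max lexx orbT.
move=> bT b'T /(_ ab) mxi /(_ a'b') mxi' xiK xiK'.
have [aa'|a'a] := orP (le_total a a'); first by rewrite (bm_bilinear_le c c' a0 aa' (ltW ab) (ltW a'b') bT b'T mxi mxi' xiK xiK').
have := bm_bilinear_le c' c a'0 a'a (ltW a'b') (ltW ab) b'T bT mxi' mxi xiK' xiK.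
rewrite ipC => ->; rewrite eq_sym (minC b') (maxC a'); congr (_ * _ * _).
by congr fine; apply: eq_integral => x _; rewrite mulrC.
Qed.

Lemma clip_mono s t : {homo clip s t : u v / u <= v}.
Proof. by move=> u v uv; rewrite /clip le_max2// le_min2. Qed.

Lemma clip_ge s t u : s <= clip s t u.
Proof. by rewrite /clip le_max lexx. Qed.

Lemma clip_le s t u : s <= t -> clip s t u <= t.
Proof. by move=> st; rewrite /clip ge_max st ge_min lexx orbT. Qed.

(** The left side is the length that [bm_bilinear] returns for clipped endpoints; the right side is
    the one that results from multiplying the indicators of [cut_tm_val]. *)
Lemma overlap_length (s t a b a' b' : R) : s <= t ->
  Num.max 0 (Num.min (clip s t b) (clip s t b') - Num.max (clip s t a) (clip s t a')) =
  Num.max 0 (Num.min (Num.min t b) (Num.min t b') - Num.max (Num.max s a) (Num.max s a')).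
Proof.
move=> st.
have -> : Num.min (clip s t b) (clip s t b') = clip s t (Num.min b b').
  case: (leP b b') => [bb'|/ltW bb']; first by rewrite min_l// clip_mono.
  by rewrite min_r// clip_mono.
have -> : Num.max (clip s t a) (clip s t a') = clip s t (Num.max a a').
  case: (leP a a') => [aa'|/ltW aa']; first by rewrite max_r// clip_mono.
  by rewrite max_l// clip_mono.
rewrite minACA minxx maxACA maxxx.
move: (Num.min b b') (Num.max a a') => {b b' a a'} b a; rewrite /clip.
have max0 (x y : R) : x <= y -> Num.max 0 (x - y) = 0 by move=> xy; rewrite max_l// subr_le0.
have [bs|sb] := orP (le_total b s).
  rewrite (max_l (x := s)); last by rewrite ge_min bs.
  rewrite !max0//; first by rewrite ge_min (le_trans bs) ?orbT// le_max lexx.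
  by rewrite le_max lexx.
rewrite (max_r (x := s)); last by rewrite le_min sb.
have [at'|ta] := orP (le_total a t).
  by rewrite (min_l at') (minC b).
rewrite (min_r ta) (max_r st) !max0//.
  by rewrite ge_min le_max ta orbT.
by rewrite ge_min lexx orbT.
Qed.

End elementary_isometry.

Section stochastic_integral.
Context (R : realType) dO (Om : measurableType dO) (P : probability Om R) (d : nat) (T : R)
  (W : nat -> Om -> cpath d T).
Hypothesis hW : independent_brownian_motions P W.
Variable N : nat.
Local Notation C := ('I_N * 'I_d)%type.
Implicit Types c : C.
Local Notation B := (@bm_coord R dO Om d T W N).
Local Notation dB := (@bm_incr R dO Om d T W N).
Local Notation FF := (FN P W N).
Local Notation leb := (@lebesgue_measure R).
Local Notation mu2 := (leb_prod P).
Local Notation okterm := {tau : term C Om R | ok_term P W tau}.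

Lemma cut_tm_val (s t : R) (tau : term C Om R) c p :
  cut s t (tm_val tau c) p =
  ((c == tm_c tau)%:R * \1_(`](Num.max s (tm_a tau)), (Num.min t (tm_b tau))]) p.1) * tm_xi tau p.2.
Proof.
rewrite /cut /tm_val indicE mem_setE in_itv /= gt_max le_min.
by case: (c == _); case: (s < _); case: (_ <= t); case: (_ < p.1); case: (p.1 <= _);
  rewrite /= ?mul0r ?mulr0 ?mul1r ?mul0r.
Qed.

Lemma indic_itv_integrable (a b : R) : leb.-integrable setT (EFin \o (\1_(`]a, b]) : R -> R)).
Proof.
exact: integrable_indic_itv.
Qed.

Lemma indic_itv_Rintegral (a b : R) : \int[leb]_u (\1_(`]a, b]) u : R) = Num.max 0 (b - a).
Proof.
transitivity (fine (leb `]a, b])); first by rewrite /Rintegral integral_indic// setIT.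
have := lebesgue_measure_itv `]a, b] => /= ->; rewrite lte_fin.
by case: ifP => [/ltW ab|/negbT]; [rewrite max_r ?subr_ge0|rewrite -leNgt => ba; rewrite max_l ?subr_le0].
Qed.

Lemma bounded_integrable (X : Om -> R) K : measurable_fun setT X -> (forall x, `|X x| <= K) ->
  P.-integrable setT (EFin \o X).
Proof. by move=> mX XK; apply: (integrable_bound (Y := fun=> K)) => //; exact: L2_integrable (L2_cst _ _). Qed.

Lemma okterm_measurable (tau : okterm) : measurable_fun setT (tm_xi (sval tau)).
Proof.
have [_ ab bT m _] := svalP tau; apply: (measurable_FN_dO hW _ m).
exact: le_trans ab bT.
Qed.

Lemma cut_tm_val_L2 (s t : R) (tau : okterm) c : L2 mu2 (cut s t (tm_val (sval tau) c)).
Proof.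
have [_ _ _ _ [K xiK]] := svalP tau; have m := okterm_measurable tau.
rewrite (funext (cut_tm_val s t (sval tau) c)).
have i1 := indic_itv_integrable (Num.max s (tm_a (sval tau))) (Num.min t (tm_b (sval tau))).
have ixi : P.-integrable setT (EFin \o (fun x => tm_xi (sval tau) x ^+ 2)).
  apply: (@bounded_integrable _ (K ^+ 2)); first exact: measurable_funX.
  by move=> x; rewrite normrX lerXn2r// nnegrE// (le_trans _ (xiK x)).
apply: (@L2_bound _ _ _ _ _ _ _ (prod_integrable i1 ixi)).
- apply: measurable_funM; last exact: measurableT_comp m measurable_snd.
  apply: measurable_funM => //; apply: (measurableT_comp _ measurable_fst).
  exact: measurable_indic.
- move=> p; rewrite exprMn ler_wpM2r ?sqr_ge0// indicE.
  by case: (c == _); case: (_ \in _); rewrite /= ?mulr0 ?mul0r ?mul1r ?expr0n ?expr1n.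
Qed.

Lemma tm_int_L2 (s t : R) (tau : okterm) : 0 <= s -> s <= t -> t <= T -> L2 P (tm_int W s t (sval tau)).
Proof.
move=> s0 st tT; have [a0 ab bT m [K xiK]] := svalP tau.
apply: (L2_mulb (okterm_measurable tau) xiK); apply: bm_incr_L2 => //.
- exact: le_trans (clip_ge _ _ _).
- exact: clip_mono.
- by apply: le_trans tT; exact: clip_le.
Qed.

(** The Ito isometry in polarised form, for two single terms. Finite sums of terms then follow by
    bilinearity. *)
Lemma tm_isometry (s t : R) (tau tau' : okterm) : 0 <= s -> s <= t -> t <= T ->
  ip P (tm_int W s t (sval tau)) (tm_int W s t (sval tau')) =
  \sum_c ip mu2 (cut s t (tm_val (sval tau) c)) (cut s t (tm_val (sval tau') c)).
Proof.
move=> s0 st tT; case: tau => tau ok; case: tau' => tau' ok' /=.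
have [a0 ab bT m [K xiK]] := ok; have [a0' ab' bT' m' [K' xiK']] := ok'.
have mt (sg : term C Om R) : ok_term P W sg -> clip s t (tm_a sg) < clip s t (tm_b sg) ->
    measurable_fun setT (tm_xi sg : g_sigma_algebraType (FF (clip s t (tm_a sg))) -> R).
  move=> [? ? ? mm _] lt; apply: measurable_FN mm.
  have [at'|ta] := orP (le_total (tm_a sg) t); first by rewrite /clip le_max le_min at' lexx orbT.
  by move: lt; rewrite [X in X < _]/clip (min_r ta) (max_r st) ltNge clip_le.
rewrite (bm_bilinear hW _ _ _ _ _ _ _ _ (mt _ ok) (mt _ ok') xiK xiK'); first last.
- by apply: le_trans tT; exact: clip_le.
- by apply: le_trans tT; exact: clip_le.
- exact: clip_mono.
- exact: clip_mono.
- exact: le_trans (clip_ge _ _ _).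
- exact: le_trans (clip_ge _ _ _).
have ixi : P.-integrable setT (EFin \o (fun x => tm_xi tau x * tm_xi tau' x)).
  apply: (@bounded_integrable _ (K * K')).
    apply: measurable_funM; first exact: (okterm_measurable (exist _ tau ok)).
    exact: (okterm_measurable (exist _ tau' ok')).
  by move=> x; rewrite normrM ler_pM.
have E c : ip mu2 (cut s t (tm_val tau c)) (cut s t (tm_val tau' c)) =
   ((c == tm_c tau) && (c == tm_c tau'))%:R *
   (Num.max 0 (Num.min (clip s t (tm_b tau)) (clip s t (tm_b tau')) -
                Num.max (clip s t (tm_a tau)) (clip s t (tm_a tau'))) * \int[P]_x (tm_xi tau x * tm_xi tau' x)).
  rewrite overlap_length// -indic_itv_Rintegral.
  have iI := indic_itv_integrable (Num.max (Num.max s (tm_a tau)) (Num.max s (tm_a tau'))) (Num.min (Num.min t (tm_b tau)) (Num.min t (tm_b tau'))).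
  rewrite -(prod_Rintegral iI ixi) -RintegralZl//; last exact: prod_integrable iI ixi.
  congr fine; apply: eq_integral => p _; congr EFin; rewrite !cut_tm_val !indicE !mem_setE !in_itv /= !gt_max !le_min.
  by rewrite -!mulnb !natrM; ring.
rewrite (eq_bigr _ (fun c _ => E c)) (bigD1 (tm_c tau))//= eqxx /= big1 ?addr0; last first.
  by move=> c /negbTE ->; rewrite mul0r.
by rewrite mulrA.
Qed.

Definition sum_int s t (L : seq okterm) x := \sum_(tau <- L) tm_int W s t (sval tau) x.

Definition sum_val (L : seq okterm) c u x := \sum_(tau <- L) tm_val (sval tau) c u x.

Lemma cut_sum (s t : R) (L : seq okterm) c :
  cut s t (sum_val L c) = fun p => \sum_(tau <- L) cut s t (tm_val (sval tau) c) p.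
Proof.
by apply/funext => p; rewrite /cut /sum_val; case: ifP => // _; rewrite big1.
Qed.

Lemma sum_int_L2 (s t : R) L : 0 <= s -> s <= t -> t <= T -> L2 P (sum_int s t L).
Proof. by move=> s0 st tT; apply: L2_sum => tau; exact: tm_int_L2. Qed.

Lemma cut_sum_val_L2 (s t : R) L c : L2 mu2 (cut s t (sum_val L c)).
Proof. by rewrite cut_sum; apply: L2_sum => tau; exact: cut_tm_val_L2. Qed.

Lemma sum_isometry (s t : R) L : 0 <= s -> s <= t -> t <= T ->
  nrm2 P (sum_int s t L) = \sum_c nrm2 mu2 (cut s t (sum_val L c)).
Proof.
move=> s0 st tT; rewrite nrm2_sum; last by move=> tau; exact: tm_int_L2.
rewrite [RHS](eq_bigr (fun c => \sum_(tau <- L) \sum_(tau' <- L)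
   ip mu2 (cut s t (tm_val (sval tau) c)) (cut s t (tm_val (sval tau') c)))); last first.
  by move=> c _; rewrite cut_sum nrm2_sum// => tau; exact: cut_tm_val_L2.
rewrite [RHS]exchange_big /=; apply: eq_bigr => tau _.
rewrite [RHS]exchange_big /=; apply: eq_bigr => tau' _.
exact: tm_isometry.
Qed.

(** After clipping, a nondegenerate term starts no earlier than [s] and its coefficient is known
    when it starts, so [X] times the coefficient is known before the increment. *)
Lemma sum_int_orth (s t : R) L X : 0 <= s -> s <= t -> t <= T ->
  measurable_fun setT (X : g_sigma_algebraType (FF s) -> R) -> L2 P X ->
  ip P X (sum_int s t L) = 0.
Proof.
move=> s0 st tT mX lX; rewrite ip_sumr//; last by move=> tau; exact: tm_int_L2.
rewrite big1// => -[tau ok] _ /=; have [a0 ab bT m [K xiK]] := ok.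
rewrite /tm_int ip_assoc.
have [at'|ta] := orP (le_total (tm_a tau) t); last first.
  have e : clip s t (tm_a tau) = clip s t (tm_b tau).
    by rewrite /clip !min_r// (le_trans ta).
  by rewrite e bm_incr0 ip0r.
have ac : tm_a tau <= clip s t (tm_a tau) by rewrite /clip le_max le_min at' lexx orbT.
apply: (bm_incr_orth_FN hW).
- exact: le_trans (clip_ge _ _ _).
- exact: clip_mono.
- by apply: le_trans tT; exact: clip_le.
- apply: measurable_funM; first exact: measurable_FN (clip_ge _ _ _) mX.
  exact: measurable_FN m.
- under eq_fun do rewrite mulrC.
  by apply: (L2_mulb (okterm_measurable (exist _ tau ok)) xiK).
Qed.

(* [V] is the integral over [s, t] of the integrand with component [A c] along the
   Brownian coordinate [c], as an L^2 limit of elementary integrals. *)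
Definition stoch_int (s t : R) (A : C -> R -> Om -> R) (V : Om -> R) :=
  exists L : nat -> seq okterm,
    (fun k => nrm2 P (fun x => sum_int s t (L k) x - V x)) @ \oo --> (0 : R) /\
    forall c, (fun k => nrm2 mu2 (fun p => cut s t (sum_val (L k) c) p - cut s t (A c) p)) @ \oo --> (0 : R).

(** For every elementary approximation the cross term with [X] vanishes and the isometry applies.
    Both sides pass to the limit because squared norms are continuous under mean-square
    convergence. *)
Lemma stoch_int_energy (s t : R) A (V X X' : Om -> R) : 0 <= s -> s <= t -> t <= T ->
  measurable_fun setT (X' : g_sigma_algebraType (FF s) -> R) -> {ae P, forall x, X x = X' x} ->
  L2 P X -> L2 P V -> (forall c, L2 mu2 (cut s t (A c))) -> stoch_int s t A V ->
  nrm2 P (fun x => X x + V x) = nrm2 P X + \sum_c nrm2 mu2 (cut s t (A c)).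
Proof.
move=> s0 st tT mX' XX' lX lV lA [L [LV LA]].
have sT : s <= T by exact: le_trans tT.
have lX' : L2 P X'.
  apply: (L2_ae (measurable_FN_dO hW sT mX') lX).
  by apply: filterS XX' => x ->.
have lL k : L2 P (sum_int s t (L k)) by exact: sum_int_L2.
have c1 : (fun k => nrm2 P (fun x => X x + sum_int s t (L k) x)) @ \oo --> nrm2 P (fun x => X x + V x).
  apply: nrm2_cvg; [exact: L2D|by move=> k; exact: L2D|].
  rewrite (_ : (fun k => _) = (fun k => nrm2 P (fun x => sum_int s t (L k) x - V x)))//.
  by apply/funext => k; congr nrm2; apply/funext => x; ring.
have e1 k : nrm2 P (fun x => X x + sum_int s t (L k) x) =
    nrm2 P X + \sum_c nrm2 mu2 (cut s t (sum_val (L k) c)).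
  rewrite nrm2D// -sum_isometry// (ip_ae _ _ _ XX').
  - by rewrite sum_int_orth// mulr0 addr0.
  - exact: L2_measurable lX.
  - exact: L2_measurable lX'.
  - exact: L2_measurable (lL k).
have c2 : (fun k => nrm2 P (fun x => X x + sum_int s t (L k) x)) @ \oo -->
    nrm2 P X + \sum_c nrm2 mu2 (cut s t (A c)).
  under eq_fun do rewrite e1.
  apply: cvgD; first exact: cvg_cst.
  apply: cvg_big => [|c _]; first exact: add_continuous.
  apply: (nrm2_cvg (lA c) _ (LA c)) => k; exact: cut_sum_val_L2.
exact: cvg_unique c1 c2.
Qed.

Lemma ok_term_opp (tau : okterm) :
  ok_term P W (Term (tm_c (sval tau)) (tm_a (sval tau)) (tm_b (sval tau)) (fun x => - tm_xi (sval tau) x)).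
Proof.
have [? ? ? m [K xiK]] := svalP tau; split => //=; first exact: measurable_funN.
by exists K => x; rewrite normrN.
Qed.

Lemma stoch_int_sub (s t : R) A A' V V' : 0 <= s -> s <= t -> t <= T ->
  L2 P V -> L2 P V' -> (forall c, L2 mu2 (cut s t (A c))) -> (forall c, L2 mu2 (cut s t (A' c))) ->
  stoch_int s t A V -> stoch_int s t A' V' -> stoch_int s t (fun c u x => A c u x - A' c u x) (fun x => V x - V' x).
Proof.
move=> s0 st tT lV lV' lA lA' [L [LV LA]] [L' [LV' LA']].
pose opp := map (fun tau : okterm => exist (fun tau => ok_term P W tau) _ (ok_term_opp tau)).
have opp_int l x : sum_int s t (opp l) x = - sum_int s t l x.
  rewrite /sum_int big_map -sumrN; apply: eq_bigr => tau _.
  by rewrite /tm_int /= mulNr.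
have opp_val l c u x : sum_val (opp l) c u x = - sum_val l c u x.
  rewrite /sum_val big_map -sumrN; apply: eq_bigr => tau _.
  by rewrite /tm_val /=; case: ifP => _; rewrite ?oppr0.
have sq0 d' (U : measurableType d') (m : {measure set U -> \bar R}) (f g : nat -> U -> R) :
    (forall k, L2 m (f k)) -> (forall k, L2 m (g k)) ->
    (fun k => nrm2 m (f k)) @ \oo --> (0 : R) -> (fun k => nrm2 m (g k)) @ \oo --> (0 : R) ->
    (fun k => nrm2 m (fun x => f k x - g k x)) @ \oo --> (0 : R).
  move=> lf lg f0 g0.
  apply: (@squeeze_cvgr _ _ _ _ (fun=> 0) (fun k => 2 * nrm2 m (f k) + 2 * nrm2 m (g k))).
  - apply: nearW => k; rewrite nrm2_ge0 /=.
    rewrite nrm2D ?nrm2N//; last exact: L2N.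
    have := ip_le ltr01 (lf k) (L2N (lg k)); rewrite invr1 !mul1r nrm2N//.
    by have := ler_norm (ip m (f k) (fun x => - g k x)); lra.
  - exact: cvg_cst.
  - rewrite -[X in _ --> X](_ : 2 * 0 + 2 * 0 = 0); last by rewrite mulr0 addr0.
    by apply: cvgD; apply: cvgMr.
exists (fun k => L k ++ opp (L' k)); split.
- rewrite (_ : (fun k => _) = fun k => nrm2 P (fun x => (sum_int s t (L k) x - V x) - (sum_int s t (L' k) x - V' x))).
    by apply: sq0 => // k; apply: L2B => //; exact: sum_int_L2.
  apply/funext => k; congr nrm2; apply/funext => x.
  by rewrite {1}/sum_int big_cat /= -/(sum_int _ _ _ _) -/(sum_int _ _ _ _) opp_int; ring.
- move=> c; rewrite (_ : (fun k => _) = fun k => nrm2 mu2 (fun p => (cut s t (sum_val (L k) c) p - cut s t (A c) p) -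
      (cut s t (sum_val (L' k) c) p - cut s t (A' c) p))).
    by apply: sq0 => // k; apply: L2B => //; exact: cut_sum_val_L2.
  apply/funext => k; congr nrm2; apply/funext => p.
  rewrite /cut; case: ifP => _; last by ring.
  by rewrite {1}/sum_val big_cat /= -/(sum_val _ _ _ _) -/(sum_val _ _ _ _) opp_val; ring.
Qed.

End stochastic_integral.

(* On a short interval the integrals on the right are absorbed by the left-hand side. *)
Lemma gronwall_step (R : realType) (K s t e B h : R) (a : R -> R) (b : R -> R -> R) :
  0 <= K -> 0 <= e -> s <= t -> t - s <= h -> 2 * h * K <= 2^-1 -> h <= 2^-1 ->
  (forall u, s <= u <= t -> 0 <= a u <= B) ->
  (forall u, s <= u <= t -> 0 <= b u t) ->
  (forall u S, s <= u <= t -> (forall v, u <= v <= t -> a v <= S) ->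
    a u + b u t <= 2 * a t + 2 * (t - u) * (K * ((t - u) * S + b u t) + (t - u) * e)) ->
  a s + b s t <= 12 * (a t + e).
Proof.
move=> K0 e0 st tsh hK h2 aB b0 H.
(* The bound [B] makes the supremum finite and does not enter the conclusion. No continuity of [a]
   is assumed. *)
pose E := [set a u | u in `[s, t]]; pose S := sup E.
have Es : E (a s) by exists s => //=; rewrite in_itv /= lexx.
have ubE : has_ubound E.
  by exists B => _ [u + <-]; rewrite /= in_itv /= => /aB /andP[].
have aS u : s <= u <= t -> a u <= S.
  by move=> su; apply: ub_le_sup => //; exists u => //=; rewrite in_itv.
have S0 : 0 <= S.
  have sst : s <= s <= t by rewrite lexx.
  by have /andP[as0 _] := aB _ sst; apply: le_trans as0 (aS _ sst).
have step u : s <= u <= t -> a u + 2^-1 * b u t <= 2 * a t + 2^-1 * S + 2 * e.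
  move=> /andP[su ut]; have sut : s <= u <= t by rewrite su.
  have aSu v : u <= v <= t -> a v <= S.
    by move=> /andP[uv vt]; apply: aS; rewrite (le_trans su).
  have le1 := H u S sut aSu.
  have bu := b0 _ sut.
  have d0 : 0 <= t - u by rewrite subr_ge0.
  have dh : t - u <= h by lra.
  have k1 : 2 * (t - u) * K <= 2^-1.
    by apply: le_trans hK; rewrite ler_wpM2r//; lra.
  have k2 : 2 * (t - u) * K * ((t - u) * S) <= 2^-1 * S.
    apply: ler_pM => //; [by rewrite !mulr_ge0|by rewrite mulr_ge0|].
    by rewrite ler_piMl//; lra.
  have k3 : 2 * (t - u) * K * b u t <= 2^-1 * b u t by rewrite ler_wpM2r.
  have k4 : 2 * (t - u) * (t - u) * e <= 2 * e.
    rewrite ler_wpM2r// -[leRHS]mulr1 -mulrA ler_wpM2l//.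
    by apply: mulr_ile1 => //; lra.
  lra.
have Sle : S <= 4 * a t + 4 * e.
  have : S <= 2 * a t + 2^-1 * S + 2 * e.
    apply: ge_sup; first by exists (a s).
    by move=> _ [u /= + <-]; rewrite in_itv /= => sut; have := step u sut; have := b0 _ sut; lra.
  by lra.
have stt : s <= t <= t by rewrite st lexx.
have sst : s <= s <= t by rewrite lexx.
(* Here [a s <= S] contributes at most [4 (a t + e)], and twice the inequality at [s] bounds [b s t]
   by [8 (a t + e)]: together the factor 12. *)
have := step s sst; have := aS s sst; have /andP[at0 _] := aB t stt; have /andP[as0 _] := aB s sst.
have := b0 _ sst; lra.
Qed.

(** The exponent is the number of intervals of length [(4 (K + 1))^-1] that cover [[0, T]]. Each
    costs a factor 13, and the leading 2 arises because [a t] and [b 0 T] are bounded separately and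
    added. *)
Definition gronwall_cst (R : realType) (K T : R) : R :=
  2 * 13 ^+ (Num.trunc (T / (4 * (K + 1))^-1)).+1.

Lemma gronwall_cst_ge0 (R : realType) (K T : R) : 0 <= gronwall_cst K T.
Proof. by rewrite mulr_ge0// exprn_ge0. Qed.

Lemma backward_gronwall (R : realType) (K T : R) (a : R -> R) (b : R -> R -> R) (e B : R) :
  0 <= K -> 0 <= T -> 0 <= e ->
  (forall t, 0 <= t <= T -> 0 <= a t <= B) ->
  (forall s t, 0 <= s -> s <= t -> t <= T -> 0 <= b s t) ->
  (forall r s t, 0 <= r -> r <= s -> s <= t -> t <= T -> b r t = b r s + b s t) ->
  (forall s t S, 0 <= s -> s <= t -> t <= T -> (forall u, s <= u <= t -> a u <= S) ->
    a s + b s t <= 2 * a t + 2 * (t - s) * (K * ((t - s) * S + b s t) + (t - s) * e)) ->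
  forall t, 0 <= t <= T -> a t + b 0 T <= gronwall_cst K T * (a T + e).
Proof.
move=> K0 T0 e0 aB b0 bD H; pose h : R := (4 * (K + 1))^-1.
have K1 : 0 < 4 * (K + 1) by lra.
have h0 : 0 < h by rewrite invr_gt0.
have h1 : 4 * (K + 1) * h = 1 by rewrite mulfV// gt_eqF.
have hK0 : 0 <= K * h by rewrite mulr_ge0// ltW.
have hK : 2 * h * K <= 2^-1 by lra.
have h2 : h <= 2^-1 by lra.
pose n := (Num.trunc (T / h)).+1.
have Tn : T <= n%:R * h by rewrite -ler_pdivrMr// ltW// truncnS_gt.
rewrite /gronwall_cst -/h -/n.
(* Induction backwards from [T]. Carrying [b] over the later intervals and [e] on the left makes the
   bound reproduce itself, at the price of turning 12 into 13. *)
have main k s : 0 <= s -> s <= T -> T - s <= k%:R * h -> a s + b s T + e <= 13 ^+ k * (a T + e).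
  elim: k s => [|k IH] s s0 sT.
    rewrite mul0r expr0 mul1r => Ts; have -> : s = T by lra.
    by have := bD T T T T0 (lexx _) (lexx _) (lexx _); lra.
  rewrite -addn1 natrD mulrDl mul1r => Ts.
  pose t := Num.min T (s + h).
  have st : s <= t by rewrite /t le_min sT; lra.
  have tT : t <= T by rewrite /t ge_min lexx.
  have t0 : 0 <= t by exact: le_trans st.
  have tsh' : t <= s + h by rewrite /t ge_min lexx orbT.
  have tsh : t - s <= h by lra.
  have Tt : T - t <= k%:R * h.
    rewrite /t; case: (leP T (s + h)) => _; last by lra.
    by rewrite subrr mulr_ge0// ltW.
  have /IH := t0 => /(_ tT Tt) IHt.
  have : a s + b s t <= 12 * (a t + e).
    apply: (@gronwall_step _ K s t e B h) => //.
    - by move=> u /andP[su ut]; apply: aB; rewrite (le_trans s0)// (le_trans ut).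
    - by move=> u /andP[su ut]; apply: b0 => //; exact: le_trans su.
    - by move=> u S /andP[su ut] aS; apply: H => //; exact: le_trans su.
  have := b0 t T t0 tT (lexx _); rewrite (bD s t T)// addn1 exprS -mulrA.
  have : 0 <= a t <= B by apply: aB; rewrite t0.
  move=> /andP[? _]; lra.
move=> t /andP[t0 tT].
have m1 : a t + b t T + e <= 13 ^+ n * (a T + e) by apply: main => //; lra.
have m2 : a 0 + b 0 T + e <= 13 ^+ n * (a T + e) by apply: main => //; lra.
have := b0 t T t0 tT (lexx _).
have /andP[? _] : 0 <= a 0 <= B by apply: aB; rewrite lexx.
lra.
Qed.

(** * Processes on time windows and their time integrals *)

Section cut_lemmas.
Context (R : realType) dO (Om : measurableType dO) (P : probability Om R).
Local Notation leb := (@lebesgue_measure R).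
Local Notation mu2 := (leb_prod P).

Lemma cutE s t (A : R -> Om -> R) p :
  cut s t A p = \1_(`]s, t]) p.1 * A p.1 p.2.
Proof. by rewrite /cut indicE mem_setE in_itv /=; case: ifP => _; rewrite ?mul1r ?mul0r. Qed.

Lemma cut_cut (s t s' t' : R) (A : R -> Om -> R) : s' <= s -> t <= t' ->
  cut s t (fun u x => cut s' t' A (u, x)) = cut s t A.
Proof.
move=> ss tt; apply/funext => -[u x]; rewrite /cut /=; case: ifP => // /andP[su ut].
by rewrite (le_lt_trans ss su) (le_trans ut tt).
Qed.

Lemma cut_L2 (s t s' t' : R) (A : R -> Om -> R) : s' <= s -> t <= t' ->
  L2 mu2 (cut s' t' A) -> L2 mu2 (cut s t A).
Proof.
move=> ss tt lA; rewrite -(cut_cut A ss tt).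
rewrite (_ : cut _ _ _ = fun p => \1_(`]s, t]) p.1 * cut s' t' A p); last first.
  by apply/funext => -[u x]; rewrite cutE.
apply: (@L2_mulb _ _ _ _ _ _ 1) => //.
- by apply: (measurableT_comp _ measurable_fst); exact: measurable_indic.
- by move=> p; rewrite indicE; case: (_ \in _); rewrite /= ?normr1 ?normr0.
Qed.

Lemma cut_nrm2D (r s t : R) (A : R -> Om -> R) : r <= s -> s <= t -> L2 mu2 (cut r t A) ->
  nrm2 mu2 (cut r t A) = nrm2 mu2 (cut r s A) + nrm2 mu2 (cut s t A).
Proof.
move=> rs st lA; have l1 : L2 mu2 (cut r s A) by exact: cut_L2 lA.
have l2 : L2 mu2 (cut s t A) by exact: cut_L2 lA.
rewrite (_ : cut r t A = fun p => cut r s A p + cut s t A p); last first.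
  apply/funext => p; rewrite /cut; case: (ltP r p.1) => rp /=; case: (leP p.1 s) => ps /=; rewrite ?add0r ?addr0//.
  - by rewrite (le_trans ps st).
  - by have := le_lt_trans (le_trans rp rs) ps; rewrite ltxx.
rewrite nrm2D// (_ : ip _ _ _ = 0) ?mulr0 ?addr0//.
rewrite /ip /Rintegral (eq_integral (fun=> 0%E)) ?integral0// => p _; congr EFin.
rewrite /cut; case: ifP => [/andP[rp ps]|_]; last by rewrite mul0r.
by rewrite ltNge ps /= mulr0.
Qed.

Lemma sqr_EFin_measurable d (U : measurableType d) (X : U -> R) : measurable_fun setT X ->
  measurable_fun setT (fun p => ((X p) ^+ 2)%:E).
Proof. by move=> mX; apply/measurable_EFinP; exact: measurable_funX. Qed.

Lemma sqr_EFin_ge0 U (X : U -> R) p : (0 <= ((X p) ^+ 2)%:E)%E.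
Proof. by rewrite lee_fin sqr_ge0. Qed.

Lemma cut_nrm2E (s t : R) (A : R -> Om -> R) : s <= t -> L2 mu2 (cut s t A) ->
  (nrm2 mu2 (cut s t A))%:E = (\int[leb]_(u in `]s, t]) \int[P]_x ((A u x) ^+ 2)%:E)%E.
Proof.
move=> st lA; have m2 := sqr_EFin_measurable (L2_measurable lA).
have p0 := sqr_EFin_ge0 (cut s t A).
rewrite nrm2_EFin//.
rewrite (@fubini_tonelli1 _ _ _ _ _ leb P _ m2 p0).
rewrite [RHS]integral_mkcond; apply: eq_integral => u _.
rewrite patchE mem_setE in_itv /= /fubini_F /cut /=; case: ifP => //= _.
by rewrite expr0n /= integral0.
Qed.

Lemma cut_nrm2_sum_le (J : finType) (s t S : R) (A : J -> R -> Om -> R) : s <= t ->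
  (forall j, L2 mu2 (cut s t (A j))) ->
  (forall u, s <= u <= t -> (\sum_j \int[P]_x ((A j u x) ^+ 2)%:E <= S%:E)%E) ->
  \sum_j nrm2 mu2 (cut s t (A j)) <= (t - s) * S.
Proof.
move=> st lA AS; rewrite -lee_fin -sumEFin; under eq_bigr do rewrite cut_nrm2E//.
have m j : measurable_fun `]s, t] (fun u : measurableTypeR R => (\int[P]_x ((A j u x) ^+ 2)%:E)%E).
  have m : measurable_fun setT (fun u : measurableTypeR R => (\int[P]_x ((cut s t (A j) (u, x)) ^+ 2)%:E)%E).
    apply: (@measurable_fun_fubini_tonelli_F _ _ _ _ R P (fun p => ((cut s t (A j) p) ^+ 2)%:E)).
    - exact: sqr_EFin_measurable (L2_measurable (lA j)).
    - exact: sqr_EFin_ge0.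
  apply: (eq_measurable_fun _ _ (measurable_funS measurableT (@subsetT _ _) m)).
  by move=> u; rewrite mem_setE in_itv /= /cut /= => ->.
have A0 j u : (0 <= \int[P]_x ((A j u x) ^+ 2)%:E)%E.
  by apply: integral_ge0 => x _; rewrite lee_fin sqr_ge0.
rewrite -ge0_integral_sum//.
have S0 : (0 <= S%:E)%E.
  by apply: le_trans (AS s _); rewrite ?lexx// sume_ge0.
have ls : leb `]s, t] = (t - s)%:E.
  have := lebesgue_measure_itv `]s, t] => /= ->; rewrite lte_fin.
  by case: ltP => // ts; rewrite (_ : s = t) ?subrr//; apply/le_anti; rewrite st ts.
rewrite EFinM muleC -ls -integral_cst//.
apply: ge0_le_integral => //.
- by move=> u _; exact: sume_ge0.
- exact: emeasurable_sum.
- by move=> u /=; rewrite in_itv /= => /andP[su ut]; apply: AS; rewrite ut ltW.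
Qed.

Lemma slice_measurable (X : measurableTypeR R * Om -> R) x : measurable_fun setT X ->
  measurable_fun setT (fun u : measurableTypeR R => X (u, x)).
Proof. by move=> mX; apply: (measurableT_comp mX); exact: measurable_pair2. Qed.

Lemma slice_L2 (X : measurableTypeR R * Om -> R) : L2 mu2 X ->
  {ae P, forall x, L2 leb (fun u : measurableTypeR R => X (u, x))}.
Proof.
move=> lX; have := ae_integrable2 (L2_sqr lX); apply: filterS => x ix.
by apply: L2P => //; apply: slice_measurable; exact: L2_measurable lX.
Qed.

Lemma nrm2_slice (X : measurableTypeR R * Om -> R) : L2 mu2 X ->
  (nrm2 mu2 X)%:E = (\int[P]_x \int[leb]_u ((X (u, x)) ^+ 2)%:E)%E.
Proof.
move=> lX; have m2 := sqr_EFin_measurable (L2_measurable lX).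
have p0 := sqr_EFin_ge0 X.
by rewrite nrm2_EFin// fubini_tonelli1// fubini_tonelli.
Qed.

Definition tint (s t : R) (Phi : R -> Om -> R) (x : Om) : R := \int[leb]_u cut s t Phi (u, x).

Lemma cut_indic_le (s t u : R) (A : R -> Om -> R) x : cut s t A (u, x) = \1_(`]s, t]) u * cut s t A (u, x).
Proof. by rewrite /cut indicE mem_setE in_itv /=; case: ifP => _; rewrite ?mul1r ?mulr0. Qed.

Lemma indic_L2 (s t : R) : L2 leb (\1_(`]s, t]) : measurableTypeR R -> R).
Proof.
apply: L2P; first exact: measurable_indic.
rewrite (_ : _ \o _ = EFin \o (\1_(`]s, t]) : R -> R)); first exact: indic_itv_integrable.
by apply/funext => u /=; rewrite indicE; case: (_ \in _); rewrite ?expr1n ?expr0n.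
Qed.

Lemma indic_nrm2 (s t : R) : s <= t -> nrm2 leb (\1_(`]s, t]) : measurableTypeR R -> R) = t - s.
Proof.
move=> st; rewrite -[RHS](_ : Num.max 0 (t - s) = _); last by rewrite max_r ?subr_ge0.
rewrite -indic_itv_Rintegral nrm2E; congr fine; apply: eq_integral => u _.
by rewrite indicE; case: (_ \in _); rewrite ?expr1n ?expr0n.
Qed.

Lemma tint_ip (s t : R) (Phi : R -> Om -> R) x :
  tint s t Phi x = ip leb (\1_(`]s, t]) : measurableTypeR R -> R) (fun u => cut s t Phi (u, x)).
Proof. by congr fine; apply: eq_integral => u _; congr EFin; exact: cut_indic_le. Qed.

(** Cauchy-Schwarz against the indicator of the window. The factor [t - s] is the small quantity on
    which the backward Gronwall argument relies. *)
Lemma tint_sqr_le (s t : R) (Phi : R -> Om -> R) x : s <= t ->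
  L2 leb (fun u : measurableTypeR R => cut s t Phi (u, x)) ->
  (tint s t Phi x) ^+ 2 <= (t - s) * nrm2 leb (fun u : measurableTypeR R => cut s t Phi (u, x)).
Proof.
rewrite le_eqVlt => /predU1P[->|st] l.
  rewrite /tint /Rintegral (eq_integral (fun=> 0%E)) ?integral0 ?expr0n /= ?subrr ?mul0r// => u _.
  by rewrite /cut /=; case: (ltP t u) => //= tu; rewrite leNgt tu.
have h0 : 0 < t - s by rewrite subr_gt0.
(* [q] is the minimiser of the squared norm of [X + q 1_(s, t]]. *)
rewrite tint_ip; set X := fun u => _ in l *; set I := ip _ _ _.
have lI := indic_L2 s t; pose q := - (I / (t - s)).
have := nrm2_ge0 leb (fun u => X u + q * (\1_(`]s, t]) : measurableTypeR R -> R) u).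
have lqI := L2Z q lI.
rewrite nrm2D// nrm2Z// indic_nrm2 ?(ltW st)// ipZr// (ipC leb X) -/I => h.
have : 0 <= (t - s) * (nrm2 leb X + 2 * (q * I) + q ^+ 2 * (t - s)) by rewrite mulr_ge0// ltW.
have -> : (t - s) * (nrm2 leb X + 2 * (q * I) + q ^+ 2 * (t - s)) = (t - s) * nrm2 leb X - I ^+ 2.
  rewrite /q; field; exact: lt0r_neq0.
by rewrite subr_ge0.
Qed.

Lemma cut_integrable (s t : R) (Phi : R -> Om -> R) : L2 mu2 (cut s t Phi) ->
  mu2.-integrable setT (EFin \o cut s t Phi).
Proof.
move=> l; have lI : L2 mu2 (fun p : measurableTypeR R * Om => \1_(`]s, t]) p.1).
  apply: L2P; first by apply: (measurableT_comp _ measurable_fst); exact: measurable_indic.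
  have := prod_integrable (indic_itv_integrable s t) (L2_integrable (L2_cst P 1)).
  congr (_.-integrable _ _); apply/funext => u /=.
  by rewrite mulr1 indicE; case: (_ \in _); rewrite ?expr1n ?expr0n.
have := L2_mul_integrable lI l; congr (_.-integrable _ _).
by apply/funext => -[u x] /=; rewrite -cut_indic_le.
Qed.

Lemma tint_measurable (s t : R) (Phi : R -> Om -> R) : L2 mu2 (cut s t Phi) ->
  measurable_fun setT (tint s t Phi).
Proof.
move=> l; apply: (measurableT_comp (@fine_measurable R setT measurableT)).
exact: (measurable_fubini_G (cut_integrable l)).
Qed.

Lemma tint_L2_nrm2 (s t : R) (Phi : R -> Om -> R) : s <= t -> L2 mu2 (cut s t Phi) ->
  L2 P (tint s t Phi) /\ nrm2 P (tint s t Phi) <= (t - s) * nrm2 mu2 (cut s t Phi).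
Proof.
move=> st l; have m := tint_measurable l.
have le1 : (\int[P]_x ((tint s t Phi x) ^+ 2)%:E <= ((t - s) * nrm2 mu2 (cut s t Phi))%:E)%E.
  rewrite EFinM nrm2_slice//.
  rewrite -ge0_integralZl//; last first.
  - by rewrite lee_fin subr_ge0.
  - by move=> x _; apply: integral_ge0 => u _; rewrite lee_fin sqr_ge0.
  - apply: (@measurable_fun_fubini_tonelli_G _ _ _ _ R leb (fun p => ((cut s t Phi p) ^+ 2)%:E)).
    + exact: sqr_EFin_measurable (L2_measurable l).
    + exact: sqr_EFin_ge0.
  apply: ae_ge0_le_integral => //.
  - by move=> x _; rewrite lee_fin sqr_ge0.
  - by apply/measurable_EFinP; apply: measurable_funX.
  - by move=> x _; rewrite mule_ge0// ?lee_fin ?subr_ge0//; apply: integral_ge0 => u _; rewrite lee_fin sqr_ge0.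
  - apply: measurable_funeM.
    apply: (@measurable_fun_fubini_tonelli_G _ _ _ _ R leb (fun p => ((cut s t Phi p) ^+ 2)%:E)).
    + exact: sqr_EFin_measurable (L2_measurable l).
    + exact: sqr_EFin_ge0.
  - have := slice_L2 l; apply: filterS => x lx _.
    by rewrite -nrm2_EFin// -EFinM lee_fin tint_sqr_le.
have lt : L2 P (tint s t Phi) by split => //; apply: le_lt_trans le1 _; exact: ltry.
by split => //; rewrite -lee_fin nrm2_EFin.
Qed.

Lemma tintB (s t : R) (Phi Phi' : R -> Om -> R) : L2 mu2 (cut s t Phi) -> L2 mu2 (cut s t Phi') ->
  {ae P, forall x, tint s t (fun u x => Phi u x - Phi' u x) x = tint s t Phi x - tint s t Phi' x}.
Proof.
move=> l l'; have i1 := ae_integrable2 (cut_integrable l); have i2 := ae_integrable2 (cut_integrable l').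
near=> x; rewrite /tint -RintegralB//.
- congr fine; apply: eq_integral => u _; congr EFin; rewrite /cut /=; case: ifP => // _; by rewrite subr0.
- by near: x.
- by near: x.
Unshelve. all: by end_near. Qed.

End cut_lemmas.

(** * Linear backward equations *)

Section linear_equation.
Context (R : realType) dO (Om : measurableType dO) (P : probability Om R) (d : nat) (T : R)
  (W : nat -> Om -> cpath d T).
Hypothesis hW : independent_brownian_motions P W.
Variable N : nat.
Local Notation C := ('I_N * 'I_d)%type.
Implicit Types c : C.
Local Notation FF := (FN P W N).
Local Notation leb := (@lebesgue_measure R).
Local Notation mu2 := (leb_prod P).
Local Notation stoch_int := (@stoch_int R dO Om P d T W N).

(** The driver [Phi] is a given process and not a function of the solution, so the class is closed
    under subtraction, as the difference of two nonlinear equations requires. The integral [V] is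
    supplied separately for each pair of times. *)
Definition lin_eq (Y Phi : R -> Om -> R) (A : C -> R -> Om -> R) :=
  [/\ (forall t : R, 0 <= t <= T -> measurable_fun setT (Y t : g_sigma_algebraType (FF t) -> R)),
      (exists b : R, forall t : R, 0 <= t <= T -> L2 P (Y t) /\ nrm2 P (Y t) <= b),
      [/\ L2 mu2 (cut 0 T Y), L2 mu2 (cut 0 T Phi) & forall c, L2 mu2 (cut 0 T (A c))]
    & forall s t : R, 0 <= s -> s <= t -> t <= T -> exists V : Om -> R,
        [/\ L2 P V, stoch_int s t A V & {ae P, forall x, Y s x + V x = Y t x + tint s t Phi x}]].

Lemma cutB (s t : R) (A A' : R -> Om -> R) :
  cut s t (fun u x => A u x - A' u x) = fun p => cut s t A p - cut s t A' p.
Proof. by apply/funext => p; rewrite /cut; case: ifP; rewrite ?subr0. Qed.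

Lemma nrm2B_le d' (U : measurableType d') (mu : {measure set U -> \bar R}) (X Y : U -> R) : L2 mu X -> L2 mu Y ->
  nrm2 mu (fun x => X x - Y x) <= 2 * nrm2 mu X + 2 * nrm2 mu Y.
Proof.
move=> lX lY; rewrite nrm2D ?nrm2N//; last exact: L2N.
have := ip_le ltr01 lX (L2N lY); rewrite invr1 !mul1r nrm2N//.
by have := ler_norm (ip mu X (fun x => - Y x)); lra.
Qed.

Lemma nrm2D_le d' (U : measurableType d') (mu : {measure set U -> \bar R}) (X Y : U -> R) : L2 mu X -> L2 mu Y ->
  nrm2 mu (fun x => X x + Y x) <= 2 * nrm2 mu X + 2 * nrm2 mu Y.
Proof.
move=> lX lY; rewrite nrm2D//.
have := ip_le ltr01 lX lY; rewrite invr1 !mul1r.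
by have := ler_norm (ip mu X Y); lra.
Qed.

Lemma lin_eqB Y Phi A Y' Phi' A' : lin_eq Y Phi A -> lin_eq Y' Phi' A' ->
  lin_eq (fun u x => Y u x - Y' u x) (fun u x => Phi u x - Phi' u x) (fun c u x => A c u x - A' c u x).
Proof.
move=> [mY [b Yb] [lY lPhi lA] E] [mY' [b' Yb'] [lY' lPhi' lA'] E']; split.
- by move=> t tT; apply: measurable_funB; [exact: mY|exact: mY'].
- exists (2 * b + 2 * b') => t tT; have [lt nt] := Yb t tT; have [lt' nt'] := Yb' t tT.
  by split; [exact: L2B|have := nrm2B_le lt lt'; lra].
- by split; [| |move=> c]; rewrite cutB; exact: L2B.
move=> s t s0 st tT; have [V [lV SV EV]] := E s t s0 st tT; have [V' [lV' SV' EV']] := E' s t s0 st tT.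
exists (fun x => V x - V' x); split; first exact: L2B.
  by apply: stoch_int_sub => //; move=> c; apply: (cut_L2 s0 tT).
have := tintB (cut_L2 s0 tT lPhi) (cut_L2 s0 tT lPhi').
move: EV EV'; apply: filterS3 => x e e' ->; lra.
Qed.

(* [V] is orthogonal to [Y s], so squaring [Y s + V = Y t + tint s t Phi] replaces
   Ito's formula. *)
Lemma lin_eq_energy Y Phi A (s t : R) : lin_eq Y Phi A -> 0 <= s -> s <= t -> t <= T ->
  nrm2 P (Y s) + \sum_c nrm2 mu2 (cut s t (A c)) <=
  2 * nrm2 P (Y t) + 2 * (t - s) * nrm2 mu2 (cut s t Phi).
Proof.
move=> [mY [b Yb] [lY lPhi lA] E] s0 st tT; have [V [lV SV EV]] := E s t s0 st tT.
have sT := le_trans st tT; have t0 := le_trans s0 st.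
have [lYs _] : L2 P (Y s) /\ nrm2 P (Y s) <= b by apply: Yb; rewrite s0.
have [lYt _] : L2 P (Y t) /\ nrm2 P (Y t) <= b by apply: Yb; rewrite t0.
have mYs : measurable_fun setT (Y s : g_sigma_algebraType (FF s) -> R) by apply: mY; rewrite s0.
have lc c : L2 mu2 (cut s t (A c)) by exact: cut_L2 s0 tT (lA c).
rewrite -(stoch_int_energy hW s0 st tT mYs _ lYs lV lc SV); last exact: aeW.
have [lI nI] := tint_L2_nrm2 st (cut_L2 s0 tT lPhi).
have -> : nrm2 P (fun x => Y s x + V x) = nrm2 P (fun x => Y t x + tint s t Phi x); last first.
  by have := nrm2D_le lYt lI; lra.
apply: nrm2_ae => //.
- by apply: measurable_funD; [exact: L2_measurable lYs|exact: L2_measurable lV].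
- by apply: measurable_funD; [exact: L2_measurable lYt|exact: L2_measurable lI].
Qed.

(** The equations are estimated jointly because the driver of one component depends on all
    components. The last hypothesis is the Lipschitz bound of the drivers, integrated over a window;
    [e] is the source per unit of time. *)
Lemma lin_eq_stability (J : finType) (Y Phi : J -> R -> Om -> R) (A : J -> C -> R -> Om -> R) (K e : R) :
  0 <= T -> 0 <= K -> 0 <= e -> (forall j, lin_eq (Y j) (Phi j) (A j)) ->
  (forall s t : R, 0 <= s -> s <= t -> t <= T ->
    \sum_j nrm2 mu2 (cut s t (Phi j)) <=
    K * (\sum_j nrm2 mu2 (cut s t (Y j)) + \sum_j \sum_c nrm2 mu2 (cut s t (A j c))) + (t - s) * e) ->
  forall t : R, 0 <= t <= T ->
  \sum_j nrm2 P (Y j t) + \sum_j \sum_c nrm2 mu2 (cut 0 T (A j c)) <=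
  gronwall_cst K T * (\sum_j nrm2 P (Y j T) + e).
Proof.
move=> T0 K0 e0 L H.
have /choice[b Yb] : forall j, exists b : R, forall t : R, 0 <= t <= T -> L2 P (Y j t) /\ nrm2 P (Y j t) <= b.
  by move=> j; have [_ ? _ _] := L j.
apply: (@backward_gronwall _ K T (fun t => \sum_j nrm2 P (Y j t))
  (fun s t => \sum_j \sum_c nrm2 mu2 (cut s t (A j c))) e (\sum_j b j)) => //.
- move=> t tT; rewrite sumr_ge0/=; last by move=> j _; exact: nrm2_ge0.
  by apply: ler_sum => j _; exact: (Yb j t tT).2.
- by move=> s t _ _ _; apply: sumr_ge0 => j _; apply: sumr_ge0 => c _; exact: nrm2_ge0.
- move=> r s t r0 rs st tT; rewrite -big_split /=; apply: eq_bigr => j _.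
  rewrite -big_split /=; apply: eq_bigr => c _; apply: cut_nrm2D => //.
  by have [_ _ [_ _ lA] _] := L j; exact: cut_L2 r0 tT (lA c).
- move=> s t S s0 st tT aS.
  have lY j : L2 mu2 (cut s t (Y j)).
    by have [_ _ [lY _ _] _] := L j; exact: cut_L2 s0 tT lY.
  have hY : \sum_j nrm2 mu2 (cut s t (Y j)) <= (t - s) * S.
    apply: cut_nrm2_sum_le => // u /andP[su ut].
    have uT : 0 <= u <= T by rewrite (le_trans s0 su) (le_trans ut tT).
    rewrite (eq_bigr (fun j => (nrm2 P (Y j u))%:E)); last first.
      by move=> j _; rewrite nrm2_EFin//; exact: (Yb j u uT).1.
    by rewrite sumEFin lee_fin aS// su.
  have : \sum_j (nrm2 P (Y j s) + \sum_c nrm2 mu2 (cut s t (A j c))) <=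
         \sum_j (2 * nrm2 P (Y j t) + 2 * (t - s) * nrm2 mu2 (cut s t (Phi j))).
    by apply: ler_sum => j _; exact: lin_eq_energy.
  rewrite !big_split /= -!mulr_sumr => /le_trans; apply.
  rewrite lerD2l ler_wpM2l// ?mulr_ge0 ?subr_ge0//.
  apply: le_trans (H s t s0 st tT) _.
  by rewrite lerD2r ler_wpM2l// lerD2r.
Qed.

End linear_equation.

Section moments.
Context (R : realType) dO (Om : measurableType dO) (P : probability Om R).
Local Notation leb := (@lebesgue_measure R).
Local Notation mu2 := (leb_prod P).

(** A nonnegative integral is a supremum over simple functions lying below the integrand, so it is
    monotone for arbitrary functions. This handles the supremum over all times in [E2sup]. *)
Lemma ge0_le_integral_nonmeasurable d' (U : measurableType d') (mu : {measure set U -> \bar R})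
    (f g : U -> \bar R) : (forall x, (0 <= f x)%E) -> (forall x, (f x <= g x)%E) ->
  (\int[mu]_x f x <= \int[mu]_x g x)%E.
Proof.
move=> f0 fg; have g0 x : (0 <= g x)%E by exact: le_trans (fg x).
rewrite !ge0_integralTE//; apply: le_ereal_sup => _ [h hf <-].
by exists h => // x; exact: le_trans (hf x) (fg x).
Qed.

Lemma E2_coord_le p q (X : Om -> 'M[R]_(p, q)) i j : (\int[P]_x ((X x i j) ^+ 2)%:E <= E2 P X)%E.
Proof.
apply: ge0_le_integral_nonmeasurable => x; first by rewrite lee_fin sqr_ge0.
by rewrite lee_fin -real_normK ?num_real// lerXn2r ?nnegrE ?euclid_ge0// coord_le_euclid.
Qed.

Lemma E2_components p q (X : Om -> 'M[R]_(p, q)) : (forall i j, measurable_fun setT (fun x => X x i j)) ->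
  E2 P X = (\sum_i \sum_j \int[P]_x ((X x i j) ^+ 2)%:E)%E.
Proof.
move=> mX; rewrite /E2; under eq_integral do rewrite euclid_sqr -sumEFin.
rewrite ge0_integral_sum//; first last.
- by move=> i x _; rewrite lee_fin sumr_ge0// => j _; rewrite sqr_ge0.
- by move=> i; apply/measurable_EFinP; apply: measurable_sum => j; exact: measurable_funX.
apply: eq_bigr => i _; under eq_integral do rewrite -sumEFin.
rewrite ge0_integral_sum//; first last.
- by move=> j x _; rewrite lee_fin sqr_ge0.
- by move=> j; exact: sqr_EFin_measurable.
Qed.

Lemma E2_nrm2 p q (X : Om -> 'M[R]_(p, q)) : (forall i j, L2 P (fun x => X x i j)) ->
  E2 P X = (\sum_i \sum_j nrm2 P (fun x => X x i j))%:E.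
Proof.
move=> lX; rewrite E2_components; last by move=> i j; exact: L2_measurable (lX i j).
by rewrite -sumEFin; apply: eq_bigr => i _; rewrite -sumEFin; apply: eq_bigr => j _; rewrite nrm2_EFin.
Qed.

Lemma E2int_coord_le (T : R) p q (Z : R -> Om -> 'M[R]_(p, q)) i j :
  measurable_fun setT (cut 0 T (fun u x => Z u x i j) : measurableTypeR R * Om -> R) ->
  (\int[mu2]_w ((cut 0 T (fun u x => Z u x i j) w) ^+ 2)%:E <= E2int P T Z)%E.
Proof.
move=> mZ; have m2 := sqr_EFin_measurable mZ; have p0 := sqr_EFin_ge0 (cut 0 T (fun u x => Z u x i j)).
rewrite (@fubini_tonelli1 _ _ _ _ _ leb P _ m2 p0) (@fubini_tonelli _ _ _ _ _ leb P _ m2 p0).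
apply: ge0_le_integral_nonmeasurable => x; first by apply: integral_ge0 => u _; rewrite lee_fin sqr_ge0.
rewrite [leRHS]integral_mkcond.
apply: ge0_le_integral_nonmeasurable => u; first by rewrite lee_fin sqr_ge0.
rewrite patchE mem_setE in_itv /= /cut /=; case: ifP => [/andP[u0 uT]|_]; last first.
  by rewrite expr0n /=; case: ifP => // _; rewrite lee_fin sqr_ge0.
rewrite (ltW u0) uT /= lee_fin -real_normK ?num_real// lerXn2r ?nnegrE ?euclid_ge0//.
exact: coord_le_euclid.
Qed.

Lemma cut_measurable (s t : R) (X : R -> Om -> R) : measurable_fun (`[s, t] `*` setT) (fun p : measurableTypeR R * Om => X p.1 p.2) ->
  measurable_fun setT (cut s t X : measurableTypeR R * Om -> R).
Proof.
move=> mX; have mD : measurable (`]s, t]%classic `*` [set: Om] : set (measurableTypeR R * Om)).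
  exact: measurableX.
have sub : `]s, t]%classic `*` [set: Om] `<=` `[s, t]%classic `*` [set: Om].
  by move=> p [/= + _]; rewrite !in_itv /= => /andP[/ltW -> ->].
rewrite (_ : cut s t X = (fun p => X p.1 p.2) \_ (`]s, t]%classic `*` [set: Om])); last first.
  apply/funext => p; rewrite patchE /cut.
  case: ifPn => sp; first by rewrite ifT// inE /=; split => //; rewrite /= in_itv.
  rewrite ifF//; apply/negbTE; rewrite notin_setE /= => -[+ _]; rewrite in_itv /=.
  by rewrite (negbTE sp).
apply: (measurable_restrictT _ mD).1; apply: measurable_funS mX => //.
exact: measurableX.
Qed.

Lemma cut_slice_measurable (s t : R) (Phi : R -> Om -> R) x : measurable_fun setT (cut s t Phi : measurableTypeR R * Om -> R) ->
  measurable_fun `]s, t] (fun u => Phi u x).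
Proof.
move=> m; have m1 : measurable_fun setT (fun u : measurableTypeR R => cut s t Phi (u, x)).
  by apply: (measurableT_comp m); exact: measurable_pair2.
apply: (eq_measurable_fun _ _ (measurable_funS measurableT (@subsetT _ _) m1)).
by move=> u; rewrite mem_setE in_itv /= /cut /= => ->.
Qed.

Lemma E2int_nrm2 (T : R) p q (Z : R -> Om -> 'M[R]_(p, q)) :
  (forall i j, measurable_fun (`[0, T] `*` setT) (fun w : measurableTypeR R * Om => Z w.1 w.2 i j)) ->
  (forall i j, L2 mu2 (cut 0 T (fun u x => Z u x i j))) ->
  E2int P T Z = (\sum_i \sum_j nrm2 mu2 (cut 0 T (fun u x => Z u x i j)))%:E.
Proof.
move=> mZ lZ; pose g w := \sum_i \sum_j (cut 0 T (fun u x => Z u x i j) w) ^+ 2.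
have g0 w : (0 <= (g w)%:E)%E.
  by rewrite lee_fin; apply: sumr_ge0 => i _; apply: sumr_ge0 => j _; exact: sqr_ge0.
have mg : measurable_fun setT (fun w : measurableTypeR R * Om => (g w)%:E).
  apply/measurable_EFinP; apply: measurable_sum => i; apply: measurable_sum => j.
  by apply: measurable_funX; exact: L2_measurable (lZ i j).
transitivity (\int[mu2]_w (g w)%:E)%E.
  rewrite (@fubini_tonelli1 _ _ _ _ _ leb P _ mg g0) (@fubini_tonelli _ _ _ _ _ leb P _ mg g0).
  apply: eq_integral => x _; rewrite /fubini_G -integral_itv_obnd_cbnd; last first.
    rewrite (_ : (fun u => _) = fun u : measurableTypeR R => (\sum_i \sum_j (Z u x i j) ^+ 2)%:E); last first.
      by apply/funext => u; rewrite euclid_sqr.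
    apply/measurable_EFinP; apply: measurable_sum => i; apply: measurable_sum => j; apply: measurable_funX.
    exact: (@cut_slice_measurable 0 T (fun u x => Z u x i j) x (L2_measurable (lZ i j))).
  rewrite integral_mkcond; apply: eq_integral => u _.
  rewrite patchE mem_setE in_itv /= euclid_sqr /g /cut /=; case: ifP => // _.
  by rewrite big1// => i _; rewrite big1// => j _; rewrite expr0n.
rewrite /g; under eq_integral do rewrite -sumEFin.
rewrite ge0_integral_sum//; first last.
- by move=> i x _; rewrite lee_fin sumr_ge0// => j _; rewrite sqr_ge0.
- move=> i; apply/measurable_EFinP; apply: measurable_sum => j; apply: measurable_funX; exact: L2_measurable (lZ i j).
rewrite -sumEFin; apply: eq_bigr => i _; under eq_integral do rewrite -sumEFin.
rewrite ge0_integral_sum//; first last.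
- by move=> j x _; rewrite lee_fin sqr_ge0.
- by move=> j; apply: sqr_EFin_measurable; exact: L2_measurable (lZ i j).
by rewrite -sumEFin; apply: eq_bigr => j _; rewrite nrm2_EFin.
Qed.

Lemma nrm2_cvg0 d' (U : measurableType d') (mu : {measure set U -> \bar R}) (X : nat -> U -> R) (y : nat -> \bar R) :
  (forall k, (\int[mu]_x ((X k x) ^+ 2)%:E <= y k)%E) -> y @ \oo --> 0%E ->
  (fun k => nrm2 mu (X k)) @ \oo --> (0 : R).
Proof.
move=> Xy y0.
have h : (fun k => (nrm2 mu (X k))%:E) @ \oo --> (0 : R)%:E.
  apply: (@squeeze_cvge _ _ _ _ (fun=> (0 : R)%:E) _ y); last exact: y0; last exact: cvg_cst.
  apply: nearW => k; rewrite lee_fin nrm2_ge0/=.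
  apply: le_trans (Xy k); rewrite nrm2E /Rintegral.
  have : (0 <= \int[mu]_x ((X k x) ^+ 2)%:E)%E by apply: integral_ge0 => x _; rewrite lee_fin sqr_ge0.
  by case: (integral _ _ _) => [r| |]//= _; rewrite leey.
exact: (fine_cvg h).
Qed.

Lemma tint_cat (s t r : R) (Phi : R -> Om -> R) : s <= t -> t <= r -> L2 mu2 (cut s r Phi) ->
  {ae P, forall x, tint s r Phi x = tint s t Phi x + tint t r Phi x}.
Proof.
move=> st tr l; have i1 := ae_integrable2 (cut_integrable (cut_L2 (lexx s) tr l)).
have i2 := ae_integrable2 (cut_integrable (cut_L2 st (lexx r) l)).
near=> x; rewrite /tint -RintegralD//.
- congr fine; apply: eq_integral => u _; congr EFin; rewrite /cut /=.
  case: (ltP s u) => su /=; case: (leP u t) => ut /=; rewrite ?add0r ?addr0//.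
  + by rewrite (le_trans ut tr).
  + by have := le_lt_trans (le_trans su st) ut; rewrite ltxx.
- by near: x.
- by near: x.
Unshelve. all: by end_near. Qed.

End moments.

Section linear_combinations.
Context (R : realType) dO (Om : measurableType dO) (P : probability Om R) (d : nat) (T : R)
  (W : nat -> Om -> cpath d T).
Hypothesis hW : independent_brownian_motions P W.
Variable N : nat.
Local Notation C := ('I_N * 'I_d)%type.
Implicit Types c : C.
Local Notation FF := (FN P W N).
Local Notation leb := (@lebesgue_measure R).
Local Notation mu2 := (leb_prod P).
Local Notation stoch_int := (@stoch_int R dO Om P d T W N).

Lemma cut0 (s t : R) : cut s t (fun _ (_ : Om) => 0 : R) = fun=> 0.
Proof. by apply/funext => p; rewrite /cut; case: ifP. Qed.

Lemma stoch_int0 (s t : R) : stoch_int s t (fun _ _ _ => 0) (fun=> 0).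
Proof.
exists (fun=> [::]); split => [|c].
- rewrite (_ : (fun k => _) = fun=> 0); first exact: cvg_cst.
  apply/funext => k; rewrite nrm2E /Rintegral (eq_integral (fun=> 0%E)) ?integral0// => x _.
  by rewrite /sum_int big_nil subr0 expr0n.
- rewrite (_ : (fun k => _) = fun=> 0); first exact: cvg_cst.
  apply/funext => k; rewrite nrm2E /Rintegral (eq_integral (fun=> 0%E)) ?integral0// => x _.
  by rewrite cut_sum cut0 big_nil subr0 expr0n.
Qed.

Lemma stoch_int_add (s t : R) A A' V V' : 0 <= s -> s <= t -> t <= T ->
  L2 P V -> L2 P V' -> (forall c, L2 mu2 (cut s t (A c))) -> (forall c, L2 mu2 (cut s t (A' c))) ->
  stoch_int s t A V -> stoch_int s t A' V' -> stoch_int s t (fun c u x => A c u x + A' c u x) (fun x => V x + V' x).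
Proof.
move=> s0 st tT lV lV' lA lA' SV SV'.
have l0 : L2 P (fun=> 0) by exact: L2_0.
have l0' c : L2 mu2 (cut s t (fun (_ : R) (_ : Om) => 0 : R)) by rewrite cut0; exact: L2_0.
(* The sum is written as [V - (0 - V')], so that subtraction suffices. *)
have h := stoch_int_sub hW s0 st tT l0 lV' l0' lA' (stoch_int0 s t) SV'.
have lN : L2 P (fun x => 0 - V' x) by exact: L2B.
have lN' c : L2 mu2 (cut s t (fun u x => 0 - A' c u x)).
  by rewrite cutB; apply: L2B => //; exact: l0'.
have := stoch_int_sub hW s0 st tT lV lN lA lN' SV h.
rewrite (_ : (fun c u x => _) = (fun c u x => A c u x + A' c u x)); last first.
  by apply/funext => c; apply/funext => u; apply/funext => x; ring.
by rewrite (_ : (fun x => _) = (fun x => V x + V' x)); last by apply/funext => x; ring.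
Qed.

Lemma stoch_int_sum (J : Type) (rs : seq J) (s t : R) (A : J -> C -> R -> Om -> R) (V : J -> Om -> R) :
  0 <= s -> s <= t -> t <= T ->
  (forall j, L2 P (V j)) -> (forall j c, L2 mu2 (cut s t (A j c))) ->
  (forall j, stoch_int s t (A j) (V j)) -> stoch_int s t (fun c u x => \sum_(j <- rs) A j c u x) (fun x => \sum_(j <- rs) V j x).
Proof.
move=> s0 st tT lV lA S; elim: rs => [|j rs IH].
  rewrite (_ : (fun c u x => _) = (fun _ _ _ => 0)); last first.
    by apply/funext => c; apply/funext => u; apply/funext => x; rewrite big_nil.
  by rewrite (_ : (fun x => _) = (fun=> 0)); [exact: stoch_int0|apply/funext => x; rewrite big_nil].
rewrite (_ : (fun c u x => _) = (fun c u x => A j c u x + \sum_(j <- rs) A j c u x)); last first.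
  by apply/funext => c; apply/funext => u; apply/funext => x; rewrite big_cons.
rewrite (_ : (fun x => _) = (fun x => V j x + \sum_(j <- rs) V j x)); last first.
  by apply/funext => x; rewrite big_cons.
apply: stoch_int_add => //; first exact: L2_sum.
move=> c; rewrite (_ : cut _ _ _ = fun p => \sum_(j <- rs) cut s t (A j c) p); first exact: L2_sum.
by apply/funext => p; rewrite /cut; case: ifP => // _; rewrite big1.
Qed.

(** Subtracting the equation at [t] from the equation at [s] cancels the terminal value [xi] and
    [M T]. *)
Lemma lin_eq_intro (Y Phi : R -> Om -> R) (A : C -> R -> Om -> R) (M : R -> Om -> R) (xi : Om -> R) (b : R) :
  (forall t : R, 0 <= t <= T -> measurable_fun setT (Y t : g_sigma_algebraType (FF t) -> R)) ->
  (forall t : R, 0 <= t <= T -> L2 P (Y t) /\ nrm2 P (Y t) <= b) ->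
  L2 mu2 (cut 0 T Y) -> L2 mu2 (cut 0 T Phi) -> (forall c, L2 mu2 (cut 0 T (A c))) ->
  (forall t : R, 0 <= t <= T -> L2 P (M t)) ->
  (forall s t : R, 0 <= s -> s <= t -> t <= T -> stoch_int s t A (fun x => M t x - M s x)) ->
  {ae P, forall x, forall t : R, 0 <= t <= T -> Y t x = xi x + tint t T Phi x - (M T x - M t x)} ->
  lin_eq P W Y Phi A.
Proof.
move=> mY lY cY cPhi cA lM SM E; split => //; first by exists b.
move=> s t s0 st tT; exists (fun x => M t x - M s x).
have t0 : 0 <= t by exact: le_trans st.
have sT : s <= T by exact: le_trans tT.
split; [apply: L2B; apply: lM; rewrite ?s0 ?t0//|exact: SM|].
have := tint_cat st tT (cut_L2 s0 (lexx T) cPhi); move: E; apply: filterS2 => x E e.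
rewrite E ?s0// E ?t0// e; ring.
Qed.

End linear_combinations.

(** * Solutions of the two systems *)

Section progressive_processes.
Context (R : realType) dO (Om : measurableType dO) (P : probability Om R) (d : nat) (T : R)
  (W : nat -> Om -> cpath d T).
Hypothesis hW : independent_brownian_motions P W.
Variables (dV : measure_display) (V : measurableType dV) (J : set nat).
Local Notation FJ := (completed_filtration P W J).

Lemma progressive_adapted (X : R -> Om -> V) (t : R) : progressive FJ T X -> 0 <= t <= T ->
  measurable_fun setT (X t : g_sigma_algebraType (FJ t) -> V).
Proof.
move=> pX tT; have := pX t tT => mX.
have mp : measurable_fun setT (fun x : g_sigma_algebraType (FJ t) => (t, x) : R * g_sigma_algebraType (FJ t)).
  exact: measurable_pair1.
apply: (measurable_comp _ _ mX mp).
  by apply: measurableX => //; exact: measurable_itv.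
by move=> _ [x _ <-]; split => //=; rewrite in_itv /= lexx andbT; case/andP: tT.
Qed.

Lemma progressive_measurable (X : R -> Om -> V) : 0 <= T -> progressive FJ T X ->
  measurable_fun (`[0, T] `*` setT) (fun p : measurableTypeR R * Om => X p.1 p.2).
Proof.
move=> T0 pX; have TT : 0 <= T <= T by rewrite T0 lexx.
have mX := pX T TT.
have mp : measurable_fun setT (fun p : measurableTypeR R * Om => (p.1, p.2) : R * g_sigma_algebraType (FJ T)).
  apply: measurable_fun_pair => //.
  apply: (measurableT_comp (measurable_id_g_sigma _)); last exact: measurable_snd.
  exact: completed_filtration_measurable.
apply: (measurable_comp _ _ mX (measurable_funTS mp)).
  by apply: measurableX => //; exact: measurable_itv.
by move=> _ [p [/= p1 p2] <-].
Qed.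

End progressive_processes.

Section ito_limits.
Context (R : realType) dO (Om : measurableType dO) (P : probability Om R) (m d : nat).
Local Notation mu2 := (leb_prod P).

(** The convergences of [is_ito_integral] in each matrix entry, as scalar mean-square limits. In
    this form they depend only on second moments and can be carried over to another Brownian
    motion. *)
Definition ito_limit (FF : R -> set_system Om) (T : R) (Z : R -> Om -> 'M[R]_(m, d))
    (B : R -> Om -> 'cV[R]_d) (M : R -> Om -> 'cV[R]_m) :=
  (forall t : R, 0 <= t <= T -> forall r, measurable_fun setT (fun x => M t x r ord0)) /\
  exists H : nat -> elementary R Om m d,
    [/\ forall k, elementary_spec FF T (H k),
        forall r q, (fun k => \int[mu2]_p ((cut 0 T (fun u x => elementary_val (H k) u x r q - Z u x r q) p) ^+ 2)%:E)%E @ \oo --> 0%E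
      & forall (t : R) r, 0 <= t <= T ->
        (fun k => \int[P]_x ((elementary_int (H k) B t x r ord0 - M t x r ord0) ^+ 2)%:E)%E @ \oo --> 0%E].

End ito_limits.

Section elementary_terms.
Context (R : realType) dO (Om : measurableType dO) (P : probability Om R) (m d : nat) (T : R)
  (W : nat -> Om -> cpath d T).
Hypothesis hW : independent_brownian_motions P W.
Variable N : nat.
Local Notation C := ('I_N * 'I_d)%type.
Implicit Types c : C.
Local Notation FF := (FN P W N).
Local Notation leb := (@lebesgue_measure R).
Local Notation mu2 := (leb_prod P).
Local Notation stoch_int := (@stoch_int R dO Om P d T W N).
Variable J : set nat.
Hypothesis JN : J `<=` `I_N.
Local Notation FJ := (completed_filtration P W J).
Variable j : 'I_N.
Local Notation Wj := (fun t x => W j x t : 'cV[R]_d).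

Lemma measurable_FJ_FN (t : R) d' (V : measurableType d') (X : Om -> V) :
  measurable_fun setT (X : g_sigma_algebraType (FJ t) -> V) ->
  measurable_fun setT (X : g_sigma_algebraType (FF t) -> V).
Proof.
apply: measurable_fun_g_sigmaS => A hA; apply: sub_sigma_algebra.
exact: completed_filtrationS JN (lexx t) _ hA.
Qed.

Definition el_term (H : @elementary R dO Om m d) (r : 'I_m) (k : nat) (q : 'I_d) : term C Om R :=
  Term (j, q) (el_time H k) (el_time H k.+1) (fun x => el_coef H k x r q).

Lemma el_term_ok (H : @elementary R dO Om m d) (r : 'I_m) k q : elementary_spec FJ T H -> (k < el_size H)%N ->
  ok_term P W (el_term H r k q).
Proof.
move=> [HH [b Hb]] kH; have [a0 ab bT mc] := HH k kH; split => //=.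
  by apply: measurable_FJ_FN; exact: (measurable_fun_mxP _ _).1 mc r q.
by exists b => x; apply: le_trans (Hb k x kH); exact: coord_le_euclid.
Qed.

Definition el_terms (H : @elementary R dO Om m d) (r : 'I_m) (hH : elementary_spec FJ T H) :
    seq {tau : term C Om R | ok_term P W tau} :=
  [seq exist (fun tau => ok_term P W tau) (el_term H r k q) (el_term_ok r q hH (ltn_ord k)) |
    k : 'I_(el_size H) <- enum 'I_(el_size H), q : 'I_d <- enum 'I_d].

Lemma clip_incr (s t u : R) (b : R -> R) : s <= t ->
  b (clip s t u) = b (Num.min u t) - b (Num.min u s) + b s.
Proof.
move=> st; rewrite /clip; have [us|su] := orP (le_total u s).
  rewrite (min_l us) (min_l (le_trans us st)) (max_l us); ring.
rewrite (min_r su) (max_r (x := s)); first by ring.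
by rewrite le_min su.
Qed.

Lemma sum_int_el_terms (s t : R) (H : @elementary R dO Om m d) r (hH : elementary_spec FJ T H) x : s <= t ->
  sum_int s t (el_terms r hH) x = elementary_int H Wj t x r ord0 - elementary_int H Wj s x r ord0.
Proof.
move=> st; rewrite /sum_int big_allpairs_dep /= big_enum /= /elementary_int !summxE -sumrB.
apply: eq_bigr => k _; rewrite big_enum /= !mxE -sumrB; apply: eq_bigr => q _.
rewrite /tm_int /= -mulrBr !mxE /bm_incr; congr (_ * _).
rewrite (clip_incr _ (bm_coord W (j, q) ^~ x) st) (clip_incr (el_time H k) (bm_coord W (j, q) ^~ x) st) /bm_coord /=.
ring.
Qed.

Lemma sum_val_el_terms (H : @elementary R dO Om m d) r (hH : elementary_spec FJ T H) c u x :
  sum_val (el_terms r hH) c u x = if c.1 == j then elementary_val H u x r c.2 else 0.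
Proof.
rewrite /sum_val big_allpairs_dep /= big_enum /= /elementary_val summxE.
case: c => j' q' /=; case: eqP => [->{j'}|jj]; last first.
  rewrite big1// => k _; rewrite big1// => q _; rewrite /tm_val /=.
  by rewrite ifF//; apply/negbTE; rewrite negb_and xpair_eqE negb_and; case: eqP.
apply: eq_bigr => k _; rewrite big_enum /= (bigD1 q')//= big1 ?addr0; last first.
  by move=> q qq; rewrite /tm_val /= xpair_eqE eqxx /= eq_sym (negbTE qq).
by rewrite /tm_val /= eqxx /=; case: ifP => //; rewrite mxE.
Qed.

Lemma elementary_int0 (H : @elementary R dO Om m d) (hH : elementary_spec FJ T H) x r : elementary_int H Wj 0 x r ord0 = 0.
Proof.
rewrite /elementary_int summxE big1// => k _.
have [a0 ab _ _] := hH.1 k (ltn_ord k).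
by rewrite !(min_r _) ?subrr ?mulmx0 ?mxE// (le_trans a0).
Qed.

Variables (Z : R -> Om -> 'M[R]_(m, d)) (M : R -> Om -> 'cV[R]_m).
Lemma is_ito_integral_limit : is_ito_integral P FJ T Z Wj M ->
  (forall r q, measurable_fun setT (cut 0 T (fun u x => Z u x r q) : measurableTypeR R * Om -> R)) ->
  ito_limit P FJ T Z Wj M.
Proof.
move=> [aM _ [H [hH HZ HM]]] cZ; split.
  move=> t tT r; apply: (measurable_fun_mxP _ _).1; apply: (measurable_FN_dO hW (N := N) (s := t)); first by case/andP: tT.
  exact: measurable_FJ_FN (aM t tT).
have sq d' (U : measurableType d') (mu : {measure set U -> \bar R}) (X : nat -> U -> R) (y : nat -> \bar R) :
    (forall k, (\int[mu]_x ((X k x) ^+ 2)%:E <= y k)%E) -> y @ \oo --> 0%E ->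
    (fun k => \int[mu]_x ((X k x) ^+ 2)%:E)%E @ \oo --> 0%E.
  move=> Xy y0; apply: (@squeeze_cvge _ _ _ _ (fun=> 0%E) _ y); [|exact: cvg_cst|exact: y0].
  by apply: nearW => k; rewrite Xy andbT; apply: integral_ge0 => x _; rewrite lee_fin sqr_ge0.
exists H; split => //.
- move=> r q; apply: sq HZ => k.
  have cE : cut 0 T (fun u x => (elementary_val (H k) u x - Z u x) r q) =
            cut 0 T (fun u x => elementary_val (H k) u x r q - Z u x r q).
    by apply/funext => p; rewrite /cut !mxE.
  have := @E2int_coord_le _ _ _ P T _ _ (fun u x => elementary_val (H k) u x - Z u x) r q.
  rewrite cE; apply.
  have := measurable_funB (L2_measurable (cut_sum_val_L2 hW 0 T (el_terms r (hH k)) (j, q))) (cZ r q).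
  congr measurable_fun; apply/funext => p; rewrite /= /cut sum_val_el_terms eqxx.
  by case: ifP => _; rewrite ?subr0.
- move=> t r tT; apply: sq (HM t tT) => k; apply: le_trans (E2_coord_le P _ r ord0).
  rewrite le_eqVlt; apply/orP; left; apply/eqP; apply: eq_integral => x _.
  by rewrite !mxE.
Qed.

Hypothesis hM : ito_limit P FJ T Z Wj M.

Lemma ito_terms (r : 'I_m) : exists L : nat -> seq {tau : term C Om R | ok_term P W tau},
  (forall t : R, 0 <= t <= T -> (fun k => nrm2 P (fun x => sum_int 0 t (L k) x - M t x r ord0)) @ \oo --> (0 : R)) /\
  (forall t : R, 0 <= t <= T -> L2 P (fun x => M t x r ord0)) /\
  forall (s t : R) c, 0 <= s -> t <= T -> (fun k => nrm2 mu2 (fun p => cut s t (sum_val (L k) c) p -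
    cut s t (fun u x => if c.1 == j then Z u x r c.2 else 0) p)) @ \oo --> (0 : R).
Proof.
have [mM [H [hH HZ HM]]] := hM.
have intE k (t : R) x : 0 <= t <= T -> sum_int 0 t (el_terms r (hH k)) x = elementary_int (H k) Wj t x r ord0.
  by move=> /andP[t0 tT]; rewrite sum_int_el_terms// elementary_int0// subr0.
exists (fun k => el_terms r (hH k)); split; [|split] => [t tT|t tT|s t c s0 tT].
- apply: nrm2_cvg0 (HM t r tT) => k.
  rewrite le_eqVlt; apply/orP; left; apply/eqP; apply: eq_integral => x _.
  by rewrite intE.
(* Square integrability of [M t] is recovered from the convergence: some approximation error is
   finite, and [M t] differs by it from a square-integrable elementary integral. *)
- have [k kf] : exists k, (\int[P]_x ((elementary_int (H k) Wj t x r ord0 - M t x r ord0)%R ^+ 2)%:E < +oo)%E.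
    have /fine_cvgP[[k _ kf] _] := HM t r tT.
    by exists k; have := kf k (leqnn k); rewrite /= fin_numElt => /andP[].
  have l1 : L2 P (sum_int 0 t (el_terms r (hH k))).
    by case/andP: tT => ? ?; exact: sum_int_L2.
  have l2 : L2 P (fun x => sum_int 0 t (el_terms r (hH k)) x - M t x r ord0).
    split; first by apply: measurable_funB; [exact: L2_measurable l1|exact: mM].
    apply: le_lt_trans kf.
    rewrite le_eqVlt; apply/orP; left; apply/eqP; apply: eq_integral => x _.
    by rewrite intE.
  rewrite (_ : (fun x => _) = fun x => sum_int 0 t (el_terms r (hH k)) x -
     (sum_int 0 t (el_terms r (hH k)) x - M t x r ord0)); first exact: L2B.
  by apply/funext => x; ring.
- case: eqP => [cj|cj]; last first.
    rewrite (_ : (fun k => _) = fun=> 0); first exact: cvg_cst.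
    apply/funext => k; rewrite nrm2E /Rintegral (eq_integral (fun=> 0%E)) ?integral0// => p _.
    by rewrite /cut sum_val_el_terms; case: eqP => //= _; case: ifP; rewrite subr0 expr0n.
  apply: nrm2_cvg0 (HZ r c.2) => k.
  apply: ge0_le_integral_nonmeasurable => p; first by rewrite lee_fin sqr_ge0.
  rewrite lee_fin /cut sum_val_el_terms cj eqxx.
  case: ifP => [/andP[sp pt]|_]; last by rewrite subr0 expr0n /=; case: ifP; rewrite ?sqr_ge0.
  by rewrite (le_lt_trans s0 sp) (le_trans pt tT).
Qed.

Lemma ito_stoch_int (r : 'I_m) (s t : R) : 0 <= s -> s <= t -> t <= T ->
  stoch_int s t (fun c u x => if c.1 == j then Z u x r c.2 else 0) (fun x => M t x r ord0 - M s x r ord0).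
Proof.
move=> s0 st tT; have [L [LM [lM LZ]]] := ito_terms r.
exists L; split; last by move=> c; exact: LZ.
have t0 := le_trans s0 st; have sT := le_trans st tT.
have tT' : 0 <= t <= T by rewrite t0.
have sT' : 0 <= s <= T by rewrite s0.
have lt k : L2 P (fun x => sum_int 0 t (L k) x - M t x r ord0).
  by apply: L2B; [exact: sum_int_L2|exact: lM].
have ls k : L2 P (fun x => sum_int 0 s (L k) x - M s x r ord0).
  by apply: L2B; [exact: sum_int_L2|exact: lM].
have E k x : sum_int s t (L k) x - (M t x r ord0 - M s x r ord0) =
  (sum_int 0 t (L k) x - M t x r ord0) - (sum_int 0 s (L k) x - M s x r ord0).
  have -> : sum_int s t (L k) x = sum_int 0 t (L k) x - sum_int 0 s (L k) x.
    rewrite /sum_int -sumrB; apply: eq_bigr => tau _; rewrite /tm_int -mulrBr /bm_incr; congr (_ * _).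
    pose b := bm_coord W (tm_c (sval tau)) ^~ x.
    rewrite -/(b _) -/(b (clip s t _)) -/(b (clip 0 t _)) -/(b (clip 0 t (tm_a _))) -/(b (clip 0 s _)) -/(b (clip 0 s (tm_a _))).
    by rewrite !(clip_incr _ b)//; ring.
  ring.
apply: (@squeeze_cvgr _ _ _ _ (fun=> 0) (fun k => 2 * nrm2 P (fun x => sum_int 0 t (L k) x - M t x r ord0) +
   2 * nrm2 P (fun x => sum_int 0 s (L k) x - M s x r ord0))).
- apply: nearW => k; rewrite nrm2_ge0/=; under eq_fun do rewrite E.
  exact: nrm2B_le.
- exact: cvg_cst.
- rewrite -[X in _ --> X](_ : 2 * 0 + 2 * 0 = 0); last by rewrite mulr0 addr0.
  by apply: cvgD; apply: cvgMr; exact: LM.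
Qed.

End elementary_terms.

Lemma measurable_fun_pairD d d1 d2 (U : measurableType d) (T1 : measurableType d1) (T2 : measurableType d2)
  (D : set U) (f : U -> T1) (g : U -> T2) : measurable_fun D f -> measurable_fun D g ->
  measurable_fun D (fun x => (f x, g x)).
Proof.
move=> mf mg mD; move: (mD); apply: (measurability _ (measurable_prod_measurableType T1 T2)).
move=> _ [_ [A mA [B mB <-]] <-].
rewrite (_ : _ `&` _ = (D `&` f @^-1` A) `&` (D `&` g @^-1` B)); first by apply: measurableI; [exact: mf|exact: mg].
by apply/seteqP; split => x /=; tauto.
Qed.

Lemma measurable_to_g_sigma d (U : measurableType d) (V : pointedType) (S : set_system V) (D : set U) (w : U -> V) :
  measurable D -> (forall A, S A -> measurable (D `&` w @^-1` A)) ->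
  measurable_fun D (w : U -> g_sigma_algebraType S).
Proof.
move=> mD h; apply: (measurability _ (erefl : @measurable _ (g_sigma_algebraType S) = <<s S >>)).
by move=> _ [A SA <-]; exact: h.
Qed.

Lemma measurable_bm_path (R : realType) dO (Om : measurableType dO) (P : probability Om R) (d : nat) (T : R)
  (W : nat -> Om -> cpath d T) (hW : independent_brownian_motions P W) (j : nat) :
  measurable_fun setT (W j : Om -> g_sigma_algebraType (@canonical_history R d T T)).
Proof.
apply: measurable_to_g_sigma => // A [s sT [B mB <-]]; rewrite setTI.
have := measurable_bm hW j (t := s); rewrite setTI; move: sT; rewrite /= in_itv /= => sT /(_ sT) m.
by rewrite -[X in measurable X]setTI; exact: m.
Qed.

Lemma cpath_dist_refl (R : realType) d (T : R) (w : cpath d T) : 0 <= T -> cpath_dist w w = 0.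
Proof.
move=> T0; rewrite /cpath_dist (_ : [set _ | _ in _] = [set 0]) ?sup1//.
apply/seteqP; split => [_ [s _ <-]|_ ->]; first by rewrite /= subrr euclid0.
by exists 0; rewrite /= ?in_itv/= ?lexx// subrr euclid0.
Qed.

(** * Measurability and integrability of the drivers *)

Section coefficients.
Context (R : realType) (d m : nat) (T LF Lf : R).
Variables (F : R -> cpath d T -> 'cV[R]_m -> 'M[R]_(m, d) -> 'cV[R]_m -> 'cV[R]_m)
    (f : R -> 'cV[R]_m -> 'cV[R]_m -> 'M[R]_(m, d) -> 'cV[R]_m).
Hypotheses (T0 : 0 <= T) (LF0 : 0 <= LF) (Lf0 : 0 <= Lf).
Hypothesis hLip : Lip LF Lf F f.
Hypothesis hF : forall y z a, progressive (@canonical_history R d T) T (fun t (w : cpath d T) => F t w y z a).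
Hypothesis hf : forall y1 y2 z, measurable_fun `[0, T] (fun t => f t y1 y2 z).

Lemma F_lip (t : R) w y y' z z' a a' r : 0 <= t <= T ->
  `|F t w y z a r ord0 - F t w y' z' a' r ord0| <= LF * (euclid (y - y') + euclid (z - z') + euclid (a - a')).
Proof.
move=> tT; have [h _ _ _] := hLip tT; have := h w w y y' z z' a a'.
rewrite cpath_dist_refl// add0r => h'; apply: le_trans h'.
by have := coord_le_euclid (F t w y z a - F t w y' z' a') r ord0; rewrite !mxE.
Qed.

Lemma f_lip (t : R) y1 y1' y2 y2' z z' r : 0 <= t <= T ->
  `|f t y1 y2 z r ord0 - f t y1' y2' z' r ord0| <=
  Lf * (euclid (y1 - y1') + euclid (y2 - y2') + euclid (z - z')).
Proof.
move=> tT; have [_ _ h _] := hLip tT; apply: le_trans (h y1 y1' y2 y2' z z').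
by have := coord_le_euclid (f t y1 y2 z - f t y1' y2' z') r ord0; rewrite !mxE.
Qed.

Lemma subrrE p q (A : 'M[R]_(p, q)) : euclid (A - A) = 0.
Proof. by rewrite subrr euclid0. Qed.

(** [f] is Lipschitz in its three space variables and measurable in time, so the Caratheodory
    argument is applied once per space variable until only the time dependence is left. *)
Lemma measurable_f dU (U : measurableType dU) (D : set U) (tau : U -> R) y1 y2 z :
  (forall x, D x -> 0 <= tau x <= T) -> measurable_fun D tau ->
  measurable_fun D y1 -> measurable_fun D y2 -> measurable_fun D z ->
  measurable_fun D (fun x => f (tau x) (y1 x) (y2 x) (z x)).
Proof.
move=> tauT mtau my1 my2 mz; apply/measurable_fun_mxP => r c; rewrite (ord1 c).
apply: (@measurable_caratheodory _ _ _ _ _ _ (fun x v => f (tau x) v (y2 x) (z x) r ord0) y1 Lf) => //; last first.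
  move=> x v v' /tauT tT; apply: le_trans (f_lip _ _ _ _ _ _ _ tT) _.
  by rewrite !subrrE !addr0.
move=> v; apply: (@measurable_caratheodory _ _ _ _ _ _ (fun x v' => f (tau x) v v' (z x) r ord0) y2 Lf) => //; last first.
  move=> x v' v'' /tauT tT; apply: le_trans (f_lip _ _ _ _ _ _ _ tT) _.
  by rewrite !subrrE addr0 add0r.
move=> v'; apply: (@measurable_caratheodory _ _ _ _ _ _ (fun x v'' => f (tau x) v v' v'' r ord0) z Lf) => //; last first.
  move=> x z1 z2 /tauT tT; apply: le_trans (f_lip _ _ _ _ _ _ _ tT) _.
  by rewrite !subrrE !add0r.
move=> v''; have /measurable_fun_mxP/(_ r ord0) mf := hf v v' v''.
apply: (measurable_comp _ _ mf mtau); first exact: measurable_itv.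
by move=> _ [x Dx <-]; rewrite /= in_itv; exact: tauT.
Qed.

Lemma measurable_F dU (U : measurableType dU) (D : set U) (tau : U -> R) (w : U -> cpath d T) y z a :
  (forall x, D x -> 0 <= tau x <= T) -> measurable_fun D tau ->
  measurable_fun D (w : U -> g_sigma_algebraType (@canonical_history R d T T)) ->
  measurable_fun D y -> measurable_fun D z -> measurable_fun D a ->
  measurable_fun D (fun x => F (tau x) (w x) (y x) (z x) (a x)).
Proof.
move=> tauT mtau mw my mz ma; apply/measurable_fun_mxP => r c; rewrite (ord1 c).
apply: (@measurable_caratheodory _ _ _ _ _ _ (fun x v => F (tau x) (w x) v (z x) (a x) r ord0) y LF) => //; last first.
  move=> x v v' /tauT tT; apply: le_trans (F_lip _ _ _ _ _ _ _ _ tT) _.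
  by rewrite !subrrE !addr0.
move=> v; apply: (@measurable_caratheodory _ _ _ _ _ _ (fun x v' => F (tau x) (w x) v v' (a x) r ord0) z LF) => //; last first.
  move=> x v' v'' /tauT tT; apply: le_trans (F_lip _ _ _ _ _ _ _ _ tT) _.
  by rewrite !subrrE addr0 add0r.
move=> v'; apply: (@measurable_caratheodory _ _ _ _ _ _ (fun x v'' => F (tau x) (w x) v v' v'' r ord0) a LF) => //; last first.
  move=> x z1 z2 /tauT tT; apply: le_trans (F_lip _ _ _ _ _ _ _ _ tT) _.
  by rewrite !subrrE !add0r.
move=> v''; have TT : 0 <= T <= T by rewrite T0 lexx.
have /measurable_fun_mxP/(_ r ord0) mF := hF v v' v'' TT.
have [mD|nD] := pselect (measurable D); last by move=> /nD.
have mp := measurable_fun_pairD mtau mw.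
apply: (measurable_comp _ _ mF mp); first by apply: measurableX => //; exact: measurable_itv.
by move=> _ [x Dx <-]; split => //=; rewrite in_itv/=; exact: tauT.
Qed.

End coefficients.

Section law_functional.
Context (R : realType) dO (Om : measurableType dO) (P : probability Om R) (d m : nat) (T LF Lf : R).
Variables (F : R -> cpath d T -> 'cV[R]_m -> 'M[R]_(m, d) -> 'cV[R]_m -> 'cV[R]_m)
    (f : R -> 'cV[R]_m -> 'cV[R]_m -> 'M[R]_(m, d) -> 'cV[R]_m).
Hypotheses (T0 : 0 <= T) (LF0 : 0 <= LF) (Lf0 : 0 <= Lf).
Hypothesis hLip : Lip LF Lf F f.
Hypothesis hf : forall y1 y2 z, measurable_fun `[0, T] (fun t => f t y1 y2 z).
Local Notation leb := (@lebesgue_measure R).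
Local Notation mu2 := (leb_prod P).

(** The integral against the law of [X], written on the underlying probability space, where the
    mean-square tools apply. *)
Definition law_functional (X : Om -> 'cV[R]_m) (u : R) (y : 'cV[R]_m) (z : 'M[R]_(m, d)) : 'cV[R]_m :=
  \col_r \int[P]_x f u y (X x) z r ord0.

Lemma measurable_f_snd (u : R) y z (X : Om -> 'cV[R]_m) r : 0 <= u <= T -> measurable_fun setT X ->
  measurable_fun setT (fun x => f u y (X x) z r ord0).
Proof.
move=> uT mX; apply: (measurable_fun_mxP _ _).1.
exact: (measurable_f hLip hf).
Qed.

Lemma law_intE (X : Om -> 'cV[R]_m) (u : R) y z : 0 <= u <= T -> measurable_fun setT X ->
  law_int P X (fun y' => f u y y' z) = law_functional X u y z.
Proof.
move=> uT mX; apply/matrixP => r c; rewrite !mxE.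
have mg : measurable_fun setT (fun y' : 'cV[R]_m => f u y y' z r ord0).
  apply: (measurable_fun_mxP _ _).1; apply: (measurable_f hLip hf) => //.
exact: (integral_law P mX mg).
Qed.

Lemma euclid_L2_integrable (X : Om -> 'cV[R]_m) : (forall r, L2 P (fun x => X x r ord0)) ->
  P.-integrable setT (EFin \o (fun x => \sum_r `|X x r ord0|)).
Proof.
move=> lX; apply: L2_integrable; apply: L2_sum => r; apply: (L2_dom _ (lX r)).
  by apply: measurableT_comp => //; exact: L2_measurable (lX r).
by move=> x; rewrite normr_id.
Qed.

Lemma f_integrable (u : R) y z (X : Om -> 'cV[R]_m) r : 0 <= u <= T -> (forall r, L2 P (fun x => X x r ord0)) ->
  P.-integrable setT (EFin \o (fun x => f u y (X x) z r ord0)).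
Proof.
move=> uT lX; have mX : measurable_fun setT X.
  by apply/measurable_fun_mxP => i j; rewrite (ord1 j); exact: L2_measurable (lX i).
apply: (@integrable_bound _ _ _ _ _ (fun x => Lf * (1 + euclid y + \sum_r `|X x r ord0| + euclid z))).
- exact: measurable_f_snd.
- have := euclid_L2_integrable lX => iX.
  have ic (k : R) : P.-integrable setT (EFin \o (fun=> k)) by exact: L2_integrable (L2_cst P k).
  have := integrable_scaleR Lf (integrable_addR (integrable_addR (ic (1 + euclid y)) iX) (ic (euclid z))).
  by [].
- move=> x; have [_ _ _ h] := hLip uT; apply: le_trans (coord_le_euclid _ _ _) (le_trans (h _ _ _) _).
  rewrite ler_wpM2l// lerD2r lerD2l; apply: le_trans (euclid_le_sum _) _.
  by apply: ler_sum => i _; rewrite big_ord1.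
Qed.

(** The two variables live on one probability space, so the distance of their laws is bounded by the
    mean distance of the variables themselves. *)
Lemma law_functional_lip (X X' : Om -> 'cV[R]_m) (u : R) y y' z z' r : 0 <= u <= T ->
  (forall r, L2 P (fun x => X x r ord0)) -> (forall r, L2 P (fun x => X' x r ord0)) ->
  `|law_functional X u y z r ord0 - law_functional X' u y' z' r ord0| <=
  Lf * (euclid (y - y') + \sum_k \int[P]_x `|X x k ord0 - X' x k ord0| + euclid (z - z')).
Proof.
move=> uT lX lX'; rewrite !mxE -RintegralB//; [|exact: f_integrable..].
have iB : P.-integrable setT (EFin \o (fun x => f u y (X x) z r ord0 - f u y' (X' x) z' r ord0)).
  have := integrableB measurableT (f_integrable y z r uT lX) (f_integrable y' z' r uT lX').
  by [].
apply: le_trans (le_normr_Rintegral measurableT iB) _.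
have ia k : P.-integrable setT (EFin \o (fun x => `|X x k ord0 - X' x k ord0|)).
  apply: L2_integrable; have lB := L2B (lX k) (lX' k); apply: (L2_dom _ lB) => [|x]; last by rewrite normr_id.
  by apply: measurableT_comp => //; exact: L2_measurable lB.
have is_ : P.-integrable setT (EFin \o (fun x => \sum_k `|X x k ord0 - X' x k ord0|)).
  rewrite (_ : _ \o _ = fun x => (\sum_k (`|X x k ord0 - X' x k ord0|)%:E)%E); last first.
    by apply/funext => x /=; rewrite sumEFin.
  by apply: integrable_sum => //; move=> k _; exact: ia.
have ic (k : R) : P.-integrable setT (EFin \o (fun=> k)) by exact: L2_integrable (L2_cst P k).
have iR : P.-integrable setT (EFin \o (fun x => Lf * (euclid (y - y') + \sum_k `|X x k ord0 - X' x k ord0| + euclid (z - z')))).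
  by have := integrable_scaleR Lf (integrable_addR (integrable_addR (ic (euclid (y - y'))) is_) (ic (euclid (z - z')))).
apply: le_trans (le_Rintegral measurableT _ iR _) _.
- by apply: (integrable_norm iB).
- move=> x _; apply: le_trans (f_lip hLip _ _ _ _ _ _ _ uT) _.
  rewrite ler_wpM2l// lerD2r lerD2l; apply: le_trans (euclid_le_sum _) _.
  by apply: ler_sum => i _; rewrite big_ord1 !mxE.
rewrite RintegralZl//; last exact: (integrable_addR (integrable_addR (ic (euclid (y - y'))) is_) (ic (euclid (z - z')))).
rewrite RintegralD//; last exact: (integrable_addR (ic (euclid (y - y'))) is_).
rewrite RintegralD// !Rintegral_cst//= probability_setT /= !mulr1.
rewrite ler_wpM2l// lerD2r lerD2l.
rewrite le_eqVlt; apply/orP; left; apply/eqP.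
have e (Y : Om -> R) : \int[P]_x Y x = ip P (fun=> 1) Y.
  by congr fine; apply: eq_integral => x _; rewrite mul1r.
rewrite e ip_sumr//; first by apply: eq_bigr => k _; rewrite -e.
- exact: L2_cst.
- move=> k; have lB := L2B (lX k) (lX' k); apply: (L2_dom _ lB) => [|x]; last by rewrite normr_id.
  by apply: measurableT_comp => //; exact: L2_measurable lB.
Qed.

End law_functional.

Section processes_L2.
Context (R : realType) dO (Om : measurableType dO) (P : probability Om R) (T : R).
Local Notation mu2 := (leb_prod P).
Local Notation D := (`]0%R, T]%classic `*` [set: Om] : set (measurableTypeR R * Om)).

Definition cutL2 p q (X : R -> Om -> 'M[R]_(p, q)) :=
  forall i j, L2 mu2 (cut 0 T (fun u x => X u x i j)).

Lemma measurable_D : measurable D.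
Proof. by apply: measurableX => //; exact: measurable_itv. Qed.

Lemma measurable_cut_D (X : R -> Om -> R) :
  measurable_fun setT (cut 0 T X : measurableTypeR R * Om -> R) <->
  measurable_fun D (fun p => X p.1 p.2).
Proof.
have E : cut 0 T X = (fun p => X p.1 p.2) \_ D.
  apply/funext => p; rewrite patchE /cut.
  case: ifPn => sp; first by rewrite ifT// inE /=; split => //; rewrite /= in_itv.
  rewrite ifF//; apply/negbTE; rewrite notin_setE /= => -[+ _]; rewrite in_itv /=.
  by rewrite (negbTE sp).
by rewrite E; split=> [|mX]; have := (measurable_restrictT (fun p : measurableTypeR R * Om => X p.1 p.2) measurable_D); case => h1 h2; [exact: h2|exact: h1].
Qed.

Lemma cutL2_measurable p q (X : R -> Om -> 'M[R]_(p, q)) : cutL2 X -> measurable_fun D (fun w => X w.1 w.2).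
Proof.
move=> lX; apply/measurable_fun_mxP => i j.
exact: ((measurable_cut_D (fun u x => X u x i j)).1 (L2_measurable (lX i j))).
Qed.

Lemma L2_normr d (U : measurableType d) (mu : {measure set U -> \bar R}) (X : U -> R) :
  L2 mu X -> L2 mu (fun x => `|X x|).
Proof.
move=> lX; apply: (L2_dom _ lX) => [|x]; last by rewrite normr_id.
by apply: measurableT_comp => //; exact: L2_measurable lX.
Qed.

Lemma cut_dom_L2 (X Y : R -> Om -> R) : measurable_fun D (fun p => X p.1 p.2) -> L2 mu2 (cut 0 T Y) ->
  (forall u x, 0 < u <= T -> `|X u x| <= `|Y u x|) -> L2 mu2 (cut 0 T X).
Proof.
move=> /measurable_cut_D mX lY XY; apply: (L2_dom mX lY) => p; rewrite /cut.
by case: ifP => [/XY|_]; rewrite ?normr0.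
Qed.

Lemma cut_cst_L2 (k : R) : L2 mu2 (cut 0 T (fun _ _ => k)).
Proof.
rewrite (_ : cut 0 T _ = fun p => k * (\1_(`]0, T]) p.1 * 1)); last first.
  by apply/funext => p; rewrite cutE mulr1 mulrC.
apply: L2Z; apply: L2P.
  apply: measurable_funM => //.
  by apply: (measurableT_comp _ measurable_fst); exact: measurable_indic.
have := prod_integrable (indic_itv_integrable 0 T) (L2_integrable (L2_cst P 1)).
congr (_.-integrable _ _); apply/funext => u /=.
by rewrite mulr1 indicE; case: (_ \in _); rewrite ?expr1n ?expr0n.
Qed.

Lemma cutD_L2 (X Y : R -> Om -> R) : L2 mu2 (cut 0 T X) -> L2 mu2 (cut 0 T Y) ->
  L2 mu2 (cut 0 T (fun u x => X u x + Y u x)).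
Proof.
move=> lX lY; rewrite (_ : cut _ _ _ = fun p => cut 0 T X p + cut 0 T Y p); first exact: L2D.
by apply/funext => p; rewrite /cut; case: ifP; rewrite ?addr0.
Qed.

Lemma cutZ_L2 (k : R) (X : R -> Om -> R) : L2 mu2 (cut 0 T X) -> L2 mu2 (cut 0 T (fun u x => k * X u x)).
Proof.
move=> lX; rewrite (_ : cut _ _ _ = fun p => k * cut 0 T X p); first exact: L2Z.
by apply/funext => p; rewrite /cut; case: ifP; rewrite ?mulr0.
Qed.

Lemma cut_sum_L2 (I : Type) (s : seq I) (X : I -> R -> Om -> R) : (forall i, L2 mu2 (cut 0 T (X i))) ->
  L2 mu2 (cut 0 T (fun u x => \sum_(i <- s) X i u x)).
Proof.
move=> lX; rewrite (_ : cut _ _ _ = fun p => \sum_(i <- s) cut 0 T (X i) p); first exact: L2_sum.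
by apply/funext => p; rewrite /cut; case: ifP => // _; rewrite big1.
Qed.

Lemma cut_normr_L2 (X : R -> Om -> R) : L2 mu2 (cut 0 T X) -> L2 mu2 (cut 0 T (fun u x => `|X u x|)).
Proof.
move=> lX; rewrite (_ : cut _ _ _ = fun p => `|cut 0 T X p|); first exact: L2_normr.
by apply/funext => p; rewrite /cut; case: ifP; rewrite ?normr0.
Qed.

Definition norm1 p q (A : 'M[R]_(p, q)) : R := \sum_i \sum_j `|A i j|.

Lemma cut_norm1_L2 p q (X : R -> Om -> 'M[R]_(p, q)) : cutL2 X -> L2 mu2 (cut 0 T (fun u x => norm1 (X u x))).
Proof.
move=> lX; apply: cut_sum_L2 => i; apply: cut_sum_L2 => j; exact: cut_normr_L2.
Qed.

Lemma cutL2B p q (X Y : R -> Om -> 'M[R]_(p, q)) : cutL2 X -> cutL2 Y -> cutL2 (fun u x => X u x - Y u x).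
Proof.
move=> lX lY i j; rewrite (_ : cut _ _ _ = fun p => cut 0 T (fun u x => X u x i j) p - cut 0 T (fun u x => Y u x i j) p).
  exact: L2B.
by apply/funext => w; rewrite /cut; case: ifP; rewrite ?subr0// !mxE.
Qed.

End processes_L2.

Section process_coefficients.
Context (R : realType) dO (Om : measurableType dO) (P : probability Om R) (d m : nat) (T LF Lf : R)
  (W : nat -> Om -> cpath d T).
Hypothesis hW : independent_brownian_motions P W.
Variables (F : R -> cpath d T -> 'cV[R]_m -> 'M[R]_(m, d) -> 'cV[R]_m -> 'cV[R]_m)
    (f : R -> 'cV[R]_m -> 'cV[R]_m -> 'M[R]_(m, d) -> 'cV[R]_m).
Hypotheses (T0 : 0 <= T) (LF0 : 0 <= LF) (Lf0 : 0 <= Lf).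
Hypothesis hLip : Lip LF Lf F f.
Hypothesis hF : forall y z a, progressive (@canonical_history R d T) T (fun t (w : cpath d T) => F t w y z a).
Hypothesis hf : forall y1 y2 z, measurable_fun `[0, T] (fun t => f t y1 y2 z).
Local Notation leb := (@lebesgue_measure R).
Local Notation mu2 := (leb_prod P).
Local Notation cutL2 := (@cutL2 R dO Om P T _ _).
Local Notation D := (`]0%R, T]%classic `*` [set: Om] : set (measurableTypeR R * Om)).

Let tauT (p : R * Om) : D p -> 0 <= p.1 <= T.
Proof. by move=> [/= + _]; rewrite in_itv /= => /andP[/ltW -> ->]. Qed.

Let mtau : measurable_fun D (fst : measurableTypeR R * Om -> R).
Proof. by apply: measurable_funTS; exact: measurable_fst. Qed.

Lemma f_process_L2 (Y1 Y2 : R -> Om -> 'cV[R]_m) (Z : R -> Om -> 'M[R]_(m, d)) :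
  cutL2 Y1 -> cutL2 Y2 -> cutL2 Z -> cutL2 (fun u x => f u (Y1 u x) (Y2 u x) (Z u x)).
Proof.
move=> l1 l2 lZ i j; rewrite (ord1 j) => {j}.
apply: (@cut_dom_L2 _ _ _ _ _ _ (fun u x => Lf * (1 + norm1 (Y1 u x) + norm1 (Y2 u x) + norm1 (Z u x)))).
- have mm := measurable_f hLip hf tauT mtau (cutL2_measurable l1) (cutL2_measurable l2) (cutL2_measurable lZ).
  exact: ((measurable_fun_mxP _ _).1 mm i ord0).
- apply: cutZ_L2; do !apply: cutD_L2; [exact: cut_cst_L2|exact: cut_norm1_L2..].
- move=> u x /andP[u0 uT]; have uu : 0 <= u <= T by rewrite ltW.
  apply: le_trans (ler_norm _); have [_ _ _ h] := hLip uu.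
  apply: le_trans (coord_le_euclid _ i ord0) _; apply: le_trans (h _ _ _) _.
  by rewrite ler_wpM2l// !lerD// euclid_le_sum.
Qed.

Lemma F_process_L2 (k : nat) (Y a : R -> Om -> 'cV[R]_m) (Z : R -> Om -> 'M[R]_(m, d)) :
  cutL2 Y -> cutL2 a -> cutL2 Z -> cutL2 (fun u x => F u (W k x) (Y u x) (Z u x) (a u x)).
Proof.
move=> lY la lZ i j; rewrite (ord1 j) => {j}.
apply: (@cut_dom_L2 _ _ _ _ _ _ (fun u x => LF * (1 + norm1 (Y u x) + norm1 (Z u x) + norm1 (a u x)))).
- have mw : measurable_fun D ((fun p => W k p.2) : measurableTypeR R * Om -> g_sigma_algebraType (@canonical_history R d T T)).
    by apply: measurable_funTS; apply: (measurableT_comp (measurable_bm_path hW k)); exact: measurable_snd.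
  have mm := measurable_F T0 hLip hF tauT mtau mw (cutL2_measurable lY) (cutL2_measurable lZ) (cutL2_measurable la).
  exact: ((measurable_fun_mxP _ _).1 mm i ord0).
- apply: cutZ_L2; do !apply: cutD_L2; [exact: cut_cst_L2|exact: cut_norm1_L2..].
- move=> u x /andP[u0 uT]; have uu : 0 <= u <= T by rewrite ltW.
  apply: le_trans (ler_norm _); have [_ h _ _] := hLip uu.
  apply: le_trans (coord_le_euclid _ i ord0) _; apply: le_trans (h _ _ _ _) _.
  by rewrite ler_wpM2l// !lerD// euclid_le_sum.
Qed.

Lemma normr_mean_le (X : Om -> R) : L2 P X -> \int[P]_x `|X x| <= 1 + nrm2 P X.
Proof.
move=> lX; rewrite nrm2E.
have i1 : P.-integrable setT (EFin \o (fun=> 1 : R)) by exact: L2_integrable (L2_cst P 1).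
have i2 := L2_sqr lX.
have -> : 1 + \int[P]_x (X x ^+ 2) = \int[P]_x (1 + X x ^+ 2).
  by rewrite RintegralD// Rintegral_cst//= probability_setT /= mulr1.
apply: le_Rintegral => //.
- exact: L2_integrable (L2_normr lX).
- exact: (integrable_addR i1 i2).
- move=> x _; have := sqr_ge0 (`|X x| - 1); rewrite sqrrB expr1n mulr1 real_normK ?num_real//.
  have := sqr_ge0 (X x); have := normr_ge0 (X x); lra.
Qed.

Definition moment_bounded (b : R) (X : R -> Om -> 'cV[R]_m) :=
  forall u : R, 0 <= u <= T -> forall r, L2 P (fun x => X u x r ord0) /\ nrm2 P (fun x => X u x r ord0) <= b.

(** For fixed [y] and [z], Fubini makes the mean measurable in time; two Caratheodory arguments
    insert [z] and [y]. Times are strictly positive because the window of [cut] is open at 0. *)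
Lemma measurable_law dU (U : measurableType dU) (E : set U) (tau : U -> R) y z (b : R) (X : R -> Om -> 'cV[R]_m) :
  moment_bounded b X -> cutL2 X ->
  (forall v, E v -> 0 < tau v <= T) -> measurable_fun E tau -> measurable_fun E y -> measurable_fun E z ->
  measurable_fun E (fun v => law_functional P f (X (tau v)) (tau v) (y v) (z v)).
Proof.
move=> bX lX Etau mt my mz; apply/measurable_fun_mxP => i j; rewrite (ord1 j) => {j}.
have lXu u r : 0 <= u <= T -> L2 P (fun x => X u x r ord0) by move=> uT; exact: (bX u uT r).1.
have vT' v : E v -> 0 <= tau v <= T by move=> /Etau/andP[/ltW -> ->].
have X0 u : \sum_k \int[P]_x `|X u x k ord0 - X u x k ord0| = 0.
  by rewrite big1// => k _; rewrite /Rintegral (eq_integral (fun=> 0%E)) ?integral0// => x _; rewrite subrr normr0.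
apply: (@measurable_caratheodory _ _ _ _ _ _ (fun v y' => law_functional P f (X (tau v)) (tau v) y' (z v) i ord0) y Lf) => //.
  move=> y'; apply: (@measurable_caratheodory _ _ _ _ _ _ (fun v z' => law_functional P f (X (tau v)) (tau v) y' z' i ord0) z Lf) => //.
    move=> z'.
    have lc : L2 mu2 (cut 0 T (fun u x => f u y' (X u x) z' i ord0)).
      apply: (@f_process_L2 (fun _ _ => y') X (fun _ _ => z')) => // k l; exact: cut_cst_L2.
    have mc := measurable_fubini_F (cut_integrable lc).
    have mg : measurable_fun E (fun v => fine (fubini_F P (EFin \o cut 0 T (fun u x => f u y' (X u x) z' i ord0)) (tau v))).
      by apply: measurableT_comp; [exact: fine_measurable|exact: (measurableT_comp mc)].
    apply: eq_measurable_fun mg => v; rewrite inE => Ev.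
    rewrite mxE /fubini_F /Rintegral; congr fine; apply: eq_integral => x _.
    by rewrite /cut /= Etau.
  move=> v v1 v2 /vT' vT; apply: le_trans (law_functional_lip Lf0 hLip hf _ _ _ _ _ vT _ _) _; [by move=> r; exact: lXu..|].
  by rewrite subrrE add0r X0 add0r.
move=> v v1 v2 /vT' vT; apply: le_trans (law_functional_lip Lf0 hLip hf _ _ _ _ _ vT _ _) _; [by move=> r; exact: lXu..|].
by rewrite subrrE addr0 X0 addr0.
Qed.

Lemma law_process_L2 (b : R) (X Y : R -> Om -> 'cV[R]_m) (Z : R -> Om -> 'M[R]_(m, d)) :
  moment_bounded b X -> cutL2 X -> cutL2 Y -> cutL2 Z ->
  cutL2 (fun u x => law_functional P f (X u) u (Y u x) (Z u x)).
Proof.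
move=> bX lX lY lZ i j; rewrite (ord1 j) => {j}.
have lXu u r : 0 <= u <= T -> L2 P (fun x => X u x r ord0) by move=> uT; exact: (bX u uT r).1.
apply: (@cut_dom_L2 _ _ _ _ _ _ (fun u x => Lf * (1 + m%:R * (1 + b) + norm1 (Y u x) + norm1 (Z u x)))).
- have tau0T (p : measurableTypeR R * Om) : D p -> 0 < p.1 <= T by move=> [+ _]; rewrite /= in_itv.
  apply: (measurable_fun_mxP _ _).1; exact: (measurable_law (tau := fst) bX lX tau0T (measurable_funTS measurable_fst) (cutL2_measurable lY) (cutL2_measurable lZ)).
- apply: cutZ_L2; do !apply: cutD_L2; [exact: cut_cst_L2|exact: cut_cst_L2|exact: cut_norm1_L2..].
- move=> u x /andP[u0 uT]; have uu : 0 <= u <= T by rewrite ltW.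
  apply: le_trans (ler_norm _); rewrite mxE.
  have if_ := f_integrable Lf0 hLip hf (Y u x) (Z u x) i uu (fun r => lXu u r uu).
  apply: le_trans (le_normr_Rintegral measurableT if_) _.
  have ic (k : R) : P.-integrable setT (EFin \o (fun=> k)) by exact: L2_integrable (L2_cst P k).
  have iX := euclid_L2_integrable (fun r => lXu u r uu).
  pose k := 1 + euclid (Y u x) + euclid (Z u x).
  apply: le_trans (le_Rintegral measurableT (integrable_norm if_) (integrable_scaleR Lf (integrable_addR (ic k) iX)) _) _.
    move=> x' _; have [_ _ _ h] := hLip uu.
    apply: le_trans (coord_le_euclid _ i ord0) _; apply: le_trans (h _ _ _) _.
    rewrite ler_wpM2l// /k; have : euclid (X u x') <= \sum_r `|X u x' r ord0|.
      by apply: le_trans (euclid_le_sum _) _; apply: ler_sum => r _; rewrite big_ord1.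
    lra.
  rewrite RintegralZl//; last exact: integrable_addR (ic k) iX.
  rewrite RintegralD// Rintegral_cst//= probability_setT /= mulr1 ler_wpM2l// /k.
  have : \int[P]_x' (\sum_r `|X u x' r ord0|) <= m%:R * (1 + b).
    have e (V : Om -> R) : \int[P]_x V x = ip P (fun=> 1) V.
      by congr fine; apply: eq_integral => x' _; rewrite mul1r.
    rewrite e ip_sumr//; [|exact: L2_cst|by move=> r; apply: L2_normr; exact: lXu].
    rewrite -[m in leRHS]card_ord -sumr_const mulr_suml; apply: ler_sum => r _.
    rewrite mul1r -e; apply: le_trans (normr_mean_le (lXu u r uu)) _.
    by rewrite lerD2l; exact: (bX u uu r).2.
  have := euclid_le_sum (Y u x); have := euclid_le_sum (Z u x).
  rewrite /norm1; lra.
Qed.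

End process_coefficients.

Section progressive_L2.
Context (R : realType) dO (Om : measurableType dO) (P : probability Om R) (d : nat) (T : R)
  (W : nat -> Om -> cpath d T).
Hypothesis hW : independent_brownian_motions P W.
Hypothesis T0 : 0 <= T.
Variable J : set nat.
Local Notation FJ := (completed_filtration P W J).
Local Notation leb := (@lebesgue_measure R).
Local Notation mu2 := (leb_prod P).

Lemma progressive_cut_measurable p q (X : R -> Om -> 'M[R]_(p, q)) i j : progressive FJ T X ->
  measurable_fun setT (cut 0 T (fun u x => X u x i j) : measurableTypeR R * Om -> R).
Proof.
move=> pX; apply: cut_measurable.
exact: ((measurable_fun_mxP _ _).1 (progressive_measurable hW T0 pX) i j).
Qed.

Lemma progressive_cutL2 p q (X : R -> Om -> 'M[R]_(p, q)) : progressive FJ T X -> (E2int P T X < +oo)%E ->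
  cutL2 P T X.
Proof.
move=> pX lX i j; have mX := progressive_cut_measurable i j pX.
by split => //; apply: le_lt_trans lX; exact: E2int_coord_le.
Qed.

Lemma progressive_coord_measurable p q (X : R -> Om -> 'M[R]_(p, q)) i j (t : R) : progressive FJ T X -> 0 <= t <= T ->
  measurable_fun setT (fun x => X t x i j).
Proof.
move=> pX tT; have mX := (measurable_fun_mxP _ _).1 (progressive_adapted pX tT) i j.
apply: measurable_fun_g_sigma mX; apply: (completed_filtration_measurable hW).
by case/andP: tT.
Qed.

(** The supremum over time inside the expectation dominates every fixed time, which turns it into
    one moment bound valid at all times. *)
Lemma E2sup_moment_bounded m (Y : R -> Om -> 'cV[R]_m) : progressive FJ T Y -> (E2sup P T Y < +oo)%E ->
  exists2 b : R, 0 <= b & moment_bounded P T b Y.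
Proof.
move=> pY lY; have s0 : (0 <= E2sup P T Y)%E.
  apply: integral_ge0 => x _; apply: (@le_trans _ _ ((euclid (Y 0 x)) ^+ 2)%:E); first by rewrite lee_fin sqr_ge0.
  by apply: ereal_sup_ubound; exists 0; rewrite //= in_itv /= lexx.
exists (fine (E2sup P T Y)); first exact: fine_ge0.
move=> u uT r; have mY := progressive_coord_measurable r ord0 pY uT.
have le1 : (\int[P]_x ((Y u x r ord0) ^+ 2)%:E <= E2sup P T Y)%E.
  apply: le_trans (E2_coord_le P (Y u) r ord0) _; apply: ge0_le_integral_nonmeasurable => x.
    by rewrite lee_fin sqr_ge0.
  by apply: ereal_sup_ubound; exists u.
have l2 : L2 P (fun x => Y u x r ord0) by split => //; exact: le_lt_trans le1 lY.
split => //; rewrite -lee_fin nrm2_EFin// fineK//.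
by rewrite ge0_fin_numE.
Qed.

Lemma moment_bounded_cutL2 m (b : R) (Y : R -> Om -> 'cV[R]_m) : progressive FJ T Y -> moment_bounded P T b Y ->
  cutL2 P T Y.
Proof.
move=> pY bY i j; rewrite (ord1 j) => {j}; have mY := progressive_cut_measurable i ord0 pY; split => //.
have m2 := sqr_EFin_measurable mY; have p0 := sqr_EFin_ge0 (cut 0 T (fun u x => Y u x i ord0)).
rewrite (@fubini_tonelli1 _ _ _ _ _ leb P _ m2 p0).
apply: (@le_lt_trans _ _ (\int[leb]_u (b * (\1_(`]0%R, T]) u : R))%:E)%E).
  apply: ge0_le_integral_nonmeasurable => u.
    by apply: integral_ge0 => x _; rewrite lee_fin sqr_ge0.
  rewrite /fubini_F indicE mem_setE in_itv /= /cut /=; case: (boolP (0 < u <= T)) => [/andP[u0 uT]|_].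
    have uu : 0 <= u <= T by rewrite ltW.
    by have [l n] := bY u uu i; rewrite mulr1 -nrm2_EFin// lee_fin.
  under eq_integral do rewrite expr0n /=.
  by rewrite integral0 mulr0.
under eq_integral do rewrite EFinM.
have iI := indic_itv_integrable 0 T.
rewrite integralZl// ltey_eq fin_numM//.
exact: integrable_fin_num iI.
Qed.

Lemma vint_tint m (Phi : R -> Om -> 'cV[R]_m) (t : R) r x : 0 <= t <= T -> cutL2 P T Phi ->
  vint `[t, T] (fun u => Phi u x) r ord0 = tint t T (fun u x => Phi u x r ord0) x.
Proof.
move=> /andP[t0 tT] lPhi; rewrite mxE.
have mc := L2_measurable (cut_L2 t0 (lexx T) (lPhi r ord0)).
have ms := cut_slice_measurable x mc.
rewrite /tint /Rintegral -integral_itv_obnd_cbnd; last exact/measurable_EFinP.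
congr fine; rewrite [LHS]integral_mkcond; apply: eq_integral => u _.
by rewrite patchE mem_setE in_itv /cut /=; case: ifP.
Qed.

Lemma eq_vint m (D : set R) (g g' : R -> 'cV[R]_m) : (forall u, D u -> g u = g' u) -> vint D g = vint D g'.
Proof.
move=> gg; apply/matrixP => i j; rewrite !mxE; apply: eq_Rintegral => u; rewrite inE => /gg ->//.
Qed.

End progressive_L2.

Section solutions.
Context (R : realType) dO (Om : measurableType dO) (P : probability Om R) (d m : nat) (T LF Lf : R)
  (W : nat -> Om -> cpath d T).
Hypothesis hW : independent_brownian_motions P W.
Variables (G : cpath d T -> 'cV[R]_m)
    (F : R -> cpath d T -> 'cV[R]_m -> 'M[R]_(m, d) -> 'cV[R]_m -> 'cV[R]_m)
    (f : R -> 'cV[R]_m -> 'cV[R]_m -> 'M[R]_(m, d) -> 'cV[R]_m).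
Hypotheses (T0 : 0 <= T) (LF0 : 0 <= LF) (Lf0 : 0 <= Lf).
Hypothesis hLip : Lip LF Lf F f.
Hypothesis hF : forall y z a, progressive (@canonical_history R d T) T (fun t (w : cpath d T) => F t w y z a).
Hypothesis hf : forall y1 y2 z, measurable_fun `[0, T] (fun t => f t y1 y2 z).
Local Notation leb := (@lebesgue_measure R).
Local Notation mu2 := (leb_prod P).

Definition mkv_driver (k : nat) (Y : R -> Om -> 'cV[R]_m) (Z : R -> Om -> 'M[R]_(m, d)) u x :=
  F u (W k x) (Y u x) (Z u x) (law_functional P f (Y u) u (Y u x) (Z u x)).

(* A solution driven by [W k] alone, seen in the filtration of [W 0, .., W N.-1]. *)
Definition one_column N (k : nat) (Z : R -> Om -> 'M[R]_(m, d)) (r : 'I_m) (c : 'I_N * 'I_d) u x : R :=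
  if val c.1 == k then Z u x r c.2 else 0.

Lemma mkv_driver_L2 (b : R) k Y Z : moment_bounded P T b Y -> cutL2 P T Y -> cutL2 P T Z ->
  cutL2 P T (mkv_driver k Y Z).
Proof.
move=> bY lY lZ; apply: (F_process_L2 hW T0 LF0 hLip hF) => //.
exact: (law_process_L2 Lf0 hLip hf bY).
Qed.

Lemma one_column_L2 N k Z r c : cutL2 P T Z -> L2 mu2 (cut 0 T (@one_column N k Z r c)).
Proof.
move=> lZ; rewrite /one_column; case: eqP => _; first exact: lZ.
by rewrite cut0; exact: L2_0.
Qed.

Record mkv_system (k N : nat) (b : R) (Y : R -> Om -> 'cV[R]_m) (Z : R -> Om -> 'M[R]_(m, d)) : Prop := MkvSystem {
  mkv_moment : moment_bounded P T b Y ;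
  mkv_Y_L2 : cutL2 P T Y ;
  mkv_Z_L2 : cutL2 P T Z ;
  mkv_lin_eq : forall r, lin_eq P W (fun u x => Y u x r ord0)
     (fun u x => mkv_driver k Y Z u x r ord0) (@one_column N k Z r) }.

(** The equation is required almost surely for each pair of times, instead of almost surely for all
    times at once. For a fixed pair it is a property of the path that can be transferred to another
    motion. *)
Definition mkv_increments (k : nat) (Y : R -> Om -> 'cV[R]_m) (Z : R -> Om -> 'M[R]_(m, d)) (M : R -> Om -> 'cV[R]_m) :=
  forall (s t : R) r, 0 <= s -> s <= t -> t <= T -> {ae P, forall x, Y s x r ord0 + (M t x r ord0 - M s x r ord0) =
    Y t x r ord0 + tint s t (fun u x => mkv_driver k Y Z u x r ord0) x}.

Lemma mkv_system_intro k N b Y Z M : (k < N)%N ->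
  (forall t : R, 0 <= t <= T -> measurable_fun setT (Y t : g_sigma_algebraType (FN P W N t) -> _)) ->
  moment_bounded P T b Y -> cutL2 P T Y -> cutL2 P T Z ->
  ito_limit P (completed_filtration P W [set k]) T Z (fun t x => W k x t : 'cV[R]_d) M ->
  mkv_increments k Y Z M -> mkv_system k N b Y Z.
Proof.
move=> kN mY bY lY lZ hM E; have lD := mkv_driver_L2 k bY lY lZ.
pose j := Ordinal kN.
have JN : [set k] `<=` `I_N by move=> _ ->.
have hM' : ito_limit P (completed_filtration P W [set k]) T Z (fun t x => W j x t : 'cV[R]_d) M by exact: hM.
have lM r t : 0 <= t <= T -> L2 P (fun x => M t x r ord0).
  by move=> tT; have [_ [_ [lM _]]] := ito_terms hW JN hM' r; exact: lM.
split => // r; split.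
- by move=> t tT; exact: ((measurable_fun_mxP _ _).1 (mY t tT) r ord0).
- by exists b => t tT; exact: bY.
- by split => // c; exact: one_column_L2.
move=> s t s0 st tT; exists (fun x => M t x r ord0 - M s x r ord0); split.
- by apply: L2B; apply: lM; rewrite ?(le_trans s0 st) ?s0 ?(le_trans st tT).
- exact: (ito_stoch_int hW JN hM' r).
- exact: E.
Qed.

Lemma mkv_solution_increments k Y Z : solves_mckean_vlasov P W G F f k Y Z -> exists M,
  [/\ adapted (completed_filtration P W [set k]) T M,
      ito_limit P (completed_filtration P W [set k]) T Z (fun t x => W k x t : 'cV[R]_d) M
    & mkv_increments k Y Z M].
Proof.
move=> [pY sY pZ iZ [M [hM E]]]; have [b b0 bY] := E2sup_moment_bounded hW T0 pY sY.
have lY := moment_bounded_cutL2 hW T0 pY bY; have lZ := progressive_cutL2 hW T0 pZ iZ.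
have lD := mkv_driver_L2 k bY lY lZ.
have JN : [set k] `<=` `I_k.+1 by move=> _ -> /=.
exists M; split; first by case: hM.
  exact: (is_ito_integral_limit hW JN (j := ord_max) hM (fun r q => L2_measurable (lZ r q))).
move=> s t r s0 st tT.
have t0 : 0 <= t <= T by rewrite (le_trans s0 st).
have sT : 0 <= s <= T by rewrite s0 (le_trans st tT).
have {}E : {ae P, forall x, forall t : R, 0 <= t <= T ->
    Y t x r ord0 = G (W k x) r ord0 + tint t T (fun u x => mkv_driver k Y Z u x r ord0) x - (M T x r ord0 - M t x r ord0)}.
  apply: filterS E => x E u uT; rewrite E//.
  rewrite (@eq_vint _ _ _ _ (fun u => mkv_driver k Y Z u x)); last first.
    move=> v; rewrite /= in_itv /= => /andP[uv vT].
    have vv : 0 <= v <= T by rewrite vT andbT; apply: le_trans uv; case/andP: uT.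
    rewrite /mkv_driver (law_intE P hLip hf)//.
    by apply/measurable_fun_mxP => i q; exact: progressive_coord_measurable pY vv.
  by rewrite !mxE -(vint_tint _ _ uT lD) !mxE.
have := tint_cat st tT (cut_L2 s0 (lexx T) (lD r ord0)); move: E; apply: filterS2 => x E e.
rewrite (E s sT) (E t t0) e; ring.
Qed.

Lemma mkv_solution_system k Y Z : solves_mckean_vlasov P W G F f k Y Z ->
  exists2 b : R, 0 <= b & forall N, (k < N)%N -> mkv_system k N b Y Z.
Proof.
move=> S; have [M [_ hM E]] := mkv_solution_increments S; have [pY sY pZ iZ _] := S.
have [b b0 bY] := E2sup_moment_bounded hW T0 pY sY.
exists b => // N kN; apply: mkv_system_intro hM E => //.
- move=> t tT; apply: (measurable_FJ_FN (J := [set k])) => [_ ->//|]; exact: progressive_adapted.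
- exact: (moment_bounded_cutL2 hW T0 pY bY).
- exact: (progressive_cutL2 hW T0 pZ iZ).
Qed.

Lemma mkv_terminal k Y Z : solves_mckean_vlasov P W G F f k Y Z ->
  {ae P, forall x, Y T x = G (W k x)}.
Proof.
move=> [pY sY pZ iZ [M [hM E]]]; have [b b0 bY] := E2sup_moment_bounded hW T0 pY sY.
apply: filterS E => x /(_ T); rewrite T0 lexx => /(_ isT) ->.
rewrite subrr subr0 [X in _ + X](_ : _ = 0) ?addr0//.
apply/matrixP => i j; rewrite !mxE set_itv1 /Rintegral.
by rewrite integral_set1.
Qed.

Definition system_driver (n : nat) (Y : nat -> R -> Om -> 'cV[R]_m) (Z : nat -> nat -> R -> Om -> 'M[R]_(m, d)) i u x :=
  F u (W i x) (Y i u x) (Z i i u x)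
    (n%:R^-1 *: \sum_(j < n) f u (Y i u x) (Y j u x) (Z i i u x)).

Lemma cutL2_mean n (X : 'I_n -> R -> Om -> 'cV[R]_m) : (forall j, cutL2 P T (X j)) ->
  cutL2 P T (fun u x => n%:R^-1 *: \sum_(j < n) X j u x).
Proof.
move=> lX r c; rewrite (_ : (fun u x => _) = fun u x => n%:R^-1 * \sum_(j < n) X j u x r c).
  by apply: cutZ_L2; apply: cut_sum_L2 => j; exact: lX.
by apply/funext => u; apply/funext => x; rewrite mxE summxE.
Qed.

Lemma system_L2 n Y Z : solves_system P W G F f n Y Z -> forall i, (i < n)%N ->
  (exists b : R, moment_bounded P T b (Y i)) /\ cutL2 P T (Y i) /\ forall j, (j < n)%N -> cutL2 P T (Z i j).
Proof.
move=> S i iN; have [pY sY pZ _] := S i iN; have [b b0 bY] := E2sup_moment_bounded hW T0 pY sY.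
split; [by exists b|split; first exact: (moment_bounded_cutL2 hW T0 pY bY)].
by move=> j jn; have [pZj iZj] := pZ j jn; exact: (progressive_cutL2 hW T0 pZj iZj).
Qed.

Lemma system_driver_L2 n Y Z i : solves_system P W G F f n Y Z -> (i < n)%N -> cutL2 P T (system_driver n Y Z i).
Proof.
move=> S iN; have [_ [lY lZ]] := system_L2 S iN.
apply: (F_process_L2 hW T0 LF0 hLip hF) => //; last exact: lZ.
apply: cutL2_mean => j; apply: (f_process_L2 Lf0 hLip hf) => //; last exact: lZ.
by have [_ [lYj _]] := system_L2 S (ltn_ord j).
Qed.

Lemma system_lin_eq n Y Z i r : solves_system P W G F f n Y Z -> (i < n)%N ->
  lin_eq P W (fun u x => Y i u x r ord0) (fun u x => system_driver n Y Z i u x r ord0)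
    (fun (c : 'I_n * 'I_d) u x => Z i c.1 u x r c.2).
Proof.
move=> S iN; have [[b bY] [lY lZ]] := system_L2 S iN; have lD := system_driver_L2 S iN.
have [pY sY pZ [M [hM E]]] := S i iN.
have JN : `I_n `<=` `I_n by [].
have cZ (j : 'I_n) p q := L2_measurable (lZ j (ltn_ord j) p q).
have hM' (j : 'I_n) : ito_limit P (completed_filtration P W `I_n) T (Z i j) (fun t x => W j x t : 'cV[R]_d) (M j).
  exact: (is_ito_integral_limit hW JN (j := j) (hM j (ltn_ord j)) (cZ j)).
have lM (j : 'I_n) t : 0 <= t <= T -> L2 P (fun x => M j t x r ord0).
  by move=> tT; have [_ [_ [lM _]]] := ito_terms hW JN (hM' j) r; exact: lM.
pose Ms t x := \sum_(j < n) M j t x r ord0.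
apply: (@lin_eq_intro _ _ _ _ _ _ _ n (fun u x => Y i u x r ord0) (fun u x => system_driver n Y Z i u x r ord0)
  (fun c u x => Z i c.1 u x r c.2) Ms (fun x => G (W i x) r ord0) b) => //.
- by move=> t tT; exact: ((measurable_fun_mxP _ _).1 (progressive_adapted pY tT) r ord0).
- by move=> t tT; exact: bY.
- by move=> c; apply: lZ; exact: ltn_ord.
- by move=> t tT; apply: L2_sum => j; exact: lM.
- move=> s t s0 st tT.
  rewrite (_ : (fun x => _) = fun x => \sum_(j < n) (M j t x r ord0 - M j s x r ord0)); last first.
    by apply/funext => x; rewrite /Ms sumrB.
  rewrite (_ : (fun c u x => _) = fun c u x => \sum_(j < n) (if c.1 == j then Z i j u x r c.2 else 0)); last first.
    apply/funext => c; apply/funext => u; apply/funext => x.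
    rewrite (bigD1 c.1)//= eqxx big1 ?addr0// => j jc.
    by rewrite eq_sym (negbTE jc).
  have t0 := le_trans s0 st; have sT := le_trans st tT.
  apply: (stoch_int_sum hW) => //.
  + by move=> j; apply: L2B; apply: lM; rewrite ?s0 ?t0.
  + move=> j c; case: eqP => _; last by rewrite cut0; exact: L2_0.
    exact: cut_L2 s0 tT (lZ j (ltn_ord j) r c.2).
  + by move=> j; exact: (ito_stoch_int hW JN (hM' j) r).
apply: filterS E => x E t tT; rewrite E//.
rewrite -/(system_driver n Y Z i _ x) !mxE summxE -(vint_tint _ _ tT lD) !mxE.
congr (_ - _); rewrite /Ms -sumrB; apply: eq_bigr => j _.
by rewrite !mxE.
Qed.

Lemma system_terminal n Y Z i : solves_system P W G F f n Y Z -> (i < n)%N ->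
  {ae P, forall x, Y i T x = G (W i x)}.
Proof.
move=> S iN; have [pY sY pZ [M [hM E]]] := S i iN.
apply: filterS E => x /(_ T); rewrite T0 lexx => /(_ isT) ->.
rewrite big1 ?subr0; last by move=> j _; rewrite subrr.
rewrite [X in _ + X](_ : _ = 0) ?addr0//.
apply/matrixP => k l; rewrite !mxE set_itv1 /Rintegral.
by rewrite integral_set1.
Qed.

End solutions.

(** Lagrange's identity: four times the sum of the squares exceeds the square of the sum by the
    squared differences of all pairs. *)
Lemma sqr_sum4_le (R : realType) (a b c e x L : R) : `|x| <= L * (a + b + c + e) ->
  x ^+ 2 <= 4 * L ^+ 2 * (a ^+ 2 + b ^+ 2 + c ^+ 2 + e ^+ 2).
Proof.
move=> h; apply: (@le_trans _ _ ((L * (a + b + c + e)) ^+ 2)).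
  rewrite -real_normK ?num_real// lerXn2r// nnegrE//.
  exact: le_trans (normr_ge0 x) h.
rewrite exprMn (mulrC 4) -(mulrA (L ^+ 2)) ler_wpM2l ?sqr_ge0//.
have h1 := sqr_ge0 (a - b); have h2 := sqr_ge0 (a - c); have h3 := sqr_ge0 (a - e).
have h4 := sqr_ge0 (b - c); have h5 := sqr_ge0 (b - e); have h6 := sqr_ge0 (c - e).
rewrite -subr_ge0.
suff -> : 4 * (a ^+ 2 + b ^+ 2 + c ^+ 2 + e ^+ 2) - (a + b + c + e) ^+ 2 =
  (a - b) ^+ 2 + (a - c) ^+ 2 + (a - e) ^+ 2 + (b - c) ^+ 2 + (b - e) ^+ 2 + (c - e) ^+ 2.
  by rewrite !addr_ge0.
ring.
Qed.

Lemma ler_sum_card (R : numDomainType) n (a : 'I_n -> R) (c : R) : (forall i, a i <= c) -> \sum_i a i <= n%:R * c.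
Proof.
move=> ac; apply: (@le_trans _ _ (\sum_(i < n) c)); first by apply: ler_sum => i _.
by rewrite sumr_const card_ord mulr_natl.
Qed.

(** * Coupling of McKean-Vlasov equations *)

Section integrated_bounds.
Context (R : realType) d (U : measurableType d) (mu : {measure set U -> \bar R}).

Lemma nrm2_le_Rintegral (X g : U -> R) : L2 mu X -> mu.-integrable setT (EFin \o g) ->
  (forall x, X x ^+ 2 <= g x) -> nrm2 mu X <= \int[mu]_x g x.
Proof. by move=> lX ig Xg; rewrite nrm2E; apply: le_Rintegral => //; exact: L2_sqr. Qed.

Definition nrmM p q (X : U -> 'M[R]_(p, q)) := \sum_i \sum_j nrm2 mu (fun x => X x i j).

Lemma euclid_sqr_integrable p q (X : U -> 'M[R]_(p, q)) : (forall i j, L2 mu (fun x => X x i j)) ->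
  mu.-integrable setT (EFin \o (fun x => euclid (X x) ^+ 2)).
Proof.
move=> lX; rewrite (_ : _ \o _ = fun x => (\sum_i \sum_j ((X x i j) ^+ 2)%:E)%E); last first.
  by apply/funext => x /=; rewrite euclid_sqr -sumEFin; apply: eq_bigr => i _; rewrite -sumEFin.
apply: integrable_sum => // i _; apply: integrable_sum => // j _; exact: (L2_sqr (lX i j)).
Qed.

Lemma euclid_sqr_Rintegral p q (X : U -> 'M[R]_(p, q)) : (forall i j, L2 mu (fun x => X x i j)) ->
  \int[mu]_x (euclid (X x) ^+ 2) = nrmM X.
Proof.
move=> lX; rewrite /Rintegral.
rewrite (eq_integral (fun x => (\sum_i \sum_j ((X x i j) ^+ 2)%:E)%E)); last first.
  by move=> x _; rewrite euclid_sqr -sumEFin; apply: eq_bigr => i _; rewrite -sumEFin.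
rewrite integral_sum//; last first.
  by move=> i; apply: integrable_sum => // j _; exact: (L2_sqr (lX i j)).
rewrite /nrmM (eq_bigr (fun i => (\sum_j nrm2 mu (fun x => X x i j))%:E)); first by rewrite sumEFin.
move=> i _; rewrite integral_sum//; last by move=> j; exact: (L2_sqr (lX i j)).
by rewrite -sumEFin; apply: eq_bigr => j _; rewrite nrm2_EFin.
Qed.

Lemma Rintegral_lin4 (L : R) (g1 g2 g3 g4 : U -> R) :
  mu.-integrable setT (EFin \o g1) -> mu.-integrable setT (EFin \o g2) ->
  mu.-integrable setT (EFin \o g3) -> mu.-integrable setT (EFin \o g4) ->
  mu.-integrable setT (EFin \o (fun x => L * (g1 x + g2 x + g3 x + g4 x))) /\
  \int[mu]_x (L * (g1 x + g2 x + g3 x + g4 x)) =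
  L * (\int[mu]_x g1 x + \int[mu]_x g2 x + \int[mu]_x g3 x + \int[mu]_x g4 x).
Proof.
move=> i1 i2 i3 i4; have i12 := integrable_addR i1 i2; have i123 := integrable_addR i12 i3.
have i1234 := integrable_addR i123 i4.
split; first exact: integrable_scaleR.
by rewrite RintegralZl// RintegralD// RintegralD// RintegralD.
Qed.

Lemma nrm2_sum_card n (V : 'I_n -> U -> R) : (forall i, L2 mu (V i)) ->
  nrm2 mu (fun x => \sum_i V i x) <= n%:R * \sum_i nrm2 mu (V i).
Proof.
move=> lV; rewrite nrm2_sum//.
apply: (@le_trans _ _ (\sum_i \sum_j 2^-1 * (nrm2 mu (V i) + nrm2 mu (V j)))).
  apply: ler_sum => i _; apply: ler_sum => j _.
  have := ip_le ltr01 (lV i) (lV j); rewrite invr1 !mul1r.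
  by have := ler_norm (ip mu (V i) (V j)); lra.
set S := \sum_i nrm2 mu (V i).
rewrite (eq_bigr (fun i => 2^-1 * (n%:R * nrm2 mu (V i)) + 2^-1 * S)); last first.
  by move=> i _; rewrite -mulr_sumr big_split /= sumr_const card_ord mulr_natl mulrDr.
rewrite big_split /= -!mulr_sumr -/S sumr_const card_ord -[_ *+ n]mulr_natl.
by rewrite -/S; lra.
Qed.

End integrated_bounds.

Section time_bounds.
Context (R : realType) dO (Om : measurableType dO) (P : probability Om R) (T : R).
Local Notation leb := (@lebesgue_measure R).
Local Notation mu2 := (leb_prod P).

Definition cutM p q (s t : R) (X : R -> Om -> 'M[R]_(p, q)) (w : R * Om) : 'M[R]_(p, q) :=
  if (s < w.1) && (w.1 <= t) then X w.1 w.2 else 0.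

Lemma cutM_coord p q (s t : R) (X : R -> Om -> 'M[R]_(p, q)) i j :
  (fun w => cutM s t X w i j) = cut s t (fun u x => X u x i j).
Proof. by apply/funext => w; rewrite /cutM /cut; case: ifP; rewrite ?mxE. Qed.

Lemma cutM_nrmM p q (s t : R) (X : R -> Om -> 'M[R]_(p, q)) :
  nrmM mu2 (cutM s t X) = \sum_i \sum_j nrm2 mu2 (cut s t (fun u x => X u x i j)).
Proof. by apply: eq_bigr => i _; apply: eq_bigr => j _; rewrite cutM_coord. Qed.

Lemma cut_const_L2 (s t : R) (D0 : Om -> R) : L2 P D0 -> L2 mu2 (cut s t (fun _ => D0)).
Proof.
move=> lD; apply: L2P.
  rewrite (_ : cut _ _ _ = fun w => \1_(`]s, t]) w.1 * D0 w.2); last by apply/funext => w; rewrite cutE.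
  apply: measurable_funM; first by apply: (measurableT_comp _ measurable_fst); exact: measurable_indic.
  by apply: (measurableT_comp (L2_measurable lD)); exact: measurable_snd.
have := prod_integrable (indic_itv_integrable s t) (L2_sqr lD).
congr (_.-integrable _ _); apply/funext => w /=.
by rewrite cutE exprMn indicE; case: (_ \in _); rewrite ?expr1n ?expr0n.
Qed.

Lemma cut_const_nrm2 (s t : R) (D0 : Om -> R) : s <= t -> L2 P D0 -> nrm2 mu2 (cut s t (fun _ => D0)) = (t - s) * nrm2 P D0.
Proof.
move=> st lD; rewrite [in RHS]nrm2E -[X in X * _](_ : Num.max 0 (t - s) = _); last by rewrite max_r ?subr_ge0.
rewrite -indic_itv_Rintegral -(prod_Rintegral (indic_itv_integrable s t) (L2_sqr lD)).
rewrite nrm2E; congr fine; apply: eq_integral => w _; congr EFin.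
by rewrite cutE exprMn indicE; case: (_ \in _); rewrite ?expr1n ?expr0n.
Qed.

(** The distance of laws enters the driver as a deterministic function of time. Seen as a process
    constant in the sample, it is bounded by Jensen's inequality at each time. *)
Lemma mean_process_nrm2 (b : R) (X : R -> Om -> R) (s t : R) :
  (forall u : R, 0 <= u <= T -> L2 P (X u) /\ nrm2 P (X u) <= b) -> L2 mu2 (cut 0 T X) ->
  0 <= s -> s <= t -> t <= T ->
  L2 mu2 (cut 0 T (fun u _ => \int[P]_x `|X u x|)) /\
  nrm2 mu2 (cut s t (fun u _ => \int[P]_x `|X u x|)) <= nrm2 mu2 (cut s t X).
Proof.
move=> bX lX s0 st tT.
have lH : L2 mu2 (cut 0 T (fun u _ => \int[P]_x `|X u x|)).
  apply: (@cut_dom_L2 _ _ _ _ _ _ (fun _ _ => 1 + b)).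
  - have mc := measurable_fubini_F (cut_integrable (cut_normr_L2 lX)).
    have mg : measurable_fun (`]0%R, T]%classic `*` [set: Om] : set (measurableTypeR R * Om))
       (fun p => fine (fubini_F P (EFin \o cut 0 T (fun u x => `|X u x|)) p.1)).
      apply: measurable_funTS; apply: measurableT_comp; first exact: fine_measurable.
      by apply: (measurableT_comp mc); exact: measurable_fst.
    apply: eq_measurable_fun mg => p; rewrite inE => -[/= + _]; rewrite in_itv /= => pT.
    rewrite /fubini_F /Rintegral; congr fine; apply: eq_integral => x _.
    by rewrite /cut /= pT.
  - exact: cut_cst_L2.
  - move=> u x /andP[u0 uT]; have uu : 0 <= u <= T by rewrite ltW.
    have [lu nu] := bX u uu; apply: le_trans (ler_norm _).
    rewrite ger0_norm; last by apply: Rintegral_ge0 => // y _.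
    by apply: le_trans (normr_mean_le lu) _; rewrite lerD2l.
split => //; rewrite -lee_fin.
rewrite (cut_nrm2E st (cut_L2 s0 tT lH)) (cut_nrm2E st (cut_L2 s0 tT lX)).
rewrite integral_mkcond [leRHS]integral_mkcond.
apply: ge0_le_integral_nonmeasurable => u.
  by rewrite patchE; case: ifP => // _; apply: integral_ge0 => x _; rewrite lee_fin sqr_ge0.
rewrite !patchE mem_setE in_itv /=; case: ifP => // /andP[su ut].
have uu : 0 <= u <= T by rewrite (ltW (le_lt_trans s0 su)) (le_trans ut tT).
have [lu nu] := bX u uu.
rewrite integral_cst//= probability_setT mule1 -nrm2_EFin// lee_fin.
apply: le_trans (Rintegral_sqr_le (L2_normr lu)) _.
rewrite le_eqVlt; apply/orP; left; apply/eqP; rewrite !nrm2E; congr fine; apply: eq_integral => x _.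
by rewrite real_normK ?num_real.
Qed.

End time_bounds.

Section coupling.
Context (R : realType) dO (Om : measurableType dO) (P : probability Om R) (d m : nat) (T LF Lf : R)
  (W : nat -> Om -> cpath d T).
Hypothesis hW : independent_brownian_motions P W.
Variables (F : R -> cpath d T -> 'cV[R]_m -> 'M[R]_(m, d) -> 'cV[R]_m -> 'cV[R]_m)
    (f : R -> 'cV[R]_m -> 'cV[R]_m -> 'M[R]_(m, d) -> 'cV[R]_m).
Hypotheses (T0 : 0 <= T) (LF0 : 0 <= LF) (Lf0 : 0 <= Lf).
Hypothesis hLip : Lip LF Lf F f.
Hypothesis hF : forall y z a, progressive (@canonical_history R d T) T (fun t (w : cpath d T) => F t w y z a).
Hypothesis hf : forall y1 y2 z, measurable_fun `[0, T] (fun t => f t y1 y2 z).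
Local Notation mu2 := (leb_prod P).

(** For equal indices both integrands sit in the same column and the difference is exact. For
    distinct indices they occupy different columns, so both full norms appear on the right;
    [2 |a|^2 + 2 |b|^2] then bounds [|a - b|^2], whence the factor 2. *)
Lemma one_column_coupling N (k1 k2 : nat) (Z1 Z2 : R -> Om -> 'M[R]_(m, d)) r (s t : R) :
  (k1 < N)%N -> (k2 < N)%N -> 0 <= s -> t <= T -> cutL2 P T Z1 -> cutL2 P T Z2 ->
  \sum_q nrm2 mu2 (cut s t (fun u x => Z1 u x r q - Z2 u x r q)) <=
  2 * \sum_(c : 'I_N * 'I_d) nrm2 mu2 (cut s t (fun u x => one_column k1 Z1 r c u x - one_column k2 Z2 r c u x)).
Proof.
move=> k1N k2N s0 tT l1 l2.
have lc1 q : L2 mu2 (cut s t (fun u x => Z1 u x r q)) by exact: cut_L2 s0 tT (l1 r q).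
have lc2 q : L2 mu2 (cut s t (fun u x => Z2 u x r q)) by exact: cut_L2 s0 tT (l2 r q).
pose g (c : 'I_N * 'I_d) := nrm2 mu2 (cut s t (fun u x => one_column k1 Z1 r c u x - one_column k2 Z2 r c u x)).
have g0 c : 0 <= g c by exact: nrm2_ge0.
rewrite (_ : \sum_(c : 'I_N * 'I_d) _ = \sum_j \sum_q g (j, q)); last first.
  by rewrite pair_bigA; apply: eq_bigr => -[].
have [k12|k12] := eqVneq k1 k2.
  have g1 q : nrm2 mu2 (cut s t (fun u x => Z1 u x r q - Z2 u x r q)) = g (Ordinal k1N, q).
    by rewrite /g /one_column /= k12 eqxx.
  rewrite (bigD1 (Ordinal k1N))//= (eq_bigr _ (fun q _ => g1 q)).
  rewrite -[leLHS]mul1r mulrDr -[leLHS]addr0 lerD//.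
    by rewrite ler_wpM2r ?ler1n// sumr_ge0.
  by rewrite mulr_ge0// sumr_ge0// => j _; rewrite sumr_ge0.
rewrite (bigD1 (Ordinal k1N))//= (bigD1 (Ordinal k2N))/=; last first.
  by rewrite -val_eqE /= eq_sym.
have g1 q : g (Ordinal k1N, q) = nrm2 mu2 (cut s t (fun u x => Z1 u x r q)).
  rewrite /g /one_column /= eqxx (negbTE k12).
  by congr nrm2; apply/funext => w; rewrite /cut subr0.
have g2 q : g (Ordinal k2N, q) = nrm2 mu2 (cut s t (fun u x => Z2 u x r q)).
  rewrite /g /one_column /= eqxx eq_sym (negbTE k12).
  rewrite -(nrm2N (lc2 q)).
  by congr nrm2; apply/funext => w; rewrite /cut; case: ifP; rewrite ?oppr0 ?sub0r.
rewrite (eq_bigr _ (fun q _ => g1 q)) (eq_bigr _ (fun q _ => g2 q)).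
apply: (@le_trans _ _ (2 * (\sum_q nrm2 mu2 (cut s t (fun u x => Z1 u x r q)) + \sum_q nrm2 mu2 (cut s t (fun u x => Z2 u x r q))))).
  rewrite -big_split mulr_sumr /=; apply: ler_sum => q _; rewrite cutB mulrDr.
  exact: nrm2B_le.
rewrite ler_wpM2l// addrA lerDl sumr_ge0// => j _; exact: sumr_ge0.
Qed.

(** [LF (1 + m Lf)] is the Lipschitz constant of the driver after the Euclidean norm of the law term
    has been bounded by [m] coordinates. The 4 comes from squaring a sum of four terms, the outer
    [m] from adding the components of the driver. *)
Definition coupling_cst : R := 4 * m%:R * (LF * (1 + m%:R * Lf)) ^+ 2.

Lemma coupling_cst_ge0 : 0 <= coupling_cst.
Proof. by rewrite /coupling_cst mulr_ge0 ?sqr_ge0// mulr_ge0. Qed.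

Lemma driver_coupling_le k1 k2 (Y1 Y2 : R -> Om -> 'cV[R]_m) (Z1 Z2 : R -> Om -> 'M[R]_(m, d)) b1 b2 r (u : R) x (D0 : R) :
  0 <= u <= T -> cpath_dist (W k1 x) (W k2 x) <= D0 ->
  moment_bounded P T b1 Y1 -> moment_bounded P T b2 Y2 ->
  (mkv_driver P W F f k1 Y1 Z1 u x r ord0 - mkv_driver P W F f k2 Y2 Z2 u x r ord0) ^+ 2 <=
  4 * (LF * (1 + m%:R * Lf)) ^+ 2 * (D0 ^+ 2 + euclid (Y1 u x - Y2 u x) ^+ 2 + euclid (Z1 u x - Z2 u x) ^+ 2 +
    (\sum_k \int[P]_x' `|Y1 u x' k ord0 - Y2 u x' k ord0|) ^+ 2).
Proof.
move=> uT dD bY1 bY2; apply: sqr_sum4_le.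
have [h _ _ _] := hLip uT.
rewrite /mkv_driver; set a1 := law_functional _ _ _ _ _ _; set a2 := law_functional _ _ _ _ _ _.
set H := \sum_k _.
have aB k : `|a1 k ord0 - a2 k ord0| <= Lf * (euclid (Y1 u x - Y2 u x) + H + euclid (Z1 u x - Z2 u x)).
  apply: (law_functional_lip Lf0 hLip hf) => // k'; first exact: (bY1 u uT k').1.
  exact: (bY2 u uT k').1.
clearbody a1 a2.
have aE : euclid (a1 - a2) <= m%:R * (Lf * (euclid (Y1 u x - Y2 u x) + H + euclid (Z1 u x - Z2 u x))).
  apply: le_trans (euclid_le_sum _) _.
  by apply: ler_sum_card => k; rewrite big_ord1 !mxE; exact: aB.
have := coord_le_euclid (F u (W k1 x) (Y1 u x) (Z1 u x) a1 - F u (W k2 x) (Y2 u x) (Z2 u x) a2) r ord0.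
rewrite !mxE => /le_trans; apply; apply: le_trans (h _ _ _ _ _ _ _ _) _.
rewrite -mulrA ler_wpM2l//.
have H0 : 0 <= H by apply: sumr_ge0 => k _; apply: Rintegral_ge0.
have e1 := euclid_ge0 (Y1 u x - Y2 u x); have e2 := euclid_ge0 (Z1 u x - Z2 u x).
have D00 : 0 <= D0.
  apply: le_trans dD; rewrite /cpath_dist.
  have [hs|hs] := pselect (has_sup [set euclid (W k1 x s - W k2 x s) | s in `[0, T]]); last by rewrite sup_out.
  apply: le_trans (euclid_ge0 (W k1 x 0 - W k2 x 0)) _; apply: ub_le_sup; first by case: hs.
  by exists 0; rewrite //= in_itv /= lexx.
have mL : 0 <= m%:R * Lf by rewrite mulr_ge0.
apply: (@le_trans _ _ (D0 + euclid (Y1 u x - Y2 u x) + euclid (Z1 u x - Z2 u x) +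
  m%:R * Lf * (euclid (Y1 u x - Y2 u x) + H + euclid (Z1 u x - Z2 u x)))).
  by rewrite -mulrA; lra.
have := mulr_ge0 mL D00; lra.
Qed.

(* [k1 = k2] gives uniqueness; [k1 <> k2] bounds the distance between two copies
   without using any moment of [G]. *)
Lemma mkv_coupling N k1 k2 b1 b2 Y1 Y2 Z1 Z2 (D0 : Om -> R) : (k1 < N)%N -> (k2 < N)%N ->
  mkv_system P W F f k1 N b1 Y1 Z1 -> mkv_system P W F f k2 N b2 Y2 Z2 ->
  L2 P D0 -> (forall x, cpath_dist (W k1 x) (W k2 x) <= D0 x) ->
  forall t : R, 0 <= t <= T ->
  \sum_r nrm2 P (fun x => Y1 t x r ord0 - Y2 t x r ord0) <=
  gronwall_cst (coupling_cst * (m%:R + 2)) T *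
   (\sum_r nrm2 P (fun x => Y1 T x r ord0 - Y2 T x r ord0) + coupling_cst * nrm2 P D0).
Proof.
move=> k1N k2N [bY1 lY1 lZ1 E1] [bY2 lY2 lZ2 E2] lD dD t tT.
have c0 := coupling_cst_ge0.
(* [m + 2] dominates both coefficients found below: [1 + m] for the Y-part, where the [m] stems from
   the law term, and 2 for the Z-part, from [one_column_coupling]. *)
have K0 : 0 <= coupling_cst * (m%:R + 2) by rewrite mulr_ge0// addr_ge0.
have e0 : 0 <= coupling_cst * nrm2 P D0 by rewrite mulr_ge0// nrm2_ge0.
have EB r := lin_eqB hW (E1 r) (E2 r).
have := lin_eq_stability hW T0 K0 e0 EB.
move=> /(_ _ t tT) => st; apply: le_trans (st _); first rewrite lerDl.
  by apply: sumr_ge0 => r _; apply: sumr_ge0 => c _; exact: nrm2_ge0.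
move=> {t tT st} s t s0 st tT.
have lD1 := mkv_driver_L2 hW T0 LF0 Lf0 hLip hF hf k1 bY1 lY1 lZ1.
have lD2 := mkv_driver_L2 hW T0 LF0 Lf0 hLip hF hf k2 bY2 lY2 lZ2.
pose dY u x := Y1 u x - Y2 u x; pose dZ u x := Z1 u x - Z2 u x.
have ldY : cutL2 P T dY by exact: cutL2B.
have ldZ : cutL2 P T dZ by exact: cutL2B.
pose H k u (_ : Om) := \int[P]_x' `|Y1 u x' k ord0 - Y2 u x' k ord0|.
have lk k : L2 mu2 (cut 0 T (H k)) /\ nrm2 mu2 (cut s t (H k)) <= nrm2 mu2 (cut s t (fun u x => Y1 u x k ord0 - Y2 u x k ord0)).
  apply: (@mean_process_nrm2 _ _ _ P T (2 * b1 + 2 * b2) (fun u x => Y1 u x k ord0 - Y2 u x k ord0)) => //.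
    move=> u uT; have [l1 n1] := bY1 u uT k; have [l2 n2] := bY2 u uT k.
    by split; [exact: L2B|have := nrm2B_le l1 l2; lra].
  by rewrite cutB; apply: L2B; [exact: lY1|exact: lY2].
have cD0 : L2 mu2 (cut s t (fun _ => D0)) by exact: cut_const_L2.
have lY' i j : L2 mu2 (fun w => cutM s t dY w i j) by rewrite cutM_coord; exact: cut_L2 s0 tT (ldY i j).
have lZ' i j : L2 mu2 (fun w => cutM s t dZ w i j) by rewrite cutM_coord; exact: cut_L2 s0 tT (ldZ i j).
have lH : L2 mu2 (fun w => \sum_k cut s t (H k) w) by apply: L2_sum => k; exact: cut_L2 s0 tT (lk k).1.
pose L' := 4 * (LF * (1 + m%:R * Lf)) ^+ 2.
have L'0 : 0 <= L' by rewrite mulr_ge0// sqr_ge0.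
(* One pointwise majorant serves all components of the driver; integrating it converts each square
   into the norm of the corresponding process. *)
pose g w := L' * ((cut s t (fun _ => D0) w) ^+ 2 + euclid (cutM s t dY w) ^+ 2 + euclid (cutM s t dZ w) ^+ 2 + (\sum_k cut s t (H k) w) ^+ 2).
have i1 := L2_sqr cD0; have i2 := euclid_sqr_integrable lY'; have i3 := euclid_sqr_integrable lZ'; have i4 := L2_sqr lH.
have [i1234 gI0] := Rintegral_lin4 L' i1 i2 i3 i4.
have gI : \int[mu2]_w g w = L' * ((t - s) * nrm2 P D0 + nrmM mu2 (cutM s t dY) + nrmM mu2 (cutM s t dZ) + nrm2 mu2 (fun w => \sum_k cut s t (H k) w)).
  by rewrite -(cut_const_nrm2 st lD) -(euclid_sqr_Rintegral lY') -(euclid_sqr_Rintegral lZ') !nrm2E; exact: gI0.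
have row r : nrm2 mu2 (cut s t (fun u x => mkv_driver P W F f k1 Y1 Z1 u x r ord0 - mkv_driver P W F f k2 Y2 Z2 u x r ord0)) <= \int[mu2]_w g w.
  apply: nrm2_le_Rintegral.
  - by rewrite cutB; apply: L2B; [exact: cut_L2 s0 tT (lD1 r ord0)|exact: cut_L2 s0 tT (lD2 r ord0)].
  - exact: i1234.
  - move=> -[u x]; rewrite /g /cut /cutM /=; case: ifP => [/andP[su ut]|_]; last first.
      by rewrite expr0n /= mulr_ge0// !addr_ge0// ?sqr_ge0.
    have uT : 0 <= u <= T by rewrite (ltW (le_lt_trans s0 su)) (le_trans ut tT).
    exact: (@driver_coupling_le k1 k2 Y1 Y2 Z1 Z2 b1 b2 r u x (D0 x) uT (dD x) bY1 bY2).
apply: (@le_trans _ _ (\sum_(r < m) \int[mu2]_w g w)); first by apply: ler_sum => r _; exact: row.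
rewrite sumr_const card_ord -[_ *+ m]mulr_natl gI /L'.
have hY : nrmM mu2 (cutM s t dY) = \sum_k nrm2 mu2 (cut s t (fun u x => Y1 u x k ord0 - Y2 u x k ord0)).
  rewrite cutM_nrmM; apply: eq_bigr => k _; rewrite big_ord1; congr nrm2; apply/funext => w.
  by rewrite /cut /dY !mxE.
have hZ : nrmM mu2 (cutM s t dZ) <= 2 * \sum_r \sum_(c : 'I_N * 'I_d) nrm2 mu2 (cut s t (fun u x => one_column k1 Z1 r c u x - one_column k2 Z2 r c u x)).
  rewrite cutM_nrmM mulr_sumr; apply: ler_sum => r _.
  apply: le_trans (one_column_coupling r k1N k2N s0 tT lZ1 lZ2).
  rewrite le_eqVlt; apply/orP; left; apply/eqP; apply: eq_bigr => q _; congr nrm2; apply/funext => w.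
  by rewrite /cut /dZ !mxE.
have hH : nrm2 mu2 (fun w => \sum_k cut s t (H k) w) <= m%:R * \sum_k nrm2 mu2 (cut s t (fun u x => Y1 u x k ord0 - Y2 u x k ord0)).
  have lHk k : L2 mu2 (cut s t (H k)) by exact: cut_L2 s0 tT (lk k).1.
  apply: (@le_trans _ _ (m%:R * \sum_k nrm2 mu2 (cut s t (H k)))); last first.
    by rewrite ler_wpM2l//; apply: ler_sum => k _; exact: (lk k).2.
  exact: nrm2_sum_card.
set SY := \sum_k nrm2 _ _ in hY hH *; set SZ := \sum_r \sum_c _ in hZ *.
rewrite hY.
have SY0 : 0 <= SY by apply: sumr_ge0 => k _; exact: nrm2_ge0.
have SZ0 : 0 <= SZ by apply: sumr_ge0 => k _; apply: sumr_ge0 => c _; exact: nrm2_ge0.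
have -> : m%:R * (4 * (LF * (1 + m%:R * Lf)) ^+ 2 * ((t - s) * nrm2 P D0 + SY + nrmM mu2 (cutM s t dZ) + nrm2 mu2 (fun w => \sum_k cut s t (H k) w)))
  = coupling_cst * ((t - s) * nrm2 P D0 + SY + nrmM mu2 (cutM s t dZ) + nrm2 mu2 (fun w => \sum_k cut s t (H k) w)).
  by rewrite /coupling_cst; ring.
have -> : coupling_cst * (m%:R + 2) * (SY + SZ) + (t - s) * (coupling_cst * nrm2 P D0) =
  coupling_cst * ((t - s) * nrm2 P D0 + (m%:R + 2) * (SY + SZ)) by ring.
rewrite ler_wpM2l// -!addrA lerD2l.
have : 0 <= m%:R * SZ by rewrite mulr_ge0.
have : 0 <= (m%:R : R) by [].
rewrite mulrDl !mulrDr; move: hZ hH; lra.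
Qed.

End coupling.

(** * Doob's inequality and the supremum distance of two Brownian paths *)

Lemma cpath_coord_continuous (R : realType) d (T : R) (w : cpath d T) k :
  {within `[0, T], continuous (fun s => w s k ord0 : R)}.
Proof.
apply: (@within_continuous_comp _ _ _ `[0, T]%classic (cpath_fun w) (fun A : 'cV[R]_d => A k ord0)).
  by move=> A _; exact: coord_continuous.
exact: cpath_continuous.
Qed.

Lemma within_continuous_eps (R : realType) (T : R) (g : R -> R) (s e : R) : {within `[0, T], continuous g} ->
  0 <= s <= T -> 0 < e -> exists2 delta : R, 0 < delta & forall s' : R, 0 <= s' <= T -> `|s - s'| < delta -> `|g s - g s'| <= e.
Proof.
move=> /subspace_continuousP cg sT e0.
have /cvgrPdist_le/(_ e e0) := cg s sT.
rewrite near_withinE => /nbhs_ballP [delta d0 H]; exists delta => // s' s'T ss.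
by apply: (H s') => //=; rewrite in_itv.
Qed.

Section running_maximum.
Context (R : realType).

(** Starting from 0 keeps the one-sided maximum nonnegative. *)
Fixpoint running_max (S : nat -> R) n : R :=
  if n is n'.+1 then Num.max (running_max S n') (S n'.+1) else 0.

Lemma running_max_ge0 S n : 0 <= running_max S n.
Proof. by elim: n => //= n IH; rewrite le_max IH. Qed.

Lemma running_max_le (S : nat -> R) n (c : R) : 0 <= c -> (forall l, (0 < l <= n)%N -> S l <= c) -> running_max S n <= c.
Proof.
move=> c0; elim: n => //= n IH H; rewrite ge_max; apply/andP; split; last by apply: H; rewrite leqnn.
by apply: IH => l /andP[l0 ln]; apply: H; rewrite l0 leqW.
Qed.

Lemma running_max_ge S n l : (0 < l <= n)%N -> S l <= running_max S n.
Proof.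
elim: n l => [|n IH] l; first by rewrite leqn0; case: l.
move=> /andP[l0]; rewrite leq_eqVlt => /predU1P[->|ln]; first by rewrite /= le_max lexx orbT.
by rewrite /= le_max IH ?l0.
Qed.

(* Summation by parts, using that the maximum only increases when it is attained. *)
Lemma running_max_sqr S n : S 0%N = 0 ->
  2^-1 * running_max S n ^+ 2 <= running_max S n * S n - \sum_(k < n) running_max S k * (S k.+1 - S k).
Proof.
move=> S0; elim: n => [|n IH]; first by rewrite big_ord0 /= S0 expr0n /= !mulr0 subrr.
rewrite big_ord_recr /=; move: IH; set M := running_max S n; set Sg := \sum_(k < n) _.
case: (leP M (S n.+1)) => [MS|SM] IH.
  by have := sqr_ge0 (S n.+1 - M); rewrite sqrrB; lra.
lra.
Qed.

End running_maximum.

Section doob.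
Context (R : realType) dO (Om : measurableType dO) (P : probability Om R) (d : nat) (T : R)
  (W : nat -> Om -> cpath d T).
Hypothesis hW : independent_brownian_motions P W.
Hypothesis T0 : 0 < T.
Variable N : nat.
Local Notation C := ('I_N * 'I_d)%type.
Local Notation FF := (FN P W N).
Local Notation dB := (@bm_incr R dO Om d T W N).
Variables (c : C) (sg : R).
Hypothesis sg1 : sg ^+ 2 = 1.

(** The sign [sg] lets the one-sided maximal inequality be used for the motion and for its
    opposite. *)
Definition grid_walk (n : nat) (x : Om) (l : nat) : R := sg * dB c 0 (l%:R * T / n%:R) x.

Lemma grid_time n l : (0 < n)%N -> (l <= n)%N -> 0 <= l%:R * T / n%:R <= T.
Proof.
move=> n0 ln; have n0' : 0 < n%:R :> R by rewrite ltr0n.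
rewrite divr_ge0 ?mulr_ge0 ?(ltW T0)//= ler_pdivrMr// mulrC ler_wpM2l ?(ltW T0)//.
by rewrite ler_nat.
Qed.

Lemma running_max_walk n l : (0 < n)%N -> (l <= n)%N ->
  measurable_fun setT ((fun x => running_max (grid_walk n x) l) : g_sigma_algebraType (FF (l%:R * T / n%:R)) -> R) /\
  L2 P (fun x => running_max (grid_walk n x) l).
Proof.
move=> n0; elim: l => [|l IH] ln; first by split; [exact: measurable_cst|exact: L2_0].
have [mM lM] := IH (ltnW ln).
have n0' : 0 < n%:R :> R by rewrite ltr0n.
have ll : l%:R * T / n%:R <= l.+1%:R * T / n%:R.
  by rewrite ler_wpM2r ?invr_ge0 ?(ltW n0')// ler_wpM2r ?(ltW T0)// ler_nat.
have /andP[t0 tT] := grid_time n0 ln.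
have lS : L2 P (fun x => grid_walk n x l.+1) by apply: L2Z; exact: bm_incr_L2.
have mM' : measurable_fun setT ((fun x => running_max (grid_walk n x) l.+1) : g_sigma_algebraType (FF (l.+1%:R * T / n%:R)) -> R).
  rewrite /=; apply: measurable_maxr; first exact: measurable_FN mM.
  by apply: measurable_funM => //; apply: measurable_bm_incr_FN; rewrite ?lexx ?t0.
split => //.
apply: (L2_dom _ (L2D (L2_normr lM) (L2_normr lS))); first exact: (measurable_FN_dO hW tT mM').
move=> x; rewrite ger0_norm ?running_max_ge0//= [leRHS]ger0_norm ?addr_ge0//.
by rewrite ge_max; apply/andP; split; rewrite (le_trans (ler_norm _))// ?lerDl ?lerDr.
Qed.

(** Each increment is orthogonal to the maximum attained so far, so the mean of [running_max_sqr]
    reads: half the second moment of the maximum is at most its inner product with the endpoint.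
    Young's inequality with parameter 1/2 yields Doob's constant 4. *)
Lemma running_max_nrm2 n : (0 < n)%N -> nrm2 P (fun x => running_max (grid_walk n x) n) <= 4 * T.
Proof.
move=> n0; have n0' : 0 < n%:R :> R by rewrite ltr0n.
have lM l : (l <= n)%N -> L2 P (fun x => running_max (grid_walk n x) l) by move=> ln; exact: (running_max_walk n0 ln).2.
have lS l : (l <= n)%N -> L2 P (fun x => grid_walk n x l).
  by move=> ln; have /andP[? ?] := grid_time n0 ln; apply: L2Z; exact: bm_incr_L2.
have orth (l : nat) : (l < n)%N ->
    ip P (fun x => running_max (grid_walk n x) l) (fun x => grid_walk n x l.+1 - grid_walk n x l) = 0.
  move=> ln; have [mM _] := running_max_walk n0 (ltnW ln).
  have /andP[t0 _] := grid_time n0 (ltnW ln); have /andP[_ tT] := grid_time n0 ln.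
  have ll : l%:R * T / n%:R <= l.+1%:R * T / n%:R.
    by rewrite ler_wpM2r ?invr_ge0 ?(ltW n0')// ler_wpM2r ?(ltW T0)// ler_nat.
  rewrite (_ : (fun x => grid_walk n x l.+1 - _) = fun x => sg * dB c (l%:R * T / n%:R) (l.+1%:R * T / n%:R) x); last first.
    by apply/funext => x; rewrite /grid_walk /bm_incr; ring.
  rewrite ipZr; [|exact: lM (ltnW ln)|exact: bm_incr_L2].
  by rewrite (bm_incr_orth_FN hW c t0 ll tT mM) ?mulr0//; exact: lM (ltnW ln).
have lMn := lM n (leqnn n); have lSn := lS n (leqnn n).
have lD (k : 'I_n) : L2 P (fun x => grid_walk n x k.+1 - grid_walk n x k).
  by apply: L2B; apply: lS => //; exact: ltnW.
have iMD (k : 'I_n) : P.-integrable setT (EFin \o (fun x => running_max (grid_walk n x) k * (grid_walk n x k.+1 - grid_walk n x k))).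
  by apply: L2_mul_integrable => //; apply: lM; exact: ltnW.
have iMS := L2_mul_integrable lMn lSn.
have isum : P.-integrable setT (EFin \o (fun x => \sum_(k < n) running_max (grid_walk n x) k * (grid_walk n x k.+1 - grid_walk n x k))).
  rewrite (_ : _ \o _ = fun x => (\sum_(k < n) (running_max (grid_walk n x) k * (grid_walk n x k.+1 - grid_walk n x k))%:E)%E); last first.
    by apply/funext => x /=; rewrite sumEFin.
  by apply: integrable_sum => // k _; exact: iMD.
have sum0 : \int[P]_x (\sum_(k < n) running_max (grid_walk n x) k * (grid_walk n x k.+1 - grid_walk n x k)) = 0.
  rewrite /Rintegral (eq_integral (fun x => (\sum_(k < n) (running_max (grid_walk n x) k * (grid_walk n x k.+1 - grid_walk n x k))%:E)%E)); last first.
    by move=> x _; rewrite sumEFin.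
  rewrite integral_sum//.
  rewrite big1// => k _; rewrite -(fineK (integrable_fin_num measurableT (iMD k))).
  by congr EFin; exact: orth.
have h1 : 2^-1 * nrm2 P (fun x => running_max (grid_walk n x) n) <=
    ip P (fun x => running_max (grid_walk n x) n) (fun x => grid_walk n x n).
  rewrite nrm2E -RintegralZl//; last exact: L2_sqr.
  have -> : ip P (fun x => running_max (grid_walk n x) n) (fun x => grid_walk n x n) =
    \int[P]_x (running_max (grid_walk n x) n * grid_walk n x n - \sum_(k < n) running_max (grid_walk n x) k * (grid_walk n x k.+1 - grid_walk n x k)).
    by rewrite RintegralB// sum0 subr0.
  apply: le_Rintegral => //.
  - exact: integrable_scaleR (L2_sqr lMn).
  - exact: (integrableB measurableT iMS isum).
  - move=> x _; apply: running_max_sqr.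
    by rewrite /grid_walk mul0r mul0r bm_incr0 mulr0.
have nS : nrm2 P (fun x => grid_walk n x n) = T.
  rewrite nrm2Z; last first.
    by have /andP[? ?] := grid_time n0 (leqnn n); exact: bm_incr_L2.
  by rewrite sg1 mul1r mulrAC divff ?gt_eqF// mul1r bm_incr_nrm2// subr0.
have := ip_le (_ : 0 < 2^-1) lMn lSn; rewrite invr_gt0 ltr0n => /(_ isT).
rewrite nS invrK; have := ler_norm (ip P (fun x => running_max (grid_walk n x) n) (fun x => grid_walk n x n)).
lra.
Qed.

Let M (k : nat) (x : Om) := running_max (grid_walk (2 ^ k) x) (2 ^ k).

(** Dyadic grids are nested: point [l] of level [k] is point [2 l] of level [k.+1]. *)
Lemma dyadic_max_mono x : {homo M^~ x : k l / (k <= l)%N >-> k <= l}.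
Proof.
apply: homo_leq => [//|? ? ?|k]; first exact: le_trans.
apply: running_max_le => [|l /andP[l0 ln]]; first exact: running_max_ge0.
have -> : grid_walk (2 ^ k) x l = grid_walk (2 ^ k.+1) x (2 * l).
  rewrite /grid_walk; congr (_ * dB _ _ _ _); rewrite expnS !natrM invfM.
  have : (2 ^ k)%:R != 0 :> R by rewrite pnatr_eq0 expn_eq0.
  by move=> ?; field.
by apply: running_max_ge; rewrite muln_gt0 l0 /= expnS leq_mul2l ln orbT.
Qed.

Lemma walk_continuous x : {within `[0, T], continuous (fun s => sg * dB c 0 s x)}.
Proof.
apply: (@within_continuous_comp _ _ _ `[0, T]%classic (fun s => bm_coord W c s x) (fun b => sg * (b - bm_coord W c 0 x))).
  by move=> b _; apply: cvgMr; apply: cvgB; [exact: cvg_id|exact: cvg_cst].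
exact: cpath_coord_continuous.
Qed.

Lemma dyadic_max_bounded x : exists b : R, forall k, M k x <= b.
Proof.
have [s _ H] := EVT_max (ltW T0) (@walk_continuous x).
exists (Num.max 0 (sg * dB c 0 s x)) => k; apply: running_max_le => [|l /andP[_ ln]].
  by rewrite le_max lexx.
rewrite le_max; apply/orP; right; apply: H; rewrite in_itv /=.
by apply: grid_time => //; rewrite expn_gt0.
Qed.

(** [D0] is the increasing limit of the maxima over dyadic grids, so it is measurable and inherits
    their moment bound by monotone convergence. Path continuity extends the domination from grid
    points to all times. *)
Lemma brownian_sup_bound : exists D0 : Om -> R, [/\ L2 P D0, nrm2 P D0 <= 4 * T, forall x, 0 <= D0 x &
  forall x s, 0 <= s <= T -> sg * dB c 0 s x <= D0 x].
Proof.
pose D0 x := limn (M^~ x).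
have cM x : M^~ x @ \oo --> D0 x.
  apply: nondecreasing_is_cvgn; first by move=> k l; exact: dyadic_max_mono.
  by have [b Mb] := dyadic_max_bounded x; exists b => _ [k _ <-].
have n2 k : (0 < 2 ^ k)%N by rewrite expn_gt0.
have lM k : L2 P (M k) by exact: (running_max_walk (n2 k) (leqnn _)).2.
have mD : measurable_fun setT D0.
  apply: (@measurable_fun_cvg _ _ _ setT M) => [k|x _]; first exact: L2_measurable (lM k).
  exact: cM.
have MD k x : M k x <= D0 x.
  have nd : nondecreasing_seq (M^~ x) by move=> i j; exact: dyadic_max_mono.
  exact: (nondecreasing_cvgn_le nd (cM x) k).
have c2 x : (fun k => ((M k x) ^+ 2)%:E) @ \oo --> ((D0 x) ^+ 2)%:E.
  by apply: cvg_EFin; [exact: nearW|exact: (cvgM (cM x) (cM x))].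
have le1 : (\int[P]_x ((D0 x) ^+ 2)%:E <= (4 * T)%:E)%E.
  rewrite (eq_integral (fun x => limn (fun k => ((M k x) ^+ 2)%:E))); last first.
    by move=> x _; apply/esym/cvg_lim.
  rewrite monotone_convergence//.
  - apply: lime_le; last first.
      apply: nearW => k; rewrite -nrm2_EFin// lee_fin.
      exact: running_max_nrm2.
    apply: ereal_nondecreasing_is_cvgn => k l kl; apply: ge0_le_integral => //.
    + by move=> x _; rewrite lee_fin sqr_ge0.
    + by apply: sqr_EFin_measurable; exact: L2_measurable (lM k).
    + by apply: sqr_EFin_measurable; exact: L2_measurable (lM l).
    + by move=> x _; rewrite lee_fin lerXn2r ?nnegrE ?running_max_ge0// dyadic_max_mono.
  - by move=> k; apply: sqr_EFin_measurable; exact: L2_measurable (lM k).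
  - by move=> k x _; rewrite lee_fin sqr_ge0.
  - by move=> x _ k l kl; rewrite lee_fin lerXn2r ?nnegrE ?running_max_ge0// dyadic_max_mono.
have lD : L2 P D0 by split => //; apply: le_lt_trans le1 _; exact: ltry.
have D00 x : 0 <= D0 x by apply: le_trans (MD 0%N x); exact: running_max_ge0.
exists D0; split => //; first by rewrite -lee_fin nrm2_EFin.
move=> x s /andP[s0 sT]; apply/ler_addgt0Pr => e e0.
have sT' : 0 <= s <= T by rewrite s0.
have [dl dl0 H] := within_continuous_eps (@walk_continuous x) sT' e0.
(* [2 ^ k] exceeds [k], which exceeds [T / dl]; the mesh is therefore below the modulus [dl]. *)
pose k := (Num.trunc (T / dl)).+1.
have pk0 : 0 < (2 ^ k)%:R :> R by rewrite ltr0n.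
have kT : T / (2 ^ k)%:R < dl.
  rewrite ltr_pdivrMr// mulrC -ltr_pdivrMr//; apply: lt_trans (truncnS_gt _) _.
  by rewrite ltr_nat; exact: ltn_expl.
pose q := s * (2 ^ k)%:R / T; pose l := Num.trunc q.
have q0 : 0 <= q by rewrite divr_ge0 ?(ltW T0)// mulr_ge0// ltW.
have /andP[lq ql] := truncn_itv q0.
have l2 : (l <= 2 ^ k)%N.
  rewrite -(ler_nat R); apply: le_trans lq _.
  by rewrite /q ler_pdivrMr// mulrC ler_wpM2l// ltW.
have e1 : sg * dB c 0 (l%:R * T / (2 ^ k)%:R) x <= M k x.
  have [l0|l0] := posnP l.
    by rewrite l0 !mul0r bm_incr0 mulr0; exact: running_max_ge0.
  by apply: (@running_max_ge _ (grid_walk (2 ^ k) x)); rewrite l0.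
have sE : s = q * T / (2 ^ k)%:R.
  by rewrite /q; field; rewrite !gt_eqF// pnatr_eq0.
have ss : `|s - l%:R * T / (2 ^ k)%:R| < dl.
  apply: le_lt_trans (_ : _ <= T / (2 ^ k)%:R) kT; rewrite {1}sE -mulrBl -mulrBl !normrM (ger0_norm (ltW T0)) [X in _ * X]ger0_norm ?invr_ge0 ?(ltW pk0)//.
  rewrite ler_wpM2r ?invr_ge0 ?(ltW pk0)// ler_piMl ?(ltW T0)//.
  by rewrite ger0_norm ?subr_ge0// lerBlDr addrC natr1 ltW.
have := H _ (grid_time (n2 k) l2) ss; rewrite ler_norml => /andP[_ h].
have := MD k x; lra.
Qed.

End doob.

Section path_distance.
Context (R : realType) dO (Om : measurableType dO) (P : probability Om R) (d : nat) (T : R)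
  (W : nat -> Om -> cpath d T).
Hypothesis hW : independent_brownian_motions P W.
Hypothesis T0 : 0 < T.

Lemma bm_coord_sup_bound N (c : 'I_N * 'I_d) : exists D0 : Om -> R, [/\ L2 P D0, nrm2 P D0 <= 32 * T, forall x, 0 <= D0 x &
  forall x s, 0 <= s <= T -> `|bm_coord W c s x| <= D0 x].
Proof.
have sg1 : (1 : R) ^+ 2 = 1 by rewrite expr1n.
have sg2 : (-1 : R) ^+ 2 = 1 by rewrite sqrrN expr1n.
have [D1 [l1 n1 p1 b1]] := brownian_sup_bound hW T0 c sg1.
have [D2 [l2 n2 p2 b2]] := brownian_sup_bound hW T0 c sg2.
have TT : 0 <= (0 : R) <= T by rewrite lexx ltW.
have m0 := measurable_bm_coord hW c TT.
have [_ /= ae0 _ _] := bm_brownian hW c.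
have l0 : L2 P (bm_coord W c 0) by apply: (L2_ae m0 (L2_0 P)).
have n0 : nrm2 P (bm_coord W c 0) = 0.
  rewrite (nrm2_ae m0 _ ae0) ?nrm2E//.
  by rewrite /Rintegral (eq_integral (fun=> 0%E)) ?integral0// => x _; rewrite expr0n.
(* The motion starts at 0 only almost surely. Adding its absolute value at time 0 makes the
   domination hold everywhere and adds nothing to the second moment. *)
exists (fun x => (D1 x + D2 x) + `|bm_coord W c 0 x|); split.
- by apply: L2D; [exact: L2D|exact: L2_normr].
- have := nrm2D_le (L2D l1 l2) (L2_normr l0); have := nrm2D_le l1 l2.
  have -> : nrm2 P (fun x => `|bm_coord W c 0 x|) = nrm2 P (bm_coord W c 0).
    by rewrite !nrm2E; congr fine; apply: eq_integral => x _; rewrite real_normK ?num_real.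
  rewrite n0; lra.
- by move=> x; rewrite !addr_ge0.
- move=> x s sT; have := b1 x s sT; have := b2 x s sT; have := p1 x; have := p2 x.
  rewrite /bm_incr mul1r mulN1r => h1 h2 h3 h4.
  have := ler_norm (bm_coord W c 0 x); have := ler_norm (- bm_coord W c 0 x); rewrite normrN => h5 h6.
  by rewrite ler_norml; apply/andP; split; lra.
Qed.

Lemma path_distance_bound i j : exists D0 : Om -> R, [/\ L2 P D0, nrm2 P D0 <= 128 * d%:R ^+ 2 * T &
  forall x, cpath_dist (W i x) (W j x) <= D0 x].
Proof.
pose N := (maxn i j).+1.
have iN : (i < N)%N by rewrite ltnS leq_maxl.
have jN : (j < N)%N by rewrite ltnS leq_maxr.
have /choice[D1 H1] := fun k : 'I_d => bm_coord_sup_bound (Ordinal iN, k).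
have /choice[D2 H2] := fun k : 'I_d => bm_coord_sup_bound (Ordinal jN, k).
have l1 k : L2 P (D1 k) by case: (H1 k).
have l2 k : L2 P (D2 k) by case: (H2 k).
exists (fun x => \sum_k (D1 k x + D2 k x)); split.
- by apply: L2_sum => k; exact: L2D.
- apply: le_trans (nrm2_sum_card (fun k => L2D (l1 k) (l2 k))) _.
  (* Each coordinate contributes [2 (32 T) + 2 (32 T) = 128 T]; the square of a sum of [d] terms
     costs one factor [d], their number the other. *)
  rewrite (_ : 128 * d%:R ^+ 2 * T = d%:R * (d%:R * (128 * T))); last by ring.
  rewrite ler_wpM2l//; apply: ler_sum_card => k.
  have := nrm2D_le (l1 k) (l2 k); have [_ ? _ _] := H1 k; have [_ ? _ _] := H2 k; lra.
- move=> x; apply: ge_sup.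
    by exists (euclid (W i x 0 - W j x 0)), 0; rewrite //= in_itv /= lexx ltW.
  move=> _ [s /= + <-]; rewrite in_itv /= => sT.
  apply: le_trans (euclid_le_sum _) _; apply: ler_sum => k _.
  rewrite big_ord1 !mxE; apply: le_trans (ler_normB _ _) _; apply: lerD.
    by have [_ _ _ /(_ x s sT)] := H1 k.
  by have [_ _ _ /(_ x s sT)] := H2 k.
Qed.

End path_distance.

Lemma segment_uniform_continuity (R : realType) (T : R) (g : R -> R) (e : R) : {within `[0, T], continuous g} -> 0 < e ->
  exists2 delta : R, 0 < delta & forall s s' : R, 0 <= s <= T -> 0 <= s' <= T -> `|s - s'| < delta -> `|g s - g s'| <= e.
Proof.
move=> cg e0; have e2 : 0 < e / 2 by rewrite divr_gt0.
have := @segment_compact R 0 T; rewrite compact_near_coveringP.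
move=> /(_ R (0 : R)^'+
  (fun dl x => 0 <= x <= T -> forall s' : R, 0 <= s' <= T -> `|x - s'| < dl -> `|g x - g s'| <= e) _).
case.
  move=> x; rewrite /= in_itv /= => xT.
  have [eta eta0 H] := within_continuous_eps cg xT e2.
  have eta2 : 0 < eta / 2 by rewrite divr_gt0.
  near=> x' dl => /= x'T s' s'T ss.
  have h1 : `|x - x'| < eta / 2 by near: x'; exact: nbhsx_ballx.
  have h2 : dl < eta / 2 by near: dl; exact: nbhs_right_lt.
  have k1 : `|g x - g x'| <= e / 2 by apply: H => //; lra.
  have k2 : `|g x - g s'| <= e / 2.
    apply: H => //; rewrite -(subrKA x'); apply: le_lt_trans (ler_normD _ _) _; lra.
  rewrite -(subrKA (g x)); apply: le_trans (ler_normD _ _) _; rewrite [X in X + _]distrC; lra.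
move=> dl /= dl0 H; exists (dl / 2); first by rewrite divr_gt0.
move=> s s' sT s'T ss; apply: (H (dl / 2)) => //=.
  rewrite sub0r normrN ger0_norm ?divr_ge0 ?(ltW dl0)// ltr_pdivrMr// mulr_natr mulr2n ltrDl //.
by rewrite divr_gt0.
Unshelve. all: by end_near. Qed.

(** * Lipschitz functionals and the law of the path *)

Section linear_interpolation.
Context (R : realType).

Definition ramp (q : R) : R := Num.max 0 (Num.min 1 q).

Lemma ramp0 q : q <= 0 -> ramp q = 0.
Proof. by move=> q0; rewrite /ramp max_l// ge_min q0 orbT. Qed.

Lemma ramp1 q : 1 <= q -> ramp q = 1.
Proof. by move=> q1; rewrite /ramp min_l// max_r. Qed.

Lemma rampE q : 0 <= q <= 1 -> ramp q = q.
Proof. by move=> /andP[q0 q1]; rewrite /ramp min_r// max_r. Qed.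

Lemma ramp_itv q : 0 <= ramp q <= 1.
Proof. by rewrite /ramp le_max lexx /= ge_max ler01 ge_min lexx. Qed.

(** Piecewise linear interpolation of the values [a l] at the nodes [l]. As a sum of ramps it is
    visibly linear in [a] and continuous in [q], without locating [q] between two nodes. *)
Definition interpolate (a : nat -> R) n q := a 0%N + \sum_(l < n) ramp (q - l%:R) * (a l.+1 - a l).

(** Between two nodes the interpolation is a convex combination of the two adjacent values, both
    attached to nodes within distance 1 of [q]. *)
Lemma interpolate_close (a : nat -> R) n (q c e : R) : 0 <= q <= n%:R ->
  (forall l, (l <= n)%N -> `|q - l%:R| <= 1 -> `|a l - c| <= e) -> `|interpolate a n q - c| <= e.
Proof.
elim: n => [|n IH] /andP[q0 qn] H.
  by rewrite /interpolate big_ord0 addr0; apply: H => //; rewrite subr0 ger0_norm// (le_trans qn).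
have [qn'|nq] := orP (le_total q n%:R).
  have -> : interpolate a n.+1 q = interpolate a n q.
    by rewrite /interpolate big_ord_recr /= [ramp (q - n%:R)]ramp0 ?subr_le0// mul0r addr0.
  by apply: IH; [rewrite q0|move=> l ln; apply: H; exact: leqW].
have -> : interpolate a n.+1 q = a n + (q - n%:R) * (a n.+1 - a n).
  rewrite /interpolate big_ord_recr /= rampE; last first.
    by rewrite subr_ge0 nq /= lerBlDr addrC natr1.
  rewrite addrA; congr (_ + _).
  rewrite (eq_bigr (fun l : 'I_n => a l.+1 - a l)); last first.
    move=> l _; rewrite ramp1 ?mul1r// lerBrDr addrC natr1; apply: le_trans nq.
    by rewrite ler_nat.
  rewrite -(big_mkord xpredT (fun l => a l.+1 - a l)) telescope_sumr//.
  by rewrite addrC subrK.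
have qn1 : q <= n%:R + 1 by rewrite natr1.
have h1 : `|a n - c| <= e by apply: H => //; rewrite ger0_norm ?subr_ge0//; lra.
have h2 : `|a n.+1 - c| <= e.
  by apply: H => //; rewrite -natr1 ler_norml; apply/andP; split; lra.
move: h1 h2; rewrite !ler_norml => /andP[h1 h1'] /andP[h2 h2'].
have th0 : 0 <= q - n%:R by rewrite subr_ge0.
have th1 : 0 <= 1 - (q - n%:R) by lra.
have := mulr_ge0 th1 (_ : 0 <= a n - c + e); have := mulr_ge0 th0 (_ : 0 <= a n.+1 - c + e).
have := mulr_ge0 th1 (_ : 0 <= e - (a n - c)); have := mulr_ge0 th0 (_ : 0 <= e - (a n.+1 - c)).
move=> /(_ ltac:(lra)) g1 /(_ ltac:(lra)) g2 /(_ ltac:(lra)) g3 /(_ ltac:(lra)) g4.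
apply/andP; split; lra.
Qed.

Lemma interpolate_lip (a a' : nat -> R) n q :
  `|interpolate a n q - interpolate a' n q| <= 2 * \sum_(l < n.+1) `|a l - a' l|.
Proof.
set S := \sum_(l < n.+1) _.
have -> : interpolate a n q - interpolate a' n q = interpolate (fun l => a l - a' l) n q.
  rewrite /interpolate opprD addrACA -sumrB; congr (_ + _); apply: eq_bigr => l _; ring.
apply: le_trans (ler_normD _ _) _.
apply: (@le_trans _ _ (`|a 0%N - a' 0%N| + \sum_(l < n) (`|a l.+1 - a' l.+1| + `|a l - a' l|))).
  rewrite lerD2l; apply: le_trans (ler_norm_sum _ _ _) _; apply: ler_sum => l _.
  have /andP[r0 r1] := ramp_itv (q - l%:R).
  rewrite normrM (ger0_norm r0); apply: le_trans (ler_piMl _ r1) _ => //.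
  exact: ler_normB.
rewrite big_split /= addrA.
have -> : `|a 0%N - a' 0%N| + \sum_(l < n) `|a l.+1 - a' l.+1| = S by rewrite /S big_ord_recl.
by rewrite /S big_ord_recr /= -/S; have := normr_ge0 (a n - a' n); lra.
Qed.

Lemma ramp_continuous : continuous ramp.
Proof.
move=> q; apply: (@continuous_max R R (fun=> 0) (fun q => Num.min 1 q) q); first exact: cst_continuous.
by apply: (@continuous_min R R (fun=> 1) id q); [exact: cst_continuous|exact: cvg_id].
Qed.

End linear_interpolation.

Section functional_measurability.
Context (R : realType) (d m : nat) (T : R).
Hypothesis T0 : 0 < T.
Local Notation history_T := (@canonical_history R d T T).

Definition interpolated (n : nat) (V : 'M[R]_(d, n.+2)) (s : R) : 'cV[R]_d :=
  \col_k interpolate (fun l => V k (inord l)) n.+1 (s * n.+1%:R / T).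

Lemma interpolated_continuous n (V : 'M[R]_(d, n.+2)) : {within `[0, T], continuous (interpolated V)}.
Proof.
apply: continuous_subspaceT => s; apply/cvg_ballP => e e0.
have ck k : (fun s => interpolate (fun l => V k (inord l)) n.+1 (s * n.+1%:R / T)) @ s -->
    interpolate (fun l => V k (inord l)) n.+1 (s * n.+1%:R / T).
  apply: cvgD; first exact: cvg_cst.
  apply: cvg_big => [|l _]; first exact: add_continuous.
  apply: cvgMl; apply: (@cvg_comp _ _ _ (fun s : R => s * n.+1%:R / T - l%:R) (@ramp R) _ (nbhs (s * n.+1%:R / T - l%:R))); last exact: ramp_continuous.
  by apply: cvgB; [apply: cvgMl; apply: cvgMl; exact: cvg_id|exact: cvg_cst].
have : \forall t \near s, forall k : 'I_d, `|interpolate (fun l => V k (inord l)) n.+1 (s * n.+1%:R / T) -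
   interpolate (fun l => V k (inord l)) n.+1 (t * n.+1%:R / T)| < e.
  apply: (@filter_forall _ 'I_d _ (nbhs s)) => k; have /cvgrPdist_lt/(_ e e0) := ck k; exact.
apply: filterS => t H; split => // i j; rewrite !mxE /ball /=; exact: H.
Qed.

Definition interpolated_path n (V : 'M[R]_(d, n.+2)) : cpath d T := CPath (@interpolated_continuous n V).

Definition samples n (w : cpath d T) : 'M[R]_(d, n.+2) := \matrix_(k, l) w (l%:R * T / n.+1%:R) k ord0.

Lemma sample_time n (l : nat) : (l <= n.+1)%N -> 0 <= l%:R * T / n.+1%:R <= T.
Proof.
move=> ln; have n0' : 0 < n.+1%:R :> R by rewrite ltr0n.
rewrite divr_ge0 ?mulr_ge0 ?(ltW T0)//= ler_pdivrMr// mulrC ler_wpM2l ?(ltW T0)//.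
by rewrite ler_nat.
Qed.

Lemma cpath_dist_le (w w' : cpath d T) e : (forall s, 0 <= s <= T -> euclid (w s - w' s) <= e) -> cpath_dist w w' <= e.
Proof.
move=> H; apply: ge_sup; first by exists (euclid (w 0 - w' 0)), 0; rewrite //= in_itv /= lexx ltW.
by move=> _ [s /= + <-]; rewrite in_itv /=; exact: H.
Qed.

Lemma samples_measurable n : measurable_fun setT (samples n : g_sigma_algebraType history_T -> 'M[R]_(d, n.+2)).
Proof.
apply/measurable_fun_mxP => k l; rewrite (_ : (fun w => _) = (fun w : cpath d T => w (l%:R * T / n.+1%:R) k ord0)); last first.
  by apply/funext => w; rewrite mxE.
apply: (measurable_fun_mxP setT (fun w : g_sigma_algebraType history_T => (w : cpath d T) (l%:R * T / n.+1%:R) : 'cV[R]_d)).1.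
move=> _ B mB; apply: sub_sigma_algebra; exists (l%:R * T / n.+1%:R); last by exists B.
by rewrite /= in_itv /=; apply: sample_time; rewrite -ltnS.
Qed.

Lemma interpolated_samples_cvg (w : cpath d T) :
  (fun n => cpath_dist (interpolated_path (samples n w)) w) @ \oo --> (0 : R).
Proof.
apply/cvgrPdist_le => e e0.
have d0 : 0 < d.+1%:R :> R by rewrite ltr0n.
have e1 : 0 < e / d.+1%:R by rewrite divr_gt0.
have /choice[dl H] : forall k : 'I_d, exists dl : R, 0 < dl /\ forall s s' : R, 0 <= s <= T -> 0 <= s' <= T ->
    `|s - s'| < dl -> `|w s k ord0 - w s' k ord0| <= e / d.+1%:R.
  by move=> k; have [dl dl0 h] := segment_uniform_continuity (@cpath_coord_continuous _ _ _ w k) e1; exists dl.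
near=> n.
have n0' : 0 < n.+1%:R :> R by rewrite ltr0n.
have ndl' : forall k, T / dl k <= n%:R.
  by near: n; apply: (@filter_forall _ 'I_d _ (nbhs \oo)) => k; exact: nbhs_infty_ger.
have ndl k : T / n.+1%:R < dl k.
  rewrite ltr_pdivrMr// mulrC -ltr_pdivrMr; last by case: (H k).
  by apply: (le_lt_trans (ndl' k)); rewrite ltr_nat.
rewrite sub0r normrN.
have P0 : 0 <= cpath_dist (interpolated_path (samples n w)) w.
  rewrite /cpath_dist; set E := [set _ | _ in _].
  have [hs|hs] := pselect (has_sup E); last by rewrite sup_out.
  apply: le_trans (euclid_ge0 (interpolated_path (samples n w) 0 - w 0)) _; apply: ub_le_sup; first by case: hs.
  by exists 0; rewrite //= in_itv /= lexx ltW.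
rewrite ger0_norm//; apply: cpath_dist_le => s sT.
apply: le_trans (euclid_le_sum _) _.
apply: (@le_trans _ _ (d%:R * (e / d.+1%:R))); last first.
  by rewrite mulrA ler_pdivrMr// mulrC ler_wpM2l ?(ltW e0)// ler_nat.
apply: ler_sum_card => k; rewrite big_ord1 !mxE.
have [/andP[s0 sT'] [dl0 hk]] := (sT, H k).
apply: interpolate_close.
  by rewrite divr_ge0 ?mulr_ge0 ?(ltW T0)//= ler_pdivrMr// mulrC ler_wpM2l.
move=> l ln ql; rewrite mxE inordK ?ltnS// distrC; apply: hk => //; first exact: sample_time.
apply: le_lt_trans (_ : _ <= T / n.+1%:R) (ndl k).
have -> : s - l%:R * T / n.+1%:R = (s * n.+1%:R / T - l%:R) * (T / n.+1%:R).
  have pz : n.+1%:R != 0 :> R by rewrite pnatr_eq0.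
  have Tz : T != 0 by rewrite gt_eqF.
  by move: pz; move: (n.+1%:R : R) => p pz; field; rewrite Tz pz.
rewrite normrM [X in _ * X]ger0_norm ?divr_ge0 ?(ltW T0)// ler_piMl// divr_ge0// ltW//.
Unshelve. all: by end_near. Qed.

(* [G] is the limit of its values at the linear interpolations of finitely many
   samples of the path. *)
Lemma lipschitz_functional_measurable (G : cpath d T -> 'cV[R]_m) (LG : R) : 0 <= LG ->
  (forall w w', euclid (G w - G w') <= LG * cpath_dist w w') ->
  measurable_fun setT (G : g_sigma_algebraType history_T -> 'cV[R]_m).
Proof.
move=> LG0 GL; apply/measurable_fun_mxP => r c; rewrite (ord1 c) => {c}.
have Gr w w' : `|G w r ord0 - G w' r ord0| <= LG * cpath_dist w w'.
  apply: le_trans (GL w w'); have := coord_le_euclid (G w - G w') r ord0; by rewrite !mxE.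
apply: (@measurable_fun_cvg _ _ _ setT (fun n (w : g_sigma_algebraType history_T) => G (interpolated_path (samples n w)) r ord0)).
  move=> n; pose K := LG * (d%:R * (2 * n.+2%:R)).
  apply: (@measurable_caratheodory R d n.+2 _ (g_sigma_algebraType history_T) setT (fun _ V => G (interpolated_path V) r ord0) (samples n) K _ _ (@samples_measurable n)).
    by move=> V; exact: measurable_cst.
  move=> _ V V' _; apply: le_trans (Gr _ _) _; rewrite /K -mulrA ler_wpM2l//.
  apply: cpath_dist_le => s sT; apply: le_trans (euclid_le_sum _) _; rewrite -mulrA.
  apply: ler_sum_card => k; rewrite big_ord1 !mxE; apply: le_trans (interpolate_lip _ _ _ _) _.
  rewrite -mulrA ler_wpM2l//; apply: ler_sum_card => l.
  by have := coord_le_euclid (V - V') k (inord l); rewrite !mxE.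
move=> w _; apply/cvgrPdist_le => e e0.
have LG1 : 0 < LG + 1 by rewrite ltr_wpDl.
have /cvgrPdist_le/(_ (e / (LG + 1))) := interpolated_samples_cvg w; rewrite divr_gt0// => /(_ isT).
apply: filterS => n; rewrite sub0r normrN => h; rewrite distrC; apply: le_trans (Gr _ _) _.
have h' := le_trans (ler_norm _) h.
apply: le_trans (ler_wpM2l LG0 h') _; rewrite mulrA ler_pdivrMr// mulrC ler_wpM2l ?(ltW e0)//.
by rewrite lerDl.
Qed.

End functional_measurability.

(** * Markov property and finite-dimensional laws of Brownian motion *)

Section markov_property.
Context (R : realType).

Definition gauss_kernel (s : R) (g : R -> R) (b : R) : R := \int[@normal_prob R 0 s]_y g (b + y).

Lemma unit_integrable d (U : measurableType d) (mu : probability U R) (g : U -> R) : measurable_fun setT g ->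
  (forall y, 0 <= g y <= 1) -> mu.-integrable setT (EFin \o g).
Proof.
move=> mg g1; apply: (@bounded_integrable _ _ _ mu g 1) => // y.
by case/andP: (g1 y) => g0 ?; rewrite ger0_norm.
Qed.

Lemma unit_Rintegral d (U : measurableType d) (mu : probability U R) (g : U -> R) : measurable_fun setT g ->
  (forall y, 0 <= g y <= 1) -> 0 <= \int[mu]_y g y <= 1.
Proof.
move=> mg g1; rewrite Rintegral_ge0/=; last by move=> y _; case/andP: (g1 y).
apply: (@le_trans _ _ (\int[mu]_y (1 : R))).
  apply: le_Rintegral => //; first exact: unit_integrable.
    by apply: unit_integrable => // y; rewrite ler01 lexx.
  by move=> y _; case/andP: (g1 y).
by rewrite Rintegral_cst//= probability_setT /= mulr1.
Qed.

Lemma gauss_kernel_measurable (s : R) (g : R -> R) : measurable_fun setT g -> (forall y, 0 <= g y <= 1) ->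
  measurable_fun setT (gauss_kernel s g) /\ forall b, 0 <= gauss_kernel s g b <= 1.
Proof.
move=> mg g1; split; last first.
  move=> b; apply: unit_Rintegral => //; apply: (measurableT_comp mg).
  exact: measurable_funD.
have mk : measurable_fun setT (fun p : measurableTypeR R * measurableTypeR R => (g (p.1 + p.2))%:E).
  apply/measurable_EFinP; apply: (measurableT_comp mg); apply: measurable_funD; [exact: measurable_fst|exact: measurable_snd].
have k0 (p : measurableTypeR R * measurableTypeR R) : (0 <= (g (p.1 + p.2))%:E)%E.
  by rewrite lee_fin; case/andP: (g1 (p.1 + p.2)).
have := @measurable_fun_fubini_tonelli_F _ _ _ _ R (@normal_prob R 0 s) _ mk k0.
move=> h; apply: (measurableT_comp (@fine_measurable R setT measurableT)); exact: h.
Qed.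

Context dO (Om : measurableType dO) (P : probability Om R) (T : R).

(** The increment after [s] is Gaussian and independent of the history, so it can be integrated out
    for a frozen value of [B s]. All factors lie in [[0, 1]], which settles integrability. *)
Lemma brownian_markov (B : R -> Om -> R) (s t : R) (X : Om -> R) (g : R -> R) :
  brownian_coordinate P T B -> 0 <= s -> s < t -> t <= T ->
  measurable_fun setT (X : g_sigma_algebraType (history B s) -> R) -> (forall x, 0 <= X x <= 1) ->
  measurable_fun setT g -> (forall y, 0 <= g y <= 1) ->
  \int[P]_x (X x * g (B t x)) = \int[P]_x (X x * gauss_kernel (Num.sqrt (t - s)) g (B s x)).
Proof.
move=> [mB _ lawB indB] s0 st tT mX X1 mg g1.
have sT : s <= T by exact: ltW (lt_le_trans st tT).
have mBt : measurable_fun setT (B t) by apply: mB; rewrite tT (le_trans s0 (ltW st)).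
have mBs : measurable_fun setT (B s) by apply: mB; rewrite s0.
pose D x := B t x - B s x.
have mD : measurable_fun setT D by exact: measurable_funB.
have mh : history B s `<=` measurable.
  by apply: history_measurable => u /andP[u0 us]; apply: mB; rewrite u0 (le_trans us).
have mI : preimage_set_system setT (D : Om -> R) measurable `<=` measurable by move=> _ [A mA <-]; exact: mD.
have mBsh : measurable_fun setT (B s : g_sigma_algebraType (history B s) -> R).
  by move=> _ A mA; apply: sub_sigma_algebra; exists s; [rewrite /= in_itv /= s0 lexx|exists A].
have ind : independent P (history B s) (preimage_set_system setT (D : Om -> R) measurable) by exact: indB.
have mX' := measurable_fun_g_sigma mh mX.
rewrite (_ : (fun x => X x * g (B t x)) = fun x => X x * g (B s x + D x)); last first.
  by apply/funext => x; rewrite /D addrC subrK.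
rewrite (@indep_integral _ _ _ P _ _ mh mI ind (fun z => X z.1 * g (B s z.1 + D z.2))) /=.
- congr fine; apply: eq_integral => x _; congr EFin.
  have mgD : measurable_fun setT (fun y => g (B s x + y)).
    by apply: (measurableT_comp mg); exact: measurable_funD.
  rewrite RintegralZl//; last first.
    by apply: unit_integrable => //; apply: (measurableT_comp mgD).
  congr (_ * _); rewrite -(@integral_law _ _ _ (measurableTypeR R) _ P D mD (fun y => g (B s x + y)))//.
  congr fine; apply: eq_measure_integral => A mA _.
  exact: lawB.
- apply: measurable_funM; first by apply: measurableT_comp measurable_fst.
  apply: (measurableT_comp mg); apply: measurable_funD; first by apply: measurableT_comp measurable_fst.
  apply: (measurableT_comp _ measurable_snd); exact: preimage_set_system_measurable_fun.
- apply: unit_integrable.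
    by apply: measurable_funM => //; apply: (measurableT_comp mg); exact: measurable_funD.
  move=> x; case/andP: (X1 x) => X0 X1'; case/andP: (g1 (B s x + D x)) => g0 g1'.
  by rewrite mulr_ge0//= mulr_ile1.
Qed.

Lemma unit_prod (I : Type) (r : seq I) (a : I -> R) : (forall i, 0 <= a i <= 1) -> 0 <= \prod_(i <- r) a i <= 1.
Proof.
move=> a1; elim: r => [|i r IH]; first by rewrite big_nil ler01 lexx.
rewrite big_cons; case/andP: (a1 i) => ? ?; case/andP: IH => ? ?.
by rewrite mulr_ge0//= mulr_ile1.
Qed.

Lemma decreasing_path_itv (L : seq R) (s : R) : path (fun a b => b < a) s L -> last s L = 0 ->
  forall p, p \in s :: L -> 0 <= p <= s.
Proof.
elim: L s => [|a L IH] s /=; first by move=> _ -> p; rewrite inE => /eqP ->; rewrite lexx.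
move=> /andP[a_s pL] lL p.
have := IH a pL lL => H; have /andP[a0 _] := H a (mem_head _ _).
rewrite inE => /predU1P[->|/H /andP[p0 pa]]; first by rewrite lexx andbT ltW// (le_lt_trans a0).
by rewrite p0 (le_trans pa)// ltW.
Qed.

(* The latest time heads the list and is integrated out by the Markov property. *)
Lemma brownian_fdd (B B' : R -> Om -> R) : brownian_coordinate P T B -> brownian_coordinate P T B' ->
  forall (L : seq R) (t : R) (g : R -> R -> R), t <= T -> path (fun a b => b < a) t L -> last t L = 0 ->
  (forall p, measurable_fun setT (g p)) -> (forall p y, 0 <= g p y <= 1) ->
  \int[P]_x (\prod_(p <- t :: L) g p (B p x)) = \int[P]_x (\prod_(p <- t :: L) g p (B' p x)).
Proof.
move=> hB hB'; elim=> [|s L IH] t g tT /=.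
  move=> _ t0 mg g1; rewrite t0.
  (* The times end at 0, where every Brownian coordinate vanishes almost surely, so the integral no
     longer depends on the motion. *)
  have base (D : R -> Om -> R) : brownian_coordinate P T D -> \int[P]_x (\prod_(p <- [:: 0]) g p (D p x)) = g 0 0.
    move=> [mD D0 _ _]; have T0 : 0 <= T by rewrite -t0.
    have mD0 : measurable_fun setT (D 0) by apply: mD; rewrite lexx.
    rewrite (_ : g 0 0 = \int[P]_x g 0 0); last by rewrite Rintegral_cst//= probability_setT /= mulr1.
    congr fine; apply: ae_eq_integral => //.
    - by apply/measurable_EFinP; under eq_fun do rewrite big_seq1; exact: measurableT_comp.
    - by apply: filterS D0 => x e _; rewrite big_seq1 e.
  by rewrite !base.
move=> /andP[st pL] lL mg g1.
have L0 := decreasing_path_itv pL lL.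
have s0 : 0 <= s by have /andP[] := L0 s (mem_head _ _).
pose Q := gauss_kernel (Num.sqrt (t - s)) (g t).
have [mQ Q1] := gauss_kernel_measurable (Num.sqrt (t - s)) (mg t) (g1 t).
(* Integrating out the latest time [t] leaves its Gaussian average as an extra factor at the next
   time [s], and the list loses one entry. *)
pose g' p y := if p == s then g s y * Q y else g p y.
have sT : s <= T by exact: ltW (lt_le_trans st tT).
have sL : s \notin L.
  have trg : transitive (fun a b : R => b < a) by move=> a b c ab bc; exact: lt_trans bc ab.
  have := pL; rewrite path_sortedE// => /andP[/allP allL _].
  by apply/negP => /allL; rewrite ltxx.
have step (D : R -> Om -> R) : brownian_coordinate P T D ->
    \int[P]_x (\prod_(p <- t :: s :: L) g p (D p x)) = \int[P]_x (\prod_(p <- s :: L) g' p (D p x)).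
  move=> hD; have [mD _ _ _] := hD.
  rewrite (_ : (fun x => \prod_(p <- t :: s :: L) g p (D p x)) = fun x => (\prod_(p <- s :: L) g p (D p x)) * g t (D t x)); last first.
    by apply/funext => x; rewrite big_cons mulrC.
  rewrite (brownian_markov hD s0 st tT) //.
  - congr fine; apply: eq_integral => x _; congr EFin; rewrite !big_cons /g' eqxx -/Q.
    rewrite mulrAC; congr (_ * _); rewrite !big_seq; apply: eq_bigr => p pL'.
    by case: eqP => // ps; rewrite ps (negbTE sL) in pL'.
  - have mh p : p \in s :: L -> measurable_fun setT (D p : g_sigma_algebraType (history D s) -> R).
      by move=> /L0 ps _ A mA; apply: sub_sigma_algebra; exists p; [rewrite /= in_itv /= |exists A].
    by apply: measurable_prod => p pin; apply: (measurableT_comp (mg p)); exact: mh.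
  - by move=> x; apply: unit_prod.
rewrite (step _ hB) (step _ hB'); apply: IH => //.
- by move=> p; rewrite /g'; have [_|_] := eqVneq p s; [exact: measurable_funM|exact: mg].
- move=> p y; rewrite /g'; have [_|_] := eqVneq p s; last exact: g1.
  by case/andP: (g1 s y) => ? ?; case/andP: (Q1 y) => ? ?; rewrite mulr_ge0//= mulr_ile1.
Qed.

End markov_property.

Section path_laws.
Context (R : realType) dO (Om : measurableType dO) (P : probability Om R) (d : nat) (T : R)
  (W : nat -> Om -> cpath d T).
Hypothesis hW : independent_brownian_motions P W.
Hypothesis T0 : 0 <= T.
Local Notation history_T := (@canonical_history R d T T).

Definition cylinder (L : seq R) (B : R -> 'I_d -> set R) : set (cpath d T) :=
  [set w : cpath d T | forall p, p \in L -> forall k, B p k (w p k ord0)].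

Lemma brownian_cylinder_prob (X X' : R -> Om -> R) (L : seq R) (B : R -> set R) :
  brownian_coordinate P T X -> brownian_coordinate P T X' ->
  (forall p, p \in L -> 0 <= p <= T) -> (forall p, measurable (B p)) ->
  P [set x | forall p, p \in L -> B p (X p x)] = P [set x | forall p, p \in L -> B p (X' p x)].
Proof.
move=> hX hX' LT mB.
(* The times are put in strictly decreasing order, with 0 added as the last one; times outside [L]
   later receive the constant factor 1. *)
pose S0 := sort (<=%O : rel R) (undup (0 :: L)); pose L0 := rev S0.
have memL0 p : (p \in L0) = (p == 0) || (p \in L) by rewrite mem_rev mem_sort mem_undup inE.
have sS0 : sorted <%O S0.
  by rewrite lt_sorted_uniq_le sort_uniq undup_uniq /=; apply: sort_sorted => a b; exact: le_total.
have sL0 : sorted (fun a b : R => b < a) L0 by rewrite /L0 rev_sorted.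
have L0T p : p \in L0 -> 0 <= p <= T.
  by rewrite memL0 => /orP[/eqP ->|/LT//]; rewrite lexx.
pose g p y := if p \in L then \1_(B p) y else 1 : R.
have mg p : measurable_fun setT (g p).
  by rewrite /g; case: (p \in L); [exact: measurable_indic|exact: measurable_cst].
have g1 p y : 0 <= g p y <= 1.
  by rewrite /g; case: (p \in L); rewrite ?indicE ?ler01 ?lexx//; case: (y \in B p); rewrite ?ler01 ?lexx.
have E (D : R -> Om -> R) : brownian_coordinate P T D ->
    P [set x | forall p, p \in L -> B p (D p x)] = (\int[P]_x (\prod_(p <- L0) g p (D p x)))%:E.
  move=> [mD _ _ _]; set A := [set x | _].
  have mA : measurable A.
    rewrite (_ : A = \big[setI/setT]_(p <- L) (D p @^-1` (B p))).
      rewrite big_seq; apply: (big_ind (fun A => measurable A)) => //; first exact: measurableI.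
      by move=> p pL; rewrite -[X in measurable X]setTI; apply: mD => //; exact: LT.
    by rewrite -bigcap_seq.
  have -> : (fun x => \prod_(p <- L0) g p (D p x)) = \1_A.
    apply/funext => x; rewrite indicE; have [xA|xA] := pselect (A x).
      rewrite mem_set// big_seq big1// => p _; rewrite /g; case: ifP => // pL.
      by rewrite indicE mem_set//; exact: xA.
    rewrite memNset//; have [p [pL Bp]] : exists p, p \in L /\ ~ B p (D p x).
      apply/not_existsP => h; apply: xA => p pL; apply: contrapT => Bp; exact: (h p).
    have pL0 : p \in L0 by rewrite memL0 pL orbT.
    by rewrite (big_rem p pL0)/= /g pL indicE memNset// mul0r.
  by rewrite /Rintegral integral_indic// setIT fineK// fin_num_measure.
rewrite !E//; congr EFin.
have last0 : last 0 L0 = 0.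
  have : 0 \in L0 by rewrite memL0 eqxx.
  rewrite /L0; case ES : S0 sS0 => [|a S'] //= pa _.
  rewrite rev_cons last_rcons.
  have aS : a \in L0 by rewrite /L0 ES mem_rev mem_head.
  have /andP[a0 _] := L0T _ aS; apply/le_anti; rewrite a0 andbT.
  have : 0 \in S0 by rewrite -mem_rev -/L0 memL0 eqxx.
  rewrite ES inE => /predU1P[->//|]; have := pa; rewrite lt_path_sortedE => /andP[/allP h _].
  by move=> /h /ltW.
case: L0 sL0 L0T last0 memL0 {E} => [|t L'] sL0 L0T last0 memL0; first by have := memL0 0; rewrite eqxx.
apply: (brownian_fdd hX hX' _ sL0) => //.
by have /andP[] := L0T t (mem_head _ _).
Qed.

Lemma coord_history_set (i : nat) (k : 'I_d) (L : seq R) (B : R -> set R) :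
  (forall p, p \in L -> 0 <= p <= T) -> (forall p, measurable (B p)) ->
  <<s history (fun t x => W i x t k ord0) T >> [set x | forall p, p \in L -> B p (W i x p k ord0)].
Proof.
move=> LT mB; set S := history _ T.
rewrite (_ : [set x | _] = \big[setI/setT]_(p <- L) ((fun x => W i x p k ord0) @^-1` (B p))); last by rewrite -bigcap_seq.
rewrite big_seq; apply: (big_ind (fun A => <<s S >> A)).
- exact: (@measurableT _ (g_sigma_algebraType S)).
- by move=> A1 A2; exact: (@measurableI _ (g_sigma_algebraType S)).
- move=> p pL; apply: sub_sigma_algebra; exists p; first by rewrite /= in_itv /=; exact: LT.
  by exists (B p) => //; rewrite setTI.
Qed.

Lemma cylinder_prob (i j : nat) (L : seq R) (B : R -> 'I_d -> set R) :
  (forall p, p \in L -> 0 <= p <= T) -> (forall p k, measurable (B p k)) ->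
  P (W i @^-1` cylinder L B) = P (W j @^-1` cylinder L B).
Proof.
move=> LT mB.
have E l : P (W l @^-1` cylinder L B) = \big[mule/1%E]_(k <- enum 'I_d) P [set x | forall p, p \in L -> B p k (W l x p k ord0)].
  have [_ ind] := hW.1 l.
  rewrite -(ind (enum 'I_d) (enum_uniq _) (fun k => [set x | forall p, p \in L -> B p k (W l x p k ord0)])).
    congr (P _); rewrite -bigcap_seq; apply/seteqP; split => [x h k _ p pL|x h p pL k]; first exact: h.
    by apply: h => //=; rewrite mem_enum.
  by move=> k _; exact: (@coord_history_set l k L (fun p => B p k) LT (fun p => mB p k)).
rewrite !E; apply: eq_bigr => k _.
have bm l : brownian_coordinate P T (fun t x => W l x t k ord0) by have [/(_ l)[/(_ k)]] := hW.
exact: (brownian_cylinder_prob (B := fun p => B p k) (bm i) (bm j)).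
Qed.

(** Cylinders with rectangular sections form a pi-system that generates the path sigma-algebra, and
    two Brownian motions give them the same probability; Dynkin induction extends the equality. *)
Lemma path_law (i j : nat) (A : set (cpath d T)) : <<s history_T >> A ->
  P (W i @^-1` A) = P (W j @^-1` A).
Proof.
pose C := [set X | exists L, exists B, [/\ forall p : R, p \in L -> 0 <= p <= T, forall p k, measurable (B p k) & X = cylinder L B]].
have mW l : measurable_fun setT (W l : Om -> g_sigma_algebraType history_T) by exact: (measurable_bm_path hW l).
have mWs l X : <<s history_T >> X -> measurable (W l @^-1` X).
  by move=> hX; rewrite -[X in measurable X]setTI; exact: (mW l measurableT X hX).
have CI : setI_closed C.
  move=> _ _ [L [B [LT mB ->]]] [L' [B' [LT' mB' ->]]].
  (* A time that occurs in only one of the lists is constrained by the full set on the other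
     side. *)
  exists (L ++ L'), (fun p k => (if p \in L then B p k else setT) `&` (if p \in L' then B' p k else setT)); split.
  - by move=> p; rewrite mem_cat => /orP[/LT|/LT'].
  - by move=> p k; apply: measurableI; case: ifP.
  - apply/seteqP; split => [w [h h'] p pL k|w h].
      by split; case: ifP => // ?; [exact: h|exact: h'].
    split => p pL k; have [] := h p _ k; rewrite ?mem_cat ?pL ?orbT//.
have Ch : history_T `<=` <<s C >>.
  move=> X [s sT [B mB <-]].
  have ms : measurable_fun setT ((fun w : cpath d T => w s : 'cV[R]_d) : g_sigma_algebraType C -> 'cV[R]_d).
    apply/measurable_fun_mxP => k l; rewrite (ord1 l) => _ B' mB'; apply: sub_sigma_algebra.
    exists [:: s], (fun p k' => if k' == k then B' else setT); split.
    - by move=> p; rewrite inE => /eqP ->; move: sT; rewrite /= in_itv.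
    - by move=> p k'; case: (k' == k).
    - apply/seteqP; split => [w [_ h] p|w h]; first by rewrite inE => /eqP -> k'; case: eqP => [->|].
      by split => //; have := h s (mem_head _ _) k; rewrite eqxx.
  exact: (ms measurableT B mB).
have hC : C `<=` <<s history_T >>.
  move=> _ [L [B [LT mB ->]]].
  rewrite (_ : cylinder L B = \big[setI/setT]_(p <- L) \big[setI/setT]_(k <- enum 'I_d) ((fun w : cpath d T => w p k ord0) @^-1` (B p k))); last first.
    rewrite -bigcap_seq; apply/seteqP; split => [w h p pL|w h p pL k].
      by rewrite -bigcap_seq => k _; exact: h.
    have := h p pL; rewrite -bigcap_seq => /(_ k); apply; by rewrite /= mem_enum.
  rewrite big_seq; apply: (big_ind (fun A => <<s history_T >> A)).
  - exact: (@measurableT _ (g_sigma_algebraType history_T)).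
  - by move=> A1 A2; exact: (@measurableI _ (g_sigma_algebraType history_T)).
  move=> p pL; apply: (big_ind (fun A => <<s history_T >> A)).
  - exact: (@measurableT _ (g_sigma_algebraType history_T)).
  - by move=> A1 A2; exact: (@measurableI _ (g_sigma_algebraType history_T)).
  move=> k _; apply: sub_sigma_algebra; exists p; first by rewrite /= in_itv /=; exact: LT.
  exists ((fun v : 'cV[R]_d => v k ord0) @^-1` (B p k)); last by rewrite setTI.
  rewrite -[X in measurable X]setTI; exact: (@measurable_coord R d 1 setT k ord0).
have eC : <<s history_T >> = <<s C >>.
  apply/seteqP; split; apply: smallest_sub => //; exact: smallest_sigma_algebra.
have trivW l (F' : nat -> set (cpath d T)) : trivIset setT F' -> trivIset setT (fun n => W l @^-1` F' n).
  move=> /trivIsetP tF; apply/trivIsetP => a b _ _ ab.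
  by rewrite -preimage_setI tF// preimage_set0.
have H1 : setT = setT :> set (cpath d T) -> P (W i @^-1` setT) = P (W j @^-1` setT) by rewrite !preimage_setT.
have H2 X : C X -> P (W i @^-1` X) = P (W j @^-1` X).
  by move=> [L [B [LT mB ->]]]; exact: cylinder_prob.
have H3 S : <<s history_T >> S -> P (W i @^-1` S) = P (W j @^-1` S) -> P (W i @^-1` (~` S)) = P (W j @^-1` (~` S)).
  move=> /[dup] /(mWs i) mi /(mWs j) mj SE.
  by rewrite 2!preimage_setC probability_setC// probability_setC// SE.
have H4 (F' : nat -> set (cpath d T)) : (forall n, <<s history_T >> (F' n)) -> trivIset setT F' ->
    (forall n, P (W i @^-1` F' n) = P (W j @^-1` F' n)) ->
    P (W i @^-1` (\bigcup_k F' k)) = P (W j @^-1` (\bigcup_k F' k)).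
  move=> mF tF FE; rewrite 2!preimage_bigcup.
  rewrite measure_bigcup; [|by move=> k _; exact: mWs|exact: trivW].
  rewrite measure_bigcup; [|by move=> k _; exact: mWs|exact: trivW].
  by apply: eq_eseriesr => k _; exact: FE.
have dyn := @dynkin_induction _ (g_sigma_algebraType history_T) C (fun A => P (W i @^-1` A) = P (W j @^-1` A)) eC CI (H1 erefl) H2 H3 H4 A.
by rewrite eC; exact: dyn.
Qed.

End path_laws.

(** * Transfer of solutions between Brownian motions *)

Section path_representation.
Context (R : realType) dO (Om : measurableType dO) (P : probability Om R) (d : nat) (T : R)
  (W : nat -> Om -> cpath d T) (i : nat).
Local Notation FJ := (completed_filtration P W [set i]).
Local Notation H := (@canonical_history R d T).

(* The null sets completing the filtration are absorbed by the exceptional set. *)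
Lemma representation_set dU (U : measurableType dU) (t : R) (A : set (U * g_sigma_algebraType (FJ t))) :
  measurable A -> exists2 B : set (U * g_sigma_algebraType (H t)), measurable B &
    {ae P, forall x : Om, forall u, A (u, x) <-> B (u, W i x)}.
Proof.
pose K := [set A : set (U * Om) | exists2 B : set (U * g_sigma_algebraType (H t)), measurable B &
    {ae P, forall x : Om, forall u, A (u, x) <-> B (u, W i x)}].
have K0 : K set0 by exists set0 => //; apply: nearW => x u.
have KC A' : K A' -> K (~` A').
  by move=> [B mB h]; exists (~` B); [exact: measurableC|apply: filterS h => x h u; split => n /h].
have KU (F : nat -> set (U * Om)) : (forall n, K (F n)) -> K (\bigcup_n F n).
  move=> hF; have /choice[B hB] n : exists B : set (U * g_sigma_algebraType (H t)), measurable B /\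
      {ae P, forall x : Om, forall u, F n (u, x) <-> B (u, W i x)}.
    by have [B] := hF n; exists B.
  exists (\bigcup_n B n); first by apply: bigcupT_measurable => n; have [] := hB n.
  have : {ae P, forall x : Om, forall n u, F n (u, x) <-> B n (u, W i x)} by apply: ae_foralln => n; have [] := hB n.
  by apply: filterS => x h u; split => -[n _ /h hn]; exists n.
have KS : sigma_algebra setT K.
  by split => // A' hA; rewrite setTD; exact: KC.
have Krect (C : set (U * Om)) : (preimage_set_system setT fst measurable `|` preimage_set_system setT (snd : U * g_sigma_algebraType (FJ t) -> _) measurable) C -> K C.
  move=> [[A1 mA1 <-]|[A2 mA2 <-]].
    exists (fst @^-1` A1); last by apply: nearW => x u; rewrite setTI.
    by rewrite -[X in measurable X]setTI; exact: measurable_fst.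
  suff : <<s FJ t >> `<=` [set A2 | K (setT `&` snd @^-1` A2)] by apply.
  apply: smallest_sub.
    split.
    - by rewrite /= preimage_set0 setI0.
    - by move=> A' /= /KC; rewrite !setTI setTD preimage_setC.
    - by move=> F hF /=; rewrite setTI preimage_bigcup; apply: KU => n; have := hF n; rewrite /= setTI.
  move=> A3 [[_ -> [s st [B mB <-]]]|[mA A0]].
    exists (snd @^-1` [set w : cpath d T | B (w s)]).
      rewrite -[X in measurable X]setTI; apply: measurable_snd => //.
      by apply: sub_sigma_algebra; exists s => //; exists B => //; rewrite setTI.
    by apply: nearW => x u; split => [[_ []]|].
  exists set0 => //; exists A3; split => // x nh; apply: contrapT => nA; apply: nh => u; split => //.
  by case.
by move=> mA; have := smallest_sub KS Krect; exact.
Qed.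

(** A real number is the infimum of the rationals above it. Each sublevel set is replaced by its
    representative on path space; there are countably many, so one exceptional set serves all
    parameters [u]. *)
Lemma representation_real dU (U : measurableType dU) (t : R) (X : U * g_sigma_algebraType (FJ t) -> R) :
  measurable_fun setT X -> exists2 h : U * g_sigma_algebraType (H t) -> R, measurable_fun setT h &
    {ae P, forall x : Om, forall u, X (u, x) = h (u, W i x)}.
Proof.
(* An enumeration of the rationals; a code that decodes to nothing merely repeats 0. *)
move=> mX; pose q k : R := ratr (odflt 0 (unpickle k : option rat)).
have /choice[B hB] k : exists B : set (U * g_sigma_algebraType (H t)), measurable B /\
      {ae P, forall x : Om, forall u, X (u, x) < q k <-> B (u, W i x)}.
  have mA : measurable [set p | X p < q k].
    have := mX measurableT _ (measurable_itv `]-oo, (q k)[); rewrite setTI.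
    by congr measurable; apply/seteqP; split => p; rewrite /= in_itv.
  by have [B mB hB] := representation_set mA; exists B.
(* The value [+oo] is neutral for the infimum. *)
pose e k p : \bar R := if p \in B k then (q k)%:E else +oo%E.
exists (fun p => fine (einfs (e ^~ p) 0%N)).
  apply: measurableT_comp; first exact: fine_measurable.
  apply: measurable_fun_einfs => k; apply: measurable_fun_ifT => //.
  apply: (measurable_fun_bool true); rewrite setTI.
  by rewrite (_ : _ @^-1` _ = B k); [have [] := hB k|apply/seteqP; split => p /=; [exact: set_mem|exact: mem_set]].
have : {ae P, forall x : Om, forall k u, X (u, x) < q k <-> B k (u, W i x)} by apply: ae_foralln => n; have [] := hB n.
apply: filterS => x h u; rewrite [einfs _ _](_ : _ = (X (u, x))%:E)//.
apply/eqP; rewrite eq_le; apply/andP; split.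
  apply/lee_addgt0Pr => eps eps0.
  have /rat_in_itvoo [r] : X (u, x) < X (u, x) + eps by rewrite ltrDl.
  rewrite in_itv /= => /andP[r1 r2].
  have qr : q (pickle r) = ratr r by rewrite /q pickleK.
  apply: (@le_trans _ _ (e (pickle r) (u, W i x))).
    by apply: ereal_inf_lbound; exists (pickle r).
  rewrite /e ifT ?qr -?EFinD ?lee_fin ?ltW// inE; apply/h.
  by rewrite qr.
apply: le_ereal_inf_tmp => _ [k _ <-]; rewrite /e; case: ifPn => [|_]; last exact: leey.
by move=> /set_mem /h; rewrite lee_fin => /ltW.
Qed.

Lemma representation_mx dU (U : measurableType dU) (t : R) p q (X : U * g_sigma_algebraType (FJ t) -> 'M[R]_(p, q)) :
  measurable_fun setT X -> exists2 h : U * g_sigma_algebraType (H t) -> 'M[R]_(p, q), measurable_fun setT h &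
    {ae P, forall x : Om, forall u, X (u, x) = h (u, W i x)}.
Proof.
move=> mX.
have /choice[h hh] (c : 'I_p * 'I_q) : exists h : U * g_sigma_algebraType (H t) -> R, measurable_fun setT h /\
    {ae P, forall x : Om, forall u, X (u, x) c.1 c.2 = h (u, W i x)}.
  have [h mh hE] := representation_real ((measurable_fun_mxP _ _).1 mX c.1 c.2).
  by exists h.
exists (fun v => \matrix_(k, l) h (k, l) v).
  apply/measurable_fun_mxP => k l; under eq_fun do rewrite mxE.
  by have [] := hh (k, l).
have : {ae P, forall x : Om, forall c u, X (u, x) c.1 c.2 = h c (u, W i x)}.
  by apply: filter_forall => c; have [] := hh c.
by apply: filterS => x hx u; apply/matrixP => k l; rewrite mxE -(hx (k, l)).
Qed.

Lemma representation_rv (t : R) p q (X : Om -> 'M[R]_(p, q)) :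
  measurable_fun setT (X : g_sigma_algebraType (FJ t) -> _) ->
  exists2 h : cpath d T -> 'M[R]_(p, q), measurable_fun setT (h : g_sigma_algebraType (H t) -> _) &
    {ae P, forall x : Om, X x = h (W i x)}.
Proof.
move=> mX.
have mX' : measurable_fun setT (fun v : unit * g_sigma_algebraType (FJ t) => X v.2).
  exact: (measurableT_comp mX measurable_snd).
have [h mh hE] := representation_mx mX'.
exists (fun w => h (tt, w)); first exact: (measurableT_comp mh (pair1_measurable tt)).
by apply: filterS hE => x /(_ tt).
Qed.

Lemma representation_progressive p q (X : R -> Om -> 'M[R]_(p, q)) : 0 <= T -> progressive FJ T X ->
  exists2 h : R -> cpath d T -> 'M[R]_(p, q),
    measurable_fun setT (fun v : measurableTypeR R * g_sigma_algebraType (H T) => h v.1 v.2) &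
    {ae P, forall x : Om, forall u, 0 <= u <= T -> X u x = h u (W i x)}.
Proof.
move=> T0 pX; have TT : 0 <= T <= T by rewrite T0 lexx.
have mD : measurable (`[0%R, T]%classic `*` [set: g_sigma_algebraType (FJ T)] : set (measurableTypeR R * g_sigma_algebraType (FJ T))).
  by apply: measurableX => //; exact: measurable_itv.
(* Extension by zero outside [[0, T]] makes the process jointly measurable for all real times, the
   form in which time can serve as the parameter of the representation. *)
have := (measurable_restrictT _ mD).1 (pX T TT).
move=> /(representation_mx (U := measurableTypeR R)) [h mh hE].
exists (fun u w => h (u, w)).
  by move: mh; congr measurable_fun; apply/funext => -[].
apply: filterS hE => x hx u uT; rewrite -hx patchE ifT// inE.
by split => //=; rewrite in_itv.
Qed.

End path_representation.

Section path_transfer.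
Context (R : realType) dO (Om : measurableType dO) (P : probability Om R) (d : nat) (T : R)
  (W : nat -> Om -> cpath d T).
Hypothesis hW : independent_brownian_motions P W.
Hypothesis T0 : 0 <= T.
Variables i j : nat.
Local Notation H := (@canonical_history R d T).
Local Notation Om' := (g_sigma_algebraType (H T)).
Local Notation leb := (@lebesgue_measure R).
Local Notation mu2 := (leb_prod P).
Local Notation mW := (measurable_bm_path hW).

Lemma path_integral (h : Om' -> \bar R) : measurable_fun setT h -> (forall w, 0 <= h w)%E ->
  (\int[P]_x h (W i x) = \int[P]_x h (W j x))%E.
Proof.
move=> mh h0; rewrite -(ge0_integral_law P (mW i))// -(ge0_integral_law P (mW j))//.
by apply: eq_measure_integral => A mA _; exact: (path_law hW T0 i j mA).
Qed.

Lemma path_Rintegral (h : Om' -> R) : measurable_fun setT h ->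
  \int[P]_x h (W i x) = \int[P]_x h (W j x).
Proof.
move=> mh; rewrite -(integral_law P (mW i))// -(integral_law P (mW j))//.
by congr fine; apply: eq_measure_integral => A mA _; exact: (path_law hW T0 i j mA).
Qed.

(** The property is a measurable set of paths, so its complement has the same probability under the
    laws of both motions. *)
Lemma path_ae (B : set Om') : measurable B -> {ae P, forall x, B (W i x)} -> {ae P, forall x, B (W j x)}.
Proof.
move=> mB [N [mN N0 BN]].
have mWB k : measurable (W k @^-1` (~` B)).
  by rewrite -[X in measurable X]setTI; apply: (mW k) => //; exact: measurableC.
exists (W j @^-1` (~` B)); split => //.
rewrite -(path_law hW T0 i j); last exact: (@measurableC _ Om').
by apply: (subset_measure0 (B := N)).
Qed.

Lemma measurable_path_process (h : measurableTypeR R * Om' -> R) k : measurable_fun setT h ->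
  measurable_fun setT (fun p : measurableTypeR R * Om => h (p.1, W k p.2)).
Proof.
move=> mh; apply: (measurableT_comp mh); apply: measurable_fun_pair => //.
by apply: (measurableT_comp (mW k)); exact: measurable_snd.
Qed.

Lemma transfer_integral2 (X : R -> Om -> R) (h : R -> cpath d T -> R) :
  measurable_fun setT (cut 0 T X : measurableTypeR R * Om -> R) ->
  measurable_fun setT (fun p : measurableTypeR R * Om' => h p.1 p.2) ->
  {ae P, forall x, forall u, 0 <= u <= T -> X u x = h u (W i x)} ->
  (\int[mu2]_p ((cut 0 T X p) ^+ 2)%:E = \int[mu2]_p ((cut 0 T (fun u x => h u (W j x)) p) ^+ 2)%:E)%E.
Proof.
move=> mX mh E.
have mc : measurable_fun setT (cut 0 T (h : R -> Om' -> R) : measurableTypeR R * Om' -> R).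
  rewrite (_ : cut 0 T _ = fun p : measurableTypeR R * Om' => \1_(`]0%R, T]) p.1 * h p.1 p.2); last by apply/funext => p; rewrite cutE.
  apply: measurable_funM => //.
  by apply: (measurableT_comp _ measurable_fst); exact: measurable_indic.
pose g (p : measurableTypeR R * Om') : \bar R := ((cut 0 T (h : R -> Om' -> R) p) ^+ 2)%:E.
have mg : measurable_fun setT g by exact: sqr_EFin_measurable mc.
have g0 p : (0 <= g p)%E by rewrite lee_fin sqr_ge0.
have mgj : measurable_fun setT (cut 0 T (fun u x => h u (W j x)) : measurableTypeR R * Om -> R).
  exact: (measurable_path_process j mc).
rewrite /leb_prod (@fubini_tonelli1 _ _ _ _ _ leb P _ (sqr_EFin_measurable mX) (sqr_EFin_ge0 _)).
rewrite (@fubini_tonelli1 _ _ _ _ _ leb P _ (sqr_EFin_measurable mgj) (sqr_EFin_ge0 _)).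
apply: eq_integral => u _; rewrite /fubini_F.
have mgu : measurable_fun setT (fun w => g (u, w)) by exact: (measurableT_comp mg (pair1_measurable _)).
transitivity (\int[P]_x g (u, W i x))%E; last exact: (path_integral mgu).
apply: ae_eq_integral => //.
- exact: (measurableT_comp (sqr_EFin_measurable mX) (pair1_measurable _)).
- exact: (measurableT_comp mgu (mW i)).
apply: filterS E => x E _; rewrite /g /cut /=; case: ifP => // /andP[u0 uT].
by rewrite E// (ltW u0).
Qed.

Lemma transfer_L2_mu2 (X : R -> Om -> R) (h : R -> cpath d T -> R) :
  L2 mu2 (cut 0 T X) ->
  measurable_fun setT (fun p : measurableTypeR R * Om' => h p.1 p.2) ->
  {ae P, forall x, forall u, 0 <= u <= T -> X u x = h u (W i x)} ->
  L2 mu2 (cut 0 T (fun u x => h u (W j x))).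
Proof.
move=> lX mh E; split; last by rewrite -(transfer_integral2 (L2_measurable lX) mh E) lX.2.
have mc := measurable_path_process j mh.
apply/measurable_cut_D; exact: measurable_funTS.
Qed.

Lemma transfer_integral (X : Om -> R) (h : cpath d T -> R) :
  measurable_fun setT X -> measurable_fun setT (h : Om' -> R) ->
  {ae P, forall x, X x = h (W i x)} ->
  (\int[P]_x ((X x) ^+ 2)%:E = \int[P]_x ((h (W j x)) ^+ 2)%:E)%E.
Proof.
move=> mX mh E; have mg := sqr_EFin_measurable mh.
transitivity (\int[P]_x ((h (W i x)) ^+ 2)%:E)%E.
  apply: ae_eq_integral => //; first exact: sqr_EFin_measurable.
    exact: (measurableT_comp mg (mW i)).
  by apply: filterS E => x -> _.
by apply: (path_integral mg) => w; exact: sqr_EFin_ge0.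
Qed.

Lemma transfer_L2 (X : Om -> R) (h : cpath d T -> R) :
  L2 P X -> measurable_fun setT (h : Om' -> R) -> {ae P, forall x, X x = h (W i x)} ->
  L2 P (fun x => h (W j x)) /\ nrm2 P (fun x => h (W j x)) = nrm2 P X.
Proof.
move=> lX mh E; have e := transfer_integral (L2_measurable lX) mh E.
have l : L2 P (fun x => h (W j x)).
  by split; [exact: (measurableT_comp mh (mW j))|rewrite -e lX.2].
by split => //; apply: EFin_inj; rewrite !nrm2_EFin.
Qed.

End path_transfer.

Section canonical_elementary.
Context (R : realType) dO (Om : measurableType dO) (P : probability Om R) (m d : nat) (T : R)
  (W : nat -> Om -> cpath d T).
Hypothesis hW : independent_brownian_motions P W.
Local Notation H := (@canonical_history R d T).
Local Notation Om' := (g_sigma_algebraType (H T)).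
Local Notation can := (@elementary R _ Om' m d).
Local Notation cspec := (@elementary_spec R _ Om' m d H T).
Implicit Types E : can.
Local Notation pi_ := (fun (t : R) (w : cpath d T) => w t : 'cV[R]_d).

Definition elementary_pull (j : nat) E : elementary R Om m d :=
  Elementary (el_size E) (el_time E) (fun k x => el_coef E k (W j x)).

Lemma measurable_path_filtration (j : nat) (t : R) :
  measurable_fun setT (W j : g_sigma_algebraType (completed_filtration P W [set j] t) -> g_sigma_algebraType (H t)).
Proof.
apply: measurable_to_g_sigma => // A [s st [B mB <-]]; rewrite setTI.
by apply: sub_sigma_algebra; left; exists j => //; exists s => //; exists B => //; rewrite !setTI.
Qed.

Lemma elementary_pull_spec j E : cspec E ->
  elementary_spec (completed_filtration P W [set j]) T (elementary_pull j E).
Proof.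
move=> [hE [c hc]]; split; last by exists c => k x kE; exact: hc.
move=> k kE; have [a0 ab bT mc] := hE k kE; split => //.
have mc' : measurable_fun setT (el_coef E k : g_sigma_algebraType (H (el_time E k)) -> _) by exact: mc.
move=> _ B mB; have := mc' measurableT B mB; rewrite setTI => mB'.
by have := @measurable_path_filtration j (el_time E k) measurableT _ mB'; rewrite setTI.
Qed.

(** Each coefficient is a functional of the path up to its own time, outside a null set; there are
    finitely many coefficients, so one null set covers them all. *)
Lemma canonical_elementary i (E : elementary R Om m d) : elementary_spec (completed_filtration P W [set i]) T E ->
  exists2 E' : can, cspec E' &
    {ae P, forall x, (forall u, elementary_val E u x = elementary_val E' u (W i x)) /\
      forall t, elementary_int E (fun t x => W i x t) t x = elementary_int E' pi_ t (W i x)}.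
Proof.
move=> [hE [c hc]].
have /choice[h hh] (k : 'I_(el_size E)) : exists h : cpath d T -> 'M[R]_(m, d),
    measurable_fun setT (h : g_sigma_algebraType (H (el_time E k)) -> _) /\
    {ae P, forall x, el_coef E k x = h (W i x)}.
  have [_ _ _ mc] := hE k (ltn_ord k).
  by have [h mh hE'] := representation_rv mc; exists h.
(* The representation controls the coefficient almost surely only. Cutting it off beyond the bound
   [c] makes it bounded on every path and changes nothing along almost all paths of [W i]. *)
pose coef k w := if insub k is Some k' then (if euclid (h k' w) ^+ 2 <= c ^+ 2 then h k' w else 0) else 0.
exists (@Elementary R _ Om' m d (el_size E) (el_time E) coef).
  split => [k kE|]; last first.
    exists c => k w kE; rewrite /= /coef insubT /=.
    have c0 : 0 <= c by apply: le_trans (hc k point kE); exact: euclid_ge0.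
    by case: ifP; rewrite ?euclid0// ler_pXn2r// nnegrE euclid_ge0.
  have [a0 ab bT mc] := hE k kE; split => //=.
  rewrite /coef insubT /=; set k' := Sub _ _.
  have [mh _] := hh k'; have mh' : measurable_fun setT (h k' : g_sigma_algebraType (H (el_time E k)) -> _) by exact: mh.
  apply: measurable_fun_ifT => //.
  by apply: measurable_fun_ler => //; exact: measurable_euclid_sqr.
have c0 (k : 'I_(el_size E)) : 0 <= c by apply: le_trans (hc k point (ltn_ord k)); exact: euclid_ge0.
have : {ae P, forall x, forall k : 'I_(el_size E), el_coef E k x = h k (W i x)}.
  by apply: filter_forall => k; have [] := hh k.
apply: filterS => x hx.
have cE (k : 'I_(el_size E)) : coef k (W i x) = el_coef E k x.
  rewrite /coef insubT //= => kE.
  rewrite (_ : Sub _ _ = k); last exact: val_inj.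
  by rewrite -hx ifT// lerXn2r ?nnegrE ?euclid_ge0 ?(c0 k)// hc.
split => [u|t]; rewrite /elementary_val /elementary_int /=.
  by apply: eq_bigr => k _; case: ifP => //; rewrite cE.
by apply: eq_bigr => k _; rewrite cE.
Qed.

Lemma canonical_coef_measurable E k : cspec E -> (k < el_size E)%N ->
  forall r q, measurable_fun setT (fun w : Om' => el_coef E k w r q).
Proof.
move=> [hE _] kE r q; have [a0 ab bT mc] := hE k kE.
apply: (measurable_fun_mxP _ _).1; apply: measurable_fun_g_sigmaS mc => A hA.
by apply: sub_sigma_algebra; apply: historyS hA; exact: le_trans bT.
Qed.

Lemma canonical_val_measurable E r q : cspec E ->
  measurable_fun setT (fun p : measurableTypeR R * Om' => elementary_val E p.1 p.2 r q).
Proof.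
move=> hE; rewrite (_ : (fun p => _) = fun p : measurableTypeR R * Om' => \sum_(k < el_size E)
   (\1_(`]el_time E k, el_time E k.+1]) p.1 * el_coef E k p.2 r q)); last first.
  apply/funext => p; rewrite /elementary_val summxE; apply: eq_bigr => k _.
  by rewrite indicE mem_setE in_itv /=; case: ifP => _; rewrite ?mxE ?mul1r ?mul0r.
apply: measurable_sum => k; apply: measurable_funM.
  by apply: (measurableT_comp _ measurable_fst); exact: measurable_indic.
exact: (measurableT_comp (canonical_coef_measurable hE (ltn_ord k) r q) measurable_snd).
Qed.

Lemma canonical_int_measurable E r (t : R) : cspec E -> 0 <= t <= T ->
  measurable_fun setT (fun w : Om' => elementary_int E pi_ t w r ord0).
Proof.
move=> hE /andP[t0 tT].
rewrite (_ : (fun w => _) = fun w : Om' => \sum_(k < el_size E) \sum_q el_coef E k w r q *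
   (w (Num.min (el_time E k.+1) t) q ord0 - w (Num.min (el_time E k) t) q ord0)); last first.
  apply/funext => w; rewrite /elementary_int summxE; apply: eq_bigr => k _.
  by rewrite mxE; apply: eq_bigr => q _; rewrite !mxE.
have mw (s : R) q : 0 <= s <= T -> measurable_fun setT (fun w : Om' => w s q ord0).
  move=> sT; apply: (measurable_fun_mxP _ _).1 => _ B mB; apply: sub_sigma_algebra.
  by exists s; [rewrite /= in_itv|exists B].
apply: measurable_sum => k; apply: measurable_sum => q; apply: measurable_funM.
  exact: canonical_coef_measurable.
have [a0 ab bT _] := hE.1 k (ltn_ord k).
by apply: measurable_funB; apply: mw; rewrite le_min ge_min t0 tT orbT ?a0 ?(le_trans a0 ab).
Qed.

End canonical_elementary.

Section auxiliary_measurability.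
Context (R : realType).
Local Notation leb := (@lebesgue_measure R).

Lemma Rintegral_section_measurable dU (U : measurableType dU) (k : measurableTypeR R * U -> R) :
  measurable_fun setT k -> measurable_fun setT (fun w => \int[leb]_u k (u, w)).
Proof.
move=> mk; rewrite /Rintegral; apply: (measurableT_comp (@fine_measurable R setT measurableT)).
under eq_fun do rewrite integralE; apply: emeasurable_funB.
  rewrite (_ : (fun x => _) = fun x => (\int[leb]_u ((EFin \o k)^\+)%E (u, x))%E).
    apply: (@measurable_fun_fubini_tonelli_G _ _ _ _ R leb ((EFin \o k)^\+)%E) => //.
    by apply: measurable_funepos; exact/measurable_EFinP.
  apply/funext => x; apply: eq_integral => u _.
  exact: (congr1 (@^~ u) (funepos_comp (EFin \o k) (fun u => (u, x)))).
rewrite (_ : (fun x => _) = fun x => (\int[leb]_u ((EFin \o k)^\-)%E (u, x))%E).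
  apply: (@measurable_fun_fubini_tonelli_G _ _ _ _ R leb ((EFin \o k)^\-)%E) => //.
  by apply: measurable_funeneg; exact/measurable_EFinP.
apply/funext => x; apply: eq_integral => u _.
exact: (congr1 (@^~ u) (funeneg_comp (EFin \o k) (fun u => (u, x)))).
Qed.

Lemma measurable_eq_set dU (U : measurableType dU) (g h : U -> R) :
  measurable_fun setT g -> measurable_fun setT h -> measurable [set w | g w = h w].
Proof.
move=> mg mh; have := measurable_funB mg mh measurableT (measurable_set1 0); rewrite setTI.
by congr measurable; apply/seteqP; split => [w /= /eqP|w /= ->]; [rewrite subr_eq0 => /eqP|rewrite subrr].
Qed.

Lemma measurable_eq_mx_set dU (U : measurableType dU) p q (g h : U -> 'M[R]_(p, q)) :
  measurable_fun setT g -> measurable_fun setT h -> measurable [set w | g w = h w].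
Proof.
move=> mg mh; rewrite (_ : [set w | _] = \bigcap_(c : 'I_p * 'I_q) [set w | g w c.1 c.2 = h w c.1 c.2]).
  by apply: fin_bigcap_measurable => // c _; apply: measurable_eq_set; exact: (measurable_fun_mxP _ _).1.
apply/seteqP; split => [w /= gh c _|w gh]; first by rewrite /= gh.
apply/matrixP => k l.
exact: (gh (k, l) Logic.I).
Qed.

End auxiliary_measurability.

Section elementary_measurability.
Context (R : realType) dO (Om : measurableType dO) (P : probability Om R) (m d : nat) (T : R)
  (W : nat -> Om -> cpath d T).
Hypothesis hW : independent_brownian_motions P W.
Variable i : nat.
Local Notation FJ := (completed_filtration P W [set i]).

Let JN : [set i] `<=` `I_i.+1. Proof. by move=> _ -> /=. Qed.

Lemma elementary_cut_measurable (E : elementary R Om m d) r q : elementary_spec FJ T E ->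
  measurable_fun setT (cut 0 T (fun u x => elementary_val E u x r q) : measurableTypeR R * Om -> R).
Proof.
move=> hE; have := L2_measurable (cut_sum_val_L2 hW 0 T (el_terms JN ord_max r hE) (ord_max, q)).
congr measurable_fun; apply/funext => p; rewrite /= /cut.
by rewrite (@sum_val_el_terms _ _ _ _ _ _ _ W _ _ JN ord_max) eqxx.
Qed.

Lemma elementary_int_measurable (E : elementary R Om m d) r (t : R) : elementary_spec FJ T E -> 0 <= t <= T ->
  measurable_fun setT (fun x => elementary_int E (fun t x => W i x t) t x r ord0).
Proof.
move=> hE /andP[t0 tT].
have := L2_measurable (sum_int_L2 hW (el_terms JN ord_max r hE) (lexx 0) t0 tT).
congr measurable_fun; apply/funext => x.
by rewrite (@sum_int_el_terms _ _ _ _ _ _ _ W _ _ JN ord_max)// (elementary_int0 ord_max hE) subr0.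
Qed.

(** The filtration contains all null events, so the part of a preimage on which [X] and [X'] differ
    belongs to it. *)
Lemma measurable_completed_ae dV (V : measurableType dV) (J : set nat) (t : R) (X X' : Om -> V) :
  measurable_fun setT X -> measurable_fun setT (X' : g_sigma_algebraType (completed_filtration P W J t) -> V) ->
  {ae P, forall x, X x = X' x} ->
  measurable_fun setT (X : g_sigma_algebraType (completed_filtration P W J t) -> V).
Proof.
move=> mX mX' [N [mN N0 XN]] _ B mB; rewrite setTI.
pose S := completed_filtration P W J t.
have nS A : measurable A -> P A = 0%E -> @measurable _ (g_sigma_algebraType S) A.
  by move=> mA A0; apply: sub_sigma_algebra; right.
have mXB : measurable (X @^-1` B) by rewrite -[X in measurable X]setTI; exact: mX.
have -> : X @^-1` B = (X' @^-1` B `\` N) `|` (X @^-1` B `&` N).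
  apply/seteqP; split => [x XB|x [[XB nN]|[]//]].
    have [Nx|nNx] := pselect (N x); [by right|left; split => //].
    have e : X x = X' x by apply: contrapT => e; apply: nNx; apply: XN.
    by rewrite /= -e.
  have e : X x = X' x by apply: contrapT => e; apply: nN; apply: XN.
  by rewrite /= e.
apply: (@measurableU _ (g_sigma_algebraType S)).
  apply: (@measurableD _ (g_sigma_algebraType S)); last exact: nS.
  by have := mX' measurableT B mB; rewrite setTI.
apply: nS; first exact: measurableI.
by apply: (subset_measure0 (B := N)) => //; exact: measurableI.
Qed.

End elementary_measurability.

Section mkv_transfer.
Context (R : realType) dO (Om : measurableType dO) (P : probability Om R) (d m : nat) (T LF Lf : R)
  (W : nat -> Om -> cpath d T).
Hypothesis hW : independent_brownian_motions P W.
Variables (G : cpath d T -> 'cV[R]_m)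
  (F : R -> cpath d T -> 'cV[R]_m -> 'M[R]_(m, d) -> 'cV[R]_m -> 'cV[R]_m)
  (f : R -> 'cV[R]_m -> 'cV[R]_m -> 'M[R]_(m, d) -> 'cV[R]_m).
Hypotheses (T0 : 0 <= T) (LF0 : 0 <= LF) (Lf0 : 0 <= Lf) (hLip : Lip LF Lf F f)
  (hF : forall y z a, progressive (@canonical_history R d T) T (fun t (w : cpath d T) => F t w y z a))
  (hf : forall y1 y2 z, measurable_fun `[0, T] (fun t => f t y1 y2 z)).
Local Notation H := (@canonical_history R d T).
Local Notation Om' := (g_sigma_algebraType (H T)).
Local Notation leb := (@lebesgue_measure R).
Local Notation mu2 := (leb_prod P).
Local Notation mW := (measurable_bm_path hW).
Variables i j : nat.
Local Notation FJ k := (completed_filtration P W [set k]).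

(** Every approximation error is a functional of the path of [W i]. Its second moment depends only
    on the path law, so it is unchanged when the functional is evaluated at [W j]. *)
Lemma ito_limit_transfer (Z : R -> Om -> 'M[R]_(m, d)) M (zeta : R -> cpath d T -> 'M[R]_(m, d)) (mu : R -> cpath d T -> 'cV[R]_m) :
  ito_limit P (FJ i) T Z (fun t x => W i x t : 'cV[R]_d) M -> cutL2 P T Z ->
  measurable_fun setT (fun p : measurableTypeR R * Om' => zeta p.1 p.2) ->
  {ae P, forall x, forall u, 0 <= u <= T -> Z u x = zeta u (W i x)} ->
  (forall t : R, 0 <= t <= T -> measurable_fun setT (mu t : Om' -> _)) ->
  (forall t : R, 0 <= t <= T -> {ae P, forall x, M t x = mu t (W i x)}) ->
  ito_limit P (FJ j) T (fun u x => zeta u (W j x)) (fun t x => W j x t : 'cV[R]_d) (fun t x => mu t (W j x)).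
Proof.
move=> [mM [E [hE EZ EM]]] lZ mz zE mmu muE.
have mmuc t r : 0 <= t <= T -> measurable_fun setT (fun w : Om' => mu t w r ord0).
  by move=> tT; exact: ((measurable_fun_mxP _ _).1 (mmu t tT) r ord0).
split => [t tT r|]; first exact: (measurableT_comp (mmuc t r tT) (mW j)).
have /choice[E' hE'] k : exists E' : @elementary R _ Om' m d, @elementary_spec R _ Om' m d H T E' /\
    {ae P, forall x, (forall u, elementary_val (E k) u x = elementary_val E' u (W i x)) /\
      forall t, elementary_int (E k) (fun t x => W i x t) t x =
        elementary_int E' (fun (t : R) (w : cpath d T) => w t : 'cV[R]_d) t (W i x)}.
  by have [E' ? ?] := canonical_elementary (hE k); exists E'.
exists (fun k => elementary_pull W j (E' k)); split.
- by move=> k; have [sE' _] := hE' k; exact: elementary_pull_spec.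
- move=> r q; apply: cvg_trans (EZ r q); apply: near_eq_cvg; apply: nearW => k; have [sE' eE'] := hE' k.
  apply: (@transfer_integral2 _ _ _ _ _ _ _ hW T0 i j (fun u x => elementary_val (E k) u x r q - Z u x r q)
     (fun u w => elementary_val (E' k) u w r q - zeta u w r q)).
  + rewrite cutB; apply: measurable_funB; [exact: (elementary_cut_measurable hW)|exact: L2_measurable (lZ r q)].
  + apply: measurable_funB; [exact: canonical_val_measurable|exact: ((measurable_fun_mxP _ _).1 mz r q)].
  + by move: eE' zE; apply: filterS2 => x [e _] ze u uT; rewrite e ze.
- move=> t r tT; apply: cvg_trans (EM t r tT); apply: near_eq_cvg; apply: nearW => k; have [sE' eE'] := hE' k.
  apply: (@transfer_integral _ _ _ _ _ _ _ hW T0 i j (fun x => elementary_int (E k) (fun t x => W i x t) t x r ord0 - M t x r ord0)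
     (fun w => elementary_int (E' k) (fun (t : R) (w : cpath d T) => w t : 'cV[R]_d) t w r ord0 - mu t w r ord0)).
  + by apply: measurable_funB; [exact: (elementary_int_measurable hW)|exact: mM].
  + by apply: measurable_funB; [exact: canonical_int_measurable|exact: mmuc].
  + by move: eE' (muE t tT); apply: filterS2 => x [_ e] me; rewrite e me.
Qed.

Lemma measurable_canonicalS dV (V : measurableType dV) (t : R) (h : cpath d T -> V) : t <= T ->
  measurable_fun setT (h : g_sigma_algebraType (H t) -> V) -> measurable_fun setT (h : Om' -> V).
Proof.
move=> tT; apply: (@measurable_fun_g_sigmaS _ Om') => A hA; apply: sub_sigma_algebra.
exact: historyS tT _ hA.
Qed.

Lemma path_process_measurable p q k (h : R -> cpath d T -> 'M[R]_(p, q)) u :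
  measurable_fun setT (fun v : measurableTypeR R * Om' => h v.1 v.2) ->
  measurable_fun setT (h u : Om' -> _) /\ measurable_fun setT (fun x => h u (W k x)).
Proof.
move=> mh; have mhu : measurable_fun setT (h u : Om' -> _) by exact: (measurableT_comp mh (pair1_measurable u)).
by split => //; exact: (measurableT_comp mhu (mW k)).
Qed.

Hypothesis mG : measurable_fun setT (G : Om' -> 'cV[R]_m).

Lemma law_functional_transfer (X : Om -> 'cV[R]_m) (h : cpath d T -> 'cV[R]_m) (u : R) y z :
  0 <= u <= T -> measurable_fun setT X -> measurable_fun setT (h : Om' -> _) ->
  {ae P, forall x, X x = h (W i x)} ->
  law_functional P f (fun x => h (W j x)) u y z = law_functional P f X u y z.
Proof.
move=> uT mX mh E; apply/matrixP => r c; rewrite !mxE.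
have mfh : measurable_fun setT (fun w : Om' => f u y (h w) z r ord0).
  by apply: (measurable_fun_mxP _ _).1; apply: (measurable_f hLip hf (tau := fun=> u)).
rewrite -(path_Rintegral hW T0 i j mfh); congr fine; apply: ae_eq_integral => //.
- by apply/measurable_EFinP; exact: (measurableT_comp mfh (mW i)).
- by apply/measurable_EFinP; exact: (measurable_f_snd hLip hf).
- by apply: filterS E => x -> _.
Qed.

(* [Y'] and [Z'] are the functionals of [W i] that represent [Y] and [Z], evaluated
   at [W j]. *)
Lemma mkv_transfer Y Z : solves_mckean_vlasov P W G F f i Y Z ->
  exists b Y' Z', [/\ forall N, (j < N)%N -> mkv_system P W F f j N b Y' Z',
    {ae P, forall x, Y' T x = G (W j x)} &
    forall u : R, 0 <= u <= T -> forall y z, law_functional P f (Y' u) u y z = law_functional P f (Y u) u y z].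
Proof.
move=> S; have [M [aM hM E]] := mkv_solution_increments hW T0 LF0 Lf0 hLip hF hf S.
have [b b0 sys] := mkv_solution_system hW T0 LF0 Lf0 hLip hF hf S.
have [bY lY lZ _] := sys i.+1 (ltnSn i).
have tY := mkv_terminal hW T0 S.
have [pY sY pZ _ _] := S.
have [phi mphi phiE] := representation_progressive T0 pY.
have [zeta mzeta zetaE] := representation_progressive T0 pZ.
have /choice[mu hmu] (t : R) : exists mu : cpath d T -> 'cV[R]_m, 0 <= t <= T ->
    measurable_fun setT (mu : Om' -> _) /\ {ae P, forall x, M t x = mu (W i x)}.
  have [tT|tT] := pselect (0 <= t <= T); last by exists (fun=> 0) => /tT.
  have [h mh hE] := representation_rv (aM t tT); exists h => _; split => //.
  by apply: measurable_canonicalS mh; case/andP: tT.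
pose Y' u x := phi u (W j x); pose Z' u x := zeta u (W j x); pose M' t x := mu t (W j x).
have phiu u : 0 <= u <= T -> {ae P, forall x, Y u x = phi u (W i x)}.
  by move=> uT; apply: filterS phiE => x /(_ u uT).
have mphiu u : measurable_fun setT (phi u : Om' -> _) by have [] := path_process_measurable j u mphi.
have mY' u : measurable_fun setT (Y' u) by have [] := path_process_measurable j u mphi.
have mY u : 0 <= u <= T -> measurable_fun setT (Y u).
  by move=> uT; apply/measurable_fun_mxP => r c; exact: (progressive_coord_measurable hW r c pY uT).
have lawE u y z : 0 <= u <= T -> law_functional P f (Y' u) u y z = law_functional P f (Y u) u y z.
  by move=> uT; apply: law_functional_transfer => //; [exact: mY|exact: phiu].
have bY' : moment_bounded P T b Y'.
  move=> u uT r; have [lu nu] := bY u uT r.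
  have [l n] := transfer_L2 hW T0 j lu ((measurable_fun_mxP _ _).1 (mphiu u) r ord0)
    (filterS (fun x (h : Y u x = phi u (W i x)) => congr1 (fun v : 'cV[R]_m => v r ord0) h) (phiu u uT)).
  by split => //; rewrite n.
have cutT p q (X : R -> Om -> 'M[R]_(p, q)) h : cutL2 P T X ->
    measurable_fun setT (fun v : measurableTypeR R * Om' => h v.1 v.2) ->
    {ae P, forall x, forall u, 0 <= u <= T -> X u x = h u (W i x)} -> cutL2 P T (fun u x => h u (W j x)).
  move=> lX mh hE r c; apply: (@transfer_L2_mu2 _ _ _ _ _ _ _ hW T0 i j (fun u x => X u x r c) (fun u w => h u w r c) (lX r c) ((measurable_fun_mxP _ _).1 mh r c)).
  by apply: filterS hE => x hE u uT; rewrite hE.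
have lY' : cutL2 P T Y' by exact: cutT lY mphi phiE.
have lZ' : cutL2 P T Z' by exact: cutT lZ mzeta zetaE.
exists b, Y', Z'; split => [||u uT y z]; last exact: lawE; last first.
  apply: (@path_ae _ _ _ P _ _ W hW T0 i j [set w | phi T w = G w]); first exact: measurable_eq_mx_set.
  have TT : 0 <= T <= T by rewrite T0 lexx.
  by move: (phiu T TT) tY; apply: filterS2 => x /= <-.
move=> N jN; suff [A1 A2 A3] : [/\ forall t : R, 0 <= t <= T -> measurable_fun setT (Y' t : g_sigma_algebraType (FN P W N t) -> _),
    ito_limit P (FJ j) T Z' (fun t x => W j x t : 'cV[R]_d) M' & mkv_increments P W F f j Y' Z' M'].
  exact: (mkv_system_intro hW T0 LF0 Lf0 hLip hF hf jN A1 bY' lY' lZ' A2 A3).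
split.
(* [phi t] is known to be measurable only for the whole path up to [T]. The functional [psi] uses
   the path up to [t] and agrees with it almost surely, which suffices because the filtration is
   completed. *)
- move=> t tT; have [psi mpsi psiE] := representation_rv (progressive_adapted pY tT).
  have mpsi' : measurable_fun setT (psi : Om' -> _).
    by apply: measurable_canonicalS mpsi; case/andP: tT.
  apply: (measurable_FJ_FN (J := [set j])) => [_ ->//|].
  apply: (@measurable_completed_ae _ _ _ _ _ _ _ _ _ _ _ _ (fun x => psi (W j x))) => //.
    move=> _ B mB; have := mpsi measurableT B mB; rewrite setTI => mB'.
    by have := @measurable_path_filtration _ _ _ P _ _ W j t measurableT _ mB'; rewrite setTI.
  apply: (@path_ae _ _ _ P _ _ W hW T0 i j [set w | phi t w = psi w]); first exact: measurable_eq_mx_set.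
  by move: (phiu t tT) psiE; apply: filterS2 => x /= <-.
- apply: (ito_limit_transfer hM lZ mzeta zetaE) => t tT; by have [] := hmu t tT.
- move=> s t r s0 st tT.
  have t0 : 0 <= t <= T by rewrite (le_trans s0 st).
  have sT : 0 <= s <= T by rewrite s0 (le_trans st tT).
  (* The driver as a functional of time and path. It contains the law of the original [Y], which the
     copy shares by [lawE], so the same [Psi] serves both motions. *)
  pose Psi (u : R) (w : cpath d T) := F u w (phi u w) (zeta u w) (law_functional P f (Y u) u (phi u w) (zeta u w)).
  pose I w := \int[leb]_u cut s t (fun u (w : Om') => Psi u w r ord0) (u, w).
  have mI : measurable_fun setT (I : Om' -> R).
    apply: Rintegral_section_measurable.
    rewrite (_ : cut _ _ _ = fun p => \1_(`]s, t]) p.1 * cut 0 T (fun u (w : Om') => Psi u w r ord0) p); last first.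
      apply/funext => p; rewrite /cut indicE mem_setE in_itv /=.
      case: (boolP (s < p.1 <= t)) => [/andP[su ut]|_]; last by rewrite mul0r.
      by rewrite (le_lt_trans s0 su) (le_trans ut tT) mul1r.
    apply: measurable_funM.
      by apply: (measurableT_comp _ measurable_fst); exact: measurable_indic.
    apply/measurable_cut_D; apply: (measurable_fun_mxP _ _).1.
    pose D := `]0%R, T]%classic `*` setT : set (measurableTypeR R * Om').
    have p1T p : D p -> 0 < p.1 <= T by move=> [+ _]; rewrite /= in_itv.
    have p1T' p : D p -> 0 <= p.1 <= T by move=> /p1T/andP[/ltW -> ->].
    have m1 : measurable_fun D fst by exact: measurable_funTS measurable_fst.
    have m2 : measurable_fun D (snd : _ -> Om') by exact: measurable_funTS measurable_snd.
    have mp : measurable_fun D (fun v => phi v.1 v.2) by exact: measurable_funTS mphi.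
    have mz : measurable_fun D (fun v => zeta v.1 v.2) by exact: measurable_funTS mzeta.
    have ml := @measurable_law _ _ _ _ _ _ _ _ _ _ _ Lf0 hLip hf _ _ D fst _ _ b Y bY lY p1T m1 mp mz.
    exact: (@measurable_F _ _ _ _ _ _ F f T0 hLip hF _ _ D fst snd _ _ _ p1T' m1 m2 mp mz ml).
  have II k (Y1 : R -> Om -> 'cV[R]_m) Z1 x : (forall u, 0 <= u <= T -> Y1 u x = phi u (W k x)) ->
      (forall u, 0 <= u <= T -> Z1 u x = zeta u (W k x)) ->
      (forall u y z, 0 <= u <= T -> law_functional P f (Y1 u) u y z = law_functional P f (Y u) u y z) ->
      tint s t (fun u x => mkv_driver P W F f k Y1 Z1 u x r ord0) x = I (W k x).
    move=> eY eZ eL; rewrite /tint /I; congr fine; apply: eq_integral => u _; congr EFin.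
    rewrite /cut /=; case: ifP => // /andP[su ut].
    have uT : 0 <= u <= T by rewrite (le_trans s0 (ltW su)) (le_trans ut tT).
    by rewrite /mkv_driver eL// eY// eZ.
  have mc (g : cpath d T -> 'cV[R]_m) : measurable_fun setT (g : Om' -> _) -> measurable_fun setT (fun w : Om' => g w r ord0).
    by move=> mg; exact: ((measurable_fun_mxP _ _).1 mg r ord0).
  have [[mus es] [mut et]] := (hmu s sT, hmu t t0).
  (* The equation between two fixed times becomes a measurable set of paths; it has full measure
     under [W i], hence under [W j]. *)
  pose B := [set w : Om' | phi s w r ord0 + (mu t w r ord0 - mu s w r ord0) = phi t w r ord0 + I w].
  have mB : measurable B.
    apply: measurable_eq_set; last by apply: measurable_funD => //; exact: mc.
    by apply: measurable_funD; [exact: mc|apply: measurable_funB; exact: mc].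
  have : {ae P, forall x, B (W i x)}.
    have := E s t r s0 st tT; move: phiE zetaE es et => h1 h2 h3 h4 h5.
    near=> x; have e1 : forall u, 0 <= u <= T -> Y u x = phi u (W i x) by near: x.
    have e2 : forall u, 0 <= u <= T -> Z u x = zeta u (W i x) by near: x.
    rewrite /B /= -e1// -e1// -(II i Y Z)//.
    rewrite -(_ : M t x = mu t (W i x)); last by near: x.
    rewrite -(_ : M s x = mu s (W i x)); last by near: x.
    by near: x.
  move=> /(@path_ae _ _ _ P _ _ W hW T0 i j B mB); apply: filterS => x.
  rewrite /B /= -(II j Y' Z')// => u y z uT; exact: lawE.
Unshelve. all: by end_near. Qed.

End mkv_transfer.

(** * Law of large numbers *)

Section finite_sums.
Context (R : realType) d (U : measurableType d) (mu : {measure set U -> \bar R}) (I : finType) (g : I -> U -> R).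
Hypothesis ig : forall i, mu.-integrable setT (EFin \o g i).

Lemma integrable_sumR : mu.-integrable setT (EFin \o (fun x => \sum_i g i x)).
Proof.
rewrite (_ : EFin \o _ = fun x => (\sum_i (EFin \o g i) x)%E); last by apply/funext => x; rewrite /= sumEFin.
by apply: integrable_sum => // i _; exact: ig.
Qed.

Lemma Rintegral_sumR : \int[mu]_x (\sum_i g i x) = \sum_i \int[mu]_x g i x.
Proof.
rewrite /Rintegral (eq_integral (fun x => (\sum_i (EFin \o g i) x)%E)); last by move=> x _; rewrite /= sumEFin.
rewrite (integral_sum measurableT ig); apply/esym/sum_fine => i _.
exact: (integrable_fin_num measurableT (ig i)).
Qed.

End finite_sums.

Section decoupling.
Context (R : realType) d (Om : measurableType d) (P : probability Om R) (S1 S2 : set_system Om).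
Hypotheses (m1 : S1 `<=` measurable) (m2 : S2 `<=` measurable) (ind : independent P S1 S2).

Lemma ip_independent (A B : Om -> R) : measurable_fun setT (A : g_sigma_algebraType S1 -> R) ->
  measurable_fun setT (B : g_sigma_algebraType S2 -> R) -> L2 P A -> L2 P B ->
  ip P A B = \int[P]_x A x * \int[P]_x B x.
Proof.
move=> mA mB lA lB.
have mk : measurable_fun setT (fun p : g_sigma_algebraType S1 * g_sigma_algebraType S2 => A p.1 * B p.2).
  apply: measurable_funM; first exact: (measurableT_comp mA measurable_fst).
  exact: (measurableT_comp mB measurable_snd).
rewrite /ip (indep_integral m1 m2 ind mk (L2_mul_integrable lA lB)) /=.
rewrite mulrC -RintegralZl//; last exact: L2_integrable.
congr fine; apply: eq_integral => x _; congr EFin.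
by rewrite mulrC -RintegralZl//; exact: L2_integrable.
Qed.

Lemma ip_decoupled (A : Om -> R) (k : g_sigma_algebraType S1 * g_sigma_algebraType S2 -> R) :
  measurable_fun setT (A : g_sigma_algebraType S1 -> R) -> measurable_fun setT k ->
  L2 P A -> L2 P (fun x => k (x, x)) -> (forall x, P.-integrable setT (EFin \o (fun y => k (x, y)))) ->
  (forall x, \int[P]_y k (x, y) = 0) -> ip P A (fun x => k (x, x)) = 0.
Proof.
move=> mA mk lA lk ik k0.
have mk' : measurable_fun setT (fun p : g_sigma_algebraType S1 * g_sigma_algebraType S2 => A p.1 * k p).
  by apply: measurable_funM => //; exact: (measurableT_comp mA measurable_fst).
rewrite /ip (indep_integral m1 m2 ind mk' (L2_mul_integrable lA lk)) /=.
have E x : \int[P]_y (A x * k (x, y)) = 0 by rewrite RintegralZl ?k0 ?mulr0//; exact: ik.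
by rewrite /Rintegral (eq_integral (fun=> 0%E)) ?integral0// => x _; congr EFin; exact: E.
Qed.

Lemma nrm2_cst (c : R) : nrm2 P (fun=> c) = c ^+ 2.
Proof.
rewrite nrm2E Rintegral_cst//=.
by rewrite [X in fine X](_ : _ = 1%E) ?mulr1//; exact: probability_setT.
Qed.

Lemma sqr_sum_card n (a : 'I_n -> R) : (\sum_q a q) ^+ 2 <= n%:R * \sum_q a q ^+ 2.
Proof.
have := @nrm2_sum_card _ _ _ P n (fun q _ => a q) (fun q => L2_cst P (a q)).
rewrite nrm2_cst => h; apply: le_trans h _; rewrite ler_wpM2l//.
by apply: ler_sum => q _; rewrite nrm2_cst.
Qed.

Lemma ip_cst (c : R) (X : Om -> R) : L2 P X -> ip P (fun=> c) X = c * \int[P]_x X x.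
Proof. by move=> lX; rewrite /ip RintegralZl//; exact: L2_integrable. Qed.

Lemma RintegralN (X : Om -> R) : L2 P X -> \int[P]_x - X x = - \int[P]_x X x.
Proof.
move=> lX; rewrite -mulN1r -RintegralZl//; last exact: L2_integrable.
by congr fine; apply: eq_integral => y _; rewrite mulN1r.
Qed.

(** The integration variable [B] is an independent copy. Integrating the squared distance [g] first
    over [B] and then over [A] gives back the second moment of [A - B], evaluated on the same
    sample. *)
Lemma decoupled_nrm2 n (A B : 'I_n -> Om -> R) (V : Om -> R) (L : R) :
  (forall q, measurable_fun setT (A q : g_sigma_algebraType S1 -> R)) ->
  (forall q, measurable_fun setT (B q : g_sigma_algebraType S2 -> R)) ->
  (forall q, L2 P (A q)) -> (forall q, L2 P (B q)) -> measurable_fun setT V ->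
  (forall x, `|V x| <= L * \sum_q \int[P]_y `|A q x - B q y|) ->
  L2 P V /\ nrm2 P V <= L ^+ 2 * n%:R * \sum_q nrm2 P (fun x => A q x - B q x).
Proof.
move=> mA mB lA lB mV VL.
pose g q x := nrm2 P (fun y => A q x - B q y).
have lAB q x : L2 P (fun y => A q x - B q y) by apply: L2B => //; exact: L2_cst.
(* A quadratic polynomial in [A q x]: its mean needs no double integral, and independence enters
   once, through the product of the means of [A] and [B]. *)
have gE q x : g q x = A q x ^+ 2 + (- (2 * \int[P]_y B q y) * A q x + nrm2 P (B q)).
  rewrite /g nrm2D; [|exact: L2_cst|exact: L2N].
  rewrite nrm2N//.
  rewrite nrm2_cst ip_cst ?RintegralN//; last exact: L2N.
  ring.
have ig q : P.-integrable setT (EFin \o g q).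
  rewrite (_ : g q = fun x => A q x ^+ 2 + (- (2 * \int[P]_y B q y) * A q x + nrm2 P (B q))); last exact/funext/gE.
  apply: integrable_addR; first exact: L2_sqr.
  apply: integrable_addR; first by apply: integrable_scaleR; exact: L2_integrable.
  exact: L2_integrable (L2_cst P _).
have Ig q : \int[P]_x g q x = nrm2 P (fun x => A q x - B q x).
  rewrite (_ : g q = fun x => A q x ^+ 2 + (- (2 * \int[P]_y B q y) * A q x + nrm2 P (B q))); last exact/funext/gE.
  have i1 : P.-integrable setT (EFin \o (fun x => - (2 * \int[P]_y B q y) * A q x)).
    by apply: integrable_scaleR; exact: L2_integrable.
  have i2 : P.-integrable setT (EFin \o (fun _ : Om => nrm2 P (B q))) by exact: L2_integrable (L2_cst P _).
  rewrite RintegralD//; [|exact: L2_sqr|exact: integrable_addR].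
  rewrite RintegralD// RintegralZl//; last exact: L2_integrable.
  rewrite -/(Rintegral _ _ _) (_ : \int[P]_x nrm2 P (B q) = nrm2 P (B q)); last first.
    by rewrite Rintegral_cst//= [X in fine X](_ : _ = 1%E) ?mulr1//; exact: probability_setT.
  rewrite nrm2D// ?nrm2N//; last exact: L2N.
  have -> : ip P (A q) (fun x => - B q x) = - ip P (A q) (B q).
    rewrite (_ : (fun x => - B q x) = fun x => -1 * B q x); last by apply/funext => x; rewrite mulN1r.
    by rewrite ipZr// mulN1r.
  rewrite ip_independent// -nrm2E; ring.
have V2 x : V x ^+ 2 <= L ^+ 2 * n%:R * \sum_q g q x.
  apply: (@le_trans _ _ ((L * \sum_q \int[P]_y `|A q x - B q y|) ^+ 2)).
    rewrite -real_normK ?num_real// lerXn2r ?nnegrE//.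
    exact: le_trans (normr_ge0 _) (VL x).
  rewrite exprMn -mulrA ler_wpM2l ?sqr_ge0//; apply: le_trans (sqr_sum_card _) _.
  rewrite ler_wpM2l//; apply: ler_sum => q _.
  apply: le_trans (Rintegral_sqr_le (L2_normr (lAB q x))) _.
  rewrite le_eqVlt /g !nrm2E; apply/orP; left; apply/eqP; congr fine; apply: eq_integral => y _.
  by rewrite real_normK ?num_real.
have iG : P.-integrable setT (EFin \o (fun x => L ^+ 2 * n%:R * \sum_q g q x)).
  by apply: integrable_scaleR; exact: integrable_sumR.
have lV : L2 P V by exact: L2_bound mV iG V2.
split => //; apply: le_trans (nrm2_le_Rintegral lV iG V2) _.
rewrite RintegralZl//; last exact: integrable_sumR.
rewrite Rintegral_sumR// (eq_bigr (fun q => nrm2 P (fun x => A q x - B q x)))// => q _; exact: Ig.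
Qed.

End decoupling.

Section independent_filtrations.
Context (R : realType) dO (Om : measurableType dO) (P : probability Om R) (d : nat) (T : R)
  (W : nat -> Om -> cpath d T).
Hypothesis hW : independent_brownian_motions P W.
Local Notation hist i := (history (fun t x => W i x t) T).

(** A summand of the law of large numbers depends on two motions, that of [i] and its own. It must
    be independent of a third one; [i = j] is allowed because the particle [i] appears among its own
    neighbours. *)
Lemma independent_filtrations i j k : i != k -> j != k ->
  independent P (completed_filtration P W [set i; j] T) (completed_filtration P W [set k] T).
Proof.
move=> ik jk; have ind := hW.2.
have mh l : hist l `<=` measurable.
  by apply: history_measurable => s sT; exact: (measurable_bm hW l sT).
have ip2 a A B : a != k -> <<s hist a >> A -> <<s hist k >> B -> P (A `&` B) = (P A * P B)%E.
  move=> ak hA hB; have := ind [:: a; k] _ (fun l => if l == a then A else B).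
  rewrite !big_cons !big_nil setIT mule1 eqxx (eq_sym k) (negbTE ak); apply.
    by rewrite /= inE ak.
  move=> l; rewrite !inE => /orP[/eqP ->|/eqP ->]; first by rewrite eqxx.
  by rewrite eq_sym (negbTE ak).
have block := @independent_block _ _ _ P bool (fun b => hist (if b then i else j)) (hist k) (fun b => mh _) (mh k).
apply: (independentS _ _ (block _)).
- move=> A [[l [->|->] hA]|[mA A0]]; apply: sub_sigma_algebra; last by right.
    by left; exists true.
  by left; exists false.
- by move=> A [[_ -> hA]|[mA A0]]; apply: sub_sigma_algebra; [left|right].
move=> A B hA hB.
rewrite (_ : \bigcap_b A b = A true `&` A false); last first.
  apply/seteqP; split => [x h|x [h1 h2] [] _ //].
  by split; [exact: (h true Logic.I)|exact: (h false Logic.I)].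
have [ij|ij] := eqVneq i j.
  apply: (ip2 i) => //.
  by apply: (@measurableI _ (g_sigma_algebraType (hist i))); [exact: (hA true)|rewrite ij; exact: (hA false)].
have := ind [:: i; j] _ (fun l => if l == i then A true else A false).
rewrite !big_cons !big_nil setIT mule1 eqxx (eq_sym j) (negbTE ij) => -> //; last first.
- move=> l; rewrite !inE => /orP[/eqP ->|/eqP ->]; first by rewrite eqxx; exact: (hA true).
  by rewrite eq_sym (negbTE ij); exact: (hA false).
- by rewrite /= inE ij.
have := ind [:: i; j; k] _ (fun l => if l == i then A true else if l == j then A false else B).
rewrite !big_cons !big_nil setIT mule1 eqxx (eq_sym j) (negbTE ij) eqxx (eq_sym k) (negbTE ik) (eq_sym k) (negbTE jk).
rewrite setIA muleA; apply.
  by rewrite /= !inE negb_or ij ik jk.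
move=> l; rewrite !inE => /or3P[/eqP ->|/eqP ->|/eqP ->].
- by rewrite eqxx; exact: (hA true).
- by rewrite eq_sym (negbTE ij) eqxx; exact: (hA false).
- by rewrite eq_sym (negbTE ik) eq_sym (negbTE jk).
Qed.

End independent_filtrations.

Section law_of_large_numbers.
Context (R : realType) dO (Om : measurableType dO) (P : probability Om R) (d m : nat) (T LF Lf LG : R)
  (W : nat -> Om -> cpath d T).
Hypothesis hW : independent_brownian_motions P W.
Variables (G : cpath d T -> 'cV[R]_m)
  (F : R -> cpath d T -> 'cV[R]_m -> 'M[R]_(m, d) -> 'cV[R]_m -> 'cV[R]_m)
  (f : R -> 'cV[R]_m -> 'cV[R]_m -> 'M[R]_(m, d) -> 'cV[R]_m).
Hypotheses (hT : 0 < T) (LF0 : 0 <= LF) (Lf0 : 0 <= Lf) (LG0 : 0 <= LG) (hLip : Lip LF Lf F f)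
  (hG : forall w w', euclid (G w - G w') <= LG * cpath_dist w w')
  (hF : forall y z a, progressive (@canonical_history R d T) T (fun t (w : cpath d T) => F t w y z a))
  (hf : forall y1 y2 z, measurable_fun `[0, T] (fun t => f t y1 y2 z)).
Variables (Y : nat -> R -> Om -> 'cV[R]_m) (Z : nat -> R -> Om -> 'M[R]_(m, d)).
Hypothesis hS : forall i, solves_mckean_vlasov P W G F f i (Y i) (Z i).
Local Notation T0 := (ltW hT).
Local Notation solution i := (mkv_solution_system hW T0 LF0 Lf0 hLip hF hf (hS i)).
Local Notation FJ J := (completed_filtration P W J T).

Lemma solution_L2 i u r : 0 <= u <= T -> L2 P (fun x => Y i u x r ord0).
Proof. by move=> uT; have [b _ /(_ i.+1 (ltnSn i)) [bY _ _ _]] := solution i; exact: (bY u uT r).1. Qed.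

(** The copy of [Y i] built on [W j] and the solution [Y j] have the same motion and the same
    terminal value. The coupling estimate with path distance 0 makes them equal almost surely at
    each time, and the copy has the law of [Y i]. *)
Lemma mkv_law_eq i j (u : R) y z : 0 <= u <= T ->
  law_functional P f (Y i u) u y z = law_functional P f (Y j u) u y z.
Proof.
move=> uT; have mG := lipschitz_functional_measurable hT LG0 hG.
have [b [Y' [Z' [sys tY' lawE]]]] := mkv_transfer hW T0 LF0 Lf0 hLip hF hf j mG (hS i).
rewrite -lawE//; have [b' _ sysj] := solution j.
have sY' := sys j.+1 (ltnSn j); have sYj := sysj j.+1 (ltnSn j).
have TT : 0 <= T <= T by rewrite lexx (ltW hT).
have lY' t r : 0 <= t <= T -> L2 P (fun x => Y' t x r ord0) by move=> tT; exact: (mkv_moment sY' tT r).1.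
have D0 x : cpath_dist (W j x) (W j x) <= 0 by rewrite cpath_dist_refl// ltW.
have lD t r0 : 0 <= t <= T -> L2 P (fun x => Y' t x r0 ord0 - Y j t x r0 ord0).
  by move=> tT; apply: L2B; [exact: lY'|exact: solution_L2].
have z0 : nrm2 P (fun=> 0) = 0 by rewrite nrm2_cst expr0n.
have sT : \sum_r nrm2 P (fun x => Y' T x r ord0 - Y j T x r ord0) = 0.
  rewrite big1// => r _; rewrite -[RHS]z0; apply: nrm2_ae => //; first exact: L2_measurable (lD T r TT).
  by move: tY' (mkv_terminal hW T0 (hS j)); apply: filterS2 => x -> ->; rewrite subrr.
have := mkv_coupling hW T0 LF0 Lf0 hLip hF hf (ltnSn j) (ltnSn j) sY' sYj (L2_0 P) D0 uT.
rewrite sT z0 mulr0 addr0 mulr0 => s0.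
have n0 r : nrm2 P (fun x => Y' u x r ord0 - Y j u x r ord0) = 0.
  apply/eqP; rewrite eq_le nrm2_ge0 andbT; apply: le_trans s0.
  by rewrite (bigD1 r)//= lerDl; apply: sumr_ge0 => ? _; exact: nrm2_ge0.
have e0 r := nrm2_eq0_ae (lD u r uT) (n0 r).
have mY (X : Om -> 'cV[R]_m) : (forall r, L2 P (fun x => X x r ord0)) -> measurable_fun setT X.
  by move=> lX; apply/measurable_fun_mxP => k l; rewrite (ord1 l); exact: L2_measurable (lX k).
apply/matrixP => r c; rewrite !mxE; congr fine; apply: ae_eq_integral => //.
- apply/measurable_EFinP; apply: (measurable_f_snd hLip hf y z r uT); apply: mY => k; exact: lY'.
- apply/measurable_EFinP; apply: (measurable_f_snd hLip hf y z r uT); apply: mY => k; exact: solution_L2.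
have : {ae P, forall x, forall r, Y' u x r ord0 - Y j u x r ord0 = 0} by exact: filter_forall.
apply: filterS => x e _; congr (_ %:E); congr (f _ _ _ _ _ _); apply/matrixP => k l; rewrite (ord1 l).
by apply/eqP; rewrite -subr_eq0; apply/eqP.
Qed.

(** [128 d^2 T] bounds the second moment of the distance between two paths. It enters through the
    terminal value, with weight [m LG^2], and through the path dependence of the driver, with weight
    [coupling_cst]. *)
Definition distance_cst : R := gronwall_cst (coupling_cst m LF Lf * (m%:R + 2)) T *
  ((m%:R * LG ^+ 2 + coupling_cst m LF Lf) * (128 * d%:R ^+ 2 * T)).

Lemma mkv_distance i j (t : R) : 0 <= t <= T ->
  \sum_r nrm2 P (fun x => Y i t x r ord0 - Y j t x r ord0) <= distance_cst.
Proof.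
move=> tT; have mG := lipschitz_functional_measurable hT LG0 hG.
have TT : 0 <= T <= T by rewrite lexx (ltW hT).
have [D0 [lD nD hD]] := path_distance_bound hW hT i j.
have [bi _ sysi] := solution i; have [bj _ sysj] := solution j.
have iN : (i < (maxn i j).+1)%N by rewrite ltnS leq_maxl.
have jN : (j < (maxn i j).+1)%N by rewrite ltnS leq_maxr.
apply: le_trans (mkv_coupling hW T0 LF0 Lf0 hLip hF hf iN jN (sysi _ iN) (sysj _ jN) lD hD tT) _.
have c0 := coupling_cst_ge0 m LF Lf.
rewrite /distance_cst ler_wpM2l ?gronwall_cst_ge0//.
rewrite mulrDl lerD//; last by rewrite ler_wpM2l.
rewrite -mulrA; apply: ler_sum_card => r.
have mGW k : measurable_fun setT (fun x => G (W k x) r ord0).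
  exact: (measurableT_comp ((measurable_fun_mxP _ _).1 mG r ord0) (measurable_bm_path hW k)).
pose X x := G (W i x) r ord0 - G (W j x) r ord0.
have mX : measurable_fun setT X by exact: measurable_funB.
have XD x : `|X x| <= `|LG * D0 x|.
  apply: le_trans (ler_norm _); apply: (@le_trans _ _ (LG * cpath_dist (W i x) (W j x))); last by rewrite ler_wpM2l.
  by apply: le_trans (hG _ _); have := coord_le_euclid (G (W i x) - G (W j x)) r ord0; rewrite !mxE.
have lGD := L2Z LG lD.
rewrite (@nrm2_ae _ _ _ _ _ X) => [|||] //; last 2 first.
- by apply: measurable_funB; apply: L2_measurable; exact: solution_L2.
- move: (mkv_terminal hW T0 (hS i)) (mkv_terminal hW T0 (hS j)); apply: filterS2 => x -> ->.
  by [].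
apply: (@le_trans _ _ (nrm2 P (fun x => LG * D0 x))); last by rewrite nrm2Z// ler_wpM2l ?sqr_ge0.
rewrite [leRHS]nrm2E; apply: nrm2_le_Rintegral; [exact: L2_dom mX lGD XD|exact: L2_sqr|].
by move=> x; rewrite -real_normK ?num_real// -[leRHS]real_normK ?num_real// lerXn2r ?nnegrE.
Qed.

Definition lln_error (n i : nat) (u : R) (x : Om) : 'cV[R]_m :=
  n%:R^-1 *: \sum_(j < n) f u (Y i u x) (Y j u x) (Z i u x) - law_functional P f (Y i u) u (Y i u x) (Z i u x).

Section fixed_time.
Variable u : R.
Hypothesis uT : 0 < u <= T.
Variables (i : nat) (r : 'I_m).
Let uT' : 0 <= u <= T. Proof. by case/andP: uT => /ltW -> ->. Qed.

(** Centred with the law of [Y j] instead of that of [Y i]. The laws agree, and in this form the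
    mean over the variable [Y j] vanishes by definition once the other arguments are frozen. *)
Let V j x := f u (Y i u x) (Y j u x) (Z i u x) r ord0 - law_functional P f (Y j u) u (Y i u x) (Z i u x) r ord0.

Lemma solution_measurable J l : J l -> measurable_fun setT (Y l u : g_sigma_algebraType (FJ J) -> _) /\
  measurable_fun setT (Z l u : g_sigma_algebraType (FJ J) -> _).
Proof.
move=> Jl; have [pY _ pZ _ _] := hS l.
have s : completed_filtration P W [set l] u `<=` <<s FJ J >>.
  move=> A hA; apply: sub_sigma_algebra; apply: (completed_filtrationS (J := [set l])) hA => [_ ->//|].
  by case/andP: uT.
by split; apply: (measurable_fun_g_sigmaS s); [exact: progressive_adapted pY uT'|exact: progressive_adapted pZ uT'].
Qed.

Lemma law_functional_measurable k dU (U : measurableType dU) (y : U -> 'cV[R]_m) (z : U -> 'M[R]_(m, d)) :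
  measurable_fun setT y -> measurable_fun setT z ->
  measurable_fun setT (fun v => law_functional P f (Y k u) u (y v) (z v) r ord0).
Proof.
move=> my mz; have [b _ /(_ k.+1 (ltnSn k)) [bY lY _ _]] := solution k.
apply: (measurable_fun_mxP _ _).1.
exact: (@measurable_law _ _ _ _ _ _ _ _ _ _ _ Lf0 hLip hf _ _ setT (fun=> u) _ _ b (Y k) bY lY (fun _ _ => uT)).
Qed.

Lemma f_measurable dU (U : measurableType dU) (y y' : U -> 'cV[R]_m) (z : U -> 'M[R]_(m, d)) :
  measurable_fun setT y -> measurable_fun setT y' -> measurable_fun setT z ->
  measurable_fun setT (fun v => f u (y v) (y' v) (z v) r ord0).
Proof.
move=> my my' mz; apply: (measurable_fun_mxP _ _).1.
exact: (@measurable_f _ _ _ _ _ _ F f hLip hf _ _ setT (fun=> u) _ _ _ (fun _ _ => uT') (measurable_cst _)).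
Qed.

Lemma deviation_measurable J j : J i -> J j -> measurable_fun setT (V j : g_sigma_algebraType (FJ J) -> R).
Proof.
move=> Ji Jj; have [myi mzi] := solution_measurable Ji; have [myj _] := solution_measurable Jj.
by apply: measurable_funB; [exact: f_measurable|exact: law_functional_measurable].
Qed.

Lemma filtration_measurable J : FJ J `<=` measurable.
Proof. exact: (completed_filtration_measurable hW). Qed.

(* The independent copy [Y j.+1] plays the role of the integration variable of the law. *)
Lemma deviation_L2 j : L2 P (V j) /\ nrm2 P (V j) <= Lf ^+ 2 * m%:R * distance_cst.
Proof.
have jk : j != j.+1 by rewrite neq_ltn ltnSn.
have ind := independent_filtrations hW jk jk.
have Jj : [set j; j] j by left.
have [myj _] := solution_measurable Jj.
have [myk _] := solution_measurable (J := [set j.+1]) (l := j.+1) erefl.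
have mV : measurable_fun setT (V j).
  by apply: (measurable_fun_g_sigma (@filtration_measurable [set i; j])); apply: deviation_measurable; [left|right].
have lip x : `|V j x| <= Lf * \sum_q \int[P]_y `|Y j u x q ord0 - Y j.+1 u y q ord0|.
  rewrite /V (mkv_law_eq j j.+1)//.
  (* A point value is an integral against the law of a constant variable, so [law_functional_lip]
     compares it with the law. The arguments taken from [i] cancel, and [j = i] needs no separate
     treatment. *)
  have -> : f u (Y i u x) (Y j u x) (Z i u x) r ord0 =
      law_functional P f (fun=> Y j u x) u (Y i u x) (Z i u x) r ord0.
    by rewrite mxE Rintegral_cst//= [X in fine X](_ : _ = 1%E) ?mulr1//; exact: probability_setT.
  apply: le_trans (law_functional_lip Lf0 hLip hf (Y i u x) (Y i u x) (Z i u x) (Z i u x) r uT' _ _) _.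
  - by move=> q; exact: L2_cst.
  - by move=> q; exact: solution_L2.
  by rewrite !subrrE add0r addr0.
have [lV nV] := decoupled_nrm2 (@filtration_measurable _) (@filtration_measurable _) ind
  (fun q => (measurable_fun_mxP _ _).1 myj q ord0) (fun q => (measurable_fun_mxP _ _).1 myk q ord0)
  (fun q => solution_L2 j q uT') (fun q => solution_L2 j.+1 q uT') mV lip.
split => //; apply: le_trans nV _; rewrite ler_wpM2l ?mulr_ge0 ?sqr_ge0//.
exact: mkv_distance.
Qed.

(** At most one of [j] and [k] equals [i], so by symmetry [k] differs from both. Given the motions
    of [i] and [j], the variable [Y k] is independent of everything else and integrates to zero. *)
Lemma deviation_orthogonal j k : j != k -> ip P (V j) (V k) = 0.
Proof.
wlog ik : j k / i != k => [hwlog jk|jk].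
  have [ik|ik] := eqVneq i k; last exact: hwlog.
  by rewrite -ik in jk *; rewrite ipC; apply: hwlog; rewrite eq_sym.
have ind := independent_filtrations hW ik jk.
have [myi mzi] := solution_measurable (J := [set i; j]) (l := i) (or_introl erefl).
have [myk _] := solution_measurable (J := [set k]) (l := k) erefl.
pose K (p : g_sigma_algebraType (FJ [set i; j]) * g_sigma_algebraType (FJ [set k])) :=
  f u (Y i u p.1) (Y k u p.2) (Z i u p.1) r ord0 - law_functional P f (Y k u) u (Y i u p.1) (Z i u p.1) r ord0.
have mi := measurableT_comp myi (@measurable_fst _ _ _ (g_sigma_algebraType (FJ [set k]))).
have mz := measurableT_comp mzi (@measurable_fst _ _ _ (g_sigma_algebraType (FJ [set k]))).
have mk := measurableT_comp myk (@measurable_snd _ _ (g_sigma_algebraType (FJ [set i; j])) _).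
have mK : measurable_fun setT K.
  by apply: measurable_funB; [exact: (f_measurable mi mk mz)|exact: (law_functional_measurable k mi mz)].
have fi x := f_integrable Lf0 hLip hf (Y i u x) (Z i u x) r uT' (fun q => solution_L2 k q uT').
have ci (c : R) : P.-integrable setT (EFin \o (fun=> c)) by exact: L2_integrable (L2_cst P c).
apply: (ip_decoupled (@filtration_measurable _) (@filtration_measurable _) ind (deviation_measurable (or_introl erefl) (or_intror erefl)) mK (deviation_L2 j).1).
- exact: (deviation_L2 k).1.
- move=> x; exact: (integrable_addR (fi x) (ci (- law_functional P f (Y k u) u (Y i u x) (Z i u x) r ord0))).
- move=> x; transitivity (\int[P]_y (f u (Y i u x) (Y k u y) (Z i u x) r ord0 -
      law_functional P f (Y k u) u (Y i u x) (Z i u x) r ord0)) => //.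
  rewrite (RintegralB measurableT (fi x) (ci _)) Rintegral_cst//= [X in fine X](_ : _ = 1%E) ?mulr1; last exact: probability_setT.
  by rewrite [in X in _ - X]mxE subrr.
Qed.

Lemma law_of_large_numbers n : (0 < n)%N ->
  L2 P (fun x => lln_error n i u x r ord0) /\
  nrm2 P (fun x => lln_error n i u x r ord0) <= n%:R^-1 * (Lf ^+ 2 * m%:R * distance_cst).
Proof.
move=> n0; have nR : (n%:R : R) != 0 by rewrite pnatr_eq0 -lt0n.
have -> : (fun x => lln_error n i u x r ord0) = fun x => n%:R^-1 * \sum_(j < n) V j x.
  have subE (A B : 'cV[R]_m) : (A - B) r ord0 = A r ord0 - B r ord0 by rewrite !mxE.
  have scaleE (c : R) (A : 'cV[R]_m) : (c *: A) r ord0 = c * A r ord0 by rewrite mxE.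
  apply/funext => x; rewrite /lln_error subE scaleE summxE /V sumrB mulrBr; congr (_ - _).
  rewrite (eq_bigr (fun=> law_functional P f (Y i u) u (Y i u x) (Z i u x) r ord0)).
    by set a := fun_of_matrix _ _ _; rewrite sumr_const card_ord -(mulr_natl a) mulKf.
  by move=> j _; rewrite (mkv_law_eq j i).
have lV (j : 'I_n) : L2 P (V j) := (deviation_L2 j).1.
have lS : L2 P (fun x => \sum_(j < n) V j x) by exact: L2_sum.
split; first exact: L2Z.
(* Off-diagonal inner products vanish: [n] diagonal terms remain against the factor [n^-2]. *)
rewrite nrm2Z// nrm2_sum// expr2 -mulrA ler_wpM2l ?invr_ge0//.
rewrite mulrC ler_pdivrMr ?ltr0n// mulrC.
apply: ler_sum_card => j; rewrite (bigD1 j)//= big1 ?addr0; first exact: (deviation_L2 j).2.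
by move=> k kj; apply: deviation_orthogonal; rewrite eq_sym.
Qed.

End fixed_time.

End law_of_large_numbers.

(** * Convergence of the particle system *)

Section propagation_of_chaos.
Context (R : realType) dO (Om : measurableType dO) (P : probability Om R) (d m : nat) (T LF Lf LG : R)
  (W : nat -> Om -> cpath d T).
Hypothesis hW : independent_brownian_motions P W.
Variables (G : cpath d T -> 'cV[R]_m)
  (F : R -> cpath d T -> 'cV[R]_m -> 'M[R]_(m, d) -> 'cV[R]_m -> 'cV[R]_m)
  (f : R -> 'cV[R]_m -> 'cV[R]_m -> 'M[R]_(m, d) -> 'cV[R]_m).
Hypotheses (hT : 0 < T) (LF0 : 0 <= LF) (Lf0 : 0 <= Lf) (LG0 : 0 <= LG) (hLip : Lip LF Lf F f)
  (hG : forall w w', euclid (G w - G w') <= LG * cpath_dist w w')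
  (hF : forall y z a, progressive (@canonical_history R d T) T (fun t (w : cpath d T) => F t w y z a))
  (hf : forall y1 y2 z, measurable_fun `[0, T] (fun t => f t y1 y2 z)).
Variables (Y : nat -> R -> Om -> 'cV[R]_m) (Z : nat -> R -> Om -> 'M[R]_(m, d)).
Hypothesis hS : forall i, solves_mckean_vlasov P W G F f i (Y i) (Z i).
Variables (n : nat) (Yn : nat -> R -> Om -> 'cV[R]_m) (Zn : nat -> nat -> R -> Om -> 'M[R]_(m, d)).
Hypotheses (n0 : (0 < n)%N) (hSn : solves_system P W G F f n Yn Zn).
Local Notation T0 := (ltW hT).
Local Notation mu2 := (leb_prod P).
Local Notation K := (distance_cst d m T LF Lf LG).
Local Notation err i := (lln_error P f Y Z n i).
Local Notation cc := (coupling_cst m LF Lf).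
Implicit Types i : 'I_n.

Let dY i u x := Yn i u x - Y i u x.
Let dZ i u x := Zn i i u x - Z i u x.
Let dPhi i r u x := system_driver W F f n Yn Zn i u x r ord0 - mkv_driver P W F f i (Y i) (Z i) u x r ord0.
Let dA i r (c : 'I_n * 'I_d) u x := Zn i c.1 u x r c.2 - one_column i (Z i) r c u x.

(** Four contributions enter the Lipschitz bound: the errors of [Y] and [Z] for the particle itself,
    the mean error of all particles, and the error of the law of large numbers. *)
Lemma driver_difference_le i r u x : 0 <= u <= T ->
  dPhi i r u x ^+ 2 <= 4 * (LF * (1 + m%:R * Lf)) ^+ 2 * (euclid (dY i u x) ^+ 2 + euclid (dZ i u x) ^+ 2 +
    n%:R^-1 * \sum_j euclid (dY j u x) ^+ 2 + m%:R * \sum_k err i u x k ord0 ^+ 2).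
Proof.
move=> uT; have [h _ _ _] := hLip uT.
pose avg := n%:R^-1 * \sum_j euclid (dY j u x); pose e := \sum_k `|err i u x k ord0|.
have nR : 0 < (n%:R : R) by rewrite ltr0n.
have avg2 : avg ^+ 2 <= n%:R^-1 * \sum_j euclid (dY j u x) ^+ 2.
  rewrite exprMn [n%:R^-1 ^+ 2]expr2 -mulrA ler_wpM2l ?invr_ge0 ?(ltW nR)//.
  by rewrite mulrC ler_pdivrMr// mulrC; exact: (sqr_sum_card P).
have e2 : e ^+ 2 <= m%:R * \sum_k err i u x k ord0 ^+ 2.
  apply: le_trans (sqr_sum_card P _) _; rewrite ler_wpM2l// ler_sum// => k _.
  by rewrite real_normK ?num_real.
have avg0 : 0 <= avg by rewrite mulr_ge0 ?invr_ge0 ?(ltW nR)// sumr_ge0// => j _; exact: euclid_ge0.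
have e0 : 0 <= e by rewrite sumr_ge0.
apply: (@le_trans _ _ (4 * (LF * (1 + m%:R * Lf)) ^+ 2 * (euclid (dY i u x) ^+ 2 + euclid (dZ i u x) ^+ 2 + avg ^+ 2 + e ^+ 2))); last first.
  apply: ler_wpM2l; first by rewrite mulr_ge0// sqr_ge0.
  exact: (lerD (lerD (lexx _) avg2) e2).
apply: sqr_sum4_le; rewrite /dPhi /system_driver /mkv_driver.
have aB k : `|(n%:R^-1 *: \sum_(j < n) f u (Yn i u x) (Yn j u x) (Zn i i u x)) k ord0 -
    law_functional P f (Y i u) u (Y i u x) (Z i u x) k ord0| <=
    Lf * (euclid (dY i u x) + avg + euclid (dZ i u x)) + `|err i u x k ord0|.
  (* [b2] averages over the limit solutions: [b1 - b2] is a Lipschitz error, and [b2] minus the law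
     integral is [lln_error]. *)
  pose b1 := n%:R^-1 * \sum_(j < n) f u (Yn i u x) (Yn j u x) (Zn i i u x) k ord0.
  pose b2 := n%:R^-1 * \sum_(j < n) f u (Y i u x) (Y j u x) (Z i u x) k ord0.
  have scaleE (c : R) (A : 'cV[R]_m) : (c *: A) k ord0 = c * A k ord0 by rewrite mxE.
  have subE (A B : 'cV[R]_m) : (A - B) k ord0 = A k ord0 - B k ord0 by rewrite !mxE.
  have -> : err i u x k ord0 = b2 - law_functional P f (Y i u) u (Y i u x) (Z i u x) k ord0.
    by rewrite /lln_error subE scaleE summxE.
  rewrite scaleE summxE -/b1.
  set l := law_functional _ _ _ _ _ _ _ _.
  have -> : b1 - l = (b1 - b2) + (b2 - l) by ring.
  apply: le_trans (ler_normD _ _) _; rewrite lerD2r.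
  rewrite /b1 /b2 -mulrBr -sumrB normrM ger0_norm ?invr_ge0 ?(ltW nR)//.
  rewrite mulrC ler_pdivrMr//; apply: le_trans (ler_norm_sum _ _ _) _.
  apply: (@le_trans _ _ (\sum_(j < n) Lf * (euclid (dY i u x) + euclid (dY j u x) + euclid (dZ i u x)))).
    by apply: ler_sum => j _; exact: (f_lip hLip).
  rewrite -mulr_sumr -mulrA ler_wpM2l// !big_split /= !sumr_const card_ord.
  rewrite -[euclid (dY i u x) *+ n]mulr_natr -[euclid (dZ i u x) *+ n]mulr_natr !mulrDl lerD2r lerD2l.
  by rewrite /avg mulrAC mulVf ?mul1r// lt0r_neq0.
have := coord_le_euclid (F u (W i x) (Yn i u x) (Zn i i u x) (n%:R^-1 *: \sum_(j < n) f u (Yn i u x) (Yn j u x) (Zn i i u x)) -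
   F u (W i x) (Y i u x) (Z i u x) (law_functional P f (Y i u) u (Y i u x) (Z i u x))) r ord0.
move: aB; set a1 := _ *: _; set a2 := law_functional _ _ _ _ _ _; clearbody a1 a2 => aB.
rewrite !mxE => /le_trans; apply; apply: le_trans (h _ _ _ _ _ _ _ _) _.
rewrite (cpath_dist_refl _ T0) add0r -mulrA ler_wpM2l//.
have aE : euclid (a1 - a2) <= m%:R * (Lf * (euclid (dY i u x) + avg + euclid (dZ i u x))) + e.
  apply: le_trans (euclid_le_sum _) _.
  apply: (@le_trans _ _ (\sum_(k < m) (Lf * (euclid (dY i u x) + avg + euclid (dZ i u x)) + `|err i u x k ord0|))).
    apply: ler_sum => k _; rewrite big_ord1; apply: le_trans (aB k).
    by rewrite [X in `|X|]mxE [X in _ + X]mxE.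
  by rewrite big_split /= sumr_const card_ord mulr_natl.
have e1 := euclid_ge0 (dY i u x); have e3 := euclid_ge0 (dZ i u x).
have mL : 0 <= m%:R * Lf by rewrite mulr_ge0.
rewrite -/(dY i u x) -/(dZ i u x).
have := mulr_ge0 mL e0; lra.
Qed.

Lemma solution_cutL2 k : cutL2 P T (Y k) /\ cutL2 P T (Z k).
Proof. by have [b _ /(_ k.+1 (ltnSn k)) [_ ? ? _]] := mkv_solution_system hW T0 LF0 Lf0 hLip hF hf (hS k). Qed.

Lemma dY_L2 i : cutL2 P T (dY i).
Proof. by have [_ [lY _]] := system_L2 hW T0 hSn (ltn_ord i); apply: cutL2B => //; have [] := solution_cutL2 i. Qed.

Lemma dZ_L2 i : cutL2 P T (dZ i).
Proof. by have [_ [_ lZ]] := system_L2 hW T0 hSn (ltn_ord i); apply: cutL2B; [exact: lZ|have [] := solution_cutL2 i]. Qed.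

Lemma err_L2 i : cutL2 P T (err i).
Proof.
have [lY lZ] := solution_cutL2 i.
have [b _ /(_ i.+1 (ltnSn i)) [bY _ _ _]] := mkv_solution_system hW T0 LF0 Lf0 hLip hF hf (hS i).
apply: cutL2B; last exact: (law_process_L2 Lf0 hLip hf bY).
apply: cutL2_mean => j; apply: (f_process_L2 Lf0 hLip hf) => //.
by have [] := solution_cutL2 j.
Qed.

(* The law of large numbers is only available at positive times, hence the truncation [A]. *)
Lemma err_nrm2 i k (s t : R) : 0 <= s -> s <= t -> t <= T ->
  nrm2 mu2 (cut s t (fun u x => err i u x k ord0)) <= (t - s) * (n%:R^-1 * (Lf ^+ 2 * m%:R * K)).
Proof.
move=> s0 st tT; pose A (_ : 'I_1) u x := if 0 < u then err i u x k ord0 else 0.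
have AE : cut s t (A ord0) = cut s t (fun u x => err i u x k ord0).
  by apply/funext => p; rewrite /cut /A; case: ifP => // /andP[su _]; rewrite (le_lt_trans s0 su).
have l0 : 0 <= n%:R^-1 * (Lf ^+ 2 * m%:R * K).
  have TT : 0 < T <= T by rewrite hT lexx.
  exact: le_trans (nrm2_ge0 _ _) (law_of_large_numbers hW hT LF0 Lf0 LG0 hLip hG hF hf hS TT i k n0).2.
have := @cut_nrm2_sum_le _ _ _ P 'I_1 s t (n%:R^-1 * (Lf ^+ 2 * m%:R * K)) A st.
rewrite big_ord1 AE; apply => [j|u /andP[su ut]].
  exact: cut_L2 s0 tT (err_L2 i k ord0).
rewrite big_ord1 /A; have [u0|u0] := ltP 0 u; last first.
  by rewrite (eq_integral (fun=> 0%E)) ?integral0 ?lee_fin// => x _; rewrite expr0n.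
have uT : 0 < u <= T by rewrite u0 (le_trans ut tT).
have [l ln] := law_of_large_numbers hW hT LF0 Lf0 LG0 hLip hG hF hf hS uT i k n0.
by rewrite -nrm2_EFin// lee_fin.
Qed.

Lemma difference_lin_eq i r : lin_eq P W (fun u x => Yn i u x r ord0 - Y i u x r ord0) (dPhi i r) (dA i r).
Proof.
have [b _ /(_ n (ltn_ord i)) [_ _ _ E]] := mkv_solution_system hW T0 LF0 Lf0 hLip hF hf (hS i).
exact: (lin_eqB hW (system_lin_eq hW T0 LF0 Lf0 hLip hF hf r hSn (ltn_ord i)) (E r)).
Qed.

Let nY i (s t : R) := \sum_r nrm2 mu2 (cut s t (fun u x => Yn i u x r ord0 - Y i u x r ord0)).
Let nA i (s t : R) := \sum_r \sum_c nrm2 mu2 (cut s t (dA i r c)).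

Lemma dY_nrmM i (s t : R) : nrmM mu2 (cutM s t (dY i)) = nY i s t.
Proof.
rewrite cutM_nrmM; apply: eq_bigr => k _; rewrite big_ord1; congr nrm2; apply/funext => w.
by rewrite /cut /dY !mxE.
Qed.

(** [nA] collects all columns of the integrand, as the energy inequality produces them; the driver
    sees only the diagonal column. *)
Lemma dZ_nrmM i (s t : R) : nrmM mu2 (cutM s t (dZ i)) <= nA i s t.
Proof.
rewrite cutM_nrmM; apply: ler_sum => r _.
rewrite (reindex_onto (fun c : 'I_n * 'I_d => c.2) (fun q => (i, q))) //=.
rewrite [leRHS](bigID (fun c : 'I_n * 'I_d => (i, c.2) == c)) /= -[leLHS]addr0 lerD//; last first.
  by apply: sumr_ge0 => c _; exact: nrm2_ge0.
rewrite le_eqVlt; apply/orP; left; apply/eqP; apply: eq_bigr => -[i' q] /eqP[<-]; congr nrm2; apply/funext => w.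
by rewrite /cut /dA /dZ /one_column /= eqxx !mxE.
Qed.

Lemma drivers_nrm2 i (s t : R) : 0 <= s -> s <= t -> t <= T ->
  \sum_r nrm2 mu2 (cut s t (dPhi i r)) <= cc * (nY i s t + nA i s t + n%:R^-1 * \sum_j nY j s t) +
    (t - s) * (n%:R^-1 * (cc * m%:R ^+ 2 * (Lf ^+ 2 * m%:R * K))).
Proof.
move=> s0 st tT; pose L' := 4 * (LF * (1 + m%:R * Lf)) ^+ 2.
have L'0 : 0 <= L' by rewrite mulr_ge0// sqr_ge0.
have lY j k l : L2 mu2 (fun w => cutM s t (dY j) w k l) by rewrite cutM_coord; exact: cut_L2 s0 tT (dY_L2 j k l).
have lZ k l : L2 mu2 (fun w => cutM s t (dZ i) w k l) by rewrite cutM_coord; exact: cut_L2 s0 tT (dZ_L2 i k l).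
have lE k : L2 mu2 (cut s t (fun u x => err i u x k ord0)) by exact: cut_L2 s0 tT (err_L2 i k ord0).
pose g3 w := n%:R^-1 * \sum_j euclid (cutM s t (dY j) w) ^+ 2.
pose g4 w := m%:R * \sum_k (cut s t (fun u x => err i u x k ord0) w) ^+ 2.
have i1 := euclid_sqr_integrable (lY i); have i2 := euclid_sqr_integrable lZ.
have iY j := euclid_sqr_integrable (lY j); have iE k := L2_sqr (lE k).
have i3 : mu2.-integrable setT (EFin \o g3) by apply: integrable_scaleR; exact: integrable_sumR.
have i4 : mu2.-integrable setT (EFin \o g4) by apply: integrable_scaleR; exact: integrable_sumR.
have [ig gI] := Rintegral_lin4 L' i1 i2 i3 i4.
set g := fun x => _ in ig gI.
have I3 : \int[mu2]_w g3 w = n%:R^-1 * \sum_j nY j s t.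
  rewrite RintegralZl//; last exact: integrable_sumR.
  by rewrite Rintegral_sumR//; congr (_ * _); apply: eq_bigr => j _; rewrite euclid_sqr_Rintegral// dY_nrmM.
have I4 : \int[mu2]_w g4 w <= m%:R * (m%:R * ((t - s) * (n%:R^-1 * (Lf ^+ 2 * m%:R * K)))).
  rewrite RintegralZl//; last exact: integrable_sumR.
  rewrite Rintegral_sumR// ler_wpM2l//; apply: ler_sum_card => k.
  by rewrite -nrm2E; exact: err_nrm2.
have row r : nrm2 mu2 (cut s t (dPhi i r)) <= \int[mu2]_w g w.
  have [_ _ [_ lP _] _] := difference_lin_eq i r.
  apply: nrm2_le_Rintegral ig _; first exact: cut_L2 s0 tT lP.
  move=> [u x]; rewrite /g /g3 /g4 /cut /cutM /=; case: ifP => [/andP[su ut]|_]; last first.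
    by rewrite expr0n /= mulr_ge0// !addr_ge0// ?sqr_ge0// mulr_ge0 ?invr_ge0 ?sumr_ge0// => *; rewrite sqr_ge0.
  by apply: driver_difference_le; rewrite (ltW (le_lt_trans s0 su)) (le_trans ut tT).
apply: le_trans (ler_sum_card row) _; rewrite gI !euclid_sqr_Rintegral// dY_nrmM I3.
have -> : m%:R * (L' * (nY i s t + nrmM mu2 (cutM s t (dZ i)) + n%:R^-1 * (\sum_j nY j s t) + \int[mu2]_w g4 w)) =
   cc * (nY i s t + nrmM mu2 (cutM s t (dZ i)) + n%:R^-1 * (\sum_j nY j s t) + \int[mu2]_w g4 w).
  by rewrite /L' /coupling_cst; ring.
have c0 : 0 <= cc by exact: coupling_cst_ge0.
apply: (@le_trans _ _ (cc * (nY i s t + nA i s t + n%:R^-1 * (\sum_j nY j s t) +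
    m%:R * (m%:R * ((t - s) * (n%:R^-1 * (Lf ^+ 2 * m%:R * K))))))).
  by rewrite ler_wpM2l// lerD// lerD2r lerD2l; exact: dZ_nrmM.
rewrite le_eqVlt; apply/orP; left; apply/eqP; ring.
Qed.

Lemma difference_terminal i r : nrm2 P (fun x => Yn i T x r ord0 - Y i T x r ord0) = 0.
Proof.
have TT : 0 <= T <= T by rewrite lexx ltW.
have [_ [b /(_ T TT)[l _]] _ _] := difference_lin_eq i r.
have z0 : nrm2 P (fun=> 0) = 0 by rewrite nrm2_cst expr0n.
rewrite -[RHS]z0; apply: nrm2_ae => //; first exact: L2_measurable l.
move: (system_terminal T0 hSn (ltn_ord i)) (mkv_terminal hW T0 (hS i)); apply: filterS2 => x -> ->; exact: subrr.
Qed.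

Let nYA_ge0 i (s t : R) : 0 <= nY i s t /\ 0 <= nA i s t.
Proof.
by split; apply: sumr_ge0 => r _; [exact: nrm2_ge0|apply: sumr_ge0 => c _; exact: nrm2_ge0].
Qed.

(** The source term of the particle equations, multiplied by [n]. One factor [m] comes from squaring
    the sum of the error coordinates, the other from adding their second moments. *)
Definition lln_cst : R := cc * m%:R ^+ 2 * (Lf ^+ 2 * m%:R * K).

Lemma lln_cst_ge0 : 0 <= lln_cst.
Proof.
have TT : 0 <= T <= T by rewrite lexx ltW.
apply: mulr_ge0; first by apply: mulr_ge0; [exact: coupling_cst_ge0|exact: exprn_ge0].
apply: mulr_ge0; first by apply: mulr_ge0; [exact: sqr_ge0|].
apply: le_trans (mkv_distance hW hT LF0 Lf0 LG0 hLip hG hF hf hS 0 0 TT).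
by apply: sumr_ge0 => r _; exact: nrm2_ge0.
Qed.

Definition total_cst : R := gronwall_cst (2 * cc) T * lln_cst.

(* Summing over all particles bounds the mean of |Y^{j,n} - Y^j|^2, which then enters
   the equation of a single particle as a source term of order 1/n. *)
Lemma total_error (t : R) : 0 <= t <= T ->
  \sum_(i < n) \sum_r nrm2 P (fun x => Yn i t x r ord0 - Y i t x r ord0) <= total_cst.
Proof.
move=> tT; have c0 : 0 <= cc by exact: coupling_cst_ge0.
(* After summation over the particles the mean error contributes a second copy of the Y-norms, hence
   the doubled constant. The sources of order [1/n] add up to [lln_cst]. *)
have K0 : 0 <= 2 * cc by rewrite mulr_ge0.
have EB (p : 'I_n * 'I_m) := difference_lin_eq p.1 p.2.
have := lin_eq_stability hW T0 K0 lln_cst_ge0 EB.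
move=> /(_ _ t tT) st; rewrite pair_bigA /= /total_cst.
have : \sum_(p : 'I_n * 'I_m) nrm2 P (fun x => Yn p.1 T x p.2 ord0 - Y p.1 T x p.2 ord0) = 0.
  by rewrite big1// => p _; exact: difference_terminal.
move=> tz; rewrite tz add0r in st.
apply: le_trans (st _); first by rewrite lerDl; do 2 (apply: sumr_ge0 => ? _); exact: nrm2_ge0.
move=> {t tT st tz} s t s0 st tT.
rewrite -(pair_bigA _ (fun i r => nrm2 mu2 (cut s t (dPhi i r)))) /=.
rewrite -(pair_bigA _ (fun i r => nrm2 mu2 (cut s t (fun u x => Yn i u x r ord0 - Y i u x r ord0)))) /=.
rewrite -(pair_bigA _ (fun i r => \sum_c nrm2 mu2 (cut s t (dA i r c)))) /=.
apply: le_trans (ler_sum _ (fun i _ => drivers_nrm2 i s0 st tT)) _.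
rewrite big_split /= sumr_const card_ord -mulr_sumr !big_split /= sumr_const card_ord.
set SY := \sum_(j < n) nY j s t; set SA := \sum_(j < n) nA j s t.
have SA0 : 0 <= SA by apply: sumr_ge0 => j _; have [] := nYA_ge0 j s t.
have nR : (n%:R : R) != 0 by rewrite pnatr_eq0 -lt0n.
rewrite -(mulr_natl (n%:R^-1 * SY)) mulrA divff// mul1r.
rewrite -(mulr_natl ((t - s) * _)) (mulrCA n%:R) (mulrA n%:R) divff// mul1r -/lln_cst lerD2r.
rewrite -/SY -/SA.
have := mulr_ge0 c0 SA0; lra.
Qed.

Definition chaos_cst : R := gronwall_cst cc T * (cc * total_cst + lln_cst).

Lemma propagation_of_chaos i (t : R) : 0 <= t <= T ->
  \sum_r nrm2 P (fun x => Yn i t x r ord0 - Y i t x r ord0) + nA i 0 T <= chaos_cst / n%:R.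
Proof.
move=> tT; have c0 : 0 <= cc by exact: coupling_cst_ge0.
have t0 : 0 <= total_cst by rewrite mulr_ge0 ?gronwall_cst_ge0 ?lln_cst_ge0.
(* The mean error of the particles is treated as known: it is at most [total_cst / n] at every time
   and joins the error of the law of large numbers. *)
pose e := n%:R^-1 * (cc * total_cst + lln_cst).
have e0 : 0 <= e by rewrite mulr_ge0 ?invr_ge0// addr_ge0 ?lln_cst_ge0// mulr_ge0.
have := lin_eq_stability hW T0 c0 e0 (difference_lin_eq i).
move=> /(_ _ t tT) st.
have tz : \sum_r nrm2 P (fun x => Yn i T x r ord0 - Y i T x r ord0) = 0.
  by rewrite big1// => r _; exact: difference_terminal.
rewrite tz add0r in st.
apply: le_trans (st _) _; last first.
  by rewrite /chaos_cst /e le_eqVlt; apply/orP; left; apply/eqP; ring.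
move=> {t tT st tz} s t s0 st tT.
apply: le_trans (drivers_nrm2 i s0 st tT) _.
have SY : \sum_j nY j s t <= (t - s) * total_cst.
  rewrite /nY pair_bigA /=.
  apply: (@cut_nrm2_sum_le _ _ _ P ('I_n * 'I_m)%type s t total_cst (fun p u x => Yn p.1 u x p.2 ord0 - Y p.1 u x p.2 ord0) st).
    by move=> p; have [_ _ [lP _ _] _] := difference_lin_eq p.1 p.2; exact: cut_L2 s0 tT lP.
  move=> u /andP[su ut]; have uT : 0 <= u <= T by rewrite (le_trans s0 su) (le_trans ut tT).
  have := total_error uT; rewrite pair_bigA /= -lee_fin -sumEFin.
  apply: le_trans; rewrite le_eqVlt; apply/orP; left; apply/eqP; apply: eq_bigr => p _.
  have [_ [b /(_ u uT)[l _]] _ _] := difference_lin_eq p.1 p.2.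
  exact: esym (nrm2_EFin l).
rewrite -/lln_cst -/(nY i s t) -/(nA i s t) /e.
have nV : 0 <= n%:R^-1 :> R by rewrite invr_ge0.
have := ler_wpM2l (mulr_ge0 c0 nV) SY.
have -> : cc * n%:R^-1 * ((t - s) * total_cst) = (t - s) * (n%:R^-1 * (cc * total_cst)) by ring.
rewrite -(mulrA cc) => h.
rewrite mulrDr -addrA lerD2l mulrDr mulrDr lerD2r.
exact: h.
Qed.

End propagation_of_chaos.

Theorem proposition11 (R : realType) (d m : nat) (hd : (0 < d)%N)
  (hm : (0 < m)%N) (T LF Lf LG : R) (hT : 0 < T) (hLF : 0 <= LF)
  (hLf : 0 <= Lf) (hLG : 0 <= LG) :
  exists C : R,
  forall (dO : measure_display) (Om : measurableType dO) (P : probability Om R)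
    (W : nat -> Om -> cpath d T)
    (G : cpath d T -> 'cV[R]_m)
    (F : R -> cpath d T -> 'cV[R]_m -> 'M[R]_(m, d) -> 'cV[R]_m -> 'cV[R]_m)
    (f : R -> 'cV[R]_m -> 'cV[R]_m -> 'M[R]_(m, d) -> 'cV[R]_m)
    (Y : nat -> R -> Om -> 'cV[R]_m)
    (Z : nat -> R -> Om -> 'M[R]_(m, d)),
  independent_brownian_motions P W ->
  (forall i, measurable_fun setT (fun x => G (W i x))) ->
  (forall i, (E2 P (fun x => G (W i x)) < +oo)%E) ->
  (forall w w', euclid (G w - G w') <= LG * cpath_dist w w') ->
  Lip LF Lf F f ->
  (forall y z a, progressive (@canonical_history R d T) T
                   (fun t (w : cpath d T) => F t w y z a)) ->
  (forall y1 y2 z, measurable_fun `[0, T] (fun t => f t y1 y2 z)) ->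
  (forall i, solves_mckean_vlasov P W G F f i (Y i) (Z i)) ->
  forall (n : nat), (0 < n)%N ->
  forall (Yn : nat -> R -> Om -> 'cV[R]_m)
    (Zn : nat -> nat -> R -> Om -> 'M[R]_(m, d)),
  solves_system P W G F f n Yn Zn ->
  forall t : R, 0 <= t <= T ->
  (E2 P (fun x => Yn 0%N t x - Y 0%N t x)%R
   + E2int P T (fun s x => Zn 0%N 0%N s x - Z 0%N s x)%R <= (C / n%:R)%:E)%E.
Proof.
(* Chosen before the probability space, the coefficients and [n]: it is built from the dimensions,
   [T] and the three Lipschitz constants. *)
exists (chaos_cst d m T LF Lf LG) => dO Om P W G F f Y Z hW _ _ hG hLip hF hf hS n n0 Yn Zn hSn t tT.
have T0 := ltW hT; pose i : 'I_n := Ordinal n0.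
have lY := difference_lin_eq hW hT hLF hLf hLip hF hf hS hSn i.
have lZ := dZ_L2 hW hT hLF hLf hLip hF hf hS hSn i.
have [_ _ pZn _] := hSn 0%N n0; have [pZn0 _] := pZn 0%N n0.
have [_ _ pZ0 _ _] := hS 0%N.
rewrite E2_nrm2; last first.
  move=> k l; rewrite (ord1 l); have [_ [b /(_ t tT)[lt _]] _ _] := lY k.
  by move: lt; congr L2; apply/funext => x; rewrite !mxE.
rewrite E2int_nrm2; last exact: lZ.
  rewrite -EFinD lee_fin.
  have := propagation_of_chaos hW hT hLF hLf hLG hLip hG hF hf hS n0 hSn i tT.
  apply: le_trans; apply: lerD.
    apply: ler_sum => k _; rewrite big_ord1 le_eqVlt; apply/orP; left; apply/eqP; congr nrm2.
    by apply/funext => x; rewrite !mxE.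
  have := dZ_nrmM P Z Zn i 0 T; rewrite cutM_nrmM; exact.
move=> k l.
have m1 := (measurable_fun_mxP _ _).1 (progressive_measurable hW T0 pZn0) k l.
have m2 := (measurable_fun_mxP _ _).1 (progressive_measurable hW T0 pZ0) k l.
have := measurable_funB m1 m2; congr measurable_fun; apply/funext => w.
by rewrite /= !mxE.
Qed.
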